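(* Let $G$ be a Lie groupoid with manifold of identities $I$ and let $k\ge1$. In the sequence (the first non-linear Spencer complex) $$1\rightarrow\mathcal G\xrightarrow{\ j^{k+1}\ }\mathcal G_{k+1}\xrightarrow{\ \mathcal D\ }\mathcal T^*\otimes\mathcal J^k\mathfrak g\xrightarrow{\ \mathcal D_1\ }\wedge^2\mathcal T^*\otimes\mathcal J^{k-1}\mathfrak g,$$ where $i(v)\mathcal D\sigma_{k+1}=\lambda^1\sigma_{k+1}^{-1}\cdot j^1\sigma_k\cdot v-v$ and $\mathcal D_1\mathbf u=D\mathbf u-\tfrac12[\mathbf u,\mathbf u]_k$, one has $\mathcal D_1\circ\mathcal D=0$, i.e. $D(\mathcal D\sigma)-\frac12[\mathcal D\sigma,\mathcal D\sigma]_k=0$ for all $\sigma\in\mathcal G_{k+1}$, and the sequence is exact at $\mathcal G_{k+1}$, i.e. $\mathcal D\sigma=0$ if and only if $\sigma=j^{k+1}F$ for some $F\in\mathcal G$.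
   Context: All objects are smooth. $G$ is a Lie groupoid with manifold of identities $I\subset G$, source and target submersions $s,t:G\to I$, product $YX$ defined when $s(Y)=t(X)$. $T=TI$. A bisection on an open $U\subset I$ is a map $F:U\to G$ with $s\circ F=\mathrm{id}$ and $f=t\circ F$ a diffeomorphism onto an open set; $(HF)(x)=H(f(x))F(x)$, $F^{-1}(y)=F(f^{-1}(y))^{-1}$. $G_k$ is the Lie groupoid of $k$-jets of local bisections of $G$ with $j^k_{f(x)}H\cdot j^k_xF=j^k_x(HF)$, $s(j^k_xF)=x$, $t(j^k_xF)=f(x)$, identities identified with $I$. $\mathcal G$, $\mathcal G_k$ denote the (germs of) local bisections of $G$, $G_k$. $\mathfrak g=\ker s_*|_I$ is the Lie algebroid of $G$; the algebroid of $G_k$ is identified with $J^k\mathfrak g$, and $TG_k|_I=T\oplus J^k\mathfrak g$. $\mathcal T$, $\mathcal J^k\mathfrak g$ are the sheaves of germs of sections of $T$, $J^k\mathfrak g$; $\xi_{k-1}$ is the projection of $\xi_k$ to $J^{k-1}\mathfrak g$. For a local bisection $F$ of $G_k$ and $w\in T_XG_k$, $j^1F\cdot w$ is the image of $w$ under the differential of $X\mapsto F(t(X))X$. For $\sigma_{k+1}\in\mathcal G_{k+1}$, $\sigma_k$ is its projection to $\mathcal G_k$; if $\sigma_{k+1}(x)=j^{k+1}_x\phi$ then $\lambda^1\sigma_{k+1}(x)=j^1_x(j^k\phi)$, a 1-jet of bisection of $G_k$, and $\lambda^1\sigma_{k+1}^{-1}$ is the inverse 1-jet. Vectors $v\in T$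 are regarded as tangent to $I\subset G_k$; the vector $\lambda^1\sigma_{k+1}^{-1}\cdot j^1\sigma_k\cdot v-v\in TG_k|_I$ is $s$-vertical, i.e. in $J^k\mathfrak g$. Linear Spencer operator $D:\mathcal J^k\mathfrak g\to\mathcal T^*\otimes\mathcal J^{k-1}\mathfrak g$: the unique $\mathbb R$-linear operator with $D(j^k\theta)=0$ for $\theta\in\Gamma(\mathfrak g)$ and $D(h\xi_k)=dh\otimes\xi_{k-1}+hD\xi_k$; extended by $D(\omega\otimes\xi_k)=d\omega\otimes\xi_{k-1}+(-1)^l\omega\wedge D\xi_k$ for $\omega\in\wedge^l\mathcal T^*$. Bracket: the first bracket $[\cdot,\cdot]^{(1)}_k:\mathcal J^k\mathfrak g\times\mathcal J^k\mathfrak g\to\mathcal J^{k-1}\mathfrak g$ is the $\mathcal O_I$-bilinear map with $[j^k\theta,j^k\mu]^{(1)}_k=j^{k-1}[\theta,\mu]$ for $\theta,\mu\in\Gamma(\mathfrak g)$ ($\mathcal O_I$: functions on $I$; the bracket of $\Gamma(\mathfrak g)$ is $[\theta,\mu]=[\bar\theta,\bar\mu]|_I$, with $\bar\theta$ the right invariant vector field on $G$ extending $\theta$), and $[\omega\otimes\xi_k,\tau\otimes\eta_k]_k=\omega\wedge\tau\otimes[\xi_k,\eta_k]^{(1)}_k$ for $\omega,\tau\in\wedge\mathcal T^*$. *)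

(* Defs.v *)
From mathcomp Require Import all_boot all_order all_algebra.
From mathcomp Require Import all_classical all_reals all_analysis.
Set Implicit Arguments.
Unset Strict Implicit.
Unset Printing Implicit Defensive.
Import Order.TTheory GRing.Theory Num.Theory.
Import numFieldNormedType.Exports.
Local Open Scope classical_set_scope.
Local Open Scope ring_scope.

(** * Smooth functions between normed spaces *)

Section Euclid.
Context {R : realType}.

(* For finite-dimensional [E] this is the class C^k on the open set [U]. *)
Fixpoint Ck_on {E W : normedModType R} (k : nat) (U : set E) (f : E -> W) : Prop :=
  if k is k'.+1 then
    (forall x, U x -> differentiable f x) /\
    (forall v : E, Ck_on k' U (fun x => 'D_v f x))
  else forall x, U x -> {for x, continuous f}.

Definition smooth_on {E W : normedModType R} (U : set E) (f : E -> W) : Prop :=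
  forall k, Ck_on k U f.

Definition smooth_near {E W : normedModType R} (f : E -> W) (x : E) : Prop :=
  exists U : set E, [/\ open U, U x & smooth_on U f].

(* iterated directional derivative: [D_(v1) (... (D_(vj) f))] at [x] *)
Definition iter_deriv {E W : normedModType R} (vs : seq E) (f : E -> W) : E -> W :=
  foldr (fun v g x => 'D_v g x) f vs.

End Euclid.

(** * Manifolds *)

(* [cmap] and [cinv] are total functions, meaningful on [cdom] and on
   [cmap @` cdom] only. *)
Record chart (R : realType) (T : topologicalType) (n : nat) := Chart {
  cdom : set T;
  cmap : T -> 'rV[R]_n;
  cinv : 'rV[R]_n -> T;
  cdom_open : open cdom;
  cimg_open : open (cmap @` cdom);
  cmapK : forall p, cdom p -> cinv (cmap p) = p;
  cmap_cont : forall p, cdom p -> {for p, continuous cmap};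
  cinv_cont : forall y, (cmap @` cdom) y -> {for y, continuous cinv} }.

Record manifold (R : realType) := Manifold {
  msort :> topologicalType;
  mdim : nat;
  atlas : set (chart R msort mdim);
  atlas_cover : forall p, exists2 c, atlas c & cdom c p;
  atlas_smooth : forall c d, atlas c -> atlas d ->
    smooth_on (cmap c @` (cdom c `&` cdom d)) (cmap d \o cinv c);
  mhausdorff : hausdorff_space msort;
  msecond_countable : @second_countable msort }.

(* Common interface for manifolds and for the jet spaces G_k:
   [dfun h p] : the real function [h] is smooth near [p];
   [dplot A y] : the map [A] from a normed space is smooth near [y]. *)
Record dspace (R : realType) := DSpace {
  dpt :> Type;
  dfun : (dpt -> R) -> dpt -> Prop;
  dplot : forall E : normedModType R, (E -> dpt) -> E -> Prop }.

Section Spaces.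
Context {R : realType}.

Definition mspace (M : manifold R) : dspace R := {|
  dpt := M;
  dfun := fun h p => forall c, atlas c -> cdom c p ->
    smooth_near (h \o cinv c) (cmap c p);
  dplot := fun E A y => forall d, @atlas R M d -> cdom d (A y) ->
    (\forall z \near y, cdom d (A z)) /\ smooth_near (cmap d \o A) y |}.

Definition smooth_map (M : manifold R) (S : dspace R) (f : M -> S) (p : M) : Prop :=
  forall c, atlas c -> cdom c p -> dplot (f \o cinv c) (cmap c p).

End Spaces.

Notation smooth_fun := (dfun (d := mspace _)).
Notation mmap := (smooth_map (S := mspace _)).

Section Tangent.
Context {R : realType}.

(* image of [v] under the differential at [p] of [f] *)
Definition push {A : Type} {S : dspace R} (f : A -> S) (p : A)
    (v : (A -> R) -> R) : (S -> R) -> R :=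
  fun h => if `[< dfun h (f p) >] then v (h \o f) else 0.

Definition velocity {S : dspace R} (c : R -> S) : (S -> R) -> R :=
  push c 0 (fun u : R -> R => derive1 u 0).

(* Tangent vectors at [p] are the velocities of smooth curves, acting as
   derivations on germs of smooth functions at [p], and extended by 0 to the
   functions that are not smooth near [p], so that equality and the pointwise
   vector space structure are those of the tangent space. *)
Definition tangent (S : dspace R) (p : S) (v : (S -> R) -> R) : Prop :=
  exists c : R -> S, [/\ c 0 = p, dplot c (0 : R) & v = velocity c].

End Tangent.

Notation mtangent := (tangent (S := mspace _)).

Section VectorFields.
Context {R : realType}.

Definition submersion (M N : manifold R) (f : M -> N) : Prop :=
  forall p, mmap f p /\
    (forall w, mtangent (f p) w ->
      exists2 v, mtangent p v & push (S := mspace N) f p v = w).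

Definition vfield_near (M : manifold R) (x : M) (V : M -> (M -> R) -> R) : Prop :=
  (\forall y \near x, mtangent y (V y)) /\
  (forall h, smooth_fun h x -> smooth_fun (fun y => V y h) x).

(* Lie bracket of vector fields *)
Definition vbracket (M : manifold R) (V W : M -> (M -> R) -> R) (p : M)
    : (M -> R) -> R :=
  fun h => if `[< smooth_fun h p >]
    then V p (fun q => W q h) - W p (fun q => V q h) else 0.

End VectorFields.

(** * Groupoids *)

(* The data of a groupoid over [I], without axioms: shared by a Lie groupoid G
   and by its jet groupoids G_k. *)
Record gpd_data (R : realType) (I : manifold R) := GpdData {
  gsp :> dspace R;
  gsrc : gsp -> I;
  gtgt : gsp -> I;
  gunit : I -> gsp;
  gmul : gsp -> gsp -> gsp;
  ginv : gsp -> gsp }.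

(* [mul Y X] is meaningful when [src Y = tgt X].  Its smoothness on the fibre
   product G x_I G is expressed by the universal property of the latter: the
   product of two smooth families of composable arrows is smooth. *)
Record lie_groupoid (R : realType) := LieGroupoid {
  base : manifold R;
  arrows : manifold R;
  src : arrows -> base;
  tgt : arrows -> base;
  unit_ : base -> arrows;
  mul : arrows -> arrows -> arrows;
  inv : arrows -> arrows;
  src_unit : forall x, src (unit_ x) = x;
  tgt_unit : forall x, tgt (unit_ x) = x;
  src_mul : forall Y X, src Y = tgt X -> src (mul Y X) = src X;
  tgt_mul : forall Y X, src Y = tgt X -> tgt (mul Y X) = tgt Y;
  mulA : forall Z Y X, src Z = tgt Y -> src Y = tgt X ->
    mul Z (mul Y X) = mul (mul Z Y) X;
  mul_unitl : forall X, mul (unit_ (tgt X)) X = X;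
  mul_unitr : forall X, mul X (unit_ (src X)) = X;
  src_inv : forall X, src (inv X) = tgt X;
  tgt_inv : forall X, tgt (inv X) = src X;
  mul_invl : forall X, mul (inv X) X = unit_ (src X);
  mul_invr : forall X, mul X (inv X) = unit_ (tgt X);
  src_submersion : submersion src;
  tgt_submersion : submersion tgt;
  unit_smooth : forall x, mmap unit_ x;
  inv_smooth : forall X, mmap inv X;
  mul_smooth : forall n (a b : 'rV[R]_n -> arrows) (y : 'rV[R]_n),
    (\forall z \near y, src (a z) = tgt (b z)) ->
    dplot (d := mspace arrows) a y -> dplot (d := mspace arrows) b y ->
    dplot (d := mspace arrows) (fun z => mul (a z) (b z)) y }.

Definition gpd_of (R : realType) (G : lie_groupoid R) : gpd_data (base G) :=
  @GpdData R (base G) (mspace (arrows G)) (@src R G) (@tgt R G) (@unit_ R G)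
    (@mul R G) (@inv R G).

Section Bisections.
Context {R : realType} {I : manifold R}.
Implicit Types (Gam : gpd_data I) (x y : I).

(* [f] is a diffeomorphism of the open set [U] onto an open set *)
Definition diffeo_on (U : set I) (f : I -> I) : Prop :=
  [/\ forall x, U x -> mmap f x,
      open (f @` U) &
      exists g : I -> I, (forall x, U x -> g (f x) = x) /\
        (forall y, (f @` U) y -> mmap g y)].

Definition bisection Gam (U : set I) (F : I -> Gam) : Prop :=
  [/\ open U,
      forall x, U x -> gsrc (F x) = x,
      forall x, U x -> smooth_map F x &
      diffeo_on U (fun x => gtgt (F x))].

(* [F] represents a germ at [x] of local bisections *)
Definition bisection_at Gam x (F : I -> Gam) : Prop :=
  exists2 U : set I, U x & bisection U F.

Definition bmul Gam (H F : I -> Gam) : I -> Gam :=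
  fun x => gmul (H (gtgt (F x))) (F x).

(* an inverse of the germ of [f] at [x]; its germ at [f x] is well defined
   when [f] is a local diffeomorphism at [x] *)
Definition local_inv x (f : I -> I) : I -> I :=
  xget (T := (I -> I)%type) id [set g : I -> I | \forall x' \near x, g (f x') = x'].

(* the inverse F^-1 of the germ at [x] of the bisection [F]; a germ at t(F(x)) *)
Definition binv Gam x (F : I -> Gam) : I -> Gam :=
  fun y => ginv (F (local_inv x (fun x' => gtgt (F x')) y)).

(* the vector j^1F . w, for w tangent at X *)
Definition j1act Gam (F : I -> Gam) (X : Gam) (w : (Gam -> R) -> R)
    : (Gam -> R) -> R :=
  push (fun Y : Gam => gmul (F (gtgt Y)) Y) X w.

(** ** The Lie algebroid ker s_* along I *)

(* a tangent vector of I regarded as tangent to the identities *)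
Definition tunit Gam x (v : (I -> R) -> R) : (Gam -> R) -> R :=
  push (@gunit R I Gam) x v.

Definition algd Gam x (xi : (Gam -> R) -> R) : Prop :=
  tangent (gunit Gam x) xi /\
  push (S := mspace I) (@gsrc R I Gam) (gunit Gam x) xi = 0.

(* [xi] represents a germ at [x] of smooth sections of the algebroid *)
Definition algd_sec Gam x (xi : I -> (Gam -> R) -> R) : Prop :=
  (\forall y \near x, algd y (xi y)) /\
  (forall h, dfun h (gunit Gam x) -> smooth_fun (fun y => xi y h) x).

(* germs at [x] of scalar 1-forms on I, and of algebroid-valued 1-forms; only the
   values on tangent vectors are meaningful *)
Definition sform_at x (om : I -> ((I -> R) -> R) -> R) : Prop :=
  (\forall y \near x, forall (a : R) v w,
     mtangent y v -> mtangent y w ->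
     om y (a *: v + w) = a * om y v + om y w) /\
  (forall V, vfield_near x V -> smooth_fun (fun y => om y (V y)) x).

Definition aform_at Gam x (u : I -> ((I -> R) -> R) -> (Gam -> R) -> R) : Prop :=
  [/\ \forall y \near x, forall v, mtangent y v -> algd y (u y v),
      \forall y \near x, forall (a : R) v w,
        mtangent y v -> mtangent y w ->
        u y (a *: v + w) = a *: u y v + u y w &
      forall V, vfield_near x V -> algd_sec x (fun y => u y (V y))].

(* [u] and [u'] define the same germ at [x] of 1-forms *)
Definition aform_eq Gam x (u u' : I -> ((I -> R) -> R) -> (Gam -> R) -> R) : Prop :=
  \forall y \near x, forall v, mtangent y v -> u y v = u' y v.

(* (d om)(V, W) *)
Definition dform (om : I -> ((I -> R) -> R) -> R) (V W : I -> (I -> R) -> R) (x : I)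
    : R :=
  V x (fun y => om y (W y)) - W x (fun y => om y (V y)) - om x (vbracket V W x).

Definition tens Gam (om : I -> ((I -> R) -> R) -> R) (xi : I -> (Gam -> R) -> R)
    : I -> ((I -> R) -> R) -> (Gam -> R) -> R :=
  fun y v => om y v *: xi y.

(* (om /\ tau)(v, w) at [x] *)
Definition wedge (om tau : I -> ((I -> R) -> R) -> R) (x : I) (v w : (I -> R) -> R)
    : R :=
  om x v * tau x w - om x w * tau x v.

End Bisections.

(** * The bracket of sections of the Lie algebroid of G *)

Section AlgebroidBracket.
Context {R : realType} (G : lie_groupoid R).
Local Notation I := (base G).

(* (R_g)_* v, for v tangent at t(g) to the source fibre over t(g) *)
Definition rtrans (g : arrows G) (v : (arrows G -> R) -> R) : (arrows G -> R) -> R :=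
  xget (T := ((arrows G -> R) -> R)%type) 0 [set w | exists c : R -> arrows G,
    [/\ c 0 = unit_ (tgt g),
        dplot (d := mspace (arrows G)) c (0 : R),
        \forall e \near (0 : R), src (c e) = tgt g,
        v = velocity (S := mspace (arrows G)) c &
        w = velocity (S := mspace (arrows G)) (fun e => mul (c e) g)]].

(* the right invariant vector field extending th *)
Definition rinv_field (th : I -> (arrows G -> R) -> R)
    : arrows G -> (arrows G -> R) -> R :=
  fun g => rtrans g (th (tgt g)).

Definition abracket (th mu : I -> (arrows G -> R) -> R) : I -> (arrows G -> R) -> R :=
  fun x => vbracket (rinv_field th) (rinv_field mu) (unit_ x).

End AlgebroidBracket.

(** * Jets of bisections *)

Section Jets.
Context {R : realType} (G : lie_groupoid R).
Local Notation I := (base G).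
Local Notation bis := (bisection_at (Gam := gpd_of G)).

(* Same k-jet at [x]: equal values, and equal partial derivatives up to order [k]
   in all charts. *)
Definition jet_eq (k : nat) (x : I) (F F' : I -> arrows G) : Prop :=
  F x = F' x /\
  forall c d, atlas c -> atlas d -> cdom c x -> cdom d (F x) ->
  forall vs, (size vs <= k)%N ->
    iter_deriv vs (cmap d \o F \o cinv c) (cmap c x) =
    iter_deriv vs (cmap d \o F' \o cinv c) (cmap c x).

(* A jet is a source point together with an equivalence class of bisections;
   the elements of G_k are singled out by [is_jet k]. *)
Definition jets : Type := (I * set (I -> arrows G))%type.

Definition jet (k : nat) (x : I) (F : I -> arrows G) : jets :=
  (x, [set F' | bis x F' /\ jet_eq k x F F']).

Definition is_jet (k : nat) (X : jets) : Prop :=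
  exists2 F, bis X.1 F & X = jet k X.1 F.

(* a representative of a jet *)
Definition jrep (X : jets) : I -> arrows G := xget (T := (I -> arrows G)%type) (@unit_ R G) X.2.

Definition jval (X : jets) : arrows G := jrep X X.1.

Definition jproj (k : nat) (X : jets) : jets := jet k X.1 (jrep X).

(* A map into G_k is smooth when its components in the standard jet coordinates
   are: the coordinates of the source and the partial derivatives up to order [k]
   of a representative, in charts of I and G. *)
Definition jplot (k : nat) (E : normedModType R) (A : E -> jets) (y : E) : Prop :=
  (\forall z \near y, is_jet k (A z)) /\
  forall c d, atlas c -> atlas d -> cdom c (A y).1 -> cdom d (jval (A y)) ->
    [/\ \forall z \near y, cdom c (A z).1 /\ cdom d (jval (A z)),
        smooth_near (fun z => cmap c (A z).1) y &
        forall vs, (size vs <= k)%N ->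
          smooth_near (fun z => iter_deriv vs (cmap d \o jrep (A z) \o cinv c)
                                  (cmap c (A z).1)) y].

(* A function on G_k is smooth near [X] iff it is so along all smooth maps from
   some R^n, e.g. inverses of charts of G_k.  Values outside G_k are irrelevant. *)
Definition jspace (k : nat) : dspace R := {|
  dpt := jets;
  dfun := fun h X => forall n (A : 'rV[R]_n -> jets) (y : 'rV[R]_n),
    A y = X -> jplot k A y -> smooth_near (h \o A) y;
  dplot := jplot k |}.

Definition jgpd (k : nat) : gpd_data I :=
  @GpdData R I (jspace k)
    (fun X => X.1)
    (fun X => tgt (jval X))
    (fun x => jet k x (@unit_ R G))
    (fun Y X => jet k X.1 (bmul (Gam := gpd_of G) (jrep Y) (jrep X)))
    (fun X => jet k (tgt (jval X)) (binv (Gam := gpd_of G) X.1 (jrep X))).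

(** ** J^k g as the Lie algebroid of G_k *)

(* [F] is a smooth family of bisections near [x], F_0 = identities, with
   derivative [th] at parameter 0 *)
Definition generates (x : I) (th : I -> (arrows G -> R) -> R)
    (F : R -> I -> arrows G) : Prop :=
  [/\ forall c, atlas c -> cdom c x ->
        dplot (d := mspace (arrows G))
          (fun z : R * 'rV[R]_(mdim I) => F z.1 (cinv c z.2)) (0, cmap c x),
      \forall y \near x, F 0 y = unit_ y,
      \forall e \near (0 : R), bis x (F e) &
      \forall y \near x,
        th y = velocity (S := mspace (arrows G)) (fun e => F e y)].

(* The section j^k th of J^k g, under the identification of J^k g with the
   algebroid of G_k: j^k_x th is the velocity of e |-> j^k_x F_e, for any family
   of bisections F generating th near x. *)
Definition jprol (k : nat) (th : I -> (arrows G -> R) -> R) : I -> (jets -> R) -> R :=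
  fun x => xget (T := ((jets -> R) -> R)%type) 0 [set xi | exists2 F, generates x th F &
                     xi = velocity (S := jspace k) (fun e => jet k x (F e))].

(* the projection J^l g -> J^k g, for k <= l, induced by G_l -> G_k *)
Definition jpr (l k : nat) (x : I) (xi : (jets -> R) -> R) : (jets -> R) -> R :=
  push (S := jspace k) (jproj k) (jet l x (@unit_ R G)) xi.

(** ** Linear Spencer operator and brackets *)

Local Notation sec k := (algd_sec (Gam := jgpd k)).
Local Notation form k := (aform_at (Gam := jgpd k)).
Local Notation gsec := (algd_sec (Gam := gpd_of G)).
Local Notation T x := (mtangent x).
Local Notation jsec := (I -> (jets -> R) -> R).
Local Notation tan := ((I -> R) -> R).
Local Notation jform := (I -> tan -> (jets -> R) -> R).
Local Notation jform2 := (I -> tan -> tan -> (jets -> R) -> R).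

(* [D xi x v] is i(v)(D xi) at [x].  All conditions bear on germs, so that
   [D] is a sheaf map, determined on germs of smooth sections and tangent
   vectors by the conditions below; likewise for the next three operators. *)
Definition is_spencer (k : nat) (D : jsec -> jform) : Prop :=
  [/\ forall x xi, sec k x xi -> form k.-1 x (D xi),
      forall x xi xi' v, sec k x xi -> sec k x xi' -> T x v ->
        (\forall y \near x, xi y = xi' y) -> D xi x v = D xi' x v,
      forall x (a : R) xi xi' v, sec k x xi -> sec k x xi' -> T x v ->
        D (a *: xi + xi') x v = a *: D xi x v + D xi' x v,
      forall x th v, gsec x th -> T x v -> D (jprol k th) x v = 0 &
      forall x (h : I -> R) xi v, smooth_fun h x -> sec k x xi -> T x v ->
        D (fun y => h y *: xi y) x v = v h *: jpr k k.-1 x (xi x) + h x *: D xi x v].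

(* [D1] extends [D] to 1-forms: D1 (om (x) xi) = d om (x) xi_(k-1) - om /\ D xi *)
Definition is_spencer_ext (k : nat) (D : jsec -> jform) (D1 : jform -> jform2) : Prop :=
  [/\ forall x u u' v w, form k x u -> form k x u' -> T x v -> T x w ->
        aform_eq (Gam := jgpd k) x u u' -> D1 u x v w = D1 u' x v w,
      forall x (a : R) u u' v w, form k x u -> form k x u' -> T x v -> T x w ->
        D1 (a *: u + u') x v w = a *: D1 u x v w + D1 u' x v w &
      forall x om xi V W, sform_at x om -> sec k x xi ->
        vfield_near x V -> vfield_near x W ->
        D1 (tens (Gam := jgpd k) om xi) x (V x) (W x) =
          dform om V W x *: jpr k k.-1 x (xi x)
          - (om x (V x) *: D xi x (W x) - om x (W x) *: D xi x (V x))].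

Definition is_bracket1 (k : nat) (B : jsec -> jsec -> jsec) : Prop :=
  [/\ forall x xi eta, sec k x xi -> sec k x eta -> sec k.-1 x (B xi eta),
      forall x xi xi' eta eta', sec k x xi -> sec k x xi' ->
        sec k x eta -> sec k x eta' ->
        (\forall y \near x, xi y = xi' y) -> (\forall y \near x, eta y = eta' y) ->
        B xi eta x = B xi' eta' x,
      forall x (h : I -> R) xi xi' eta, smooth_fun h x ->
        sec k x xi -> sec k x xi' -> sec k x eta ->
        B (fun y => h y *: xi y + xi' y) eta x = h x *: B xi eta x + B xi' eta x,
      forall x (h : I -> R) xi eta eta', smooth_fun h x ->
        sec k x xi -> sec k x eta -> sec k x eta' ->
        B xi (fun y => h y *: eta y + eta' y) x = h x *: B xi eta x + B xi eta' x &
      forall x th mu, gsec x th -> gsec x mu ->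
        B (jprol k th) (jprol k mu) x = jprol k.-1 (abracket th mu) x].

(* the bracket of 1-forms with values in J^k g *)
Definition is_bracket (k : nat) (B : jsec -> jsec -> jsec)
    (Bk : jform -> jform -> jform2) : Prop :=
  [/\ forall x u u' t t' v w, form k x u -> form k x u' ->
        form k x t -> form k x t' -> T x v -> T x w ->
        aform_eq (Gam := jgpd k) x u u' -> aform_eq (Gam := jgpd k) x t t' ->
        Bk u t x v w = Bk u' t' x v w,
      forall x (a : R) u u' t v w, form k x u -> form k x u' -> form k x t ->
        T x v -> T x w ->
        Bk (a *: u + u') t x v w = a *: Bk u t x v w + Bk u' t x v w,
      forall x (a : R) u t t' v w, form k x u -> form k x t -> form k x t' ->
        T x v -> T x w ->
        Bk u (a *: t + t') x v w = a *: Bk u t x v w + Bk u t' x v w &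
      forall x om tau xi eta v w, sform_at x om -> sform_at x tau ->
        sec k x xi -> sec k x eta -> T x v -> T x w ->
        Bk (tens (Gam := jgpd k) om xi) (tens (Gam := jgpd k) tau eta) x v w =
          wedge om tau x v w *: B xi eta x].

(** ** The non-linear Spencer operators *)

(* i(v) (D sigma_(k+1)) at x.  With phi a representative of sigma_(k+1)(x),
   lambda^1 sigma_(k+1)(x) is the 1-jet at x of the bisection y |-> j^k_y phi. *)
Definition nl_spencer (k : nat) (sigma : I -> jets) : jform :=
  fun x v =>
    let phi := jrep (sigma x) in
    let lam := (fun y => jet k y phi) : I -> jgpd k in
    let sigk := (fun y => jproj k (sigma y)) : I -> jgpd k in
    j1act (binv x lam) (sigk x)
      (j1act sigk (gunit (jgpd k) x) (tunit (Gam := jgpd k) x v))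
    - tunit (Gam := jgpd k) x v.

Definition nl_spencer1 (D1 : jform -> jform2) (Bk : jform -> jform -> jform2)
    (u : jform) : jform2 :=
  D1 u - 2^-1 *: Bk u u.

End Jets.

(* Main.v *)
Require Import Defs.
From mathcomp Require Import all_boot all_order all_algebra.
From mathcomp Require Import all_classical all_reals all_analysis.
From mathcomp Require Import ring lra.
From HB Require Import structures.
(* Required again, so that [src], [tgt], [mul], [inv] are those of a Lie groupoid. *)
Require Import Defs.
Set Implicit Arguments.
Unset Strict Implicit.
Unset Printing Implicit Defensive.
Import Order.TTheory GRing.Theory Num.Theory.
Import numFieldNormedType.Exports.
Local Open Scope classical_set_scope.
Local Open Scope ring_scope.

(* Near a point, sigma is represented by a smooth family of bisections Psi_z of G,
   with sigma(z) = j^(k+1)_z Psi_z.  Put Theta_(z,z') = Psi_z^-1 Psi_z' and let zeta_v(z, .),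
   a section of g, be the derivative of Theta_(z,z') in z' at z' = z, in the direction v.
   Then i(v) D sigma at z is j^k_z (zeta_v(z, .)).

   D1 o D = 0.  Differentiating Theta_(z,z'') = Theta_(z,z') Theta_(z',z'') twice gives the
   Maurer-Cartan equation d_v zeta_w - d_w zeta_v = [zeta_v, zeta_w], the derivatives on the left
   being taken in z.  By a Taylor expansion, zeta_v(z, .) agrees to order k at z with a finite
   sum of products om_t(v)(z) theta_t, so that D sigma is the sum of the om_t (x) j^k theta_t,
   on which D1 and the bracket are given explicitly.  Agreement to order k at z, for all z, of
   two functions of (z, w) yields agreement to order k-1 of their derivatives in z, so the
   equation above, taken to order k-1, is D(D sigma) = [D sigma, D sigma] / 2.

   Exactness.  If D sigma = 0, the derivative of Psi_z in z has vanishing k-jet at z; hence the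
   jet coordinates s_J of sigma satisfy d_i s_J = s_(i J) for |J| <= k, which means that sigma
   is the (k+1)-jet of the bisection z |-> Psi_z(z) underlying it. *)

(** * Smooth maps between normed spaces *)

(** G_k never receives a manifold structure: its smooth functions are those that are smooth along
    all plots. What replaces charts is [jet_family], which realises the jets near a given one by a
    smooth family of bisections. Every plot of G_k then comes from such a family, and tangent
    vectors are computed in redundant jet coordinates.

    Two obstacles come from G. Multiplication is smooth on composable pairs only, so it cannot be
    differentiated in charts before it is extended ([mul_extension]). And the Taylor polynomials of
    bisections, or of sections of ker s_*, are no longer of that kind, whence the corrections
    [retraction] and [vproj]. Inverting families of bisections takes an implicit function theorem
    with parameters.

    D, D_1 and the bracket are known only through their values on tensors om (x) j^k theta, so D
    sigma must be a finite sum of such tensors with smooth om. Splitting w - z into w and z in the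
    Taylor polynomial at z provides it. The factor 1/2 compensates for [u, u](v, w), which contains
    each product of u(v) and u(w) twice. *)

Section Calc.
Context {R : realType}.
Implicit Types E V W : normedModType R.

(** The difference [g - f] vanishes near [x], so its differential there is 0. *)
Lemma near_eq_differentiable E W (f g : E -> W) x :
  (\near x, f x = g x) -> differentiable f x -> differentiable g x.
Proof.
move=> fg df.
have fg' : \forall y \near (0 : E), f (y + x) = g (y + x).
  by move: fg; rewrite (near_shift 0 x) subr0.
suff dh : differentiable (g - f) x.
  rewrite (_ : g = f + (g - f)); first exact: differentiableD.
  by rewrite addrC subrK.
have e0 : (g - f) \o shift x = cst ((g - f) x) + (\0 : E -> W) +o_ 0 id.
  apply/eqaddoP => e e0; near=> y.
  rewrite !fctE /= (nbhs_singleton fg) subrr.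
  suff -> : g (y + x) = f (y + x).
    by rewrite subrr !addr0 !subr0 normr0 mulr_ge0// ltW.
  by near: y; near do apply/esym.
have d0 : 'd (g - f) x = (\0 : E -> W) :> (E -> W).
  by apply: (@diff_unique _ _ _ _ \0) => // y; exact: cst_continuous.
by apply/diff_locallyP; rewrite d0; split => // y; exact: cst_continuous.
Unshelve. all: by end_near. Qed.

Lemma derive_comp E V W (f : E -> V) (g : V -> W) x v :
  differentiable f x -> differentiable g (f x) ->
  'D_v (g \o f) x = 'D_('D_v f x) g (f x).
Proof.
move=> df dg; rewrite !deriveE //; last exact: differentiable_comp.
by rewrite diff_comp.
Qed.

Lemma derive_linear E W (f : {linear E -> W}) x v :
  continuous f -> 'D_v f x = f v.
Proof. by move=> cf; rewrite deriveE ?diff_lin//; exact: linear_differentiable. Qed.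

Lemma deriveDv E W (f : E -> W) x v w : differentiable f x ->
  'D_(v + w) f x = 'D_v f x + 'D_w f x.
Proof. by move=> df; rewrite !deriveE // linearD. Qed.

Lemma deriveZv E W (f : E -> W) x a v : differentiable f x ->
  'D_(a *: v) f x = a *: 'D_v f x.
Proof. by move=> df; rewrite !deriveE // linearZ. Qed.

Lemma derive_sumv E W (f : E -> W) x I (r : seq I) (v : I -> E) :
  differentiable f x ->
  'D_(\sum_(i <- r) v i) f x = \sum_(i <- r) 'D_(v i) f x.
Proof. by move=> df; rewrite deriveE // linear_sum; apply: eq_bigr => i _; rewrite deriveE. Qed.

(** Named so that it can carry a structure of bilinear map: the Leibniz rule below is the
    differential of a bilinear map. *)
Definition scl W (a : R) (w : W) : W := a *: w.

Lemma scl_is_bilinear W : bilinear_for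
  (GRing.Scale.Law.clone _ _ *:%R _) (GRing.Scale.Law.clone _ _ *:%R _) (@scl W).
Proof.
by split=> [u a x y|u a x y]; rewrite /scl /= ?scalerDl ?scalerDr ?scalerA // mulrC.
Qed.

HB.instance Definition _ W :=
  bilinear_isBilinear.Build R R W W _ _ (@scl W) (scl_is_bilinear W).

Lemma scl_continuous W : continuous (fun p : R * W => scl p.1 p.2).
Proof. by move=> p; apply: cvgZ; [exact: cvg_fst|exact: cvg_snd]. Qed.

Lemma differentiable_scale E W (h : E -> R) (f : E -> W) x :
  differentiable h x -> differentiable f x ->
  differentiable (fun y => h y *: f y) x.
Proof.
move=> dh df; apply: (@differentiable_comp _ _ _ _ (fun y => (h y, f y)) (fun p => scl p.1 p.2)).
  exact: differentiable_pair.
by apply: differentiable_bilin; exact: scl_continuous.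
Qed.

Lemma derive_scale E W (h : E -> R) (f : E -> W) x v :
  differentiable h x -> differentiable f x ->
  'D_v (fun y => h y *: f y) x = 'D_v h x *: f x + h x *: 'D_v f x.
Proof.
move=> dh df; rewrite !deriveE //; last exact: differentiable_scale.
rewrite (@diff_comp _ _ _ _ (fun y => (h y, f y)) (fun p => scl p.1 p.2)) /=.
- rewrite diff_bilin /=; last exact: scl_continuous.
  by rewrite diff_pair //= addrC.
- exact: differentiable_pair.
- by apply: differentiable_bilin; exact: scl_continuous.
Qed.

Lemma differentiable_snd E W (p : E * W) : differentiable snd p.
Proof. by apply: (@linear_differentiable _ _ _ snd) => x; exact: cvg_snd. Qed.

Lemma open_near E (U : set E) x : open U -> U x -> \forall y \near x, U y.
Proof. by move=> oU Ux; exact: open_nbhs_nbhs. Qed.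

Lemma Ck_S k E W (U : set E) (f : E -> W) : Ck_on k.+1 U f -> Ck_on k U f.
Proof.
elim: k f => [|k IH] f [df Df]; first by move=> x /df; exact: differentiable_continuous.
by split=> // v; apply: IH; exact: Df.
Qed.

Lemma Ck_sub k E W (U V : set E) (f : E -> W) : V `<=` U -> Ck_on k U f -> Ck_on k V f.
Proof.
move=> VU; elim: k f => [|k IH] f; first by move=> h x /VU; exact: h.
by move=> [df Df]; split=> [x /VU|v]; [exact: df|exact: (IH _ (Df v))].
Qed.

Lemma Ck_ext k E W (U : set E) (f g : E -> W) : open U ->
  (forall x, U x -> f x = g x) -> Ck_on k U f -> Ck_on k U g.
Proof.
move=> oU; elim: k f g => [|k IH] f g fg.
  move=> cf x Ux; rewrite /prop_for /continuous_at -(fg x Ux).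
  apply: cvg_trans (cf x Ux); apply: near_eq_cvg.
  by near=> y; apply: fg; near: y; exact: open_near.
have nfg x : U x -> \near x, f x = g x.
  by move=> Ux; near=> y; apply: fg; near: y; exact: open_near.
move=> [df Df]; split=> [x Ux|v]; first exact: near_eq_differentiable (nfg x Ux) (df x Ux).
by apply: IH (Df v) => x /nfg; exact: near_eq_derive.
Unshelve. all: by end_near. Qed.

Lemma Ck_cst k E W (U : set E) (a : W) : Ck_on k U (fun _ : E => a).
Proof.
elim: k a => [|k IH] a /=; first by move=> x _; exact: cvg_cst.
split=> [x _|v]; first exact: differentiable_cst.
suff -> : (fun x => 'D_v (fun _ : E => a) x) = fun _ => 0 by exact: IH.
by apply/funext => x; exact: derive_cst.
Qed.

Lemma CkD k E W (U : set E) (f g : E -> W) : open U ->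
  Ck_on k U f -> Ck_on k U g -> Ck_on k U (fun x => f x + g x).
Proof.
move=> oU; elim: k f g => [|k IH] f g.
  by move=> cf cg x Ux; apply: cvgD; [exact: cf|exact: cg].
move=> [df Df] [dg Dg]; split=> [x Ux|v]; first by apply: differentiableD; [exact: df|exact: dg].
apply: Ck_ext oU _ (IH _ _ (Df v) (Dg v)) => x Ux.
by rewrite deriveD //; apply: diff_derivable; [exact: df|exact: dg].
Qed.

Lemma Ck_scale k E W (U : set E) (h : E -> R) (f : E -> W) : open U ->
  Ck_on k U h -> Ck_on k U f -> Ck_on k U (fun x => h x *: f x).
Proof.
move=> oU; elim: k h f => [|k IH] h f.
  by move=> cf cg x Ux; apply: cvgZ; [exact: cf|exact: cg].
move=> Ch Cf; have [dh Dh] := Ch; have [df Df] := Cf.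
split=> [x Ux|v]; first by apply: differentiable_scale; [exact: dh|exact: df].
apply: Ck_ext oU _ (CkD oU (IH _ _ (Dh v) (Ck_S Cf)) (IH _ _ (Ck_S Ch) (Df v))) => x Ux.
by rewrite derive_scale //; [exact: dh|exact: df].
Qed.

Lemma Ck_sum k E W (U : set E) I (r : seq I) (f : I -> E -> W) : open U ->
  (forall i, Ck_on k U (f i)) -> Ck_on k U (fun x => \sum_(i <- r) f i x).
Proof.
move=> oU Cf; elim: r => [|i r IH].
  by under eq_fun do rewrite big_nil; exact: Ck_cst.
by under eq_fun do rewrite big_cons; exact: CkD.
Qed.

Lemma Ck_linear k E V W (U : set E) (l : {linear V -> W}) (f : E -> V) : open U ->
  continuous l -> Ck_on k U f -> Ck_on k U (l \o f).
Proof.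
move=> oU cl; elim: k f => [|k IH] f.
  by move=> cf x Ux; apply: continuous_comp; [exact: cf|exact: cl].
move=> [df Df]; split=> [x Ux|v].
  by apply: differentiable_comp; [exact: df|exact: linear_differentiable].
apply: Ck_ext oU _ (IH _ (Df v)) => x Ux.
rewrite derive_comp ?derive_linear //; [exact: df|exact: linear_differentiable].
Qed.

(* [b] need not be linearly independent. *)
Definition findim E := exists n (b : 'I_n -> E) (l : 'I_n -> {linear E -> R}),
  (forall i, continuous (l i)) /\ (forall x, x = \sum_i l i x *: b i).

(** The chain rule differentiates [g] in the varying direction ['D_v f x], whereas [Ck_on] speaks of
    fixed directions. Expanding that direction on the finite spanning family of [V] turns the
    derivative into a sum of products covered by the induction. *)
Lemma Ck_comp k E V W (U : set E) (S : set V) (f : E -> V) (g : V -> W) : findim V ->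
  open U -> (forall x, U x -> S (f x)) -> Ck_on k U f -> Ck_on k S g -> Ck_on k U (g \o f).
Proof.
move=> [n [b [l [cl bl]]]] oU US; elim: k f g US => [|k IH] f g US.
  by move=> cf cg x Ux; apply: continuous_comp; [exact: cf|apply: cg; exact: US].
move=> Cf Cg; have [df Df] := Cf; have [dg Dg] := Cg; split=> [x Ux|v].
  by apply: differentiable_comp; [exact: df|apply: dg; exact: US].
pose F i x := l i ('D_v f x) *: ('D_(b i) g \o f) x.
apply: (@Ck_ext k _ _ U (fun x => \sum_i F i x)) => //.
  move=> x Ux; rewrite derive_comp; [|exact: df|by apply: dg; exact: US].
  rewrite (bl ('D_v f x)) derive_sumv; last by apply: dg; exact: US.
  by apply: eq_bigr => i _; rewrite deriveZv //; apply: dg; exact: US.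
apply: Ck_sum => // i; apply: Ck_scale => //; first exact: (Ck_linear oU (cl i) (Df v)).
by apply: (IH f ('D_(b i) g) US); [exact: Ck_S|exact: Dg].
Qed.

Local Notation sm := smooth_near.

Lemma sm_near_ext E W (f g : E -> W) x : (\near x, f x = g x) -> sm f x -> sm g x.
Proof.
move=> fg [U [oU Ux sf]].
have [V [oV Vx] VE] : exists2 B, open_nbhs x B & B `<=` [set y | f y = g y].
  by move: fg; rewrite -[X in X -> _]/(nbhs x [set y | f y = g y]) nbhsE.
exists (U `&` V); split; [exact: openI|by []|move=> k].
apply: (@Ck_ext k _ _ _ f); [exact: openI|by move=> y [_ /VE]|].
by apply: Ck_sub (sf k) => y [].
Qed.

Lemma sm_near E W (f : E -> W) x : sm f x -> \forall y \near x, sm f y.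
Proof.
move=> [U [oU Ux sf]]; near=> y; exists U; split => //; near: y; exact: open_near.
Unshelve. all: by end_near. Qed.

Lemma sm_diff E W (f : E -> W) x : sm f x -> differentiable f x.
Proof. by move=> [U [oU Ux /(_ 1%N)[+ _]]]; exact. Qed.

Lemma sm_cont E W (f : E -> W) x : sm f x -> {for x, continuous f}.
Proof. by move=> [U [oU Ux /(_ 0%N)]]; exact. Qed.

Lemma sm_derive E W (f : E -> W) x v : sm f x -> sm ('D_v f) x.
Proof. by move=> [U [oU Ux sf]]; exists U; split => // k; have [_] := sf k.+1; exact. Qed.

Lemma sm_cst E W (a : W) (x : E) : sm (fun _ : E => a) x.
Proof. by exists setT; split => [||k]; [exact: openT|by []|exact: Ck_cst]. Qed.

Lemma sm_bin E W1 W2 W (op : W1 -> W2 -> W) (f : E -> W1) (g : E -> W2) x :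
  (forall k (U : set E), open U -> Ck_on k U f -> Ck_on k U g ->
     Ck_on k U (fun x => op (f x) (g x))) ->
  sm f x -> sm g x -> sm (fun y => op (f y) (g y)) x.
Proof.
move=> H [U [oU Ux sf]] [V [oV Vx sg]]; exists (U `&` V); split => //; first exact: openI.
by move=> k; apply: H; [exact: openI|apply: Ck_sub (sf k) => ? []|apply: Ck_sub (sg k) => ? []].
Qed.

Lemma smD E W (f g : E -> W) x : sm f x -> sm g x -> sm (fun y => f y + g y) x.
Proof. by apply: sm_bin => k U; exact: CkD. Qed.

Lemma sm_scale E W (h : E -> R) (f : E -> W) x : sm h x -> sm f x -> sm (fun y => h y *: f y) x.
Proof. by apply: (@sm_bin _ _ _ _ (@scl W)) => k U; exact: Ck_scale. Qed.

Lemma sm_linear E V W (l : {linear V -> W}) (f : E -> V) x : continuous l -> sm f x ->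
  sm (fun y => l (f y)) x.
Proof. by move=> cl [U [oU Ux sf]]; exists U; split => // k; exact: Ck_linear. Qed.

Lemma smN E W (f : E -> W) x : sm f x -> sm (fun y => - f y) x.
Proof.
move=> sf; apply: (@sm_near_ext _ _ (fun y => -1 *: f y)); first by near=> y; rewrite scaleN1r.
by apply: sm_scale => //; exact: sm_cst.
Unshelve. all: by end_near. Qed.

Lemma smB E W (f g : E -> W) x : sm f x -> sm g x -> sm (fun y => f y - g y) x.
Proof. by move=> sf sg; apply: smD => //; exact: smN. Qed.

Lemma smM E (f g : E -> R) x : sm f x -> sm g x -> sm (fun y => f y * g y) x.
Proof. exact: (@sm_scale E R). Qed.

Lemma sm_sum E W I (r : seq I) (P : pred I) (f : I -> E -> W) x :
  (forall i, P i -> sm (f i) x) -> sm (fun y => \sum_(i <- r | P i) f i y) x.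
Proof.
move=> sf; elim: r => [|i r IH].
  by under eq_fun do rewrite big_nil; exact: sm_cst.
under eq_fun do rewrite big_cons; case Pi: (P i) => //; apply: smD => //; exact: sf.
Qed.

Lemma sm_prod E I (r : seq I) (P : pred I) (f : I -> E -> R) x :
  (forall i, P i -> sm (f i) x) -> sm (fun y => \prod_(i <- r | P i) f i y) x.
Proof.
move=> sf; elim: r => [|i r IH].
  by under eq_fun do rewrite big_nil; exact: sm_cst.
under eq_fun do rewrite big_cons; case Pi: (P i) => //; apply: smM => //; exact: sf.
Qed.

Lemma sm_lin E W (l : {linear E -> W}) x : continuous l -> sm l x.
Proof.
move=> cl; exists setT; split => [||k]; [exact: openT|by []|].
case: k => [|k]; first by move=> y _; exact: cl.
split=> [y _|v]; first exact: linear_differentiable.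
have -> : 'D_v l = fun _ => l v by apply/funext => y; exact: derive_linear.
exact: Ck_cst.
Qed.

Lemma sm_id E (x : E) : sm id x.
Proof. by apply: (@sm_lin _ _ idfun) => y. Qed.

Lemma sm_fst E W (p : E * W) : sm fst p.
Proof. by apply: sm_lin => y; exact: cvg_fst. Qed.

Lemma sm_snd E W (p : E * W) : sm snd p.
Proof. by apply: sm_lin => y; exact: cvg_snd. Qed.

Lemma sm_comp E V W (g : V -> W) (f : E -> V) x : findim V ->
  sm f x -> sm g (f x) -> sm (fun y => g (f y)) x.
Proof.
move=> fV [U [oU Ux sf]] [S [oS Sx sg]].
have oUS : open (U `&` f @^-1` S).
  rewrite openE => y [Uy Sy]; apply: filterI; first exact: open_near.
  have := sf 0%N y Uy; apply; exact: open_near.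
exists (U `&` f @^-1` S); split => // k.
apply: (Ck_comp (S := S) fV oUS) (sg k); first by move=> y [].
by apply: Ck_sub (sf k) => y [].
Qed.

End Calc.
Notation sm := smooth_near.

(** * Finite-dimensional normed spaces *)

Section Findim.
Context {R : realType}.
Implicit Types E V W : normedModType R.

Lemma findimI E (I : finType) (b : I -> E) (l : I -> {linear E -> R}) :
  (forall i, continuous (l i)) -> (forall x, x = \sum_i l i x *: b i) -> findim E.
Proof.
move=> cl bl; exists #|I|, (fun i => b (enum_val i)), (fun i => l (enum_val i)).
split=> [i|x]; first exact: cl.
by rewrite {1}(bl x) (reindex_onto enum_val enum_rank) /=; [apply: eq_bigl => i; rewrite enum_valK eqxx|move=> i _; exact: enum_rankK].
Qed.

Lemma findim_real : findim R.
Proof.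
apply: (@findimI R unit (fun=> 1) (fun=> idfun : {linear R -> R})) => [_|x]; first by move=> y.
by rewrite (big_pred1 tt) => [|[]//]; rewrite [RHS]mulr1.
Qed.

Definition mxcoord m n (i : 'I_m) (j : 'I_n) (A : 'M[R]_(m, n)) : R := A i j.

Lemma mxcoord_is_linear m n i j : linear (@mxcoord m n i j).
Proof. by move=> a A B; rewrite /mxcoord !mxE. Qed.

HB.instance Definition _ m n i j :=
  GRing.isLinear.Build R 'M[R]_(m, n) R _ (@mxcoord m n i j) (mxcoord_is_linear i j).

Lemma mxcoord_continuous m n i j : continuous (@mxcoord m n i j).
Proof. exact: coord_continuous. Qed.

Lemma findim_mx m n : findim 'M[R]_(m, n).
Proof.
apply: (@findimI _ ('I_m * 'I_n)%type (fun p => delta_mx p.1 p.2) (fun p => @mxcoord m n p.1 p.2)).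
  by move=> p; exact: mxcoord_continuous.
by move=> A; rewrite {1}[A]matrix_sum_delta pair_big.
Qed.

Lemma fst_continuous E W : continuous (fst : E * W -> E).
Proof. by move=> p; exact: cvg_fst. Qed.

Lemma snd_continuous E W : continuous (snd : E * W -> W).
Proof. by move=> p; exact: cvg_snd. Qed.

Lemma comp_continuous E V W (f : E -> V) (g : V -> W) : continuous f -> continuous g ->
  continuous (g \o f).
Proof. by move=> cf cg x; apply: continuous_comp; [exact: cf|exact: cg]. Qed.

Lemma sum_pair E W I (r : seq I) (f : I -> E) (g : I -> W) :
  \sum_(i <- r) (f i, g i) = (\sum_(i <- r) f i, \sum_(i <- r) g i).
Proof. by elim: r => [|i r IH]; rewrite ?big_nil // !big_cons IH. Qed.

Lemma findim_prod E W : findim E -> findim W -> findim (E * W)%type.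
Proof.
move=> [n [b [l [cl bl]]]] [p [c [m [cm cb]]]].
pose B (i : 'I_n + 'I_p) : (E * W)%type := match i with inl i => (b i, 0) | inr j => (0, c j) end.
pose L (i : 'I_n + 'I_p) : {linear (E * W)%type -> R} :=
  match i with inl i => (l i \o fst) | inr j => (m j \o snd) end.
apply: (@findimI _ _ B L).
  by case=> i; apply: comp_continuous => //; [exact: fst_continuous|exact: snd_continuous].
move=> [x y]; rewrite big_sumType /=.
have -> : \sum_i l i x *: (b i, 0 : W) = (x, 0).
  have -> : (x, 0 : W) = (\sum_i l i x *: b i, \sum_(i < n) (0 : W)) by congr pair; [exact: bl|rewrite big1].
  rewrite -sum_pair.
  by apply: eq_bigr => i _; rewrite -[LHS]/(l i x *: b i, l i x *: (0 : W)) scaler0.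
have -> : \sum_i m i y *: (0 : E, c i) = (0, y).
  have -> : (0 : E, y) = (\sum_(i < p) (0 : E), \sum_i m i y *: c i) by congr pair; [rewrite big1|exact: cb].
  rewrite -sum_pair.
  by apply: eq_bigr => i _; rewrite -[LHS]/(m i y *: (0 : E), m i y *: c i) scaler0.
by rewrite -[RHS]/(x + 0, 0 + y) addr0 add0r.
Qed.

(** Smoothness of the multiplication of G and of functions on G_k is tested on row vectors only; the
    linear section [g] of [f] transfers it to any finite-dimensional space of parameters. *)
Lemma findim_iso E : findim E -> exists n (f : {linear 'rV[R]_n -> E}) (g : {linear E -> 'rV[R]_n}),
  [/\ continuous f, continuous g & cancel g f].
Proof.
move=> [n [b [l [cl bl]]]].
pose f (u : 'rV[R]_n) : E := \sum_i u ord0 i *: b i.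
pose g (x : E) : 'rV[R]_n := \row_i l i x.
have lf : linear f.
  move=> a u v; rewrite /f scaler_sumr -big_split /=; apply: eq_bigr => i _.
  by rewrite !mxE scalerDl scalerA.
have lg : linear g by move=> a u v; apply/rowP => i; rewrite !mxE linearP.
pose F : {linear 'rV[R]_n -> E} := HB.pack f (GRing.isLinear.Build _ _ _ _ _ lf).
pose G : {linear E -> 'rV[R]_n} := HB.pack g (GRing.isLinear.Build _ _ _ _ _ lg).
exists n, F, G; split.
- suff : sm f 0 by move/sm_cont; rewrite -[f]/(F : _ -> _) => /continuousfor0_continuous.
  apply: sm_sum => i _; apply: sm_scale; last exact: sm_cst.
  exact: (sm_lin _ (@mxcoord_continuous _ _ ord0 i)).
- suff : sm g 0 by move/sm_cont; rewrite -[g]/(G : _ -> _) => /continuousfor0_continuous.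
  apply: (@sm_near_ext _ _ _ (fun x => \sum_i l i x *: delta_mx ord0 i)).
    by near=> x; rewrite [RHS]row_sum_delta; apply: eq_bigr => i _; rewrite mxE.
  apply: sm_sum => i _; apply: sm_scale; last exact: sm_cst.
  exact: sm_lin.
- move=> x; rewrite [RHS]bl; apply: eq_bigr => i _ /=; by rewrite /g mxE.
Unshelve. all: by end_near. Qed.

End Findim.
#[global] Hint Extern 0 (findim _) =>
  solve [repeat first [exact: findim_mx | exact: findim_real | assumption | apply: findim_prod]] : core.

(** * Derivatives along affine substitutions, of pairs, and in varying directions *)

Section Deriv.
Context {R : realType}.
Implicit Types E V W : normedModType R.

(** A directional derivative reads the function on a line only, so affine substitutions need no
    differentiability. Slices, translations and projections are all handled in this way. *)
Lemma derive_affine E V W (a : E -> V) (f : V -> W) y v w :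
  (forall h : R, a (h *: v + y) = h *: w + a y) -> 'D_v (fun y => f (a y)) y = 'D_w f (a y).
Proof.
move=> aE; rewrite /derive.
set F := (fun h : R => _); set G := (fun h : R => _).
by have -> : F = G by apply/funext => h; rewrite /F /G /= aE.
Qed.

Lemma iter_deriv_affine E V W (a : E -> V) (L : E -> V) (f : V -> W) vs y :
  (forall (h : R) v y, a (h *: v + y) = h *: L v + a y) ->
  iter_deriv vs (fun y => f (a y)) y = iter_deriv (map L vs) f (a y).
Proof.
move=> aE; elim: vs y => [//|v vs IH] y /=.
rewrite (_ : iter_deriv vs _ = fun y => iter_deriv (map L vs) f (a y)); last exact/funext.
exact: derive_affine.
Qed.

Lemma iter_deriv_rcons E W vs v (f : E -> W) :
  iter_deriv (rcons vs v) f = iter_deriv vs ('D_v f).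
Proof. by rewrite /iter_deriv foldr_rcons. Qed.

Lemma near_near (T : topologicalType) (P : T -> Prop) (x : T) : (\forall z \near x, P z) -> nbhs x (fun y : T => nbhs y P).
Proof. by move/near_join. Qed.

Lemma near_derive_eq E W (f g : E -> W) (x : E) v : (\near x, f x = g x) ->
  \forall y \near x, 'D_v f y = 'D_v g y.
Proof. by move=> /near_near fg; near do apply: near_eq_derive. Unshelve. all: by end_near. Qed.

Lemma near_iter_deriv_eq E W (f g : E -> W) (x : E) vs : (\near x, f x = g x) ->
  \forall y \near x, iter_deriv vs f y = iter_deriv vs g y.
Proof. by elim: vs => [//|v vs IH] /= /IH; exact: near_derive_eq. Qed.

Lemma sm_iter E W (f : E -> W) x vs : sm f x -> sm (iter_deriv vs f) x.
Proof. by elim: vs => [//|v vs IH] /= /IH; exact: sm_derive. Qed.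

Lemma sm_pair E V W (f : E -> V) (g : E -> W) x : sm f x -> sm g x -> sm (fun y => (f y, g y)) x.
Proof.
move=> sf sg; pose i1 (v : V) : (V * W)%type := (v, 0); pose i2 (w : W) : (V * W)%type := (0, w).
have l1 : linear i1 by move=> a u v; rewrite /i1; congr pair; rewrite /= scaler0 addr0.
have l2 : linear i2 by move=> a u v; rewrite /i2; congr pair; rewrite /= scaler0 addr0.
pose L1 : {linear V -> (V * W)%type} := HB.pack i1 (GRing.isLinear.Build _ _ _ _ _ l1).
pose L2 : {linear W -> (V * W)%type} := HB.pack i2 (GRing.isLinear.Build _ _ _ _ _ l2).
apply: (@sm_near_ext _ _ _ (fun y => L1 (f y) + L2 (g y))).
  by near=> y; rewrite -[LHS]/(f y + 0, 0 + g y) addr0 add0r.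
apply: smD; apply: sm_linear => // z; apply: cvg_pair => //=.
- exact: cvg_cst.
- exact: cvg_cst.
Unshelve. all: by end_near. Qed.

Lemma derive_pair E V W (f : E -> V) (g : E -> W) x v :
  differentiable f x -> differentiable g x ->
  'D_v (fun y => (f y, g y)) x = ('D_v f x, 'D_v g x).
Proof.
by move=> df dg; rewrite !deriveE ?diff_pair//; exact: differentiable_pair.
Qed.

Lemma derive_findim E W n (b : 'I_n -> E) (l : 'I_n -> {linear E -> R}) (f : E -> W) x v :
  (forall x, x = \sum_i l i x *: b i) -> differentiable f x ->
  'D_v f x = \sum_i l i v *: 'D_(b i) f x.
Proof.
move=> bl df; rewrite {1}(bl v) derive_sumv //; apply: eq_bigr => i _; exact: deriveZv.
Qed.

Lemma near_comp (T S : topologicalType) (c : T -> S) (x : T) (P : S -> Prop) :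
  {for x, continuous c} -> (\forall z \near c x, P z) -> \forall y \near x, P (c y).
Proof. by move=> cc Pz; exact: cc. Qed.

(** The direction varies with the point and is therefore expanded on a fixed spanning family. *)
Lemma sm_D E V W (f : V -> W) (c : E -> V) (v : E -> V) x : findim V -> sm f (c x) ->
  sm c x -> sm v x -> sm (fun y => 'D_(v y) f (c y)) x.
Proof.
move=> fE sf sc sv; have [n [b [l [cl bl]]]] := fE.
have nf : \forall y \near x, sm f (c y) by apply: near_comp (sm_cont sc) _; exact: sm_near.
apply: (@sm_near_ext _ _ _ (fun y => \sum_i l i (v y) *: 'D_(b i) f (c y))).
  by near=> y; rewrite -derive_findim //; apply: sm_diff; near: y.
apply: sm_sum => i _; apply: sm_scale; first exact: (sm_linear (cl i)).
by apply: (@sm_comp _ _ _ _ ('D_(b i) f) c) => //; exact: sm_derive.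
Unshelve. all: by end_near. Qed.

End Deriv.

(** * Symmetry of derivatives, agreement to finite order *)

Section Schwarz.
Context {R : realType}.
Implicit Types E V W : normedModType R.

Lemma nearI (T : topologicalType) (x : T) (P Q : T -> Prop) :
  nbhs x P -> nbhs x Q -> nbhs x (fun y => P y /\ Q y).
Proof. exact: filterI. Qed.

Lemma sm_line E (u p : E) (t : R) : sm (fun s : R => s *: u + p) t.
Proof. by apply: smD; [apply: sm_scale; [exact: sm_id|exact: sm_cst]|exact: sm_cst]. Qed.

Lemma derive_line E W (g : E -> W) u p (t : R) :
  'D_1 (fun s : R => g (s *: u + p)) t = 'D_u g (t *: u + p).
Proof. by apply: derive_affine => h; rewrite -[h *: 1]/(h * 1) mulr1 scalerDl addrA. Qed.

Lemma line_MVT E (g : E -> R) p u (d : R) : 0 <= d ->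
  (forall t, 0 <= t <= d -> differentiable g (t *: u + p)) ->
  exists2 t, 0 <= t <= d & g (d *: u + p) - g p = d * 'D_u g (t *: u + p).
Proof.
move=> d0 dg; pose phi (t : R) := g (t *: u + p).
have dphi t : 0 <= t <= d -> differentiable phi t.
  move=> /dg dgt; apply: (@differentiable_comp _ _ _ _ (fun s : R => s *: u + p) g) => //.
have [t||t] := @MVT_segment R phi (fun t => 'D_u g (t *: u + p)) 0 d d0.
- rewrite in_itv /= => /andP[t0 td]; rewrite -derive_line; apply: derivableP.
  by apply: diff_derivable; apply: dphi; rewrite !ltW.
- apply: derivable_within_continuous => t; rewrite in_itv /= => ht.
  by apply: diff_derivable; exact: dphi.
rewrite in_itv /= => td; rewrite /phi scale0r add0r subr0 => ->.
by exists t => //; rewrite mulrC.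
Qed.

(** Two mean value theorems: along [v] for the increment of [f] in the direction [w], then along [w]
    for ['D_v f]. *)
Lemma schwarz_sq E (f : E -> R) x v w (d : R) : 0 <= d ->
  (forall s t, 0 <= s <= d -> 0 <= t <= d -> sm f (t *: w + (s *: v + x))) ->
  exists s t, [/\ 0 <= s <= d, 0 <= t <= d &
    f (d *: w + (d *: v + x)) - f (d *: v + x) - (f (d *: w + x) - f x) =
    d * (d * 'D_w ('D_v f) (t *: w + (s *: v + x)))].
Proof.
move=> d0 sf; have dd : 0 <= d <= d by rewrite d0 lexx.
have d00 : 0 <= (0 : R) <= d by rewrite lexx.
have d1 s t : 0 <= s <= d -> 0 <= t <= d -> differentiable f (t *: w + (s *: v + x)).
  by move=> hs ht; apply: sm_diff; exact: sf.
have d2 s : 0 <= s <= d -> differentiable f (s *: v + x).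
  by move=> hs; move: (d1 s 0 hs d00); rewrite scale0r add0r.
pose g y := f (d *: w + y) - f y.
have dsh y : differentiable f (d *: w + y) -> differentiable (fun y => f (d *: w + y)) y.
  move=> h; apply: (@differentiable_comp _ _ _ _ (fun y => d *: w + y) f) => //.
have [s hs Es] := @line_MVT _ g x v d d0 (fun s hs => differentiableB (dsh _ (d1 s d hs dd)) (d2 s hs)).
have [t ht Et] := @line_MVT _ ('D_v f) (s *: v + x) w d d0
   (fun t ht => sm_diff (sm_derive v (sf s t hs ht))).
exists s, t; split => //; rewrite -Et -[LHS]/(g (d *: v + x) - g x) Es; congr (_ * _).
rewrite (@deriveB _ _ _ (fun y => f (d *: w + y)) f); last 2 first.
- by apply: diff_derivable; apply: dsh; exact: d1.
- by apply: diff_derivable; exact: d2.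
rewrite (@derive_affine _ _ _ _ (fun y => d *: w + y) f (s *: v + x) v v) // => h.
by rewrite addrCA.
Qed.

Lemma dist_half (A B C e : R) : `|A - C| < e / 2 -> `|B - C| < e / 2 -> A <= B + e.
Proof. by rewrite !ltr_norml => /andP[h1 h2] /andP[h3 h4]; lra. Qed.

Lemma mulff_inj2 (d a b c : R) : d != 0 -> c = d * (d * a) -> c = d * (d * b) -> a = b.
Proof. by move=> d0 -> /(mulfI d0) /(mulfI d0). Qed.

Lemma subr_swap (a b c d : R) : a - b - (c - d) = a - c - (b - d).
Proof. by ring. Qed.

(** The second difference of [schwarz_sq] is symmetric in [v] and [w], so the two mixed derivatives
    take a common value at points arbitrarily near [x]; continuity concludes up to [e]. By symmetry
    one inequality is enough. *)
Lemma schwarz_real E (f : E -> R) x v w : sm f x -> 'D_w ('D_v f) x = 'D_v ('D_w f) x.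
Proof.
move=> sf; apply/eqP; rewrite eq_le; apply/andP.
suff H v' w' : 'D_w' ('D_v' f) x <= 'D_v' ('D_w' f) x by split; exact: H.
apply/ler_addgt0Pr => e e0; have e2 : 0 < e / 2 by rewrite divr_gt0.
have n1 : \forall y \near x, sm f y by exact: sm_near.
have n2 : \forall y \near x, `|'D_w' ('D_v' f) x - 'D_w' ('D_v' f) y| < e / 2.
  have /sm_cont c := sm_derive w' (sm_derive v' sf).
  by apply: (@cvgr_dist_lt _ _ _ (nbhs x) _ _ _ c).
have n3 : \forall y \near x, `|'D_v' ('D_w' f) x - 'D_v' ('D_w' f) y| < e / 2.
  have /sm_cont c := sm_derive v' (sm_derive w' sf).
  by apply: (@cvgr_dist_lt _ _ _ (nbhs x) _ _ _ c).
have [r /= r0 Hr] := (nbhs_ballP x _).1 (filterI n1 (filterI n2 n3)).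
(* With side d = r / c the whole parallelogram stays in the ball of radius r; the summand 1 keeps
   [c] positive. *)
pose c := `|v'| + `|w'| + 1.
have c0 : 0 < c by rewrite ltr_pwDr // addr_ge0.
pose d := r / c; have d0 : 0 < d by rewrite divr_gt0.
have inB s t p q : `|p| + `|q| < c -> 0 <= s <= d -> 0 <= t <= d ->
    ball x r (t *: q + (s *: p + x)).
  move=> pq /andP[s0 sd] /andP[t0 td].
  rewrite -ball_normE /= addrA opprD addrCA subrr addr0 normrN.
  rewrite (le_lt_trans (ler_normD _ _)) // !normrZ !ger0_norm //.
  apply: (@le_lt_trans _ _ (d * (`|q| + `|p|))).
    by rewrite mulrDr lerD // ler_wpM2r.
  by rewrite /d mulrAC ltr_pdivrMr // ltr_pM2l // addrC.
have vc : `|v'| + `|w'| < c by rewrite /c ltrDl.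
have wc : `|w'| + `|v'| < c by rewrite addrC.
have B1 s t : 0 <= s <= d -> 0 <= t <= d -> sm f (t *: w' + (s *: v' + x)).
  by move=> hs ht; have [] := Hr _ (inB s t v' w' vc hs ht).
have B2 s t : 0 <= s <= d -> 0 <= t <= d -> sm f (t *: v' + (s *: w' + x)).
  by move=> hs ht; have [] := Hr _ (inB s t w' v' wc hs ht).
have [s1 [t1 [hs1 ht1 E1]]] := schwarz_sq (ltW d0) B1.
have [s2 [t2 [hs2 ht2 E2]]] := schwarz_sq (ltW d0) B2.
have E12 : 'D_w' ('D_v' f) (t1 *: w' + (s1 *: v' + x)) = 'D_v' ('D_w' f) (t2 *: v' + (s2 *: w' + x)).
  have dn0 : d != 0 by rewrite gt_eqF.
  apply: (mulff_inj2 dn0 E1); rewrite -E2 [d *: v' + (d *: w' + x)]addrCA.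
  exact: subr_swap.
have [_ [h1 _]] := Hr _ (inB s1 t1 v' w' vc hs1 ht1).
have [_ [_ h2]] := Hr _ (inB s2 t2 w' v' wc hs2 ht2).
by rewrite E12 in h1; exact: dist_half h1 h2.
Qed.

Lemma derive_lcomp E V W (l : {linear V -> W}) (f : E -> V) x v : continuous l ->
  differentiable f x -> 'D_v (fun y => l (f y)) x = l ('D_v f x).
Proof.
by move=> cl df; rewrite (@derive_comp _ _ _ _ f l) ?derive_linear //; exact: linear_differentiable.
Qed.

Lemma derive2_lcomp E W (l : {linear W -> R}) (f : E -> W) x v w : continuous l -> sm f x ->
  'D_w ('D_v (fun y => l (f y))) x = l ('D_w ('D_v f) x).
Proof.
move=> cl sf; rewrite -(derive_lcomp _ cl); last by apply: sm_diff; exact: sm_derive.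
apply: near_eq_derive; have := sm_near sf; apply: filterS => y /sm_diff dy.
by rewrite derive_lcomp.
Qed.

Lemma schwarz E W (f : E -> W) x v w : findim W -> sm f x ->
  'D_w ('D_v f) x = 'D_v ('D_w f) x.
Proof.
move=> [n [b [l [cl bl]]]] sf.
have lE i : l i ('D_w ('D_v f) x) = l i ('D_v ('D_w f) x).
  rewrite -(derive2_lcomp v w (cl i) sf) -(derive2_lcomp w v (cl i) sf).
  by apply: schwarz_real; exact: sm_linear.
transitivity (\sum_i l i ('D_w ('D_v f) x) *: b i); first exact: bl.
transitivity (\sum_i l i ('D_v ('D_w f) x) *: b i); last exact/esym/bl.
by apply: eq_bigr => i _; rewrite (lE i).
Qed.

Lemma derive_iterC E W (f : E -> W) x v vs : findim W -> sm f x ->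
  'D_v (iter_deriv vs f) x = iter_deriv vs ('D_v f) x.
Proof.
move=> fW; elim: vs x => [//|u vs IH] x sf /=.
rewrite schwarz //; last exact: sm_iter.
by apply: near_eq_derive; have := sm_near sf; apply: filterS => y; exact: IH.
Qed.

Lemma deriveDf E W (f g : E -> W) x v : differentiable f x -> differentiable g x ->
  'D_v (fun y => f y + g y) x = 'D_v f x + 'D_v g x.
Proof. by move=> df dg; apply: deriveD; exact: diff_derivable. Qed.

Lemma deriveBf E W (f g : E -> W) x v : differentiable f x -> differentiable g x ->
  'D_v (fun y => f y - g y) x = 'D_v f x - 'D_v g x.
Proof. by move=> df dg; apply: deriveB; exact: diff_derivable. Qed.

Lemma deriveZf E W a (f : E -> W) x v : differentiable f x ->
  'D_v (fun y => a *: f y) x = a *: 'D_v f x.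
Proof. by move=> df; apply: deriveZ; exact: diff_derivable. Qed.

Lemma derive_sumf E W I (r : seq I) (f : I -> E -> W) x v : (forall i, differentiable (f i) x) ->
  'D_v (fun y => \sum_(i <- r) f i y) x = \sum_(i <- r) 'D_v (f i) x.
Proof.
move=> df; elim: r => [|i r IH].
  by rewrite big_nil; under eq_fun do rewrite big_nil; exact: derive_cst.
rewrite big_cons -IH -deriveDf //; first by under eq_fun do rewrite big_cons.
elim: r {IH} => [|j r IH]; first by under eq_fun do rewrite big_nil; exact: differentiable_cst.
by under eq_fun do rewrite big_cons; apply: differentiableD.
Qed.

Lemma iter_derivD E W (f g : E -> W) x vs : sm f x -> sm g x ->
  iter_deriv vs (fun y => f y + g y) x = iter_deriv vs f x + iter_deriv vs g x.
Proof.
elim: vs x => [//|v vs IH] x sf sg /=.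
rewrite -deriveDf; try by apply: sm_diff; exact: sm_iter.
apply: near_eq_derive; have := nearI (sm_near sf) (sm_near sg).
by apply: filterS => y []; exact: IH.
Qed.

Lemma iter_derivZ E W a (f : E -> W) x vs : sm f x ->
  iter_deriv vs (fun y => a *: f y) x = a *: iter_deriv vs f x.
Proof.
elim: vs x => [//|v vs IH] x sf /=.
rewrite -deriveZf; try by apply: sm_diff; exact: sm_iter.
apply: near_eq_derive; have := sm_near sf.
by apply: filterS => y; exact: IH.
Qed.

Lemma iter_deriv_cst0 E W (x : E) vs : iter_deriv vs (fun _ : E => 0 : W) x = 0.
Proof.
elim: vs x => [//|v vs IH] x /=.
by rewrite (_ : iter_deriv vs _ = fun=> 0); [exact: derive_cst|apply/funext].
Qed.

Lemma iter_deriv_sum E W I (r : seq I) (f : I -> E -> W) x vs : (forall i, sm (f i) x) ->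
  iter_deriv vs (fun y => \sum_(i <- r) f i y) x = \sum_(i <- r) iter_deriv vs (f i) x.
Proof.
move=> sf; elim: r => [|i r IH].
  by rewrite big_nil; under eq_fun do rewrite big_nil; exact: iter_deriv_cst0.
rewrite big_cons -IH -iter_derivD //; first by under eq_fun do rewrite big_cons.
by apply: sm_sum.
Qed.

(** Equality of k-jets of functions between normed spaces: the condition that [jet_eq] imposes in
    each pair of charts. *)
Definition agree k E W (f g : E -> W) (x : E) : Prop :=
  forall vs, (size vs <= k)%N -> iter_deriv vs f x = iter_deriv vs g x.

Lemma agree_val k E W (f g : E -> W) x : agree k f g x -> f x = g x.
Proof. by move=> /(_ [::]); exact. Qed.

Lemma agree_refl k E W (f : E -> W) x : agree k f f x. Proof. by []. Qed.

Lemma agree_sym k E W (f g : E -> W) x : agree k f g x -> agree k g f x.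
Proof. by move=> fg vs /fg. Qed.

Lemma agree_trans k E W (f g h : E -> W) x : agree k f g x -> agree k g h x -> agree k f h x.
Proof. by move=> fg gh vs s; rewrite fg // gh. Qed.

Lemma agreeW k k' E W (f g : E -> W) x : (k' <= k)%N -> agree k f g x -> agree k' f g x.
Proof. by move=> kk fg vs s; apply: fg; exact: leq_trans kk. Qed.

Lemma agree_near k E W (f g : E -> W) (x : E) : (\forall y \near x, f y = g y) -> agree k f g x.
Proof. by move=> fg vs _; exact: nbhs_singleton (near_iter_deriv_eq vs fg). Qed.

Lemma agree_near_ext k E W (f f' g g' : E -> W) (x : E) : (\forall y \near x, f y = f' y) ->
  (\forall y \near x, g y = g' y) -> agree k f g x -> agree k f' g' x.
Proof.
move=> ff gg fg vs s.
by rewrite -(nbhs_singleton (near_iter_deriv_eq vs ff)) fg // (nbhs_singleton (near_iter_deriv_eq vs gg)).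
Qed.

Lemma agree_derive k E W (f g : E -> W) x v : agree k.+1 f g x -> agree k ('D_v f) ('D_v g) x.
Proof. by move=> fg vs s; rewrite -!iter_deriv_rcons fg // size_rcons. Qed.

Lemma agreeS k E W (f g : E -> W) x : f x = g x -> (forall v, agree k ('D_v f) ('D_v g) x) ->
  agree k.+1 f g x.
Proof.
move=> fgx fg vs; case: (lastP vs) => [//|us v]; rewrite size_rcons => s.
by rewrite !iter_deriv_rcons fg.
Qed.

Lemma agreeD k E W (f f' g g' : E -> W) x : sm f x -> sm f' x -> sm g x -> sm g' x ->
  agree k f f' x -> agree k g g' x -> agree k (fun y => f y + g y) (fun y => f' y + g' y) x.
Proof. by move=> ? ? ? ? ff gg vs s; rewrite !iter_derivD // ff // gg. Qed.

Lemma agree_sum k E W I (r : seq I) (f f' : I -> E -> W) x :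
  (forall i, sm (f i) x) -> (forall i, sm (f' i) x) ->
  (forall i, agree k (f i) (f' i) x) ->
  agree k (fun y => \sum_(i <- r) f i y) (fun y => \sum_(i <- r) f' i y) x.
Proof.
by move=> sf sf' ff vs s; rewrite !iter_deriv_sum //; apply: eq_bigr => i _; exact: ff.
Qed.

Lemma near_derive_scale E W (h : E -> R) (f : E -> W) x v : sm h x -> sm f x ->
  \forall y \near x, 'D_v h y *: f y + h y *: 'D_v f y = 'D_v (fun y => h y *: f y) y.
Proof.
move=> sh sf; have := nearI (sm_near sh) (sm_near sf).
by apply: filterS => y [/sm_diff ? /sm_diff ?]; rewrite derive_scale.
Qed.

Lemma agree_scale k E W (h h' : E -> R) (f f' : E -> W) x : sm h x -> sm h' x ->
  sm f x -> sm f' x -> agree k h h' x -> agree k f f' x ->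
  agree k (fun y => h y *: f y) (fun y => h' y *: f' y) x.
Proof.
elim: k h h' f f' => [|k IH] h h' f f' sh sh' sf sf' hh ff.
  by move=> [|//] _ /=; rewrite (agree_val hh) (agree_val ff).
apply: agreeS => [|v]; first by rewrite (agree_val hh) (agree_val ff).
apply: (agree_near_ext (near_derive_scale _ sh sf) (near_derive_scale _ sh' sf')).
apply: agreeD; try by apply: sm_scale => //; exact: sm_derive.
- apply: IH => //; try exact: sm_derive; [exact: agree_derive|exact: agreeW ff].
- apply: IH => //; try exact: sm_derive; [exact: agreeW hh|exact: agree_derive].
Qed.

Lemma agree_lcomp k E V W (l : {linear V -> W}) (f f' : E -> V) x : continuous l ->
  sm f x -> sm f' x -> agree k f f' x -> agree k (fun y => l (f y)) (fun y => l (f' y)) x.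
Proof.
move=> cl; have H g vs : sm g x -> iter_deriv vs (fun y => l (g y)) x = l (iter_deriv vs g x).
  elim: vs x => [//|v vs IH] y sg /=.
  rewrite -(derive_lcomp _ cl); last by apply: sm_diff; exact: sm_iter.
  by apply: near_eq_derive; have := sm_near sg; apply: filterS => z; exact: IH.
by move=> sf sf' ff vs s; rewrite !H // ff.
Qed.

Lemma near_derive_comp E V W n (b : 'I_n -> V) (l : 'I_n -> {linear V -> R})
    (f : E -> V) (g : V -> W) x v :
  (forall x, x = \sum_i l i x *: b i) -> sm f x -> sm g (f x) ->
  \forall y \near x, \sum_i l i ('D_v f y) *: 'D_(b i) g (f y) = 'D_v (fun y => g (f y)) y.
Proof.
move=> bl sf sg; have := nearI (sm_near sf) (near_comp (sm_cont sf) (sm_near sg)).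
apply: filterS => y [/sm_diff dy /sm_diff dg].
by rewrite -(derive_findim _ bl) // -(@derive_comp _ _ _ _ f g).
Qed.

(** Induction on [k] through the chain rule. The derivatives of [g] and [g'] are taken along a fixed
    spanning family so that the induction hypothesis applies to them. *)
Lemma agree_comp k E V W (f f' : E -> V) (g g' : V -> W) x : findim V ->
  sm f x -> sm f' x -> sm g (f x) -> sm g' (f x) -> agree k f f' x -> agree k g g' (f x) ->
  agree k (fun y => g (f y)) (fun y => g' (f' y)) x.
Proof.
move=> fV; have [n [b [l [cl bl]]]] := fV.
elim: k g g' => [|k IH] g g' sf sf' sg sg' ff gg.
  by move=> [|//] _ /=; rewrite -(agree_val ff) (agree_val gg).
have sg2 : sm g' (f' x) by rewrite -(agree_val ff).
apply: agreeS => [|v]; first by rewrite -(agree_val ff) (agree_val gg).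
apply: (agree_near_ext (near_derive_comp _ bl sf sg) (near_derive_comp _ bl sf' sg2)).
have sl u i : sm u x -> sm (fun y => l i ('D_v u y)) x.
  by move=> su; apply: sm_linear => //; exact: sm_derive.
have sc i : sm (fun y => 'D_(b i) g (f y)) x.
  by apply: (@sm_comp _ _ _ _ ('D_(b i) g) f) => //; exact: sm_derive.
have sc' i : sm (fun y => 'D_(b i) g' (f' y)) x.
  by apply: (@sm_comp _ _ _ _ ('D_(b i) g') f') => //; exact: sm_derive.
apply: agree_sum => i; try by apply: sm_scale => //; exact: sl.
apply: agree_scale => //; try exact: sl.
  by apply: agree_lcomp => //; try exact: sm_derive; exact: agree_derive.
by apply: (IH ('D_(b i) g) ('D_(b i) g')) => //; try exact: sm_derive; [exact: agreeW ff|exact: agree_derive].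
Qed.

(** One order is lost on [f] and [g], which are differentiated, and none on the point or the
    direction. *)
Lemma agree_D k E V W (f g : V -> W) (c c' v w : E -> V) x : findim V ->
  sm f (c x) -> sm g (c x) -> sm v x -> sm w x -> sm c x -> sm c' x ->
  agree k.+1 f g (c x) -> agree k v w x -> agree k c c' x ->
  agree k (fun y => 'D_(v y) f (c y)) (fun y => 'D_(w y) g (c' y)) x.
Proof.
move=> fE sf sg sv sw sc sc' fg vw cc; have [n [b [l [cl bl]]]] := fE.
have H (h : V -> W) (c0 u : E -> V) : sm c0 x -> sm h (c0 x) ->
    \forall y \near x, \sum_i l i (u y) *: 'D_(b i) h (c0 y) = 'D_(u y) h (c0 y).
  move=> s0 sh; have := near_comp (sm_cont s0) (sm_near sh); apply: filterS => y /sm_diff dh.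
  by rewrite -derive_findim.
have sg' : sm g (c' x) by rewrite -(agree_val cc).
apply: (agree_near_ext (H f c v sc sf) (H g c' w sc' sg')).
have s1 i : sm (fun y => 'D_(b i) f (c y)) x.
  by apply: (@sm_comp _ _ _ _ ('D_(b i) f) c) => //; exact: sm_derive.
have s2 i : sm (fun y => 'D_(b i) g (c' y)) x.
  by apply: (@sm_comp _ _ _ _ ('D_(b i) g) c') => //; exact: sm_derive.
apply: agree_sum => i; try by apply: sm_scale => //; exact: sm_linear.
apply: agree_scale => //; try exact: sm_linear; first exact: agree_lcomp.
by apply: (@agree_comp _ _ _ _ c c' ('D_(b i) f) ('D_(b i) g)) => //; try exact: sm_derive; exact: agree_derive.
Qed.

Lemma iter_deriv_pair E V W (f : E -> V) (g : E -> W) x vs : sm f x -> sm g x ->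
  iter_deriv vs (fun y => (f y, g y)) x = (iter_deriv vs f x, iter_deriv vs g x).
Proof.
elim: vs x => [//|v vs IH] x sf sg /=.
rewrite -derive_pair; try by apply: sm_diff; exact: sm_iter.
by apply: near_eq_derive; have := nearI (sm_near sf) (sm_near sg); apply: filterS => y []; exact: IH.
Qed.

Lemma agree_pair k E V W (f f' : E -> V) (g g' : E -> W) x : sm f x -> sm f' x ->
  sm g x -> sm g' x -> agree k f f' x -> agree k g g' x ->
  agree k (fun y => (f y, g y)) (fun y => (f' y, g' y)) x.
Proof. by move=> ? ? ? ? ff gg vs s; rewrite !iter_deriv_pair // ff // gg. Qed.

End Schwarz.

(** * Taylor polynomials *)

Section Taylor.
Context {R : realType} {n : nat} {W : normedModType R}.
Hypothesis fW : findim W.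
Implicit Types (C : seq 'I_n -> W) (k j : nat).
Local Notation e := (fun i : 'I_n => delta_mx ord0 i : 'rV[R]_n).

(** If [C] lists the derivatives of a function, these are the derivatives of its i-th partial
    derivative; the index goes last because [iter_deriv] applies the last vector first. *)
Definition shiftC C (i : 'I_n) : seq 'I_n -> W := fun I => C (rcons I i).

Definition symC C := forall I (i i' : 'I_n) J, C (I ++ i :: i' :: J) = C (I ++ i' :: i :: J).

(* the homogeneous part of degree [j] of the polynomial with derivatives [C] at 0 *)
Fixpoint tq j C (w : 'rV[R]_n) : W :=
  if j is j'.+1 then (j'.+1%:R)^-1 *: \sum_i w ord0 i *: tq j' (shiftC C i) w else C [::].

Definition taylor k C (w : 'rV[R]_n) : W := \sum_(j < k.+1) tq j C w.

Definition jetc (f : 'rV[R]_n -> W) (x : 'rV[R]_n) (I : seq 'I_n) : W := iter_deriv (map e I) f x.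

Lemma symC_shift C i : symC C -> symC (shiftC C i).
Proof. by move=> sC I a b J; rewrite /shiftC !rcons_cat /= sC. Qed.

Lemma sm_coord p q (i : 'I_p) (j : 'I_q) (A : 'M[R]_(p, q)) : sm (fun A : 'M[R]_(p, q) => A i j) A.
Proof. exact: (sm_lin _ (@mxcoord_continuous _ _ _ i j)). Qed.

Lemma sm_tq (E : normedModType R) j (C : E -> seq 'I_n -> W) (c : E -> 'rV[R]_n) x :
  (forall I, (size I <= j)%N -> sm (fun p => C p I) x) -> sm c x -> sm (fun p => tq j (C p) (c p)) x.
Proof.
elim: j C => [|j IH] C sC sc /=; first exact: sC.
apply: sm_scale; first exact: sm_cst.
apply: sm_sum => i _; apply: sm_scale.
  by apply: (@sm_comp _ _ _ _ (fun A : 'rV[R]_n => A ord0 i) c) => //; exact: sm_coord.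
by apply: IH => // I sI; apply: sC; rewrite size_rcons.
Qed.

Lemma sm_taylor (E : normedModType R) k (C : E -> seq 'I_n -> W) (c : E -> 'rV[R]_n) x :
  (forall I, (size I <= k)%N -> sm (fun p => C p I) x) -> sm c x ->
  sm (fun p => taylor k (C p) (c p)) x.
Proof.
move=> sC sc; apply: sm_sum => j _; apply: sm_tq => // I sI; apply: sC.
by apply: leq_trans sI _; rewrite -ltnS.
Qed.

Lemma derive_coord p q (i : 'I_p) (j : 'I_q) (A v : 'M[R]_(p, q)) :
  'D_v (fun A : 'M[R]_(p, q) => A i j) A = v i j.
Proof. exact: (derive_linear _ _ (@mxcoord_continuous _ _ _ i j)). Qed.

Lemma sm_tq1 j C w : sm (tq j C) w.
Proof. by apply: (@sm_tq _ j (fun _ => C) id) => [I _|]; [exact: sm_cst|exact: sm_id]. Qed.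

Lemma derive_tqS j C v w : 'D_v (tq j.+1 C) w = (j.+1%:R)^-1 *:
    \sum_i (v ord0 i *: tq j (shiftC C i) w + w ord0 i *: 'D_v (tq j (shiftC C i)) w).
Proof.
have dc i (w' : 'rV[R]_n) : differentiable (fun A : 'rV[R]_n => A ord0 i) w'.
  by apply: sm_diff; exact: sm_coord.
rewrite /= deriveZf; last first.
  by apply: sm_diff; apply: sm_sum => i _; apply: sm_scale; [exact: sm_coord|exact: sm_tq1].
congr (_ *: _); rewrite derive_sumf; last first.
  by move=> i; apply: differentiable_scale => //; exact: sm_diff (sm_tq1 _ _ _).
apply: eq_bigr => i _; rewrite derive_scale //; last exact: sm_diff (sm_tq1 _ _ _).
by rewrite derive_coord.
Qed.

Lemma tqS j C w : tq j.+1 C w = (j.+1%:R)^-1 *: \sum_i w ord0 i *: tq j (shiftC C i) w.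
Proof. by []. Qed.

Local Arguments tq : simpl never.

(** The recursion for [tq] is Euler's identity for homogeneous polynomials. By induction and
    symmetry the Leibniz terms make up as many copies of the right-hand side as the degree, which
    the leading factor normalises. *)
Lemma derive_tq j C v w : symC C ->
  'D_v (tq j.+1 C) w = \sum_i v ord0 i *: tq j (shiftC C i) w.
Proof.
elim: j C => [|j IH] C sC.
  rewrite derive_tqS invr1 scale1r; apply: eq_bigr => i _.
  by rewrite (_ : 'D_v _ w = 0) ?scaler0 ?addr0 //; exact: derive_cst.
rewrite derive_tqS big_split /=.
under [X in _ + X]eq_bigr => i _ do rewrite (IH _ (symC_shift i sC)) scaler_sumr.
rewrite exchange_big /=.
have -> : \sum_l \sum_i w ord0 i *: (v ord0 l *: tq j (shiftC (shiftC C i) l) w) =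
   \sum_l v ord0 l *: (j.+1%:R *: tq j.+1 (shiftC C l) w).
  apply: eq_bigr => l _; rewrite tqS [_%:R *: _]scalerA mulfV ?pnatr_eq0 // scale1r scaler_sumr.
  apply: eq_bigr => i _; rewrite !scalerA mulrC; congr (_ *: tq _ _ _).
  by apply/funext => I; rewrite /shiftC -!cats1 -!catA /= sC.
rewrite -big_split scaler_sumr; apply: eq_bigr => l _.
move: (tq _ _ _) => T /=; rewrite -scalerDr -{1}[T]scale1r -scalerDl !scalerA.
congr (_ *: _); rewrite -natr1 [1 + _]addrC mulrC -mulrA mulfV ?mulr1 //.
Qed.

Lemma derive_taylor k C i w : symC C -> 'D_(e i) (taylor k.+1 C) w = taylor k (shiftC C i) w.
Proof.
move=> sC; rewrite /taylor derive_sumf; last by move=> j; exact: sm_diff (sm_tq1 _ _ _).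
rewrite big_ord_recl /= derive_cst add0r; apply: eq_bigr => j _.
rewrite derive_tq // (bigD1 i) //= mxE !eqxx scale1r big1 ?addr0 // => l li.
by rewrite mxE eqxx (negbTE li) scale0r.
Qed.

Lemma taylor0 k C : taylor k C 0 = C [::].
Proof.
rewrite /taylor big_ord_recl /= big1 ?addr0 // => j _.
by rewrite tqS big1 ?scaler0 // => i _; rewrite mxE scale0r.
Qed.

Lemma jetc_taylor k C I : symC C -> (size I <= k)%N -> jetc (taylor k C) 0 I = C I.
Proof.
elim: k C I => [|k IH] C I sC; first by case: I => // _; exact: taylor0.
case: (lastP I) => [_|I' i]; first exact: taylor0.
rewrite size_rcons ltnS => sI; rewrite /jetc map_rcons iter_deriv_rcons.
rewrite (_ : 'D_(e i) (taylor k.+1 C) = taylor k (shiftC C i)); last first.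
  by apply/funext => w; exact: derive_taylor.
by rewrite -/(jetc _ _ _) IH //; exact: symC_shift.
Qed.

Lemma symC_jetc f x : sm f x -> symC (jetc f x).
Proof.
move=> sf I i i' J; rewrite /jetc !map_cat /= /iter_deriv !foldr_cat /=.
have H : \forall y \near x, 'D_(e i) ('D_(e i') (iter_deriv (map e J) f)) y =
    'D_(e i') ('D_(e i) (iter_deriv (map e J) f)) y.
  by have := sm_near (sm_iter (map e J) sf); apply: filterS => y sy; exact: schwarz.
exact: nbhs_singleton (near_iter_deriv_eq (map e I) H).
Qed.

Lemma derive_basis (f : 'rV[R]_n -> W) x v : differentiable f x ->
  'D_v f x = \sum_i v ord0 i *: 'D_(e i) f x.
Proof.
move=> df; rewrite {1}(row_sum_delta v) derive_sumv //; apply: eq_bigr => i _; exact: deriveZv.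
Qed.

(** Iterated derivatives of a smooth function are multilinear in the directions. *)
Lemma agree_basis k (f g : 'rV[R]_n -> W) x : sm f x -> sm g x ->
  (forall I, (size I <= k)%N -> jetc f x I = jetc g x I) -> agree k f g x.
Proof.
elim: k f g => [|k IH] f g sf sg fg; first by move=> [|//] _; exact: (fg [::]).
apply: agreeS => [|v]; first exact: (fg [::]).
have H (h : 'rV[R]_n -> W) : sm h x -> \forall y \near x, \sum_i v ord0 i *: 'D_(e i) h y = 'D_v h y.
  by move=> sh; have := sm_near sh; apply: filterS => y /sm_diff dh; rewrite [RHS]derive_basis.
apply: (agree_near_ext (H f sf) (H g sg)); apply: agree_sum => i.
- by apply: sm_scale; [exact: sm_cst|exact: sm_derive].
- by apply: sm_scale; [exact: sm_cst|exact: sm_derive].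
apply: agree_scale => //; try exact: sm_cst; try exact: sm_derive.
apply: IH; try exact: sm_derive.
by move=> I sI; move: (fg (rcons I i)); rewrite /jetc map_rcons !iter_deriv_rcons; apply; rewrite size_rcons.
Qed.

Lemma jetc_shift (f : 'rV[R]_n -> W) x y I : jetc (fun w => f (w - x)) y I = jetc f (y - x) I.
Proof.
rewrite /jetc (@iter_deriv_affine _ _ _ _ (fun w => w - x) id) ?map_id //.
by move=> h v w; rewrite addrA.
Qed.

Lemma sm_shift (f : 'rV[R]_n -> W) x y : sm f (y - x) -> sm (fun w => f (w - x)) y.
Proof.
move=> sf; apply: (@sm_comp _ _ _ _ f (fun w => w - x)) => //.
by apply: smB; [exact: sm_id|exact: sm_cst].
Qed.

Lemma taylor_agree k (f : 'rV[R]_n -> W) x : sm f x ->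
  agree k (fun y => taylor k (jetc f x) (y - x)) f x.
Proof.
move=> sf; apply: agree_basis => //.
  by apply: sm_shift; apply: (@sm_taylor _ k (fun _ => jetc f x) id) => [I _|]; [exact: sm_cst|exact: sm_id].
move=> I sI; rewrite (jetc_shift (taylor k (jetc f x))) subrr jetc_taylor //; exact: symC_jetc.
Qed.

End Taylor.

(** * The implicit function theorem *)

(** Completeness is what the Banach fixed point theorem asks for. *)
HB.instance Definition _ (R : realType) (m n : nat) :=
  Uniform_isComplete.Build 'M[R]_(m, n) (@cauchy_cvg 'M[R]_(m, n)).

Section Implicit.
Context {R : realType}.
Implicit Types E V W : normedModType R.

Lemma Ck_local k E W (S : set E) (f : E -> W) :
  (forall x, S x -> exists2 U : set E, U x & Ck_on k U f) -> Ck_on k S f.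
Proof.
elim: k f => [|k IH] f H; first by move=> x /H [U Ux /(_ x Ux)].
split=> [x /H [U Ux [/(_ x Ux)]]|] // v.
by apply: IH => x /H [U Ux [_ /(_ v)]]; exists U.
Qed.

Lemma Ck_of_sm k E W (S : set E) (f : E -> W) : (forall x, S x -> sm f x) -> Ck_on k S f.
Proof. by move=> H; apply: Ck_local => x /H [U [_ Ux sf]]; exists U. Qed.

Lemma inl_is_linear E W : linear (fun x : E => (x, 0) : E * W).
Proof. by move=> a u v; congr pair; rewrite /= scaler0 addr0. Qed.

Lemma inr_is_linear E W : linear (fun y : W => (0, y) : E * W).
Proof. by move=> a u v; congr pair; rewrite /= scaler0 addr0. Qed.

Lemma Ck_pair k E V W (U : set E) (f : E -> V) (g : E -> W) : open U ->
  Ck_on k U f -> Ck_on k U g -> Ck_on k U (fun y => (f y, g y)).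
Proof.
move=> oU Cf Cg.
pose L1 : {linear V -> (V * W)%type} := HB.pack (fun x : V => (x, 0) : (V * W)%type)
  (GRing.isLinear.Build _ _ _ _ _ (@inl_is_linear V W)).
pose L2 : {linear W -> (V * W)%type} := HB.pack (fun x : W => (0, x) : (V * W)%type)
  (GRing.isLinear.Build _ _ _ _ _ (@inr_is_linear V W)).
apply: (@Ck_ext _ k _ _ U (fun y => L1 (f y) + L2 (g y))) => //.
  by move=> x Ux; rewrite -[LHS]/(f x + 0, 0 + g x) addr0 add0r.
have c1 : continuous L1 by move=> z; apply: cvg_pair => //=; exact: cvg_cst.
have c2 : continuous L2 by move=> z; apply: cvg_pair => //=; exact: cvg_cst.
by apply: CkD => //; [exact: (Ck_linear oU c1 Cf)|exact: (Ck_linear oU c2 Cg)].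
Qed.

Lemma mx_entry_norm m n (A : 'M[R]_(m, n)) i j : `|A i j| <= `|A|.
Proof.
rewrite [leRHS]/Num.Def.normr /= mx_normrE.
exact: (le_bigmax _ (fun p : 'I_m * 'I_n => `|A p.1 p.2|) (i, j)).
Qed.

Lemma mx_norm_le m n (A : 'M[R]_(m, n)) c : 0 <= c -> (forall i j, `|A i j| <= c) -> `|A| <= c.
Proof.
by move=> c0 Ac; rewrite [leLHS]/Num.Def.normr /= mx_normrE; apply: bigmax_le => // -[i j] _; exact: Ac.
Qed.

Lemma sm_mx E m n (f : E -> 'M[R]_(m, n)) x : (forall i j, sm (fun y => f y i j) x) -> sm f x.
Proof.
move=> sf; apply: (@sm_near_ext _ _ _ (fun y => \sum_i \sum_j f y i j *: delta_mx i j)).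
  by near=> y; rewrite -matrix_sum_delta.
by apply: sm_sum => i _; apply: sm_sum => j _; apply: sm_scale => //; exact: sm_cst.
Unshelve. all: by end_near. Qed.

Lemma sm_entry E m n (f : E -> 'M[R]_(m, n)) x i j : sm f x -> sm (fun y => f y i j) x.
Proof. by move=> sf; apply: (@sm_comp _ _ _ _ (fun A : 'M[R]_(m, n) => A i j) f) => //; exact: sm_coord. Qed.

Lemma sm_det E n (f : E -> 'M[R]_n) x : sm f x -> sm (fun y => \det (f y)) x.
Proof.
move=> sf; rewrite /determinant; apply: sm_sum => s _; apply: smM; first exact: sm_cst.
by apply: sm_prod => i _; exact: sm_entry.
Qed.

Lemma sm_adj E n (f : E -> 'M[R]_n) x : sm f x -> sm (fun y => \adj (f y)) x.
Proof.
move=> sf; apply: sm_mx => i j.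
apply: (@sm_near_ext _ _ _ (fun y => cofactor (f y) j i)); first by near=> y; rewrite mxE.
apply: smM; first exact: sm_cst.
by apply: sm_det; apply: sm_mx => a b; under eq_fun do rewrite !mxE; exact: sm_entry.
Unshelve. all: by end_near. Qed.

(** The derivative is a multiple of a product of two inverses, of class C^k by induction. *)
Lemma Ck_inv k (U : set R) : open U -> (forall x, U x -> x != 0) -> Ck_on k U (GRing.inv : R -> R).
Proof.
move=> oU U0; elim: k => [|k IH]; first by move=> x /U0; exact: inv_continuous.
split=> [x /U0|v]; first exact: differentiable_Rinv.
apply: (@Ck_ext _ k _ _ U (fun x => (- v) *: (x^-1 * x^-1))) => //.
  move=> x /U0 x0; rewrite deriveE; last exact: differentiable_Rinv.
  rewrite diff_Rinv // -[LHS]/(- v * (x^-1 * x^-1)) -[RHS]/(- x ^- 2 * v) expr2 invfM.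
  by rewrite !mulNr mulrC.
apply: Ck_scale => //; first exact: Ck_cst.
by apply: (@Ck_scale _ k R R) => //.
Qed.

Lemma smV E (f : E -> R) x : sm f x -> f x != 0 -> sm (fun y => (f y)^-1) x.
Proof.
move=> sf fx0; apply: (@sm_comp _ _ _ _ (GRing.inv : R -> R) f) => //.
exists [set y | y != 0]; split => [||k]; [exact: open_neq|exact: fx0|].
by apply: Ck_inv => //; exact: open_neq.
Qed.

Lemma sm_invmx E n (f : E -> 'M[R]_n) x : sm f x -> \det (f x) != 0 -> sm (fun y => invmx (f y)) x.
Proof.
move=> sf fx0; have sd := sm_det sf.
apply: (@sm_near_ext _ _ _ (fun y => (\det (f y))^-1 *: \adj (f y))).
  have : \forall y \near x, \det (f y) != 0.
    by apply: (near_comp (P := fun z => z != 0) (sm_cont sd)); apply: open_near => //; exact: open_neq.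
  by apply: filterS => y fy; rewrite /invmx unitmxE unitfE fy.
by apply: sm_scale; [exact: smV|exact: sm_adj].
Qed.

Lemma sm_mulmx E m n p (f : E -> 'M[R]_(m, n)) (g : E -> 'M[R]_(n, p)) x :
  sm f x -> sm g x -> sm (fun y => f y *m g y) x.
Proof.
move=> sf sg; apply: sm_mx => i j; under eq_fun do rewrite mxE.
by apply: sm_sum => l _; apply: smM; exact: sm_entry.
Qed.

Lemma near_forall (T : topologicalType) (I : finType) (P : I -> T -> Prop) (x : T) :
  (forall i, \forall y \near x, P i y) -> \forall y \near x, forall i, P i y.
Proof. exact: filter_forall. Qed.

Lemma cont_near_dist E W (g : E -> W) x (e : R) : {for x, continuous g} -> 0 < e ->
  \forall y \near x, `|g x - g y| < e.
Proof. by move=> cg e0; apply: (@cvgr_dist_lt _ _ _ (nbhs x) _ _ _ cg). Qed.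

Section Core.
Variables (E : normedModType R) (n : nat) (f : E * 'rV[R]_n -> 'rV[R]_n)
  (z0 : E) (y0 : 'rV[R]_n).
Hypotheses (fE : findim E) (sf : sm f (z0, y0)).
Hypothesis Df : forall v, 'D_(0, v) f (z0, y0) = v.
Let h (p : E * 'rV[R]_n) := p.2 - f p.

Let sh : sm h (z0, y0).
Proof. by apply: smB => //; exact: sm_snd. Qed.

(** Mean value theorem on the segment from y' to y, which stays in the ball by convexity. The factor
    n comes from splitting y - y' into coordinates, each bounded by the sup norm. *)
Lemma segment_bound (F : E * 'rV[R]_n -> R) z (y y' : 'rV[R]_n) c r :
  (forall u : 'rV[R]_n, `|u - y0| <= r -> differentiable F (z, u)) -> 0 <= c ->
  (forall u : 'rV[R]_n, `|u - y0| <= r -> forall i, `|'D_(0, delta_mx ord0 i) F (z, u)| <= c) ->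
  `|y - y0| <= r -> `|y' - y0| <= r ->
  `|F (z, y) - F (z, y')| <= n%:R * c * `|y - y'|.
Proof.
move=> dF c0 Fc yr yr'.
have inr (t : R) : 0 <= t <= 1 -> `|t *: (y - y') + y' - y0| <= r.
  move=> /andP[t0 t1]; have -> : t *: (y - y') + y' - y0 = t *: (y - y0) + (1 - t) *: (y' - y0).
    by rewrite scalerBl scale1r !scalerBr; apply/rowP => i; rewrite !mxE; ring.
  apply: (le_trans (ler_normD _ _)); rewrite !normrZ (ger0_norm t0) ger0_norm ?subr_ge0 //.
  apply: (@le_trans _ _ (t * r + (1 - t) * r)); last by rewrite -mulrDl addrC subrK mul1r.
  by apply: lerD; apply: ler_wpM2l => //; rewrite subr_ge0.
have dG (t : R) : 0 <= t <= 1 -> differentiable F (t *: (0 : E, y - y') + (z, y')).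
  by move=> /inr /dF; rewrite -[X in _ -> differentiable F X]/(t *: (0 : E) + z, t *: (y - y') + y') scaler0 add0r.
have [t /inr ht] := @line_MVT _ _ F (z, y') (0, y - y') 1 ler01 dG.
rewrite -[1 *: _ + _]/(1 *: (0 : E) + z, 1 *: (y - y') + y') scaler0 add0r scale1r subrK.
rewrite -[t *: _ + _]/(t *: (0 : E) + z, t *: (y - y') + y') scaler0 add0r mul1r => ->.
have -> : (0 : E, y - y') = \sum_i (y - y') ord0 i *: (0 : E, delta_mx ord0 i).
  rewrite {1}(row_sum_delta (y - y')).
  have -> : (0 : E, \sum_i (y - y') ord0 i *: delta_mx ord0 i) =
     (\sum_(i < n) (0 : E), \sum_i (y - y') ord0 i *: delta_mx ord0 i : 'rV[R]_n).
    by congr pair; rewrite big1.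
  rewrite -sum_pair; apply: eq_bigr => i _.
  by rewrite -[RHS]/((y - y') ord0 i *: (0 : E), (y - y') ord0 i *: delta_mx ord0 i) scaler0.
rewrite derive_sumv; last exact: dF.
apply: le_trans (ler_norm_sum _ _ _) _.
apply: (@le_trans _ _ (\sum_(i < n) c * `|y - y'|)).
  apply: ler_sum => i _; rewrite deriveZv; last exact: dF.
  rewrite normrM mulrC; apply: ler_pM => //; first exact: Fc.
  exact: mx_entry_norm.
by rewrite sumr_const card_ord -[leLHS]mulr_natl mulrA.
Qed.

(** The derivative of [h] in y vanishes at the base point, hence is small nearby. *)
Lemma diff_contraction : exists2 r : R, 0 < r &
  (forall z u, `|z - z0| <= r -> `|u - y0| <= r -> sm f (z, u)) /\
  (forall z y y', `|z - z0| <= r -> `|y - y0| <= r -> `|y' - y0| <= r ->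
     `|h (z, y) - h (z, y')| <= 2^-1 * `|y - y'|).
Proof.
(* Chosen so that n c <= 1/2 in [segment_bound]; n + 1 also covers n = 0. *)
pose c : R := (2 * n.+1%:R)^-1; have c0 : 0 < c by rewrite invr_gt0 mulr_gt0.
have nD i j : \forall p \near (z0, y0), `|'D_(0, delta_mx ord0 i) (fun p => h p ord0 j) p| < c.
  have s : sm ('D_(0, delta_mx ord0 i) (fun p => h p ord0 j)) (z0, y0).
    by apply: sm_derive; exact: sm_entry.
  have e0 : 'D_(0, delta_mx ord0 i) (fun p => h p ord0 j) (z0, y0) = 0.
    rewrite (derive_lcomp _ (@mxcoord_continuous _ _ _ ord0 j)); last exact: sm_diff.
    rewrite deriveBf; [|exact: differentiable_snd|exact: sm_diff].
    rewrite (derive_linear _ _ (@snd_continuous _ _ _)) Df /= subrr.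
    by rewrite /mxcoord mxE.
  have := cont_near_dist (sm_cont s) c0.
  by apply: filterS => p; rewrite e0 sub0r normrN.
have nDall : \forall p \near (z0, y0), forall ij : 'I_n * 'I_n,
   `|'D_(0, delta_mx ord0 ij.1) (fun p => h p ord0 ij.2) p| < c.
  by apply: near_forall => -[i j]; exact: nD.
have [r /= r0 Hr] := (nbhs_ballP (z0, y0) _).1 (nearI (sm_near sf) nDall).
have B z u : `|z - z0| <= r / 2 -> `|u - y0| <= r / 2 -> ball (z0, y0) r (z, u).
  have r2 : r / 2 < r by rewrite ltr_pdivrMr // ltr_pMr // ltr1n.
  by move=> hz hu; split; rewrite -ball_normE /= distrC; exact: le_lt_trans r2.
exists (r / 2); first by rewrite divr_gt0.
split=> [z u hz hu|z y y' hz hy hy']; first by have [] := Hr _ (B z u hz hu).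
apply: mx_norm_le => [|i j]; first by rewrite mulr_ge0.
rewrite !mxE (ord1 i).
have := @segment_bound (fun p => h p ord0 j) z y y' c (r / 2) _ (ltW c0) _ hy hy'.
rewrite !mxE => H; apply: (le_trans (H _ _)).
- move=> u hu; apply: sm_diff; apply: sm_entry; apply: smB; first exact: sm_snd.
  by have [] := Hr _ (B z u hz hu).
- by move=> u hu k; have [_ /(_ (k, j)) /ltW] := Hr _ (B z u hz hu).
apply: ler_wpM2r => //; rewrite /c invfM mulrCA ler_piMr // ler_pdivrMr // mul1r.
by rewrite ler_nat.
Qed.

End Core.
End Implicit.

(** * Inverting (z, y) |-> (z, f (z, y)) *)

Section Implicit.
Context {R : realType}.
Implicit Types E V W : normedModType R.

Lemma cont_pair (T U V : topologicalType) (f : T -> U) (g : T -> V) (x : T) :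
  {for x, continuous f} -> {for x, continuous g} -> {for x, continuous (fun y => (f y, g y))}.
Proof. by move=> cf cg; exact: (cvg_pair cf cg). Qed.

Lemma contraction_fix n (T : 'rV[R]_n -> 'rV[R]_n) y0 r : 0 < r ->
  (forall y, `|y - y0| <= r -> `|T y - y0| <= r) ->
  (forall y y', `|y - y0| <= r -> `|y' - y0| <= r -> `|T y - T y'| <= 2^-1 * `|y - y'|) ->
  exists2 y, `|y - y0| <= r & y = T y.
Proof.
move=> r0 TU TL; pose U : set 'rV[R]_n := closed_ball_ Num.Def.normr y0 r.
have UE y : U y <-> `|y - y0| <= r by rewrite /U /closed_ball_ /= distrC.
have TU' : {homo T : y / U y >-> U y} by move=> y /UE /TU /UE.
have ct : is_contraction (mkfun TU').
  exists (2^-1 : R)%:nng; split; first by rewrite /= invf_lt1 // ltr1n.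
  by move=> [y y'] [/= /UE Uy /UE Uy']; exact: TL.
have [||y] := @banach_fixed_point R 'rV[R]_n U _ ct.
- exact: closed_closed_ball_.
- by exists y0; rewrite /U /closed_ball_ /= subrr normr0 ltW.
by move=> /UE Uy yT; exists y.
Qed.

Lemma diff_of_bound V W (g : V -> W) p (L : {linear V -> W}) : continuous L ->
  (forall e : R, 0 < e -> \forall q \near (0 : V), `|g (q + p) - (g p + L q)| <= e * `|q|) ->
  differentiable g p /\ 'd g p = L :> (V -> W).
Proof.
move=> cL H.
have e0 : g \o shift p = cst (g p) + (L : V -> W) +o_ 0 id by apply/eqaddoP => e; exact: H.
have dL : 'd g p = L :> (V -> W) by exact: diff_unique.
by split=> //; apply/diff_locallyP; rewrite dL.
Qed.

(** Expand f (q.1, g q) = q.2 to first order along the increment of (q.1, g q), which tends to 0 as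
    [g] is continuous, and solve for the increment of [g] with the inverse matrix [N]. *)
Lemma diff_inverse E n (f : E * 'rV[R]_n -> 'rV[R]_n) (g : E * 'rV[R]_n -> 'rV[R]_n) p
    (N : 'M[R]_n) :
  differentiable f (p.1, g p) -> {for p, continuous g} ->
  (\forall q \near p, f (q.1, g q) = q.2) ->
  (forall v, 'D_(0, v) f (p.1, g p) *m N = v) ->
  differentiable g p /\
  forall a b, 'D_(a, b) g p = (b - 'D_(a, 0) f (p.1, g p)) *m N.
Proof.
move=> df cg fg DN; set P := (p.1, g p).
pose i1 (q : E * 'rV[R]_n) : E * 'rV[R]_n := (q.1, 0).
pose l (q : E * 'rV[R]_n) : 'rV[R]_n := (q.2 - 'd f P (i1 q)) *m N.
have ll : linear l.
  move=> a u v; rewrite /l /=.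
  have -> : i1 (a *: u + v) = a *: i1 u + i1 v.
    by rewrite /i1 -[RHS]/(a *: u.1 + v.1, a *: (0 : 'rV[R]_n) + 0) scaler0 addr0.
  by rewrite linearP scalemxAl -mulmxDl scalerBr opprD addrACA.
pose L : {linear (E * 'rV[R]_n)%type -> 'rV[R]_n} := HB.pack l (GRing.isLinear.Build _ _ _ _ _ ll).
have cN : continuous (fun v : 'rV[R]_n => v *m N).
  by move=> v; apply: sm_cont; apply: sm_mulmx; [exact: sm_id|exact: sm_cst].
have cd : continuous ('d f P) by exact: diff_continuous.
have cL : continuous L.
  move=> q; rewrite -[L : _ -> _]/l /l.
  apply: (@continuous_comp _ _ _ (fun q : E * 'rV[R]_n => q.2 - 'd f P (i1 q)) (fun v => v *m N)); last exact: cN.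
  apply: cvgB; first exact: cvg_snd.
  apply: (@continuous_comp _ _ _ i1 ('d f P)); last exact: cd.
  by apply: sm_cont; apply: sm_pair; [exact: sm_fst|exact: sm_cst].
have [K K0 HK] := linear_lipschitz (f := mulmxr N : {linear 'rV[R]_n -> 'rV[R]_n}) cN.
have [K' K'0 HK'] := linear_lipschitz cL.
have [dg dL] : differentiable g p /\ 'd g p = L :> (_ -> _).
  apply: diff_of_bound cL _ => e e0.
  (* As t <= 1/2, the term t |D| is absorbed on the left, which gives |D| <= (2 K' + 1) |q| and |u
     q| <= (2 K' + 2) |q|. The second bound on t then makes the error at most e |q|. *)
  pose t := Num.min 2^-1 (e / (2 * K' + 2)).
  have k2 : 0 < 2 * K' + 2 by rewrite addr_gt0 // mulr_gt0.
  have t0 : 0 < t by rewrite lt_min invr_gt0 ltr0n divr_gt0.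
  have h0 : 0 < t / K by rewrite divr_gt0.
  have [_ /eqaddoP /(_ _ h0) /= df'] := (diff_locallyP _ _).1 df.
  pose u (q : E * 'rV[R]_n) : E * 'rV[R]_n := (q.1, g (q + p) - g p).
  have u0 : u 0 = 0 by rewrite /u add0r subrr.
  have cu : {for 0, continuous u}.
    apply: cont_pair; first exact: sm_cont (sm_fst _).
    have c1 : {for 0, continuous (g \o +%R^~ p)}.
      apply: continuous_comp; last by rewrite add0r.
      by apply: (@sm_cont _ _ _ (+%R^~ p)); apply: smD; [exact: sm_id|exact: sm_cst].
    exact: (cvgB c1 (cvg_cst _)).
  have fgs : \forall q \near (0 : E * 'rV[R]_n), f ((q + p).1, g (q + p)) = (q + p).2.
    by move: fg; rewrite (near_shift 0 p) subr0.
  have Hus : \forall q \near (0 : E * 'rV[R]_n),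
      `|f (u q + P) - f P - 'd f P (u q)| <= t / K * `|u q|.
    apply: (@near_comp _ _ u 0 (fun w => `|f (w + P) - f P - 'd f P w| <= t / K * `|w|) cu).
    by rewrite u0; apply: filterS df' => w; rewrite !fctE /= opprD addrA.
  near=> q.
  have Hq : f ((q + p).1, g (q + p)) = (q + p).2 by near: q.
  have Hu : `|f (u q + P) - f P - 'd f P (u q)| <= t / K * `|u q|.
    by near: q.
  have fP : f P = p.2 by exact: (nbhs_singleton fg).
  have uP : u q + P = ((q + p).1, g (q + p)).
    by rewrite -[LHS]/(q.1 + p.1, g (q + p) - g p + g p) subrK.
  rewrite uP Hq fP -[(q + p).2]/(q.2 + p.2) addrK in Hu.
  pose D := g (q + p) - g p.
  have uE : u q = i1 q + (0, D) by rewrite -[RHS]/(q.1 + 0, 0 + D) addr0 add0r.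
  have DE : D - l q = - ((q.2 - 'd f P (u q)) *m N).
    rewrite uE linearD opprD addrA mulmxBl -/(l q) opprB.
    by rewrite -(deriveE (0, D) df) DN.
  have lD : `|D - l q| <= t * `|u q|.
    rewrite DE normrN; apply: (le_trans (HK _)).
    apply: (@le_trans _ _ (K * (t / K * `|u q|))); first by rewrite ler_pM2l.
    by rewrite mulrA mulrCA divff ?gt_eqF // mulr1.
  have qa : `|q.1| <= `|q| by rewrite [leRHS]prod_normE le_max lexx.
  have lu : `|u q| <= `|q| + `|D|.
    rewrite [leLHS]prod_normE /= ge_max; apply/andP; split.
      by apply: (le_trans qa); rewrite lerDl.
    by rewrite lerDr.
  have lq := HK' q.
  have D1 : `|D| <= `|l q| + t * (`|q| + `|D|).
    rewrite -[D in leLHS](subrK (l q)) addrC; apply: (le_trans (ler_normD _ _)).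
    rewrite lerD2l; apply: (le_trans lD); exact: (ler_wpM2l (ltW t0)).
  have t1 : t <= 2^-1 by rewrite ge_min lexx.
  have t2 : t * (2 * K' + 2) <= e by rewrite -ler_pdivlMr // ge_min lexx orbT.
  have q0 : 0 <= `|q| := normr_ge0 q.
  have D0 : 0 <= `|D| := normr_ge0 D.
  have tD : t * (`|q| + `|D|) <= 2^-1 * (`|q| + `|D|) by rewrite ler_wpM2r // addr_ge0.
  have D2 : `|D| <= (2 * K' + 1) * `|q|.
    by move: D1 tD; rewrite -[L q]/(l q) in lq *; move: lq; nra.
  rewrite opprD addrA -/D.
  apply: (le_trans lD); apply: (@le_trans _ _ (t * ((2 * K' + 2) * `|q|))).
    apply: (ler_wpM2l (ltW t0)); apply: (le_trans lu).
    move: D2; nra.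
  by rewrite mulrA ler_wpM2r.
split=> // a b; rewrite deriveE // dL /= /l deriveE //.
Unshelve. all: by end_near. Qed.

(** f (z, y) = w means that y is a fixed point of y |-> h (z, y) + w, and [h] is contracting in y
    near the base point. *)
Lemma implicit_id E n (f : E * 'rV[R]_n -> 'rV[R]_n) z0 y0 : findim E -> sm f (z0, y0) ->
  (forall v, 'D_(0, v) f (z0, y0) = v) ->
  exists g : E * 'rV[R]_n -> 'rV[R]_n, [/\ sm g (z0, f (z0, y0)),
    g (z0, f (z0, y0)) = y0,
    \forall p \near (z0, f (z0, y0)), f (p.1, g p) = p.2 &
    \forall p \near (z0, y0), g (p.1, f p) = p.2].
Proof.
move=> fE sf Df; set w0 := f (z0, y0).
have [r r0 [Hs Hc]] := diff_contraction sf Df.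
pose h (p : E * 'rV[R]_n) := p.2 - f p.
have hf z y : f (z, y) = y - h (z, y) by rewrite /h /= opprB addrCA subrr addr0.
pose g (p : E * 'rV[R]_n) := xget y0 [set y | `|y - y0| <= r /\ f (p.1, y) = p.2].
have uniq z y y' : `|z - z0| <= r -> `|y - y0| <= r -> `|y' - y0| <= r ->
    f (z, y) = f (z, y') -> y = y'.
  move=> hz hy hy'; rewrite !hf => e.
  have := Hc z y y' hz hy hy'; rewrite -/(h _) -/(h _).
  have -> : h (z, y) - h (z, y') = y - y'.
    have -> : h (z, y) = y - (y' - h (z, y')) by rewrite -e opprB addrCA subrr addr0.
    by rewrite opprB addrA addrAC addrK.
  move=> H; apply/eqP; rewrite -subr_eq0 -normr_le0; move: H (normr_ge0 (y - y')); lra.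
have z0r : `|z0 - z0| <= r by rewrite subrr normr0 ltW.
have y0r : `|y0 - y0| <= r by rewrite subrr normr0 ltW.
(* The bound r / 2, together with the ratio 1/2 of the contraction, makes the ball of radius r
   stable. *)
pose Q (p : E * 'rV[R]_n) := `|p.1 - z0| < r /\ `|p.2 - f (p.1, y0)| < r / 2.
have Qg p : Q p -> `|g p - y0| <= r /\ f (p.1, g p) = p.2.
  move=> [/ltW hz hw]; rewrite /g; apply: (@xgetPex _ y0 [set y | `|y - y0| <= r /\ f (p.1, y) = p.2]).
  have [||y hy yT] := @contraction_fix n (fun y => h (p.1, y) + p.2) y0 r r0.
  - move=> y hy.
    have -> : h (p.1, y) + p.2 - y0 = (h (p.1, y) - h (p.1, y0)) + (p.2 - f (p.1, y0)).
      by rewrite /h /=; apply/rowP => i; rewrite !mxE; ring.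
    apply: (le_trans (ler_normD _ _)); rewrite [leRHS]splitr; apply: lerD; last exact: ltW.
    by apply: (le_trans (Hc _ _ _ hz hy y0r)); rewrite mulrC; exact: ler_wpM2r.
  - by move=> y y' hy hy'; rewrite opprD addrACA subrr addr0; exact: Hc.
  by exists y; split=> //; rewrite hf {1}yT addrAC subrr add0r.
have nQ : \forall p \near (z0, w0), Q p.
  apply: nearI.
    have := @cont_near_dist _ _ _ _ (z0, w0) r (sm_cont (sm_fst (z0, w0))) r0.
    by apply: filterS => p; rewrite distrC.
  have s : sm (fun p : E * 'rV[R]_n => p.2 - f (p.1, y0)) (z0, w0).
    apply: smB; first exact: sm_snd.
    apply: (@sm_comp _ _ _ _ f (fun p : E * 'rV[R]_n => (p.1, y0))) => //.
    by apply: sm_pair; [exact: sm_fst|exact: sm_cst].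
  have := cont_near_dist (sm_cont s) (divr_gt0 r0 (ltr0n R 2)).
  by apply: filterS => p; rewrite /= /w0 subrr sub0r normrN.
have Q0 : Q (z0, w0) by exact: nbhs_singleton nQ.
have g0 : g (z0, w0) = y0.
  by have [h1 h2] := Qg _ Q0; apply: (uniq z0) => //; rewrite [LHS]h2.
have gf : \forall p \near (z0, y0), g (p.1, f p) = p.2.
  have n1 : \forall p \near (z0, y0), Q (p.1, f p).
    apply: (@near_comp _ _ (fun p : E * 'rV[R]_n => (p.1, f p)) (z0, y0) Q) => //.
    by apply: sm_cont; apply: sm_pair => //; exact: sm_fst.
  have := nearI n1 (@cont_near_dist _ _ _ _ (z0, y0) r (sm_cont (sm_snd (z0, y0))) r0).
  apply: filterS => -[z y] /= [Qp yr]; have [h1 h2] := Qg _ Qp.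
  by apply: (uniq z) => //; [case: Qp => /ltW|rewrite distrC ltW].
(* Half of |g p - g q| is absorbed by the contraction, so it is at most twice |q.2 - f (q.1, g p)|,
   which is small for q near p. *)
have cg p : Q p -> (\forall q \near p, Q q) -> {for p, continuous g}.
  move=> Qp nQp; apply/cvgrPdist_lt => e e0 /=.
  have [hz _] := Qp; have [gr fgp] := Qg p Qp.
  have s1 : sm (fun q : E * 'rV[R]_n => q.2 - f (q.1, g p)) p.
    apply: smB; first exact: sm_snd.
    apply: (@sm_comp _ _ _ _ f (fun q : E * 'rV[R]_n => (q.1, g p))) => //.
      by apply: sm_pair; [exact: sm_fst|exact: sm_cst].
    by apply: Hs => //; exact: ltW.
  have := nearI nQp (cont_near_dist (sm_cont s1) (divr_gt0 e0 (ltr0n R 2))).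
  apply: filterS => q [Qq]; rewrite /= fgp subrr sub0r normrN => lt.
  have [hzq _] := Qq; have [grq fgq] := Qg q Qq.
  have Hq := Hc q.1 (g p) (g q) (ltW hzq) gr grq.
  have E1 : g p - g q = (h (q.1, g p) - h (q.1, g q)) - (q.2 - f (q.1, g p)).
    by rewrite /h /= fgq; apply/rowP => i; rewrite !mxE; ring.
  have := ler_normB (h (q.1, g p) - h (q.1, g q)) (q.2 - f (q.1, g p)).
  rewrite -E1 => H1; move: H1 Hq lt; rewrite -/(h _) -/(h _).
  set a := `|g p - g q|; set b := `|h _ - h _|; set c := `|_ - f _|.
  by move=> H1 H2 H3; lra.
pose M (q : E * 'rV[R]_n) : 'M[R]_n := \matrix_(i, j) ('D_(0, delta_mx ord0 i) f q) ord0 j.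
have sM q : sm f q -> sm M q.
  move=> sq; apply: sm_mx => i j; under eq_fun do rewrite mxE.
  by apply: sm_entry; exact: sm_derive.
have ME q v : differentiable f q -> 'D_(0, v) f q = v *m M q.
  move=> dq; have -> : (0 : E, v) = \sum_i v ord0 i *: (0 : E, delta_mx ord0 i).
    rewrite {1}(row_sum_delta v).
    have -> : (0 : E, \sum_i v ord0 i *: delta_mx ord0 i) =
       (\sum_(i < n) (0 : E), \sum_i v ord0 i *: delta_mx ord0 i : 'rV[R]_n).
      by congr pair; rewrite big1.
    rewrite -sum_pair; apply: eq_bigr => i _.
    by rewrite -[RHS]/(v ord0 i *: (0 : E), v ord0 i *: delta_mx ord0 i) scaler0.
  rewrite derive_sumv //; apply/rowP => j; rewrite summxE mxE; apply: eq_bigr => i _.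
  by rewrite deriveZv // !mxE.
have M0 : M (z0, y0) = 1%:M.
  by apply/matrixP => i j; rewrite !mxE Df !mxE eqxx eq_sym.
have nS : \forall q \near (z0, y0), sm f q /\ \det (M q) != 0.
  apply: (nearI (sm_near sf)).
  apply: (@near_comp _ _ (fun q => \det (M q)) (z0, y0) (fun d => d != 0)).
    by apply: sm_cont; apply: sm_det; exact: sM.
  by apply: open_near; [exact: open_neq|rewrite /= M0 det1 oner_eq0].
have [S [oS S0] SE] : exists2 B : set (E * 'rV[R]_n), open_nbhs (z0, y0) B &
    B `<=` [set q | sm f q /\ \det (M q) != 0].
  by move: nS; rewrite -[X in X -> _]/(nbhs (z0, y0) [set q | sm f q /\ \det (M q) != 0]) nbhsE.
pose G (p : E * 'rV[R]_n) := (p.1, g p).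
have nO : \forall p \near (z0, w0), Q p /\ S (G p).
  apply: nearI => //; apply: (@near_comp _ _ G (z0, w0) S).
    by apply: cont_pair; [exact: sm_cont (sm_fst _)|exact: cg].
  by rewrite /G /= g0; apply: open_near.
have [Om [oO O0] OE] : exists2 B : set (E * 'rV[R]_n), open_nbhs (z0, w0) B &
    B `<=` [set p | Q p /\ S (G p)].
  by move: nO; rewrite -[X in X -> _]/(nbhs (z0, w0) [set p | Q p /\ S (G p)]) nbhsE.
have cgO p : Om p -> {for p, continuous g}.
  by move=> Op; have [Qp _] := OE _ Op; apply: cg => //; have := open_near oO Op; apply: filterS => q /OE [].
pose Phi (v q : E * 'rV[R]_n) := (v.2 - 'D_(v.1, 0) f q) *m invmx (M q).
have sPhi v q : S q -> sm (Phi v) q.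
  move=> /SE [sq dq]; apply: sm_mulmx; last by apply: sm_invmx => //; exact: sM.
  by apply: smB; [exact: sm_cst|exact: sm_derive].
have dgO p : Om p -> differentiable g p /\ forall v, 'D_v g p = Phi v (G p).
  move=> Op; have [Qp /SE [sq dq]] := OE _ Op.
  have [||||dg Dg] := @diff_inverse E n f g p (invmx (M (G p))).
  - exact: sm_diff.
  - exact: cgO.
  - by have := open_near oO Op; apply: filterS => q /OE [/Qg []].
  - by move=> v; rewrite ME ?mulmxK ?unitmxE ?unitfE //; exact: sm_diff.
  by split=> // -[a b]; rewrite Dg.
exists g; split=> //; last by apply: filterS nQ => p /Qg [].
(* Bootstrap: the derivative of [g] is a smooth function of (p.1, g p), so [g] is of class C^(k+1)
   as soon as it is of class C^k. *)
exists Om; split=> //; elim=> [|k IH]; first exact: cgO.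
split=> [p /dgO[]|v] //.
apply: (@Ck_ext _ k _ _ Om (Phi v \o G)) => //; first by move=> p /dgO [_ ->].
apply: (@Ck_comp _ k _ _ _ Om S) => //.
- by move=> p /OE [].
- apply: Ck_pair => //; apply: Ck_of_sm => p _; exact: sm_fst.
- by apply: Ck_of_sm => q; exact: sPhi.
Qed.

(** [implicit_id] applies to the composite of [f] with [L], which inverts the partial differential;
    injectivity of [L] carries the equation back to [f]. *)
Theorem implicit E n (f : E * 'rV[R]_n -> 'rV[R]_n) z0 y0 (L : {linear 'rV[R]_n -> 'rV[R]_n}) :
  findim E -> sm f (z0, y0) ->
  (forall v, L ('D_(0, v) f (z0, y0)) = v) -> injective L ->
  exists g : E * 'rV[R]_n -> 'rV[R]_n, [/\ sm g (z0, f (z0, y0)),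
    g (z0, f (z0, y0)) = y0,
    \forall p \near (z0, f (z0, y0)), f (p.1, g p) = p.2 &
    \forall p \near (z0, y0), g (p.1, f p) = p.2].
Proof.
move=> fE sf LD injL.
have cL : continuous L.
  have LE : (L : _ -> _) = fun v => v *m lin1_mx L by apply/funext => v; rewrite mul_rV_lin1.
  by move=> v; rewrite LE; apply: sm_cont; apply: sm_mulmx; [exact: sm_id|exact: sm_cst].
have sLf : sm (fun p => L (f p)) (z0, y0) by exact: sm_linear.
have [|g [sg g0 fg gf]] := implicit_id fE sLf.
  by move=> v; rewrite (derive_lcomp _ cL) //; exact: sm_diff.
pose A (p : E * 'rV[R]_n) := (p.1, L p.2).
have sA p : sm A p by apply: sm_pair; [exact: sm_fst|apply: sm_linear => //; exact: sm_snd].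
exists (fun p => g (p.1, L p.2)); split => //.
- by apply: (@sm_comp _ _ _ _ g A) => //; exact: findim_prod.
have := near_comp (sm_cont (sA (z0, f (z0, y0)))) fg.
by apply: filterS => p /= /injL.
Qed.

End Implicit.

(** * Smooth maps on manifolds *)

Section Charts.
Context {R : realType}.
Implicit Types (M N : manifold R) (E : normedModType R).

Lemma cinvK (T : topologicalType) n (c : chart R T n) w : (cmap c @` cdom c) w ->
  cdom c (cinv c w) /\ cmap c (cinv c w) = w.
Proof. by move=> [p cp <-]; rewrite cmapK. Qed.

Lemma near_cdom M (c : chart R M (mdim M)) p : cdom c p -> \forall q \near p, cdom c q.
Proof. by move=> cp; apply: open_nbhs_nbhs; split=> //; exact: cdom_open. Qed.

Lemma near_cimg M (c : chart R M (mdim M)) p : cdom c p ->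
  \forall w \near cmap c p, (cmap c @` cdom c) w.
Proof. by move=> cp; apply: open_near; [exact: cimg_open|exists p]. Qed.

Lemma cinv_cont_at M (c : chart R M (mdim M)) p : cdom c p -> {for cmap c p, continuous (cinv c)}.
Proof. by move=> cp; apply: cinv_cont; exists p. Qed.

Lemma near_chart M (c : chart R M (mdim M)) p (P : M -> Prop) : cdom c p ->
  (\forall q \near p, P q) -> \forall w \near cmap c p, P (cinv c w).
Proof. by move=> cp Pp; apply: (near_comp (cinv_cont_at cp)); rewrite cmapK. Qed.

Lemma chart_near M (c : chart R M (mdim M)) p (P : M -> Prop) : cdom c p ->
  (\forall w \near cmap c p, P (cinv c w)) -> \forall q \near p, P q.
Proof.
move=> cp Pp; have := nearI (near_cdom cp) (near_comp (cmap_cont cp) Pp).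
by apply: filterS => q [cq]; rewrite cmapK.
Qed.

Lemma sm_transition M (c d : chart R M (mdim M)) p : atlas c -> atlas d -> cdom c p -> cdom d p ->
  sm (cmap d \o cinv c) (cmap c p).
Proof.
move=> ac ad cp dp; exists (cmap c @` (cdom c `&` cdom d)); split; last exact: atlas_smooth.
  rewrite openE => w [q [cq dq] <-]; have := nearI (near_cimg cq) (near_chart cq (near_cdom dq)).
  by apply: filterS => v [/cinvK [cv vE] dv]; exists (cinv c v).
by exists p.
Qed.

Definition plot M E (A : E -> M) (y : E) : Prop := dplot (d := mspace M) A y.

Lemma plotE M E (A : E -> M) y (d : chart R M (mdim M)) : plot A y -> atlas d -> cdom d (A y) ->
  (\forall z \near y, cdom d (A z)) /\ sm (cmap d \o A) y.
Proof. exact. Qed.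

Lemma plot_cont M E (A : E -> M) y : plot A y -> {for y, continuous A}.
Proof.
move=> pA; have [c ac cA] := atlas_cover (A y).
have [ncA sA] := pA c ac cA.
have c1 : {for y, continuous (cinv c \o (cmap c \o A))}.
  by apply: continuous_comp; [exact: sm_cont|exact: cinv_cont_at].
move=> S HS; have : nbhs ((cinv c \o (cmap c \o A)) y) S by rewrite /= cmapK.
move=> /(near_comp c1) H; have := nearI ncA H.
by apply: filterS => z [cz]; rewrite /= cmapK.
Qed.

(** One chart suffices where [dplot] asks for all of them, thanks to the transition maps. *)
Lemma plotI M E (A : E -> M) y (c : chart R M (mdim M)) : atlas c -> cdom c (A y) ->
  (\forall z \near y, cdom c (A z)) -> sm (cmap c \o A) y -> plot A y.
Proof.
move=> ac cA ncA sA d ad dA.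
have cc : {for y, continuous (cmap c \o A)} by exact: sm_cont.
have AE : \forall z \near y, cinv c (cmap c (A z)) = A z.
  by apply: filterS ncA => z cz; rewrite cmapK.
split.
  have := nearI AE (near_comp cc (near_chart cA (near_cdom dA))).
  by apply: filterS => z [<-].
apply: (@sm_near_ext _ _ _ (fun z => (cmap d \o cinv c) ((cmap c \o A) z))).
  by apply: filterS AE => z /= ->.
by apply: sm_comp => //; exact: sm_transition.
Qed.

Lemma plot_ext M E (A B : E -> M) y : (\forall z \near y, A z = B z) -> plot A y -> plot B y.
Proof.
move=> AB pA; have ABy := nbhs_singleton AB.
have [c ac cA] := atlas_cover (A y); have [ncA sA] := pA c ac cA.
apply: (plotI ac); first by rewrite -ABy.
  by have := nearI AB ncA; apply: filterS => z [<-].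
by apply: sm_near_ext sA; apply: filterS AB => z /= ->.
Qed.

Lemma plot_near M E (A : E -> M) y : plot A y -> \forall z \near y, plot A z.
Proof.
move=> pA; have [c ac cA] := atlas_cover (A y); have [ncA sA] := pA c ac cA.
have := nearI (near_near ncA) (sm_near sA); apply: filterS => z [nz sz].
by apply: (plotI ac) => //; exact: nbhs_singleton nz.
Qed.

Lemma plot_comp M E E' (A : E -> M) (B : E' -> E) y : findim E -> sm B y -> plot A (B y) ->
  plot (fun z => A (B z)) y.
Proof.
move=> fE sB pA; have [c ac cA] := atlas_cover (A (B y)); have [ncA sA] := pA c ac cA.
apply: (plotI ac) => //; first exact: (near_comp (P := fun u => cdom c (A u)) (sm_cont sB)).
exact: (@sm_comp _ _ _ _ (cmap c \o A) B).
Qed.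

Lemma plot_chart M (c : chart R M (mdim M)) p : atlas c -> cdom c p -> plot (cinv c) (cmap c p).
Proof.
move=> ac cp; apply: (plotI ac); first by rewrite cmapK.
  exact: near_chart (near_cdom cp).
apply: (@sm_near_ext _ _ _ id); last exact: sm_id.
by apply: filterS (near_cimg cp) => w /cinvK [].
Qed.

Lemma plot_chart_near M (c : chart R M (mdim M)) w : atlas c -> (cmap c @` cdom c) w -> plot (cinv c) w.
Proof. by move=> ac [p cp <-]; exact: plot_chart. Qed.

Lemma plot_cst M E (p : M) (y : E) : plot (fun _ : E => p) y.
Proof.
have [c ac cp] := atlas_cover p; apply: (plotI ac) => //; first by near=> z.
exact: sm_cst.
Unshelve. all: by end_near. Qed.

Lemma plot_map M N E (f : M -> N) (A : E -> M) y : mmap f (A y) -> plot A y -> plot (fun z => f (A z)) y.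
Proof.
move=> sf pA; have [c ac cA] := atlas_cover (A y); have [ncA sA] := pA c ac cA.
apply: (@plot_ext _ _ (fun z => (f \o cinv c) ((cmap c \o A) z))).
  by apply: filterS ncA => z cz; rewrite /= cmapK.
by apply: plot_comp => //; exact: sf.
Qed.

Lemma map_plot M N (f : M -> N) p (c : chart R M (mdim M)) : atlas c -> cdom c p ->
  plot (f \o cinv c) (cmap c p) -> mmap f p.
Proof.
move=> ac cp pf d ad dp.
apply: (@plot_ext _ _ (fun w => (f \o cinv c) ((cmap c \o cinv d) w))).
  have := nearI (near_cimg dp) (near_chart dp (near_cdom cp)).
  by apply: filterS => w [_ cw]; rewrite /= cmapK.
by apply: plot_comp => //; [exact: sm_transition|rewrite /= cmapK].
Qed.

Lemma map_near M N (f : M -> N) p : mmap f p -> \forall q \near p, mmap f q.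
Proof.
move=> sf; have [c ac cp] := atlas_cover p; have pf := sf c ac cp.
apply: (chart_near cp); have := nearI (near_cimg cp) (plot_near pf).
by apply: filterS => w [/cinvK [cw wE] pw]; apply: (map_plot ac cw); rewrite wE.
Qed.

Lemma map_cont M N (f : M -> N) p : mmap f p -> {for p, continuous f}.
Proof.
move=> sf; have [c ac cp] := atlas_cover p; have /plot_cont cf := sf c ac cp.
rewrite /prop_for /continuous_at => S.
move=> H; have : nbhs ((f \o cinv c) (cmap c p)) S by rewrite /= cmapK.
by move=> /(near_comp cf) /(chart_near cp (P := S \o f)).
Qed.

Lemma map_comp M N (K : manifold R) (f : M -> N) (g : N -> K) p : mmap f p -> mmap g (f p) -> mmap (g \o f) p.
Proof.
move=> sf sg; have [c ac cp] := atlas_cover p; apply: (map_plot ac cp).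
by apply: (@plot_map _ _ _ g (f \o cinv c)); [rewrite /= cmapK|exact: sf].
Qed.

Lemma map_id M (p : M) : mmap id p.
Proof. by move=> c ac cp; exact: plot_chart. Qed.

Lemma map_ext M N (f g : M -> N) p : (\forall q \near p, f q = g q) -> mmap f p -> mmap g p.
Proof.
move=> fg sf; have [c ac cp] := atlas_cover p; apply: (map_plot ac cp).
apply: plot_ext (sf c ac cp); have := near_chart cp fg.
by apply: filterS => w /= ->.
Qed.

Lemma plot_fun M E (h : M -> R) (A : E -> M) y : smooth_fun h (A y) -> plot A y -> sm (fun z => h (A z)) y.
Proof.
move=> sh pA; have [c ac cA] := atlas_cover (A y); have [ncA sA] := pA c ac cA.
apply: (@sm_near_ext _ _ _ (fun z => (h \o cinv c) ((cmap c \o A) z))).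
  by apply: filterS ncA => z cz; rewrite /= cmapK.
by apply: sm_comp => //; exact: sh.
Qed.

Lemma fun_chart M (h : M -> R) p (c : chart R M (mdim M)) : atlas c -> cdom c p ->
  sm (h \o cinv c) (cmap c p) -> smooth_fun h p.
Proof.
move=> ac cp sh d ad dp.
apply: (@sm_near_ext _ _ _ (fun w => (h \o cinv c) ((cmap c \o cinv d) w))).
  have := near_chart dp (near_cdom cp).
  by apply: filterS => w cw; rewrite /= cmapK.
by apply: sm_comp => //; [exact: sm_transition|rewrite /= cmapK].
Qed.

Lemma fun_near M (h : M -> R) p : smooth_fun h p -> \forall q \near p, smooth_fun h q.
Proof.
move=> sh; have [c ac cp] := atlas_cover p; have sf := sh c ac cp.
apply: (chart_near cp); have := nearI (near_cimg cp) (sm_near sf).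
by apply: filterS => w [/cinvK [cw wE] pw]; apply: (fun_chart ac cw); rewrite wE.
Qed.

Lemma fun_ext M (f g : M -> R) p : (\forall q \near p, f q = g q) -> smooth_fun f p -> smooth_fun g p.
Proof.
move=> fg sf; have [c ac cp] := atlas_cover p; apply: (fun_chart ac cp).
apply: sm_near_ext (sf c ac cp); have := near_chart cp fg.
by apply: filterS => w /= ->.
Qed.

Lemma fun_comp M N (f : M -> N) (h : N -> R) p : mmap f p -> smooth_fun h (f p) -> smooth_fun (h \o f) p.
Proof.
move=> sf sh; have [c ac cp] := atlas_cover p; apply: (fun_chart ac cp).
by apply: (@plot_fun _ _ h (f \o cinv c)); [rewrite /= cmapK|exact: sf].
Qed.

Definition ccoord M (c : chart R M (mdim M)) (i : 'I_(mdim M)) : M -> R := fun p => cmap c p ord0 i.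

Lemma fun_coord M (c : chart R M (mdim M)) i p : atlas c -> cdom c p -> smooth_fun (ccoord c i) p.
Proof.
move=> ac cp; apply: (fun_chart ac cp).
exact: (sm_entry ord0 i (sm_transition ac ac cp cp)).
Qed.

(** The tangent vector with coordinates [q] in the chart [c]. Functions that are not smooth near [p]
    get the same default value 0 as in [push]. *)
Definition tanv M (c : chart R M (mdim M)) (p : M) (q : 'rV[R]_(mdim M)) : (M -> R) -> R :=
  fun h => if `[< smooth_fun h p >] then 'D_q (h \o cinv c) (cmap c p) else 0.

Lemma tanvD M (c : chart R M (mdim M)) p a q q' : atlas c -> cdom c p ->
  tanv c p (a *: q + q') = a *: tanv c p q + tanv c p q'.
Proof.
move=> ac cp; apply/funext => h; rewrite /tanv !fctE /=; case: asboolP => [sh|_]; last by rewrite scaler0 addr0.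
have dh := sm_diff (sh c ac cp).
by rewrite deriveDv // deriveZv.
Qed.

Lemma tanv0 M (c : chart R M (mdim M)) p : tanv c p 0 = 0.
Proof. by apply/funext => h; rewrite /tanv; case: asboolP => // _; rewrite derive0. Qed.

Lemma tanv_coord M (c : chart R M (mdim M)) p q i : atlas c -> cdom c p ->
  tanv c p q (ccoord c i) = q ord0 i.
Proof.
move=> ac cp; rewrite /tanv asboolT; last exact: fun_coord.
rewrite -[RHS](derive_coord ord0 i (cmap c p) q); apply: near_eq_derive.
by apply: filterS (near_cimg cp) => w /cinvK [_ wE]; rewrite /= /ccoord wE.
Qed.

Lemma tanv_inj M (c : chart R M (mdim M)) p q q' : atlas c -> cdom c p ->
  tanv c p q = tanv c p q' -> q = q'.
Proof. by move=> ac cp e; apply/rowP => i; rewrite -!(tanv_coord _ i ac cp) e. Qed.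

Lemma velocity_tanv M (c : chart R M (mdim M)) (g : R -> M) : atlas c -> cdom c (g 0) ->
  plot g 0 -> velocity (S := mspace M) g = tanv c (g 0) ('D_1 (cmap c \o g) 0).
Proof.
move=> ac cg pg; have [ng sg] := pg c ac cg.
apply/funext => h; rewrite /velocity /push /tanv /=; case: asboolP => // sh.
rewrite derive1E -(@derive_comp _ _ _ _ (cmap c \o g) (h \o cinv c)); last 2 first.
- exact: sm_diff.
- exact: sm_diff (sh c ac cg).
apply: near_eq_derive; apply: filterS ng => e ce; by rewrite /= cmapK.
Qed.

Lemma plot_line M (c : chart R M (mdim M)) p q : atlas c -> cdom c p ->
  plot (fun e : R => cinv c (e *: q + cmap c p)) 0.
Proof.
move=> ac cp; apply: (@plot_comp M _ _ (cinv c) (fun e : R => e *: q + cmap c p)) => //.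
  exact: sm_line.
by rewrite scale0r add0r; exact: plot_chart.
Qed.

Lemma tangent_tanv M (c : chart R M (mdim M)) p q : atlas c -> cdom c p -> mtangent p (tanv c p q).
Proof.
move=> ac cp; exists (fun e : R => cinv c (e *: q + cmap c p)).
have g0 : cinv c (0 *: q + cmap c p) = p by rewrite scale0r add0r cmapK.
split => //; first exact: plot_line.
rewrite (velocity_tanv ac) //=; last 2 first.
- by rewrite g0.
- exact: plot_line.
rewrite g0; congr (tanv c p _).
have -> : 'D_1 (cmap c \o (fun e : R => cinv c (e *: q + cmap c p))) 0 =
    'D_1 (fun e : R => id (e *: q + cmap c p)) 0.
  apply: near_eq_derive.
  have n := @near_comp _ _ (fun e : R => e *: q + cmap c p) 0 _ (sm_cont (sm_line _ _ _)).
  have := n (cmap c @` cdom c); rewrite scale0r add0r => /(_ (near_cimg cp)).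
  by apply: filterS => e /cinvK [].
by rewrite [RHS](derive_line id q (cmap c p) 0) derive_id.
Qed.

Lemma tangent_ex M (c : chart R M (mdim M)) p v : atlas c -> cdom c p -> mtangent p v ->
  exists q, v = tanv c p q.
Proof.
move=> ac cp [g [g0 pg ->]]; exists ('D_1 (cmap c \o g) 0).
by rewrite (velocity_tanv ac) ?g0.
Qed.

(** Curves cannot be added on a manifold; their velocities are added in a chart, where every vector
    is the velocity of a line. *)
Lemma tangent_lin M (p : M) a v w : mtangent p v -> mtangent p w -> mtangent p (a *: v + w).
Proof.
have [c ac cp] := atlas_cover p; move=> /(tangent_ex ac cp) [q ->] /(tangent_ex ac cp) [q' ->].
by rewrite -tanvD //; exact: tangent_tanv.
Qed.

End Charts.

(** * Vector fields and local bisections *)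

Section Brackets.
Context {R : realType}.

Lemma derive_D (E V W : normedModType R) (f : V -> W) (c u : E -> V) x a : findim V ->
  sm f (c x) -> sm c x -> sm u x ->
  'D_a (fun y => 'D_(u y) f (c y)) x =
  'D_('D_a u x) f (c x) + 'D_('D_a c x) ('D_(u x) f) (c x).
Proof.
move=> fV sf sc su; have [n [b [l [cl bl]]]] := fV.
have df := sm_diff sf.
have nf : \forall y \near x, sm f (c y) by exact: (near_comp (P := fun z => sm f z) (sm_cont sc) (sm_near sf)).
transitivity ('D_a (fun y => \sum_i l i (u y) *: 'D_(b i) f (c y)) x).
  apply: near_eq_derive; apply: filterS nf => y /sm_diff dy.
  by rewrite -derive_findim.
have slu i : sm (fun y => l i (u y)) x by exact: sm_linear.
have sDf i : sm (fun y => 'D_(b i) f (c y)) x.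
  by apply: (@sm_comp _ _ _ _ ('D_(b i) f) c) => //; exact: sm_derive.
rewrite derive_sumf; last by move=> i; apply: sm_diff; exact: sm_scale.
transitivity (\sum_i (l i ('D_a u x) *: 'D_(b i) f (c x) +
    l i (u x) *: 'D_('D_a c x) ('D_(b i) f) (c x))).
  apply: eq_bigr => i _; rewrite derive_scale; [|exact: sm_diff|exact: sm_diff].
  rewrite (derive_lcomp _ (cl i)); last exact: sm_diff.
  congr (_ + _ *: _); rewrite -(@derive_comp _ _ _ _ c ('D_(b i) f)) //; first exact: sm_diff.
  by apply: sm_diff; exact: sm_derive.
rewrite big_split /= -(derive_findim _ bl df); congr (_ + _).
transitivity ('D_('D_a c x) (fun y => \sum_i l i (u x) *: 'D_(b i) f y) (c x)).
  rewrite derive_sumf; last first.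
    by move=> i; apply: sm_diff; apply: sm_scale; [exact: sm_cst|exact: sm_derive].
  by apply: eq_bigr => i _; rewrite deriveZf //; apply: sm_diff; exact: sm_derive.
apply: near_eq_derive; apply: filterS (sm_near sf) => y /sm_diff dy.
by rewrite -derive_findim.
Qed.

Lemma deriveBv (E W : normedModType R) (f : E -> W) x v w : differentiable f x ->
  'D_(v - w) f x = 'D_v f x - 'D_w f x.
Proof. by move=> df; rewrite !deriveE // linearB. Qed.

Lemma addr_cancel (a b s : R) : a + s - (b + s) = a - b.
Proof. by ring. Qed.

(** In coordinates V (W h) and W (V h) have the same second-order part by [schwarz], and it
    cancels. *)
Lemma vbracket_tanv (M : manifold R) (c : chart R M (mdim M)) p
    (V W : M -> (M -> R) -> R) (v w : 'rV[R]_(mdim M) -> 'rV[R]_(mdim M)) :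
  atlas c -> cdom c p -> sm v (cmap c p) -> sm w (cmap c p) ->
  (\forall q \near p, V q = tanv c q (v (cmap c q))) ->
  (\forall q \near p, W q = tanv c q (w (cmap c q))) ->
  vbracket V W p = tanv c p ('D_(v (cmap c p)) w (cmap c p) - 'D_(w (cmap c p)) v (cmap c p)).
Proof.
move=> ac cp sv sw VE WE; apply/funext => h; rewrite /vbracket /tanv; case: asboolP => // sh.
have sh' := sh c ac cp.
have H (V' : M -> (M -> R) -> R) (v' : 'rV[R]_(mdim M) -> 'rV[R]_(mdim M)) : sm v' (cmap c p) ->
    (\forall q \near p, V' q = tanv c q (v' (cmap c q))) ->
    \forall z \near cmap c p, V' (cinv c z) h = 'D_(v' z) (h \o cinv c) z.
  move=> sv' VE'; have := nearI (near_cimg cp) (nearI (near_chart cp VE') (near_chart cp (fun_near sh))).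
  by apply: filterS => z [/cinvK [_ zE] [-> shz]]; rewrite /tanv asboolT // zE.
have HV (V' W' : M -> (M -> R) -> R) (v' w' : 'rV[R]_(mdim M) -> 'rV[R]_(mdim M)) :
    sm v' (cmap c p) -> sm w' (cmap c p) ->
    (\forall q \near p, V' q = tanv c q (v' (cmap c q))) ->
    (\forall q \near p, W' q = tanv c q (w' (cmap c q))) ->
    V' p (fun q => W' q h) = 'D_('D_(v' (cmap c p)) w' (cmap c p)) (h \o cinv c) (cmap c p) +
       'D_(v' (cmap c p)) ('D_(w' (cmap c p)) (h \o cinv c)) (cmap c p).
  move=> sv' sw' VE' WE'; rewrite (nbhs_singleton VE') /tanv asboolT; last first.
    apply: (fun_chart ac cp); apply: (@sm_near_ext _ _ _ (fun z => 'D_(w' z) (h \o cinv c) z)).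
      by apply: filterS (H _ _ sw' WE') => z /= ->.
    by apply: (@sm_D _ _ _ _ (h \o cinv c) id w') => //; exact: sm_id.
  transitivity ('D_(v' (cmap c p)) (fun z => 'D_(w' z) (h \o cinv c) z) (cmap c p)).
    by apply: near_eq_derive; exact: H.
  by rewrite (@derive_D _ _ _ (h \o cinv c) id w') ?derive_id //; exact: sm_id.
have S := @schwarz _ _ _ (h \o cinv c) (cmap c p) (v (cmap c p)) (w (cmap c p)) findim_real sh'.
rewrite (HV V W v w sv sw VE WE) (HV W V w v sw sv WE VE) S addr_cancel.
by apply/esym; apply: deriveBv; exact: sm_diff.
Qed.

End Brackets.

(** * Germs of bisections of G: criterion, products and inverses *)

Section Groupoid.
Context {R : realType} (G : lie_groupoid R).
Local Notation I := (base G).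
Local Notation bis := (bisection_at (Gam := gpd_of G)).
Implicit Types (E : normedModType R) (F H : I -> arrows G).

Lemma mmap_src X : mmap (@src R G) X. Proof. by have [] := src_submersion X. Qed.
Lemma mmap_tgt X : mmap (@tgt R G) X. Proof. by have [] := tgt_submersion X. Qed.

Lemma plot_mul E (a b : E -> arrows G) y : findim E ->
  (\forall z \near y, src (a z) = tgt (b z)) -> plot a y -> plot b y ->
  plot (fun z => mul (a z) (b z)) y.
Proof.
move=> fE ab pa pb; have [n [f [g [cf cg gf]]]] := findim_iso fE.
have sf w : sm f w by exact: sm_lin.
have sg w : sm g w by exact: sm_lin.
apply: (@plot_ext _ _ _ (fun z => mul (a (f (g z))) (b (f (g z))))).
  by near=> z; rewrite gf.
apply: (@plot_comp _ _ _ _ (fun w => mul (a (f w)) (b (f w))) g) => //.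
apply: mul_smooth.
- by apply: (@near_comp _ _ f (g y) (fun z => src (a z) = tgt (b z))); [exact: sm_cont|rewrite gf].
- by apply: (@plot_comp _ _ _ _ a f) => //; rewrite gf.
- by apply: (@plot_comp _ _ _ _ b f) => //; rewrite gf.
Unshelve. all: by end_near. Qed.

Lemma near_open (T : topologicalType) (x : T) (P : T -> Prop) : (\forall y \near x, P y) ->
  exists A : set T, [/\ open A, A x & forall y, A y -> P y].
Proof.
move=> H; have [A [oA Ax] AP] : exists2 B : set T, open_nbhs x B & B `<=` P.
  by move: H; rewrite -[X in X -> _]/(nbhs x P) nbhsE.
by exists A.
Qed.

Lemma open_preim (T S : topologicalType) (f : T -> S) (A : set T) (B : set S) : open A -> open B ->
  (forall x, A x -> {for x, continuous f}) -> open (A `&` f @^-1` B).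
Proof.
move=> oA oB cf; rewrite openE => x [Ax Bfx]; apply: filterI; first exact: open_nbhs_nbhs.
by apply: cf => //; exact: open_nbhs_nbhs.
Qed.

(** An inverse [g] known near the point is enough: the domain is shrunk to A [&] f
    @^-1[B, whose image B]&[g @^-1] A is open. *)
Lemma bis_intro F x (g : I -> I) : (\forall y \near x, src (F y) = y) -> mmap F x ->
  mmap g (tgt (F x)) -> (\forall y \near x, g (tgt (F y)) = y) ->
  (\forall y \near tgt (F x), tgt (F (g y)) = y) -> bis x F.
Proof.
move=> sF mF mg gf fg.
have [A [oA Ax AP]] := near_open (nearI sF (nearI (map_near mF) gf)).
have [B [oB Bx BP]] := near_open (nearI (map_near mg) fg).
pose f y := tgt (F y).
have mf y : A y -> mmap f y.
  by move=> /AP [_ [mFy _]]; apply: (@map_comp _ _ _ _ F (@tgt R G)) => //; exact: mmap_tgt.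
have UE : f @` (A `&` f @^-1` B) = B `&` g @^-1` A.
  apply/seteqP; split=> [y [z [Az Bz] <-]|y [By Agy]]; first by split=> //=; have [_ [_ ->]] := AP _ Az.
  by exists (g y); [split=> //=|]; rewrite /f; have [_ ->] := BP _ By.
exists (A `&` f @^-1` B); first by [].
split.
- by apply: open_preim => // y /mf; exact: map_cont.
- by move=> y [/AP []].
- by move=> y [/AP [_ []]].
- split; first by move=> y [/mf].
    by rewrite UE; apply: open_preim => // y /BP [/map_cont].
  exists g; split=> [y [/AP [_ [_ ->]]]|y] //.
  by rewrite UE => -[/BP []].
Qed.

Lemma bis_near F x : bis x F -> \forall y \near x, bis y F.
Proof.
move=> [U Ux bU]; have [oU _ _ _] := bU.
have : \forall y \near x, U y by exact: open_nbhs_nbhs.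
by apply: filterS => y Uy; exists U.
Qed.

Lemma bis_src F x : bis x F -> src (F x) = x.
Proof. by move=> [U Ux [_ sF _ _]]; exact: sF. Qed.

Lemma bis_srcs F x : bis x F -> \forall y \near x, src (F y) = y.
Proof. by move=> /bis_near; apply: filterS => y; exact: bis_src. Qed.

Lemma bis_map F x : bis x F -> mmap F x.
Proof. by move=> [U Ux [_ _ mF _]]; exact: mF. Qed.

Lemma bis_mapt F x : bis x F -> mmap (fun y => tgt (F y)) x.
Proof. by move=> /bis_map mF; apply: (@map_comp _ _ _ _ F (@tgt R G)) => //; exact: mmap_tgt. Qed.

Lemma bis_elim F x : bis x F -> exists g : I -> I, [/\ mmap g (tgt (F x)),
  \forall y \near x, g (tgt (F y)) = y, \forall y \near tgt (F x), tgt (F (g y)) = y &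
  g (tgt (F x)) = x].
Proof.
move=> [U Ux [oU sF mF [mf oV [g [gf mg]]]]]; exists g.
have n1 : \forall y \near x, g (tgt (F y)) = y.
  by have : \forall y \near x, U y by [exact: open_nbhs_nbhs]; apply: filterS.
split=> //; last exact: gf; first by apply: mg; exists x.
have : \forall y \near tgt (F x), ((fun x => tgt (F x)) @` U) y.
  by apply: open_nbhs_nbhs; split=> //; exists x.
by apply: filterS => y [z Uz <-]; rewrite gf.
Qed.

Lemma bis_ext F F' x : (\forall y \near x, F y = F' y) -> bis x F -> bis x F'.
Proof.
move=> FF bF; have [g [mg gf fg gx]] := bis_elim bF; have FFx := nbhs_singleton FF.
have cg : {for tgt (F x), continuous g} by exact: map_cont.
apply: (@bis_intro _ _ g).
- by have := nearI FF (bis_srcs bF); apply: filterS => y [<-].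
- exact: map_ext (bis_map bF).
- by rewrite -FFx.
- by have := nearI FF gf; apply: filterS => y [<-].
- rewrite -FFx; have n := @near_comp _ _ g (tgt (F x)) (fun y => F y = F' y) cg.
  rewrite gx in n; have := nearI fg (n FF); by apply: filterS => y [e1 e2]; rewrite -e2.
Qed.

Lemma bis_unit x : bis x (@unit_ R G).
Proof.
apply: (@bis_intro _ _ id); rewrite ?tgt_unit.
- by near=> y; rewrite src_unit.
- exact: unit_smooth.
- exact: map_id.
- by near=> y; rewrite tgt_unit.
- by near=> y; rewrite tgt_unit.
Unshelve. all: by end_near. Qed.

Lemma bis_mul F H x : bis x F -> bis (tgt (F x)) H -> bis x (bmul (Gam := gpd_of G) H F).
Proof.
move=> bF bH; have [g [mg gf fg gx]] := bis_elim bF; have [h [mh hf fh hx]] := bis_elim bH.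
have cf := map_cont (bis_mapt bF).
have nsH := @near_comp _ _ _ _ (fun y => src (H y) = y) cf (bis_srcs bH).
have tE y : src (H (tgt (F y))) = tgt (F y) -> tgt (bmul (Gam := gpd_of G) H F y) = tgt (H (tgt (F y))).
  by move=> e; rewrite /bmul /= tgt_mul.
have e0 := tE x (nbhs_singleton nsH).
apply: (@bis_intro _ _ (g \o h)).
- have := nearI nsH (bis_srcs bF); apply: filterS => y [e1 e2].
  by rewrite /bmul /= src_mul.
- have [c ac cx] := atlas_cover x; apply: (map_plot ac cx).
  apply: plot_mul => //.
  + exact: (near_chart cx (P := fun y => src (H (tgt (F y))) = tgt (F y)) nsH).
  + apply: (@plot_map _ _ _ _ H (fun w => tgt (F (cinv c w)))); first by rewrite cmapK //; exact: bis_map.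
    exact: (bis_mapt bF ac cx).
  + exact: (bis_map bF ac cx).
- rewrite e0; apply: map_comp => //; by rewrite hx.
- have := nearI nsH (nearI gf (@near_comp _ _ _ _ (fun y => h (tgt (H y)) = y) cf hf)).
  by apply: filterS => y [e1 [e2 e3]]; rewrite tE //= e3.
- rewrite e0; have ch := map_cont mh.
  have fg' : \forall y \near h (tgt (H (tgt (F x)))), tgt (F (g y)) = y by rewrite hx.
  have := nearI (@near_comp _ _ _ _ (fun y => tgt (F (g y)) = y) ch fg') (nearI fh
    (@near_comp _ _ h _ (fun y => src (H y) = y) ch _)).
  rewrite hx => /(_ (bis_srcs bH)); apply: filterS => y [e1 [e2 e3]] /=.
  by rewrite tE e1 // e3.
Qed.

(** [local_inv] is chosen among left inverses only. Near [tgt (F x)] it agrees with the smooth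
    inverse given by the bisection, from which it inherits smoothness and the other identity. *)
Lemma local_invP F x : bis x F ->
  let g := local_inv x (fun y => tgt (F y)) in
  [/\ mmap g (tgt (F x)), \forall y \near x, g (tgt (F y)) = y,
   \forall y \near tgt (F x), tgt (F (g y)) = y & g (tgt (F x)) = x].
Proof.
move=> bF g; have [g' [mg gf fg gx]] := bis_elim bF.
have ng : \forall y \near x, g (tgt (F y)) = y.
  pose S := [set g : I -> I | \forall y \near x, g (tgt (F y)) = y].
  exact: (@xgetPex (I -> I)%type id S (ex_intro S g' gf)).
have cg' : {for tgt (F x), continuous g'} by exact: map_cont.
have E : \forall y \near tgt (F x), g' y = g y.
  have n := @near_comp _ _ g' (tgt (F x)) (fun y => g (tgt (F y)) = y) cg'.
  rewrite gx in n; have := nearI fg (n ng); by apply: filterS => y [e1 e2]; rewrite -e2 e1.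
split=> //; last exact: nbhs_singleton ng.
  exact: map_ext E mg.
by have := nearI E fg; apply: filterS => y [<-].
Qed.

Lemma bis_inv F x : bis x F -> bis (tgt (F x)) (binv (Gam := gpd_of G) x F).
Proof.
move=> bF; have /= := local_invP bF; set g := local_inv _ _ => -[mg gf fg gx].
have gE : local_inv x (fun x' => gtgt (F x' : gpd_of G)) = g by [].
have cf := map_cont (bis_mapt bF).
have tE : tgt (binv (Gam := gpd_of G) x F (tgt (F x))) = x.
  by rewrite /binv /= -/g gx tgt_inv bis_src.
apply: (@bis_intro _ _ (fun y => tgt (F y))).
- by apply: filterS fg => y e; rewrite /binv /= -/g src_inv.
- apply: (@map_comp _ _ _ _ (fun y => F (g y)) (@inv R G)); last exact: inv_smooth.
  by apply: (@map_comp _ _ _ _ g F) => //; rewrite gx; exact: bis_map.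
- by rewrite tE; exact: bis_mapt.
- have n := @near_comp _ _ g (tgt (F x)) (fun y => src (F y) = y) (map_cont mg).
  rewrite gx in n; have := nearI fg (n (bis_srcs bF)).
  by apply: filterS => y [e1 e2]; rewrite /binv /= -/g tgt_inv e2 e1.
- rewrite tE; have := nearI gf (bis_srcs bF).
  by apply: filterS => y [e1 e2]; rewrite /binv /= -/g tgt_inv e1 e2.
Qed.

End Groupoid.

(** * Smooth families of bisections *)

Section Families.
Context {R : realType} (G : lie_groupoid R).
Local Notation I := (base G).
Local Notation n := (mdim I).
Local Notation m := (mdim (arrows G)).
Local Notation bis := (bisection_at (Gam := gpd_of G)).
Local Notation bmulG := (bmul (Gam := gpd_of G)).
Implicit Types (E : normedModType R) (F H : I -> arrows G) (x y : I).

Lemma sm_pairr E E' (z : E) (w : E') : sm (fun w' : E' => (z, w')) w.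
Proof. by apply: sm_pair; [exact: sm_cst|exact: sm_id]. Qed.

Lemma sm_pairl E E' (z : E) (w : E') : sm (fun z' : E => (z', w)) z.
Proof. by apply: sm_pair; [exact: sm_id|exact: sm_cst]. Qed.

Lemma near_slice E E' (z : E) (w : E') (P : E * E' -> Prop) :
  (\forall q \near (z, w), P q) -> \forall w' \near w, P (z, w').
Proof. exact: (near_comp (sm_cont (sm_pairr z w))). Qed.

Lemma near_slicel E E' (z : E) (w : E') (P : E * E' -> Prop) :
  (\forall q \near (z, w), P q) -> \forall z' \near z, P (z', w).
Proof. exact: (near_comp (sm_cont (sm_pairl z w))). Qed.

Lemma near_fst E E' (z : E) (w : E') (P : E -> Prop) :
  (\forall z' \near z, P z') -> \forall q \near (z, w), P q.1.
Proof. by apply: near_comp; exact: sm_cont (sm_fst (z, w)). Qed.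

Lemma near_snd E E' (z : E) (w : E') (P : E' -> Prop) :
  (\forall w' \near w, P w') -> \forall q \near (z, w), P q.2.
Proof. by apply: near_comp; exact: sm_cont (sm_snd (z, w)). Qed.

Lemma derive_partial E E' (W : normedModType R) (f : E * E' -> W) z w v :
  'D_v (fun w => f (z, w)) w = 'D_(0, v) f (z, w).
Proof.
apply: derive_affine => h.
by rewrite -[RHS]/(h *: (0 : E) + z, h *: v + w) scaler0 add0r.
Qed.

(* [Psi z] is then a bisection for all [z] near [z0]: see [family_bis]. *)
Definition family E (c : chart R I n) (z0 : E) x (Psi : E -> I -> arrows G) : Prop :=
  [/\ atlas c /\ cdom c x,
      plot (fun p : E * 'rV[R]_n => Psi p.1 (cinv c p.2)) (z0, cmap c x),
      \forall p \near (z0, cmap c x), src (Psi p.1 (cinv c p.2)) = cinv c p.2 &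
      bis x (Psi z0)].

Section FamilyInverse.
Variables (E : normedModType R) (fE : findim E) (c c' : chart R I n) (z0 : E) (x : I)
  (Psi : E -> I -> arrows G).
Hypotheses (fam : family c z0 x Psi) (ac' : atlas c') (cy : cdom c' (tgt (Psi z0 x))).
Local Notation y := (tgt (Psi z0 x)).

Lemma plot_family_tgt : plot (fun p : E * 'rV[R]_n => tgt (Psi p.1 (cinv c p.2))) (z0, cmap c x).
Proof.
have [[ac cx] pP _ _] := fam.
by apply: (@plot_map _ _ _ _ (@tgt R G) (fun p : E * 'rV[R]_n => Psi p.1 (cinv c p.2))) => //; exact: mmap_tgt.
Qed.

(** The implicit function theorem for the target map of [Psi z] in charts. Its partial differential
    at [z0] is invertible because [Psi z0] is a bisection: the differential of the inverse [h0] of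
    the target map inverts it. *)
Lemma family_coord_inverse : exists g : E * 'rV[R]_n -> 'rV[R]_n,
  [/\ sm g (z0, cmap c' y), g (z0, cmap c' y) = cmap c x,
   \forall p \near (z0, cmap c' y), cmap c' (tgt (Psi p.1 (cinv c (g p)))) = p.2 &
   \forall p \near (z0, cmap c x), g (p.1, cmap c' (tgt (Psi p.1 (cinv c p.2)))) = p.2].
Proof.
have [[ac cx] pP sP bP] := fam.
pose f (p : E * 'rV[R]_n) := cmap c' (tgt (Psi p.1 (cinv c p.2))).
have fx : f (z0, cmap c x) = cmap c' y by rewrite /f /= cmapK.
have [|nf sf] := plotE plot_family_tgt ac'; first by rewrite /= cmapK.
have [g0 [mg gf fg gx]] := bis_elim bP.
have pg : plot (g0 \o cinv c') (cmap c' y) by exact: mg.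
have [|ng sg] := plotE pg ac; first by rewrite /= cmapK // gx.
pose f0 w := f (z0, w); pose h0 := cmap c \o (g0 \o cinv c').
have sf0 : sm f0 (cmap c x).
  by apply: (@sm_comp _ _ _ _ f (fun w => (z0, w))) => //; exact: sm_pairr.
have h0f : \forall w \near cmap c x, h0 (f0 w) = id w.
  have := nearI (near_chart cx gf) (nearI (near_cimg cx) (near_slice nf)).
  by apply: filterS => w [e1 [/cinvK [_ e2] cw]]; rewrite /h0 /f0 /f /= cmapK // e1 e2.
have fh0 : \forall w \near cmap c' y, f0 (h0 w) = id w.
  have := nearI (near_chart cy fg) (nearI (near_cimg cy) ng).
  by apply: filterS => w [e1 [/cinvK [_ e2] cw]]; rewrite /h0 /f0 /f /= cmapK // e1 e2.
have h0x : h0 (cmap c' y) = cmap c x by rewrite /h0 /= cmapK // gx.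
have dh0 : differentiable h0 (cmap c' y) by exact: sm_diff.
have df0 : differentiable f0 (cmap c x) by exact: sm_diff.
have f0x : f0 (cmap c x) = cmap c' y by exact: fx.
have LD v : 'd h0 (cmap c' y) ('D_(0, v) f (z0, cmap c x)) = v.
  rewrite -derive_partial -/f0 -deriveE // -f0x -(@derive_comp _ _ _ _ f0 h0) ?f0x //.
  by rewrite (near_eq_derive _ h0f) derive_id.
have Linj : injective ('d h0 (cmap c' y)).
  move=> u u'; rewrite -!deriveE // => e.
  have H v : v = 'D_('D_v h0 (cmap c' y)) f0 (cmap c x).
    rewrite -h0x -(@derive_comp _ _ _ _ h0 f0) ?h0x //.
    by rewrite (near_eq_derive _ fh0) derive_id.
  by rewrite (H u) (H u') e.
have [g [sg' g0x fgn gfn]] := implicit fE sf LD Linj.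
by exists g; rewrite -fx.
Qed.

(** The inverse target map [g] stays visible in the statement because [family_bis] and
    [family_inverse_sided] work with it. *)
Lemma family_inverse : exists Phi : E -> I -> arrows G,
  (exists2 g : E * 'rV[R]_n -> 'rV[R]_n,
     [/\ sm g (z0, cmap c' y), g (z0, cmap c' y) = cmap c x,
        \forall p \near (z0, cmap c' y), cmap c' (tgt (Psi p.1 (cinv c (g p)))) = p.2,
        \forall p \near (z0, cmap c x), g (p.1, cmap c' (tgt (Psi p.1 (cinv c p.2)))) = p.2 &
        \forall p \near (z0, cmap c x), cdom c' (tgt (Psi p.1 (cinv c p.2)))] &
     forall z y', Phi z y' = inv (Psi z (cinv c (g (z, cmap c' y'))))) /\
  [/\ family c' z0 y Phi &
      \forall p \near (z0, cmap c x), Phi p.1 (tgt (Psi p.1 (cinv c p.2))) = inv (Psi p.1 (cinv c p.2))].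
Proof.
have [g [sg gx fg gf]] := family_coord_inverse.
have [[ac cx] pP sP bP] := fam.
have [|nc' _] := plotE plot_family_tgt ac'; first by rewrite /= cmapK.
exists (fun z y' => inv (Psi z (cinv c (g (z, cmap c' y'))))); split; first by exists g.
have sG : sm (fun p : E * 'rV[R]_n => (p.1, g p)) (z0, cmap c' y).
  by apply: sm_pair => //; exact: sm_fst.
have ncy : \forall p \near (z0, cmap c' y), (cmap c' @` cdom c') p.2 by apply: near_snd; exact: near_cimg.
have nG (P : E * 'rV[R]_n -> Prop) : (\forall p \near (z0, cmap c x), P p) ->
    \forall p \near (z0, cmap c' y), P (p.1, g p).
  by move=> nP; apply: (near_comp (sm_cont sG)); rewrite /= gx.
split; last by apply: filterS gf => p /= ->.
split=> //.
- apply: (@plot_ext _ _ _ (fun p : E * 'rV[R]_n => inv (Psi p.1 (cinv c (g p))))).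
    by apply: filterS ncy => -[z w] /cinvK [_ e] /=; rewrite e.
  apply: (@plot_map _ _ _ _ (@inv R G)); first exact: inv_smooth.
  apply: (@plot_comp _ _ _ _ (fun p : E * 'rV[R]_n => Psi p.1 (cinv c p.2)) (fun p => (p.1, g p))) => //.
  by rewrite /= gx.
- have := nearI ncy (nearI fg (nG _ nc')).
  apply: filterS => -[z w] /= [/cinvK [_ e] [e1 e2]]; rewrite e src_inv.
  by rewrite -(cmapK e2) e1.
- apply: (bis_ext _ (bis_inv bP)); rewrite /binv /=.
  have [mg gfx fgx gy] := local_invP bP; set g' := local_inv _ _ in mg gfx fgx gy *.
  have cg' : {for y, continuous g'} by exact: map_cont.
  have n1 := near_comp cg' (P := fun u => cmap c' (tgt (Psi z0 u)) = cmap c' (tgt (Psi z0 u)) -> cdom c u /\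
     g (z0, cmap c' (tgt (Psi z0 u))) = cmap c u).
  rewrite gy in n1.
  have H : \forall u \near x, cmap c' (tgt (Psi z0 u)) = cmap c' (tgt (Psi z0 u)) -> cdom c u /\
     g (z0, cmap c' (tgt (Psi z0 u))) = cmap c u.
    apply: (chart_near cx); have := nearI (near_cimg cx) (near_slice gf).
    by apply: filterS => w [/cinvK [cw e] e1] _; rewrite e e1.
  have := nearI fgx (n1 H); apply: filterS => u [e1] /(_ erefl) [cu].
  by rewrite e1 => ->; rewrite cmapK.
Qed.

(** For z near z0 the target map of [Psi z] is inverted by [g (z, .)]. The hypotheses of [bis_intro]
    are germs at the varying point, so each identity is first spread to neighbourhoods of all nearby
    points. *)
Lemma family_bis : \forall p \near (z0, cmap c x), bis (cinv c p.2) (Psi p.1).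
Proof.
have [Phi [[g [sg gx fg gf nc'] _] _]] := family_inverse.
have [[ac cx] pP sP bP] := fam.
pose f (p : E * 'rV[R]_n) := (p.1, cmap c' (tgt (Psi p.1 (cinv c p.2)))).
have [|_ sf'] := plotE plot_family_tgt ac'; first by rewrite /= cmapK.
have sf : sm f (z0, cmap c x) by apply: sm_pair => //; exact: sm_fst.
have fx : f (z0, cmap c x) = (z0, cmap c' y) by rewrite /f /= cmapK.
have nf (P : E * 'rV[R]_n -> Prop) : (\forall p \near (z0, cmap c' y), P p) ->
    \forall p \near (z0, cmap c x), P (f p).
  by move=> nP; apply: (near_comp (sm_cont sf)); rewrite fx.
have nimg : \forall p \near (z0, cmap c x), (cmap c @` cdom c) p.2 by apply: near_snd; exact: near_cimg.
have sG : sm (fun p : E * 'rV[R]_n => (p.1, g p)) (z0, cmap c' y).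
  by apply: sm_pair => //; exact: sm_fst.
have nG (P : E * 'rV[R]_n -> Prop) : (\forall p \near (z0, cmap c x), P p) ->
    \forall p \near (z0, cmap c' y), P (p.1, g p).
  by move=> nP; apply: (near_comp (sm_cont sG)); rewrite /= gx.
have N1 := near_near (nearI nimg (nearI sP (nearI gf nc'))).
have N2 := nf _ (near_near (nearI fg (nG _ nc'))).
have N3 := nf _ (sm_near sg).
have := nearI N1 (nearI N2 (nearI N3 (plot_near pP))).
apply: filterS => -[z w] /= [M1 [M2 [M3 pz]]].
have [/= /cinvK [cw we] [sw [gw cw']]] := nbhs_singleton M1.
have mPsi : mmap (Psi z) (cinv c w).
  apply: (map_plot ac cw); rewrite we.
  by apply: (@plot_comp _ _ _ _ (fun p : E * 'rV[R]_n => Psi p.1 (cinv c p.2)) (fun w => (z, w))) => //;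
    exact: sm_pairr.
apply: (@bis_intro _ _ _ _ (fun y' => cinv c (g (z, cmap c' y')))) => //.
- apply: (chart_near cw); rewrite we; have := near_slice M1.
  by apply: filterS => w' [_ []].
- apply: (map_plot ac' cw').
  apply: (@plot_ext _ _ _ (fun w' => cinv c (g (z, w')))).
    by apply: filterS (near_cimg cw') => w' /cinvK [_ e]; rewrite /= e.
  apply: (@plot_comp _ _ _ _ (cinv c) (fun w' => g (z, w'))) => //.
    by apply: (@sm_comp _ _ _ _ g (fun w => (z, w))) => //; exact: sm_pairr.
  by apply: plot_chart_near => //; rewrite gw; exists (cinv c w).
- apply: (chart_near cw); rewrite we; have := near_slice M1.
  by apply: filterS => w' [_ [_ [/= -> _]]].
- apply: (chart_near cw').
  have := nearI (near_cimg cw') (near_slice M2).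
  apply: filterS => w' [/cinvK [cw2 e] [/= e1 e2]].
  by rewrite e -[RHS](cmapK cw2) e -{2}e1 cmapK.
Qed.

End FamilyInverse.

Lemma family_param E E' (B : E' -> E) c z0 x Psi : findim E -> findim E' -> sm B z0 ->
  family c (B z0) x Psi -> family c z0 x (fun z => Psi (B z)).
Proof.
move=> fE fE' sB [acx pP sP bP].
have sB2 : sm (fun p : E' * 'rV[R]_n => (B p.1, p.2)) (z0, cmap c x).
  apply: sm_pair; last exact: sm_snd.
  by apply: (@sm_comp _ _ _ _ B fst) => //; exact: sm_fst.
split=> //.
- exact: (@plot_comp _ _ _ _ (fun p : E * 'rV[R]_n => Psi p.1 (cinv c p.2)) (fun p => (B p.1, p.2))).
- exact: (near_comp (sm_cont sB2) sP).
Qed.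

Lemma family_const E c (z0 : E) x F : atlas c -> cdom c x -> bis x F -> family c z0 x (fun _ => F).
Proof.
move=> ac cx bF; split => //.
- apply: (@plot_comp _ _ _ _ (fun w => F (cinv c w)) snd) => //; first exact: sm_snd.
  exact: (bis_map bF ac cx).
- exact: (near_snd _ (near_chart cx (bis_srcs bF))).
Qed.

Lemma family_chart E c c1 (z0 : E) x Psi : findim E -> atlas c1 -> cdom c1 x ->
  family c z0 x Psi -> family c1 z0 x Psi.
Proof.
move=> fE ac1 c1x [[ac cx] pP sP bP].
have sT : sm (fun p : E * 'rV[R]_n => (p.1, (cmap c \o cinv c1) p.2)) (z0, cmap c1 x).
  apply: sm_pair; first exact: sm_fst.
  by apply: (@sm_comp _ _ _ _ (cmap c \o cinv c1) snd) => //; [exact: sm_snd|exact: sm_transition].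
have e0 : (z0, (cmap c \o cinv c1) (cmap c1 x)) = (z0, cmap c x) by rewrite /= cmapK.
have nc := near_snd z0 (near_chart c1x (near_cdom cx)).
split=> //.
- apply: (@plot_ext _ _ _ (fun p : E * 'rV[R]_n => Psi p.1 (cinv c ((cmap c \o cinv c1) p.2)))).
    by apply: filterS nc => p cp /=; rewrite cmapK.
  apply: (@plot_comp _ _ _ _ (fun p : E * 'rV[R]_n => Psi p.1 (cinv c p.2)) (fun p => (p.1, (cmap c \o cinv c1) p.2))) => //.
  by rewrite /= cmapK.
- have := near_comp (sm_cont sT) (P := fun p => src (Psi p.1 (cinv c p.2)) = cinv c p.2).
  rewrite e0 => /(_ sP) H; have := nearI nc H.
  by apply: filterS => p [cp] /=; rewrite cmapK.
Qed.

Lemma family_mul E c c' (z0 : E) x Psi Phi : findim E -> family c z0 x Psi ->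
  family c' z0 (tgt (Psi z0 x)) Phi -> family c z0 x (fun z => bmulG (Phi z) (Psi z)).
Proof.
move=> fE fP [[ac' cy] pF sF bF]; have [[ac cx] pP sP bP] := fP.
have [|nc' st] := plotE (plot_family_tgt fP) ac'; first by rewrite /= cmapK.
have sT : sm (fun p : E * 'rV[R]_n => (p.1, cmap c' (tgt (Psi p.1 (cinv c p.2))))) (z0, cmap c x).
  by apply: sm_pair => //; exact: sm_fst.
have nsF := near_comp (sm_cont sT) (P := fun p => src (Phi p.1 (cinv c' p.2)) = cinv c' p.2).
rewrite /= cmapK // in nsF; have {}nsF := nsF sF.
have sFt : \forall p \near (z0, cmap c x), src (Phi p.1 (tgt (Psi p.1 (cinv c p.2)))) = tgt (Psi p.1 (cinv c p.2)).
  by have := nearI nc' nsF; apply: filterS => p [cp] /=; rewrite cmapK.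
split=> //.
- apply: plot_mul => //.
  apply: (@plot_ext _ _ _ (fun p : E * 'rV[R]_n => Phi p.1 (cinv c' (cmap c' (tgt (Psi p.1 (cinv c p.2))))))).
    by apply: filterS nc' => p cp; rewrite cmapK.
  apply: (@plot_comp _ _ _ _ (fun p : E * 'rV[R]_n => Phi p.1 (cinv c' p.2)) (fun p => (p.1, cmap c' (tgt (Psi p.1 (cinv c p.2)))))) => //.
  by rewrite /= cmapK.
- have := nearI sFt sP; apply: filterS => p [e1 e2].
  by rewrite /bmul /= src_mul.
- exact: bis_mul.
Qed.

Lemma derive_comp_affine (E V W : normedModType R) (f : V -> W) (L : {linear E -> V}) (v : V) (p w : E) :
  'D_w (fun u : E => f (v + L u)) p = 'D_(L w) f (v + L p).
Proof.
apply: derive_affine => h.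
by rewrite linearD linearZ addrCA.
Qed.

(* [rho (w, q)] moves the point [q] of the chart [d] into the source fibre of [w],
   and fixes the points already in that fibre. *)
Lemma retraction F x (c : chart R I n) (d : chart R (arrows G) m) :
  atlas c -> atlas d -> cdom c x -> cdom d (F x) -> bis x F ->
  exists rho : 'rV[R]_n * 'rV[R]_m -> 'rV[R]_m,
  [/\ sm rho (cmap c x, cmap d (F x)), rho (cmap c x, cmap d (F x)) = cmap d (F x),
   \forall p \near (cmap c x, cmap d (F x)), src (cinv d (rho p)) = cinv c p.1 &
   \forall q \near cmap d (F x), cdom c (src (cinv d q)) /\ rho (cmap c (src (cinv d q)), q) = q].
Proof.
move=> ac ad cx dx bF.
have pF : plot (F \o cinv c) (cmap c x) by exact: (bis_map bF).
have [|nF sF] := plotE pF ad; first by rewrite /= cmapK.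
set Fh := cmap d \o (F \o cinv c) in sF.
have Fhx : Fh (cmap c x) = cmap d (F x) by rewrite /Fh /= cmapK.
have pS : plot (@src R G \o cinv d) (cmap d (F x)) by exact: (@mmap_src _ _ (F x) _ ad dx).
have [|nS sS] := plotE pS ac; first by rewrite /= cmapK // bis_src.
set Sh := cmap c \o (@src R G \o cinv d) in sS.
have dF : differentiable Fh (cmap c x) by exact: sm_diff.
pose L := 'd Fh (cmap c x); have cL : continuous L by exact: diff_continuous.
(* The point q is displaced by L v, tangent to the image of [F]. As the source of [F] is the
   identity, [implicit_id] finds the v for which the displaced point has source w; it is 0 if q has
   that source already. *)
pose T (p : 'rV[R]_m * 'rV[R]_n) := p.1 + L p.2.
have sT p : sm T p by apply: smD; [exact: sm_fst|apply: sm_linear => //; exact: sm_snd].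
pose f p := Sh (T p); set q0 := cmap d (F x).
have T0 : T (q0, 0) = q0 by rewrite /T /= linear0 addr0.
have sf : sm f (q0, 0) by apply: sm_comp => //; rewrite T0.
have Sx : Sh q0 = cmap c x by rewrite /Sh /q0 /= cmapK // bis_src.
have SF : \forall w \near cmap c x, Sh (Fh w) = id w.
  have := nearI (near_cimg cx) (nearI nF (near_chart cx (bis_srcs bF))).
  by apply: filterS => w [/cinvK [_ e] [dw sw]]; rewrite /Sh /Fh /= cmapK // sw e.
have Df v : 'D_(0, v) f (q0, 0) = v.
  rewrite -derive_partial (@derive_comp_affine _ _ _ Sh L) // ?linear0 ?addr0 //.
  rewrite /L -deriveE // -[q0]Fhx -(@derive_comp _ _ _ _ Fh Sh) //; last by apply: sm_diff; rewrite Fhx.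
  by rewrite (near_eq_derive _ SF) derive_id.
have [g [sg g0 fg gf]] := implicit_id (findim_mx _ _) sf Df.
have f0 : f (q0, 0) = cmap c x by rewrite /f T0.
rewrite f0 in sg g0 fg.
pose sw (p : 'rV[R]_n * 'rV[R]_m) := (p.2, p.1).
have ssw p : sm sw p by apply: sm_pair; [exact: sm_snd|exact: sm_fst].
pose rho p := T (p.2, g (sw p)).
have srho : sm rho (cmap c x, q0).
  apply: sm_comp => //; apply: sm_pair; first exact: sm_snd.
  by apply: (@sm_comp _ _ _ _ g sw).
have rho0 : rho (cmap c x, q0) = q0 by rewrite /rho /sw /= g0.
exists rho; split => //.
- have n1 := near_comp (sm_cont (ssw (cmap c x, q0))) fg.
  have n2 : \forall p \near (cmap c x, q0), cdom c (src (cinv d (rho p))).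
    apply: (near_comp (P := fun q => cdom c (src (cinv d q))) (sm_cont srho)).
    by rewrite rho0.
  have := nearI n1 (nearI n2 (near_fst _ (near_cimg cx))).
  apply: filterS => -[w q] /= [e1 [e2 /cinvK [e3 e4]]].
  by rewrite -(cmapK e2); congr (cinv c _); exact: e1.
- have n1 : \forall q \near q0, g (q, f (q, 0)) = 0 := near_slicel gf.
  have := nearI nS n1; apply: filterS => q [e1 e2]; split=> //.
  have -> : cmap c (src (cinv d q)) = f (q, 0) by rewrite /f /T /= linear0 addr0.
  by rewrite /rho /sw /= e2 /T /= linear0 addr0.
Qed.

(* Multiplication extends smoothly, in charts, to non-composable pairs. *)
Lemma mul_extension H y (X : arrows G) (d1 d2 d3 : chart R (arrows G) m) :
  bis y H -> tgt X = y -> atlas d1 -> atlas d2 -> atlas d3 ->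
  cdom d1 (H y) -> cdom d2 X -> cdom d3 (mul (H y) X) ->
  exists mt : 'rV[R]_m * 'rV[R]_m -> 'rV[R]_m, sm mt (cmap d1 (H y), cmap d2 X) /\
    \forall p \near (cmap d1 (H y), cmap d2 X), src (cinv d1 p.1) = tgt (cinv d2 p.2) ->
      cdom d3 (mul (cinv d1 p.1) (cinv d2 p.2)) /\
      mt p = cmap d3 (mul (cinv d1 p.1) (cinv d2 p.2)).
Proof.
move=> bH tX ad1 ad2 ad3 d1H d2X d3HX.
have [c ac cy] := atlas_cover y.
have [rho [srho rho0 srcrho rhoK]] := retraction ac ad1 cy d1H bH.
have pt : plot (@tgt R G \o cinv d2) (cmap d2 X) by exact: (@mmap_tgt _ _ X _ ad2 d2X).
have [|nt st] := plotE pt ac; first by rewrite /= cmapK // tX.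
pose p0 := (cmap d1 (H y), cmap d2 X).
pose B (p : 'rV[R]_m * 'rV[R]_m) := (cmap c (tgt (cinv d2 p.2)), p.1).
have sB : sm B p0.
  apply: sm_pair; last exact: sm_fst.
  apply: (@sm_comp _ _ _ _ (cmap c \o (@tgt R G \o cinv d2)) snd) => //; exact: sm_snd.
have B0 : B p0 = (cmap c y, cmap d1 (H y)) by rewrite /B /p0 /= cmapK // tX.
(* The left factor is first moved into the source fibre over the target of the right factor; this
   makes the pair composable, and changes nothing if it was. *)
pose a p := cinv d1 (rho (B p)); pose b (p : 'rV[R]_m * 'rV[R]_m) := cinv d2 p.2.
have rB0 : rho (B p0) = cmap d1 (H y) by rewrite B0.
have pa : plot a p0.
  apply: (@plot_comp _ _ _ _ (cinv d1) (fun p => rho (B p))) => //.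
    by apply: sm_comp => //; rewrite B0.
  by rewrite rB0; exact: plot_chart.
have pb : plot b p0.
  apply: (@plot_comp _ _ _ _ (cinv d2) snd) => //; [exact: sm_snd|exact: plot_chart].
have nt' : \forall p \near p0, cdom c (tgt (cinv d2 p.2)) := near_snd _ nt.
have ab : \forall p \near p0, src (a p) = tgt (b p).
  have n1 := near_comp (sm_cont sB) (P := fun p => src (cinv d1 (rho p)) = cinv c p.1).
  rewrite B0 in n1; have := nearI nt' (n1 srcrho).
  by apply: filterS => p [e1 e2]; rewrite /a e2 /= cmapK.
have pm : plot (fun p => mul (a p) (b p)) p0 by apply: plot_mul.
have ab0 : mul (a p0) (b p0) = mul (H y) X by rewrite /a /b rB0 /= !cmapK.
have [|nm smt] := plotE pm ad3; first by rewrite ab0.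
exists (fun p => cmap d3 (mul (a p) (b p))); split => //.
have := nearI nm (near_fst _ rhoK).
apply: filterS => -[q r] /= [dm [cq rq]] e.
suff -> : cinv d1 q = a (q, r) by [].
by rewrite /a /B /= -e rq.
Qed.

End Families.

(** * Jets of maps and of bisections *)

Section MapJets.
Context {R : realType}.
Implicit Types (M N K : manifold R).

(** [jet_eq] between arbitrary manifolds, since the maps that bisections induce on the base, and
    their inverses, have to be compared too. *)
Definition meq k M N (p : M) (f f' : M -> N) : Prop :=
  f p = f' p /\
  forall (c : chart R M (mdim M)) (d : chart R N (mdim N)), atlas c -> atlas d -> cdom c p -> cdom d (f p) ->
    agree k (cmap d \o f \o cinv c) (cmap d \o f' \o cinv c) (cmap c p).

Lemma sm_map M N (f : M -> N) p (c : chart R M (mdim M)) (d : chart R N (mdim N)) : mmap f p ->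
  atlas c -> atlas d -> cdom c p -> cdom d (f p) ->
  sm (cmap d \o f \o cinv c) (cmap c p) /\ \forall w \near cmap c p, cdom d (f (cinv c w)).
Proof.
move=> mf ac ad cp df; have pf : plot (f \o cinv c) (cmap c p) by exact: mf.
by have [|? ?] := plotE pf ad; first by rewrite /= cmapK.
Qed.

(** One pair of charts is enough: other pairs differ by transition maps, which preserve agreement to
    order [k]. *)
Lemma meqI k M N (p : M) (f f' : M -> N) (c : chart R M (mdim M)) (d : chart R N (mdim N)) :
  mmap f p -> mmap f' p -> atlas c -> atlas d -> cdom c p -> cdom d (f p) -> f p = f' p ->
  agree k (cmap d \o f \o cinv c) (cmap d \o f' \o cinv c) (cmap c p) -> meq k p f f'.
Proof.
move=> mf mf' ac ad cp df ff aff; split=> // c1 d1 ac1 ad1 c1p d1f.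
have [sf nf] := sm_map mf ac ad cp df.
have [|sf' nf'] := sm_map mf' ac ad cp; first by rewrite -ff.
have sT := sm_transition ac1 ac c1p cp.
have ncp := near_chart c1p (near_cdom cp).
have H (h : M -> N) : (\forall w \near cmap c p, cdom d (h (cinv c w))) ->
   \forall w \near cmap c1 p, (cmap d1 \o cinv d) ((cmap d \o h \o cinv c) ((cmap c \o cinv c1) w)) =
     (cmap d1 \o h \o cinv c1) w.
  move=> nh; have := nearI ncp (near_comp (sm_cont sT) (P := fun w => cdom d (h (cinv c w))) _).
  rewrite /= cmapK // => /(_ nh); apply: filterS => w [cw]; rewrite cmapK // => dw.
  by rewrite !cmapK.
have cpE : (cmap c \o cinv c1) (cmap c1 p) = cmap c p by rewrite /= cmapK.
have dfE : (cmap d \o f \o cinv c) (cmap c p) = cmap d (f p) by rewrite /= cmapK.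
apply: (agree_near_ext (H f nf) (H f' nf')).
have s1 : sm (fun w => (cmap d \o f \o cinv c) ((cmap c \o cinv c1) w)) (cmap c1 p).
  by apply: (@sm_comp _ _ _ _ (cmap d \o f \o cinv c) (cmap c \o cinv c1)) => //; rewrite cpE.
have s2 : sm (fun w => (cmap d \o f' \o cinv c) ((cmap c \o cinv c1) w)) (cmap c1 p).
  by apply: (@sm_comp _ _ _ _ (cmap d \o f' \o cinv c) (cmap c \o cinv c1)) => //; rewrite cpE.
have s3 : sm (cmap d1 \o cinv d) ((cmap d \o f \o cinv c) ((cmap c \o cinv c1) (cmap c1 p))).
  by rewrite cpE dfE; exact: sm_transition.
apply: (@agree_comp _ _ _ _ _ _ _ (cmap d1 \o cinv d) (cmap d1 \o cinv d)) => //.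
by apply: (@agree_comp _ _ _ _ _ (cmap c \o cinv c1) (cmap c \o cinv c1)) => //; rewrite cpE.
Qed.

Lemma meq_near k M N (p : M) (f f' : M -> N) : (\forall q \near p, f q = f' q) -> meq k p f f'.
Proof.
move=> ff; split; first exact: nbhs_singleton ff.
move=> c d ac ad cp df; apply: agree_near; have := near_chart cp ff.
by apply: filterS => w /= ->.
Qed.

Lemma meq_refl k M N (p : M) (f : M -> N) : meq k p f f.
Proof. by split. Qed.

Lemma meq_sym k M N (p : M) (f f' : M -> N) : meq k p f f' -> meq k p f' f.
Proof.
move=> [ff H]; split=> // c d ac ad cp df; apply: agree_sym; apply: H => //; by rewrite ff.
Qed.

Lemma meq_trans k M N (p : M) (f g h : M -> N) : meq k p f g -> meq k p g h -> meq k p f h.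
Proof.
move=> [fg H] [gh H']; split; first by rewrite fg.
move=> c d ac ad cp df; apply: agree_trans (H c d ac ad cp df) _.
by apply: H' => //; rewrite -fg.
Qed.

Lemma meqW k l M N (p : M) (f f' : M -> N) : (k <= l)%N -> meq l p f f' -> meq k p f f'.
Proof. by move=> kl [ff H]; split=> // c d ac ad cp df; apply: agreeW kl (H c d ac ad cp df). Qed.

Lemma meq_comp k M N K (p : M) (f f' : M -> N) (g g' : N -> K) :
  mmap f p -> mmap f' p -> mmap g (f p) -> mmap g' (f p) -> meq k p f f' -> meq k (f p) g g' ->
  meq k p (g \o f) (g' \o f').
Proof.
move=> mf mf' mg mg' [ff aff] [gg agg].
have [c ac cp] := atlas_cover p; have [d ad df] := atlas_cover (f p).
have [e ae eg] := atlas_cover (g (f p)).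
have [sf nf] := sm_map mf ac ad cp df.
have [|sf' nf'] := sm_map mf' ac ad cp; first by rewrite -ff.
have [sg ng] := sm_map mg ad ae df eg.
have [|sg' ng'] := sm_map mg' ad ae df; first by rewrite -gg.
have H (h : M -> N) (h2 : N -> K) : (\forall w \near cmap c p, cdom d (h (cinv c w))) ->
   \forall w \near cmap c p, (cmap e \o h2 \o cinv d) ((cmap d \o h \o cinv c) w) =
     (cmap e \o (h2 \o h) \o cinv c) w.
  by apply: filterS => w dw; rewrite /= cmapK.
have dfE : (cmap d \o f \o cinv c) (cmap c p) = cmap d (f p) by rewrite /= cmapK.
have mgf' : mmap (g' \o f') p by apply: map_comp => //; rewrite -ff.
apply: (meqI (c := c) (d := e)) => //; first exact: map_comp.
  by rewrite /= -ff gg.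
apply: (agree_near_ext (H f g nf) (H f' g' nf')).
apply: (@agree_comp _ _ _ _ _ (cmap d \o f \o cinv c) (cmap d \o f' \o cinv c)
   (cmap e \o g \o cinv d) (cmap e \o g' \o cinv d)) => //.
- by rewrite dfE.
- by rewrite dfE.
- exact: aff.
- by rewrite dfE; exact: agg.
Qed.

End MapJets.

(** * Jets of bisections, their products and inverses *)

Section Jets.
Context {R : realType} (G : lie_groupoid R).
Local Notation I := (base G).
Local Notation n := (mdim I).
Local Notation m := (mdim (arrows G)).
Local Notation bis := (bisection_at (Gam := gpd_of G)).
Local Notation bmulG := (bmul (Gam := gpd_of G)).
Local Notation binvG := (binv (Gam := gpd_of G)).
Implicit Types (k l : nat) (F H : I -> arrows G) (x y : I).

Lemma jet_eqE k x F F' : jet_eq k x F F' <-> meq k x F F'.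
Proof. by split=> -[e H]. Qed.

Lemma jrep_bis k x F : bis x F -> bis x (jrep (jet k x F)).
Proof.
move=> bF; pose S := [set F' | bis x F' /\ jet_eq k x F F'].
by have [] := @xgetPex (I -> arrows G)%type (@unit_ R G) S (ex_intro S F (conj bF ((jet_eqE k x F F).2 (meq_refl k x F)))).
Qed.

Lemma jrep_meq k x F : bis x F -> meq k x F (jrep (jet k x F)).
Proof.
move=> bF; pose S := [set F' | bis x F' /\ jet_eq k x F F'].
by have [_ /jet_eqE] := @xgetPex (I -> arrows G)%type (@unit_ R G) S (ex_intro S F (conj bF ((jet_eqE k x F F).2 (meq_refl k x F)))).
Qed.

Lemma jet_meq k x F F' : meq k x F F' -> jet k x F = jet k x F'.
Proof.
move=> FF; congr pair; apply/seteqP; split=> K [bK /jet_eqE FK]; split=> //; apply/jet_eqE.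
  exact: meq_trans (meq_sym FF) FK.
exact: meq_trans FF FK.
Qed.

Lemma jet_near k x F F' : (\forall y \near x, F y = F' y) -> jet k x F = jet k x F'.
Proof. by move=> FF; apply: jet_meq; exact: meq_near. Qed.

Lemma jval_jet k x F : bis x F -> jval (jet k x F) = F x.
Proof. by move=> /(jrep_meq k) [e _]; rewrite /jval e. Qed.

Lemma jproj_jet k l x F : (k <= l)%N -> bis x F -> jproj k (jet l x F) = jet k x F.
Proof.
by move=> kl bF; rewrite /jproj /=; apply/esym/jet_meq; apply: meqW kl _; exact: jrep_meq.
Qed.

Lemma is_jet_jet k x F : bis x F -> is_jet k (jet k x F).
Proof. by move=> bF; exists F. Qed.

Lemma jet_jrep k (X : jets G) : is_jet k X -> [/\ bis X.1 (jrep X) & X = jet k X.1 (jrep X)].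
Proof.
case: X => x S [F /= bF ->]; split; first exact: jrep_bis.
by apply: jet_meq; exact: jrep_meq.
Qed.

Lemma bis_meq_tgt k x F F' : bis x F -> bis x F' -> meq k x F F' ->
  meq k x (fun y => tgt (F y)) (fun y => tgt (F' y)).
Proof.
move=> bF bF' FF; apply: (@meq_comp _ _ _ _ _ _ F F' (@tgt R G) (@tgt R G)) => //.
- exact: bis_map.
- exact: bis_map.
- exact: mmap_tgt.
- exact: mmap_tgt.
Qed.

(** In charts, thanks to [mul_extension], both products are composites of the same smooth function
    [mt] with the coordinates of the factors. *)
Lemma meq_bmul k x F F' H H' : bis x F -> bis x F' -> bis (tgt (F x)) H -> bis (tgt (F x)) H' ->
  meq k x F F' -> meq k (tgt (F x)) H H' -> meq k x (bmulG H F) (bmulG H' F').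
Proof.
move=> bF bF' bH bH' FF HH.
have FFx := FF.1; have HHx := HH.1.
have bH2 : bis (tgt (F' x)) H' by rewrite -FFx.
have mHF : meq k x (H \o (fun y => tgt (F y))) (H' \o (fun y => tgt (F' y))).
  apply: (@meq_comp _ _ _ _ _ _ (fun y => tgt (F y)) (fun y => tgt (F' y))) => //.
  - exact: bis_mapt.
  - exact: bis_mapt.
  - exact: bis_map.
  - exact: bis_map.
  - exact: (bis_meq_tgt bF bF' FF).
have [c ac cx] := atlas_cover x; have [d1 ad1 d1H] := atlas_cover (H (tgt (F x))).
have [d2 ad2 d2F] := atlas_cover (F x); have [d3 ad3 d3M] := atlas_cover (mul (H (tgt (F x))) (F x)).
have [mt [smt mtE]] := mul_extension bH (erefl (tgt (F x))) ad1 ad2 ad3 d1H d2F d3M.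
have key F0 H0 : bis x F0 -> bis (tgt (F0 x)) H0 -> F0 x = F x -> H0 (tgt (F x)) = H (tgt (F x)) ->
   let a := cmap d1 \o (H0 \o (fun y => tgt (F0 y))) \o cinv c in
   let b := cmap d2 \o F0 \o cinv c in
   [/\ sm a (cmap c x), sm b (cmap c x), (a (cmap c x), b (cmap c x)) = (cmap d1 (H (tgt (F x))), cmap d2 (F x)) &
   \forall w \near cmap c x, mt (a w, b w) = (cmap d3 \o bmulG H0 F0 \o cinv c) w].
  move=> bF0 bH0 F0x H0x a b.
  have mH0 : mmap (H0 \o (fun y => tgt (F0 y))) x.
    by apply: map_comp; [exact: bis_mapt|exact: bis_map].
  have [|sa na] := sm_map mH0 ac ad1 cx; first by rewrite /= F0x H0x.
  have [|sb nb] := sm_map (bis_map bF0) ac ad2 cx; first by rewrite F0x.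
  have ab0 : (a (cmap c x), b (cmap c x)) = (cmap d1 (H (tgt (F x))), cmap d2 (F x)).
    by rewrite /a /b /= cmapK // F0x H0x.
  split=> //.
  have sab : sm (fun w => (a w, b w)) (cmap c x) by exact: sm_pair.
  have n1 := near_comp (sm_cont sab) (P := fun p => src (cinv d1 p.1) = tgt (cinv d2 p.2) ->
      cdom d3 (mul (cinv d1 p.1) (cinv d2 p.2)) /\ mt p = cmap d3 (mul (cinv d1 p.1) (cinv d2 p.2))).
  rewrite ab0 in n1; have {}n1 := n1 mtE.
  have n2 := near_comp (map_cont (bis_mapt bF0)) (P := fun y => src (H0 y) = y) (bis_srcs bH0).
  have := nearI na (nearI nb (nearI n1 (near_chart cx n2))).
  apply: filterS => w [/= dw1 [dw2 [e1 e2]]]; rewrite /a /b /= in e1 *.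
  rewrite (cmapK dw1) (cmapK dw2) in e1; by have [_ ->] := e1 e2.
have [sa sb ab0 abn] := key F H bF bH erefl erefl.
have [sa' sb' ab0' abn'] := key F' H' bF' bH2 (esym FFx) (esym HHx).
apply: (meqI (c := c) (d := d3)) => //.
- by apply: bis_map; exact: bis_mul.
- by apply: bis_map; exact: bis_mul.
- by rewrite /bmul /= -FFx HHx.
apply: (agree_near_ext abn abn').
apply: (@agree_comp _ _ _ _ _ _ _ mt mt) => //.
- exact: sm_pair.
- exact: sm_pair.
- by rewrite ab0.
- by rewrite ab0.
- apply: agree_pair => //; first exact: (mHF.2 c d1).
  exact: (FF.2 c d2).
Qed.

(** Let g and g' invert the base maps f and f' of F and F'. Then g = g o f' o g', which has the
    k-jet of g o f o g' = g'. *)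
Lemma meq_binv k x F F' : bis x F -> bis x F' -> meq k x F F' ->
  meq k (tgt (F x)) (binvG x F) (binvG x F').
Proof.
move=> bF bF' FF; have FFx := FF.1.
have := local_invP bF; have := local_invP bF'; rewrite -FFx.
set g' := local_inv _ _; set g := local_inv _ _ => -[mg' gf' fg' gx'] [mg gf fg gx].
have mf := bis_mapt bF; have mf' := bis_mapt bF'.
have mfx : mmap (fun y => tgt (F y)) (g' (tgt (F x))) by rewrite gx'.
have mfx' : mmap (fun y => tgt (F' y)) (g' (tgt (F x))) by rewrite gx'.
have gg : meq k (tgt (F x)) g g'.
  apply: (@meq_trans _ _ _ _ _ _ (g \o ((fun y => tgt (F' y)) \o g'))).
    by apply: meq_near; apply: filterS fg' => y /= ->.
  apply: (@meq_trans _ _ _ _ _ _ (g \o ((fun y => tgt (F y)) \o g'))); last first.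
    apply: meq_near; have n1 := near_comp (map_cont mg') (P := fun y => g (tgt (F y)) = y).
    by rewrite gx' in n1; apply: filterS (n1 gf) => y.
  have m1 : mmap ((fun y => tgt (F' y)) \o g') (tgt (F x)) by exact: map_comp.
  have m2 : mmap ((fun y => tgt (F y)) \o g') (tgt (F x)) by exact: map_comp.
  apply: (@meq_comp _ _ _ _ _ _ ((fun y => tgt (F' y)) \o g') ((fun y => tgt (F y)) \o g')) => //.
  - by rewrite /= gx' -FFx.
  - by rewrite /= gx' -FFx.
  apply: meq_comp => //; rewrite gx'; apply: meq_sym; exact: bis_meq_tgt.
apply: (@meq_comp _ _ _ _ _ _ (F \o g) (F' \o g') (@inv R G) (@inv R G)).
- by apply: map_comp; rewrite ?gx //; exact: bis_map.
- by apply: map_comp; rewrite ?gx' //; exact: bis_map.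
- exact: inv_smooth.
- exact: inv_smooth.
- apply: meq_comp => //; rewrite gx //; exact: bis_map.
- exact: meq_refl.
Qed.

(** Frees the product of jets from the representatives chosen by [jrep]. *)
Lemma gmul_jet k x F H : bis x F -> bis (tgt (F x)) H ->
  gmul (g := jgpd G k) (jet k (tgt (F x)) H) (jet k x F) = jet k x (bmulG H F).
Proof.
move=> bF bH; have rF := jrep_meq k bF; have rH := jrep_meq k bH.
apply/esym/jet_meq; apply: meq_bmul => //; exact: jrep_bis.
Qed.

Lemma ginv_jet k x F : bis x F ->
  ginv (g := jgpd G k) (jet k x F) = jet k (tgt (F x)) (binvG x F).
Proof.
move=> bF; rewrite /= jval_jet //.
apply/esym/jet_meq; apply: meq_binv => //; [exact: jrep_bis|exact: jrep_meq].
Qed.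

End Jets.

(** * Jet coordinates *)

Section JetCoordinates.
Context {R : realType} (G : lie_groupoid R).
Local Notation I := (base G).
Local Notation n := (mdim I).
Local Notation m := (mdim (arrows G)).
Local Notation bis := (bisection_at (Gam := gpd_of G)).
Local Notation e := (fun i : 'I_n => delta_mx ord0 i : 'rV[R]_n).
Implicit Types (k l : nat) (F H : I -> arrows G) (x y : I) (E : normedModType R).

Lemma iter_partial E E' (W : normedModType R) (f : E * E' -> W) z w vs :
  iter_deriv vs (fun w => f (z, w)) w = iter_deriv (map (pair (0 : E)) vs) f (z, w).
Proof.
apply: (@iter_deriv_affine _ _ _ _ (fun w => (z, w)) (pair (0 : E)) f) => h v y.
by rewrite -[RHS]/(h *: (0 : E) + z, h *: v + y) scaler0 add0r.
Qed.

(** Lists rather than multi-indices: the jet coordinates are redundant, but no normal form of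
    partial derivatives is needed. *)
Definition lidx k := {j : 'I_k.+1 & j.-tuple 'I_n}.

Definition ldec k (l : lidx k) : seq 'I_n := tval (tagged l).

Lemma ldec_ex k (J : seq 'I_n) : (size J <= k)%N -> exists l : lidx k, ldec l = J.
Proof.
by rewrite -ltnS => h; exists (Tagged (fun j : 'I_k.+1 => j.-tuple 'I_n) (in_tuple J : (Ordinal h).-tuple 'I_n)).
Qed.

Lemma size_ldec k (l : lidx k) : (size (ldec l) <= k)%N.
Proof. by rewrite /ldec size_tuple -ltnS ltn_ord. Qed.

Definition jcoord k := ('rV[R]_n * 'M[R]_(#|{: lidx k}|, m))%type.

Definition coefs k (C : seq 'I_n -> 'rV[R]_m) : 'M[R]_(#|{: lidx k}|, m) :=
  \matrix_(l, a) C (ldec (enum_val l)) ord0 a.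

(** Decodes [coefs]; lists longer than [k] get 0. *)
Definition coef k (P : 'M[R]_(#|{: lidx k}|, m)) (J : seq 'I_n) : 'rV[R]_m :=
  if [pick l : lidx k | ldec l == J] is Some l then row (enum_rank l) P else 0.

Lemma coefK k C J : (size J <= k)%N -> coef (coefs k C) J = C J.
Proof.
move=> /ldec_ex [l0 l0J]; rewrite /coef; case: pickP => [l /eqP lJ|/(_ l0)]; last by rewrite l0J eqxx.
by apply/rowP => a; rewrite !mxE enum_rankK lJ.
Qed.

Lemma sm_coef E k (P : E -> 'M[R]_(#|{: lidx k}|, m)) J z : sm P z -> sm (fun z => coef (P z) J) z.
Proof.
move=> sP; rewrite /coef; case: pickP => [l _|_]; last exact: sm_cst.
by apply: sm_mx => i j; under eq_fun do rewrite mxE; exact: sm_entry.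
Qed.

Lemma sm_coefs E k (C : E -> seq 'I_n -> 'rV[R]_m) z :
  (forall J, (size J <= k)%N -> sm (fun z => C z J) z) -> sm (fun z => coefs k (C z)) z.
Proof.
move=> sC; apply: sm_mx => i j; under eq_fun do rewrite mxE; apply: sm_entry.
apply: sC; exact: size_ldec.
Qed.

Definition hat (c : chart R I n) (d : chart R (arrows G) m) F : 'rV[R]_n -> 'rV[R]_m :=
  cmap d \o F \o cinv c.

Definition kap k (c : chart R I n) (d : chart R (arrows G) m) x F : jcoord k :=
  (cmap c x, coefs k (jetc (hat c d F) (cmap c x))).

Lemma kap_meq k c d x F F' : atlas c -> atlas d -> cdom c x -> cdom d (F x) ->
  meq k x F F' -> kap k c d x F = kap k c d x F'.
Proof.
move=> ac ad cx dF FF; congr pair; apply/matrixP => i j; rewrite !mxE.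
have := FF.2 c d ac ad cx dF (map e (ldec (enum_val i))).
by rewrite size_map => /(_ (size_ldec _)); rewrite /jetc /hat => ->.
Qed.

Lemma findim_jcoord k : findim (jcoord k : normedModType R).
Proof. by []. Qed.

(** The smoothness part of [family], which the families of [generates] satisfy as well. *)
Definition pfamily E (c : chart R I n) (z0 : E) x (Psi : E -> I -> arrows G) : Prop :=
  [/\ atlas c, cdom c x & plot (fun p : E * 'rV[R]_n => Psi p.1 (cinv c p.2)) (z0, cmap c x)].

Lemma family_pfamily E c (z0 : E) x Psi : family c z0 x Psi -> pfamily c z0 x Psi.
Proof. by move=> [[ac cx] pP _ _]. Qed.

Lemma pfamily_chart E c c1 (z0 : E) x Psi : findim E -> atlas c1 -> cdom c1 x ->
  pfamily c z0 x Psi -> pfamily c1 z0 x Psi.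
Proof.
move=> fE ac1 c1x [ac cx pP]; split=> //.
have sT : sm (fun p : E * 'rV[R]_n => (p.1, (cmap c \o cinv c1) p.2)) (z0, cmap c1 x).
  apply: sm_pair; first exact: sm_fst.
  by apply: (@sm_comp _ _ _ _ (cmap c \o cinv c1) snd) => //; [exact: sm_snd|exact: sm_transition].
have nc := near_snd z0 (near_chart c1x (near_cdom cx)).
apply: (@plot_ext _ _ _ (fun p : E * 'rV[R]_n => Psi p.1 (cinv c ((cmap c \o cinv c1) p.2)))).
  by apply: filterS nc => p cp /=; rewrite cmapK.
apply: (@plot_comp _ _ _ _ (fun p : E * 'rV[R]_n => Psi p.1 (cinv c p.2)) (fun p => (p.1, (cmap c \o cinv c1) p.2))) => //.
by rewrite /= cmapK.
Qed.

Lemma family_hat E c (z0 : E) Psi x (d : chart R (arrows G) m) : pfamily c z0 x Psi -> atlas d -> cdom d (Psi z0 x) ->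
  sm (fun p : E * 'rV[R]_n => hat c d (Psi p.1) p.2) (z0, cmap c x) /\
  \forall p \near (z0, cmap c x), cdom d (Psi p.1 (cinv c p.2)).
Proof.
move=> [ac cx pP] ad dP; have [|nd sd] := plotE pP ad; first by rewrite /= cmapK.
by [].
Qed.

(** The jet coordinates are partial derivatives in w of one smooth function of (z, w), evaluated at
    the coordinates w of [xz z]. *)
Lemma plot_jet_gen E c (z0 : E) Psi (xz : E -> I) k : findim E -> plot xz z0 ->
  pfamily c z0 (xz z0) Psi -> (\forall z \near z0, bis (xz z) (Psi z)) ->
  jplot (G := G) k (fun z => jet k (xz z) (Psi z)) z0.
Proof.
move=> fE px fam nb; have bz0 := nbhs_singleton nb.
split; first by apply: filterS nb => z; exact: is_jet_jet.
move=> c1 d1 ac1 ad1 /= c1x; rewrite jval_jet // => d1P.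
have fam1 := pfamily_chart fE ac1 c1x fam.
have [sh nd] := family_hat fam1 ad1 d1P.
have [nc1 sx] := plotE px ac1 c1x.
have nd1 : \forall z \near z0, cdom d1 (Psi z (xz z)).
  have sB : sm (fun z => (z, (cmap c1 \o xz) z)) z0 by apply: sm_pair => //; exact: sm_id.
  have := nearI nc1 (near_comp (sm_cont sB) (P := fun p => cdom d1 (Psi p.1 (cinv c1 p.2))) nd).
  by apply: filterS => z [cz] /=; rewrite cmapK.
have nall := nearI nb (nearI nc1 nd1).
split => //; first by apply: filterS nall => z [bz [cz dz]]; rewrite jval_jet.
move=> vs svs.
apply: (@sm_near_ext _ _ _ (fun z => iter_deriv (map (pair (0 : E)) vs)
   (fun p : E * 'rV[R]_n => hat c1 d1 (Psi p.1) p.2) (z, (cmap c1 \o xz) z))).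
  apply: filterS nall => z [bz [cz dz]].
  rewrite -(iter_partial (fun p : E * 'rV[R]_n => hat c1 d1 (Psi p.1) p.2)) /=.
  by have [_] := jrep_meq k bz; apply.
apply: (@sm_comp _ _ _ _ (iter_deriv (map (pair (0 : E)) vs) _) (fun z => (z, (cmap c1 \o xz) z))) => //.
  by apply: sm_pair => //; exact: sm_id.
exact: sm_iter.
Qed.

Section PlotJet.
Variables (E : normedModType R) (fE : findim E) (c : chart R I n) (z0 : E) (Psi : E -> I -> arrows G).

Variables (xz : E -> I).
Hypotheses (px : plot xz z0) (fam : family c z0 (xz z0) Psi).

Lemma near_family_diag (P : E -> I -> Prop) :
  (\forall p \near (z0, cmap c (xz z0)), P p.1 (cinv c p.2)) -> \forall z \near z0, P z (xz z).
Proof.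
have [[ac cx] _ _ _] := fam; have [nc sx] := plotE px ac cx.
have sB : sm (fun z => (z, (cmap c \o xz) z)) z0 by apply: sm_pair => //; exact: sm_id.
move=> nP; have := nearI nc (near_comp (sm_cont sB) nP).
by apply: filterS => z [cz] /=; rewrite cmapK.
Qed.

Lemma near_bis_diag : \forall z \near z0, bis (xz z) (Psi z).
Proof.
have [c' ac' cy] := atlas_cover (tgt (Psi z0 (xz z0))).
by apply: (@near_family_diag (fun z y => bis y (Psi z))); exact: (family_bis fE fam ac' cy).
Qed.

Lemma plot_jet k : jplot (G := G) k (fun z => jet k (xz z) (Psi z)) z0.
Proof. exact: plot_jet_gen fE px (family_pfamily fam) near_bis_diag. Qed.

End PlotJet.

Lemma tq_ext j (C C' : seq 'I_n -> 'rV[R]_m) (w : 'rV[R]_n) :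
  (forall J, size J = j -> C J = C' J) -> tq j C w = tq j C' w.
Proof.
elim: j C C' => [|j IH] C C' CC; first exact: CC.
rewrite !tqS; congr (_ *: _); apply: eq_bigr => a _; congr (_ *: _).
by apply: IH => J sJ; apply: CC; rewrite size_rcons sJ.
Qed.

Lemma taylor_ext k (C C' : seq 'I_n -> 'rV[R]_m) (w : 'rV[R]_n) :
  (forall J, (size J <= k)%N -> C J = C' J) -> taylor k C w = taylor k C' w.
Proof.
by move=> CC; apply: eq_bigr => j _; apply: tq_ext => J sJ; apply: CC; rewrite sJ -ltnS.
Qed.

Lemma tq_zero j (w : 'rV[R]_n) : tq j (fun _ => 0 : 'rV[R]_m) w = 0.
Proof.
elim: j => [//|j IH]; rewrite tqS big1 ?scaler0 // => i _.
by rewrite IH scaler0.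
Qed.

Lemma taylor_zero k (w : 'rV[R]_n) : taylor k (fun _ => 0 : 'rV[R]_m) w = 0.
Proof. by rewrite /taylor big1 // => j _; exact: tq_zero. Qed.

(* A smooth family of bisections indexed by jet coordinates, through which all k-jets
   near that of [F] factor. *)
Lemma jet_family k c d x F : atlas c -> atlas d -> cdom c x -> cdom d (F x) -> bis x F ->
  exists Psi : jcoord k -> I -> arrows G,
  [/\ family c (kap k c d x F) x Psi,
      \forall y \near x, Psi (kap k c d x F) y = F y &
      \forall p \near (kap k c d x F), forall y F', cdom c y -> bis y F' -> cdom d (F' y) ->
         kap k c d y F' = p -> bis y (Psi p) /\ meq k y F' (Psi p)].
Proof.
move=> ac ad cx dx bF; set k0 := kap k c d x F.
have [rho [srho rho0 rhosrc rhoK]] := retraction ac ad cx dx bF.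
pose f0 := hat c d F; have [sf0 nf0] := sm_map (bis_map bF) ac ad cx dx.
have f0x : f0 (cmap c x) = cmap d (F x) by rewrite /f0 /hat /= cmapK.
(* [F] is corrected by a polynomial with the missing derivatives, so that its own coordinates give
   back [F] itself; [rho] then returns the values to the right source fibres. *)
pose C (p : jcoord k) J := coef p.2 J - jetc f0 p.1 J.
pose Q (p : jcoord k * 'rV[R]_n) := f0 p.2 + taylor k (C p.1) (p.2 - p.1.1).
have s11 (p : jcoord k * 'rV[R]_n) : sm (fun p : jcoord k * 'rV[R]_n => p.1.1) p.
  by apply: (@sm_comp _ _ _ _ fst fst) => //; exact: sm_fst.
have s12 (p : jcoord k * 'rV[R]_n) : sm (fun p : jcoord k * 'rV[R]_n => p.1.2) p.
  by apply: (@sm_comp _ _ _ _ snd fst) => //; [exact: sm_fst|exact: sm_snd].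
have sQ : sm Q (k0, cmap c x).
  apply: smD; first by apply: (@sm_comp _ _ _ _ f0 snd) => //; exact: sm_snd.
  apply: (@sm_taylor _ _ _ _ k (fun p : jcoord k * 'rV[R]_n => C p.1) (fun p : jcoord k * 'rV[R]_n => p.2 - p.1.1)).
    move=> J _; apply: smB; first by apply: (@sm_coef _ k (fun p : jcoord k * 'rV[R]_n => p.1.2)).
    apply: (@sm_comp _ _ _ _ (fun w => jetc f0 w J) (fun p : jcoord k * 'rV[R]_n => p.1.1)) => //.
    exact: sm_iter.
  by apply: smB; [exact: sm_snd|exact: s11].
have Qk0 w : Q (k0, w) = f0 w.
  rewrite /Q /= (@taylor_ext _ _ (fun _ => 0)) ?taylor_zero ?addr0 // => J sJ.
  by rewrite /C /k0 /kap /= coefK // subrr.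
pose rq (p : jcoord k * 'rV[R]_n) := rho (p.2, Q p).
have srq : sm rq (k0, cmap c x).
  apply: sm_comp => //; last by rewrite /= Qk0 f0x.
  by apply: sm_pair => //; exact: sm_snd.
have rq0 : rq (k0, cmap c x) = cmap d (F x) by rewrite /rq /= Qk0 f0x.
pose Psi (p : jcoord k) y := cinv d (rq (p, cmap c y)).
have nimg : \forall p \near (k0, cmap c x), (cmap c @` cdom c) p.2 := near_snd _ (near_cimg cx).
have PsiF : \forall y \near x, Psi k0 y = F y.
  apply: (chart_near cx); rewrite /Psi.
  have n1 := near_comp (sm_cont sf0) (P := fun q => cdom c (src (cinv d q)) /\ rho (cmap c (src (cinv d q)), q) = q).
  rewrite -/f0 -/(hat c d F) -/f0 f0x in n1.
  have := nearI (near_cimg cx) (nearI nf0 (nearI (n1 rhoK) (near_chart cx (bis_srcs bF)))).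
  apply: filterS => w [/cinvK [cw we] [dw [[_ rK] sw]]].
  rewrite we /rq /= Qk0; rewrite /= (cmapK dw) sw we in rK.
  by rewrite /f0 /hat /= rK cmapK.
have fam : family c k0 x Psi.
  split=> //; last by apply: (bis_ext _ bF); apply: filterS PsiF => y ->.
  - apply: (@plot_ext _ _ _ (fun p => cinv d (rq p))).
      by apply: filterS nimg => -[p w] /cinvK [_ /= we]; rewrite /Psi we.
    by apply: plot_comp => //; rewrite rq0; exact: plot_chart.
  - have sB : sm (fun p : jcoord k * 'rV[R]_n => (p.2, Q p)) (k0, cmap c x) by apply: sm_pair => //; exact: sm_snd.
    have n1 := near_comp (sm_cont sB) (P := fun p => src (cinv d (rho p)) = cinv c p.1).
    rewrite /= Qk0 f0x in n1; have := nearI nimg (n1 rhosrc).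
    by apply: filterS => -[p w] /= [/cinvK [_ we]]; rewrite /Psi we.
exists Psi; split=> //.
have [c' ac' cy'] := atlas_cover (tgt (Psi k0 x)).
have nb := near_near (family_bis (findim_jcoord k) fam ac' cy').
have dPsi0 : cdom d (Psi k0 x) by rewrite (nbhs_singleton PsiF).
have [_ ndP] := family_hat (family_pfamily fam) ad dPsi0.
pose B1 (p : jcoord k) := (p, p.1); pose B2 (p : jcoord k) := (p.1, coef p.2 [::]).
have sB1 : sm B1 k0 by apply: sm_pair; [exact: sm_id|exact: sm_fst].
have sB2 : sm B2 k0 by apply: sm_pair; [exact: sm_fst|apply: sm_coef; exact: sm_snd].
have B20 : B2 k0 = (cmap c x, cmap d (F x)) by rewrite /B2 /k0 /kap /= coefK // -f0x.
have N1 := near_comp (sm_cont sB1) nb.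
have N2 := near_comp (sm_cont sB1) (near_near ndP).
have N3 : \forall p \near k0, sm rho (B2 p) by apply: (near_comp (sm_cont sB2)); rewrite B20; exact: sm_near.
have N4 : \forall p \near k0, nbhs (B2 p).2 (fun q => cdom c (src (cinv d q)) /\ rho (cmap c (src (cinv d q)), q) = q).
  have H := near_comp (sm_cont sB2) (P := fun r => nbhs r.2 (fun q => cdom c (src (cinv d q)) /\ rho (cmap c (src (cinv d q)), q) = q)).
  by rewrite B20 in H; apply: H; exact: near_snd (near_near rhoK).
have N5 : \forall p \near k0, sm f0 p.1 by apply: near_fst; exact: sm_near.
have N6 : \forall p \near k0, (cmap c @` cdom c) p.1 by apply: near_fst; exact: near_cimg.
have N7 : \forall p \near k0, sm Q (p, p.1) := near_comp (sm_cont sB1) (sm_near sQ).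
have := nearI N1 (nearI N2 (nearI N3 (nearI N4 (nearI N5 (nearI N6 N7))))).
apply: filterS => p [M1 [M2 [M3 [M4 [M5 [M6 M7]]]]]] y F' cy bF' dF' kp.
have p1 : p.1 = cmap c y by rewrite -kp.
have bPy : bis y (Psi p) by have := nbhs_singleton M1; rewrite /B1 /= p1 cmapK.
split=> //.
have [sf' nf'] := sm_map (bis_map bF') ac ad cy dF'; rewrite -/(hat c d F') in sf'.
set f' := hat c d F' in sf'.
have f'y : f' (cmap c y) = cmap d (F' y) by rewrite /f' /hat /= cmapK.
have pC J : (size J <= k)%N -> coef p.2 J = jetc f' (cmap c y) J.
  by move=> sJ; rewrite -kp /= coefK.
have B2p : B2 p = (cmap c y, cmap d (F' y)) by rewrite /B2 p1 pC //= -f'y.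
rewrite B2p /= in M3 M4; rewrite p1 in M5 M6 M7.
have sQp : sm (fun w => Q (p, w)) (cmap c y).
  by apply: (@sm_comp _ _ _ _ Q (fun w => (p, w))) => //; exact: sm_pairr.
(* The coordinates [p] are those of F', so the correction is the Taylor polynomial of f' - f0. *)
have Qf' : agree k f' (fun w => Q (p, w)) (cmap c y).
  have sd : sm (fun w => f' w - f0 w) (cmap c y) by exact: smB.
  have aT := taylor_agree (findim_mx 1 m) (k := k) sd.
  have aQ : agree k (fun w => f0 w + taylor k (jetc (fun w => f' w - f0 w) (cmap c y)) (w - cmap c y))
     (fun w => f0 w + (f' w - f0 w)) (cmap c y).
    apply: agreeD => //.
    apply: (@sm_taylor _ _ _ _ k (fun _ => jetc (fun w => f' w - f0 w) (cmap c y)) (fun w => w - cmap c y)).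
      by move=> J _; exact: sm_cst.
    by apply: smB; [exact: sm_id|exact: sm_cst].
  apply: agree_sym; apply: agree_near_ext aQ; near=> w; last by rewrite addrC subrK.
  rewrite /Q /= p1; congr (_ + _); apply: taylor_ext => J sJ.
  rewrite /C pC // p1 /jetc.
  have -> : (fun w => f' w - f0 w) = (fun w => f' w + (-1) *: f0 w) by apply/funext => u; rewrite scaleN1r.
  rewrite iter_derivD //; last by apply: sm_scale => //; exact: sm_cst.
  by rewrite iter_derivZ // scaleN1r.
have Qy : Q (p, cmap c y) = cmap d (F' y) by rewrite -f'y (agree_val Qf').
have nd : \forall w \near cmap c y, cdom d (Psi p (cinv c w)).
  by have := near_slice M2; rewrite p1; apply: filterS => w.
have dPy : cdom d (Psi p y) by have := nbhs_singleton nd; rewrite cmapK.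
have rdF' : rho (cmap c y, cmap d (F' y)) = cmap d (F' y).
  by have [_] := nbhs_singleton M4; rewrite cmapK // (bis_src bF').
have sQ2 : sm (fun w => (w, Q (p, w))) (cmap c y) by apply: sm_pair => //; exact: sm_id.
have srQ : sm (fun w => rho (w, Q (p, w))) (cmap c y) by apply: sm_comp => //; rewrite Qy.
have hE : \forall w \near cmap c y, rho (w, Q (p, w)) = hat c d (Psi p) w.
  have n1 := near_comp (sm_cont srQ) (P := fun q => (cmap d @` cdom d) q).
  rewrite Qy rdF' in n1; have := nearI (near_cimg cy) (n1 (near_cimg dF')).
  apply: filterS => w [/cinvK [cw we] /cinvK [_ re]].
  by rewrite /hat /= /Psi we.
(* The values of F' lie in the right source fibres, so [rho] fixes them, and composing with [rho]
   preserves the agreement of f' with Q. *)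
have f'E : \forall w \near cmap c y, rho (w, f' w) = f' w.
  have n1 := near_comp (sm_cont sf') (P := fun q => cdom c (src (cinv d q)) /\ rho (cmap c (src (cinv d q)), q) = q).
  rewrite f'y in n1; have := nearI (near_cimg cy) (nearI nf' (nearI (n1 M4) (near_chart cy (bis_srcs bF')))).
  apply: filterS => w [/cinvK [cw we] [dw [[_ rK] sw]]].
  by rewrite {2}/f' /hat /= (cmapK dw) sw we in rK; rewrite /f' /hat /=.
have aH : agree k f' (hat c d (Psi p)) (cmap c y).
  apply: (agree_near_ext f'E hE).
  apply: (@agree_comp _ _ _ _ _ (fun w => (w, f' w)) (fun w => (w, Q (p, w))) rho rho) => //.
  - by apply: sm_pair => //; exact: sm_id.
  - by rewrite f'y.
  - by rewrite f'y.
  - by apply: agree_pair => //; exact: sm_id.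
apply: (meqI (c := c) (d := d)) => //; [exact: bis_map|exact: bis_map|].
have := agree_val aH; rewrite f'y /hat /= (cmapK cy) => eF.
by rewrite -(cmapK dF') eF cmapK.
Unshelve. all: by end_near. Qed.

End JetCoordinates.

(** * Local parametrisations, plots and smooth functions of G_k *)

Section JetSpace.
Context {R : realType} (G : lie_groupoid R).
Local Notation I := (base G).
Local Notation n := (mdim I).
Local Notation m := (mdim (arrows G)).
Local Notation bis := (bisection_at (Gam := gpd_of G)).
Local Notation bmulG := (bmul (Gam := gpd_of G)).
Implicit Types (k l : nat) (F H : I -> arrows G) (x y : I) (E : normedModType R).

Lemma family_near E c (z0 : E) x Psi : findim E -> family c z0 x Psi ->
  \forall q \near (z0, cmap c x), family c q.1 (cinv c q.2) Psi.
Proof.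
move=> fE fam; have [[ac cx] pP sP bP] := fam.
have [c' ac' cy] := atlas_cover (tgt (Psi z0 x)).
have nimg : \forall p \near (z0, cmap c x), (cmap c @` cdom c) p.2 := near_snd _ (near_cimg cx).
have := nearI (near_near sP) (nearI (plot_near pP) (nearI nimg (family_bis fE fam ac' cy))).
by apply: filterS => -[z w] /= [n1 [n2 [/cinvK [cw we] n3]]]; split; rewrite ?we.
Qed.

Definition kapX k c d (X : jets G) : jcoord G k := kap k c d X.1 (jrep X).

Lemma kapX_jet k c d x F : atlas c -> atlas d -> cdom c x -> cdom d (F x) -> bis x F ->
  kapX k c d (jet k x F) = kap k c d x F.
Proof. by move=> ac ad cx dF bF; apply/esym/kap_meq => //; exact: jrep_meq. Qed.

(** A local parametrisation of G_k, inverse to the coordinates [kapX] on jets. It is a plot on a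
    full neighbourhood in [jcoord], including coordinates that belong to no jet. *)
Lemma jchart k c d x F : atlas c -> atlas d -> cdom c x -> cdom d (F x) -> bis x F ->
  exists A : jcoord G k -> jets G,
   (\forall p \near kap k c d x F, jplot (G := G) k A p) /\
   (\forall p \near kap k c d x F, forall X, is_jet k X -> cdom c X.1 -> cdom d (jval X) ->
      kapX k c d X = p -> X = A p).
Proof.
move=> ac ad cx dF bF; have [Psi [fam PF PX]] := jet_family k ac ad cx dF bF.
exists (fun p => jet k (cinv c p.1) (Psi p)); split; last first.
  have := nearI PX (near_fst _ (near_cimg cx)).
  apply: filterS => p [H /cinvK [cp pe]] X /jet_jrep [bX XE] cX dX kX.
  have [|bP /jet_meq XP] := H X.1 (jrep X) cX bX _ kX; first exact: dX.
  by rewrite XE XP -kX /= cmapK.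
have fj : findim (jcoord G k : normedModType R) by exact: findim_jcoord.
pose B (p : jcoord G k) := (p, p.1); have sB p : sm B p by apply: sm_pair; [exact: sm_id|exact: sm_fst].
have n1 := near_comp (sm_cont (sB (kap k c d x F))) (P := fun q => family c q.1 (cinv c q.2) Psi).
have := nearI (n1 (family_near fj fam)) (near_fst _ (near_cimg cx)).
apply: filterS => p [/= famp /(plot_chart_near ac) pp].
apply: (@plot_jet _ _ _ fj c p Psi (fun p => cinv c p.1)) => //.
by apply: (@plot_comp _ _ _ _ (cinv c) fst) => //; exact: sm_fst.
Qed.

Lemma sm_kapX E k c d (A : E -> jets G) z0 : atlas c -> atlas d -> cdom c (A z0).1 ->
  cdom d (jval (A z0)) -> jplot k A z0 -> sm (fun z => kapX k c d (A z)) z0.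
Proof.
move=> ac ad cA dA [_ /(_ c d ac ad cA dA) [_ sc sv]].
apply: sm_pair => //; apply: sm_coefs => J sJ.
by apply: sv; rewrite size_map.
Qed.

Lemma jplot_src E k (A : E -> jets G) z0 : jplot k A z0 -> plot (fun z => (A z).1) z0.
Proof.
move=> [_ H]; have [c ac cA] := atlas_cover (A z0).1; have [d ad dA] := atlas_cover (jval (A z0)).
have [nc sc _] := H c d ac ad cA dA.
by apply: (plotI ac) => //; apply: filterS nc => z [].
Qed.

(** Substitute the coordinates of the plot for the parameter of [jet_family]. *)
Lemma jplot_family E k (A : E -> jets G) z0 : findim E -> jplot k A z0 ->
  exists c (Psi : E -> I -> arrows G), family c z0 (A z0).1 Psi /\
    \forall z \near z0, bis (A z).1 (Psi z) /\ A z = jet k (A z).1 (Psi z).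
Proof.
move=> fE pA; have [nj H] := pA; have [bF AE] := jet_jrep (nbhs_singleton nj).
have [c ac cA] := atlas_cover (A z0).1; have [d ad dA] := atlas_cover (jval (A z0)).
have [nc _ _] := H c d ac ad cA dA.
have [Psi [fam PF PX]] := jet_family k ac ad cA dA bF.
have sk := sm_kapX ac ad cA dA pA.
exists c, (fun z => Psi (kapX k c d (A z))); split.
  exact: (@family_param _ _ _ _ (fun z => kapX k c d (A z)) c z0 (A z0).1 Psi).
have := nearI nc (nearI nj (near_comp (sm_cont sk) PX)).
apply: filterS => z [[cz dz] [/jet_jrep [bz zE] Hz]].
have [bP /jet_meq zP] := Hz (A z).1 (jrep (A z)) cz bz dz erefl.
by split=> //; rewrite {1}zE zP.
Qed.

Lemma jplot_comp E E' k (A : E -> jets G) (B : E' -> E) z0 : findim E -> sm B z0 ->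
  jplot k A (B z0) -> jplot k (fun z => A (B z)) z0.
Proof.
move=> fE sB [nj H]; split; first exact: (near_comp (P := fun z => is_jet k (A z)) (sm_cont sB)).
move=> c d ac ad cA dA; have [nc sc sv] := H c d ac ad cA dA; split.
- exact: (near_comp (P := fun z => cdom c (A z).1 /\ cdom d (jval (A z))) (sm_cont sB)).
- exact: (@sm_comp _ _ _ _ (fun z => cmap c (A z).1) B).
- move=> vs svs; exact: (@sm_comp _ _ _ _ (fun z => iter_deriv vs (cmap d \o jrep (A z) \o cinv c) (cmap c (A z).1)) B _ fE sB (sv vs svs)).
Qed.

Lemma jplot_ext E k (A B : E -> jets G) z0 : (\forall z \near z0, A z = B z) ->
  jplot k A z0 -> jplot k B z0.
Proof.
move=> AB [nj H]; have AB0 := nbhs_singleton AB.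
split; first by have := nearI AB nj; apply: filterS => z [<-].
rewrite -AB0 => c d ac ad cA dA; have [nc sc sv] := H c d ac ad cA dA; split.
- by have := nearI AB nc; apply: filterS => z [<-].
- by apply: sm_near_ext sc; apply: filterS AB => z ->.
- by move=> vs svs; apply: sm_near_ext (sv vs svs); apply: filterS AB => z ->.
Qed.

Lemma dfun_plot E k h (A : E -> jets G) z0 : findim E -> dfun (d := jspace G k) h (A z0) -> jplot k A z0 ->
  sm (fun z => h (A z)) z0.
Proof.
move=> fE dh pA; have [p [f [g [cf cg gf]]]] := findim_iso fE.
have sf w : sm f w by exact: sm_lin.
have sg w : sm g w by exact: sm_lin.
apply: (@sm_near_ext _ _ _ (fun z => (h \o (A \o f)) (g z))).
  by near=> z; rewrite /= gf.
apply: (@sm_comp _ _ _ _ (h \o (A \o f)) g) => //; apply: dh; first by rewrite /= gf.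
by apply: (@jplot_comp _ _ _ A f) => //; rewrite gf.
Unshelve. all: by end_near. Qed.

(** Smoothness near a jet is tested on plots through that very jet. It passes to neighbouring jets
    because [h] is there the composite of the smooth [h \o A] with the coordinates. *)
Lemma dfun_near k c d x F h : atlas c -> atlas d -> cdom c x -> cdom d (F x) -> bis x F ->
  dfun (d := jspace G k) h (jet k x F) ->
  \forall p \near kap k c d x F, forall X, is_jet k X -> cdom c X.1 -> cdom d (jval X) ->
      kapX k c d X = p -> dfun (d := jspace G k) h X.
Proof.
move=> ac ad cx dF bF dh; have [A [pA AX]] := jchart k ac ad cx dF bF.
have A0 : jet k x F = A (kap k c d x F).
  apply: (nbhs_singleton AX); rewrite ?jval_jet //; [exact: is_jet_jet|exact: kapX_jet].
have shA : sm (fun p => h (A p)) (kap k c d x F).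
  by apply: (@dfun_plot _ k) => //; [rewrite -A0|exact: nbhs_singleton pA].
have := nearI (sm_near shA) (near_near AX).
apply: filterS => p [sp np] X jX cX dX kX r B y BX pB.
rewrite -BX in cX dX kX.
have sk := sm_kapX ac ad cX dX pB.
have nB := near_comp (sm_cont sk) (P := fun p => forall X, is_jet k X -> cdom c X.1 -> cdom d (jval X) ->
      kapX k c d X = p -> X = A p).
rewrite kX in nB; have [nj /(_ c d ac ad cX dX) [nc _ _]] := pB.
apply: (@sm_near_ext _ _ _ (fun z => (fun p => h (A p)) (kapX k c d (B z)))).
  have := nearI nj (nearI nc (nB np)).
  by apply: filterS => z [jz [[cz dz] Hz]]; rewrite -(Hz (B z)).
by apply: (@sm_comp _ _ _ _ (fun p => h (A p)) (fun z => kapX k c d (B z))) => //; rewrite kX.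
Qed.

(** Smoothness at [X] of a map of jet spaces, in the form that makes [push] act on velocities. *)
Definition plot_preserving k l (f : jets G -> jets G) (X : jets G) : Prop :=
  forall p (A : 'rV[R]_p -> jets G) z, A z = X -> jplot k A z -> jplot l (fun z => f (A z)) z.

Lemma push_velocity k l f (g : R -> jets G) : plot_preserving k l f (g 0) ->
  push (S := jspace G l) f (g 0) (velocity (S := jspace G k) g) =
  velocity (S := jspace G l) (fun t => f (g t)).
Proof.
move=> H; apply/funext => h; rewrite /velocity /push; case: asboolP => // dh.
rewrite asboolT // => p A y AX pA; apply: (@dfun_plot _ l h (fun z => f (A z))) => //.
  by rewrite AX.
exact: H AX pA.
Qed.

Lemma velocity_ext k (g g' : R -> jets G) : (\forall t \near (0 : R), g t = g' t) ->
  velocity (S := jspace G k) g = velocity (S := jspace G k) g'.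
Proof.
move=> gg; apply/funext => h; rewrite /velocity /push (nbhs_singleton gg); case: asboolP => // _.
by rewrite !derive1E; apply: near_eq_derive; apply: filterS gg => t /= ->.
Qed.

(** This is the map along which [j1act] pushes vectors. On a plot written as a family of jets it
    gives the jets of a product of two families, by [gmul_jet]. *)
Lemma mul_plot_preserving k c' y0 (Phi : 'rV[R]_n -> I -> arrows G) (mu : I -> jets G) (X : jets G) :
  family c' (cmap c' y0) y0 Phi -> (\forall y \near y0, mu y = jet k y (Phi (cmap c' y))) ->
  tgt (jval X) = y0 ->
  plot_preserving k k (fun Y => gmul (g := jgpd G k) (mu (tgt (jval Y))) Y) X.
Proof.
move=> famF muE tX p A z0 AX pA.
have fE : findim ('rV[R]_p : normedModType R) by [].
have [c [Psi [fam AE]]] := jplot_family fE pA.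
have [b0 A0E] := nbhs_singleton AE.
have jv z : bis (A z).1 (Psi z) /\ A z = jet k (A z).1 (Psi z) -> jval (A z) = Psi z (A z).1.
  by move=> [b ->]; rewrite jval_jet.
have ty0 : tgt (Psi z0 (A z0).1) = y0 by rewrite -(jv z0) // AX.
have [[ac cA] pP _ _] := fam; have [[ac' cy'] _ _ _] := famF.
have ps := jplot_src pA; have [nc sc] := plotE ps ac cA.
have pt : plot (fun z => tgt (Psi z (A z).1)) z0.
  have sB : sm (fun z => (z, cmap c (A z).1)) z0 by apply: sm_pair => //; exact: sm_id.
  apply: (@plot_map _ _ _ _ (@tgt R G)); first exact: mmap_tgt.
  apply: (@plot_ext _ _ _ (fun z => Psi z (cinv c (cmap c (A z).1)))).
    by apply: filterS nc => z cz; rewrite cmapK.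
  exact: (@plot_comp _ _ _ _ (fun p : 'rV[R]_p * 'rV[R]_n => Psi p.1 (cinv c p.2)) (fun z => (z, cmap c (A z).1))).
have ct := plot_cont pt.
have [|nt st] := plotE pt ac'; first by rewrite ty0.
set B := cmap c' \o (fun z => tgt (Psi z (A z).1)) in st.
have B0 : B z0 = cmap c' y0 by rewrite /B /= ty0.
have famB : family c' z0 y0 (fun z => Phi (B z)).
  by apply: (@family_param _ _ _ _ B) => //; rewrite B0.
have famM : family c z0 (A z0).1 (fun z => bmulG (Phi (B z)) (Psi z)).
  by apply: (family_mul (c' := c') fE fam); rewrite ty0.
apply: jplot_ext (plot_jet fE ps famM k).
have nbF : \forall z \near z0, bis (tgt (Psi z (A z).1)) (Phi (B z)).
  apply: (@near_bis_diag _ _ _ fE c' z0 (fun z => Phi (B z)) (fun z => tgt (Psi z (A z).1))) => //.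
  by rewrite ty0.
have nmu : \forall z \near z0, mu (tgt (Psi z (A z).1)) = jet k (tgt (Psi z (A z).1)) (Phi (B z)).
  by apply: (near_comp (P := fun y => mu y = jet k y (Phi (cmap c' y))) ct); rewrite ty0.
have := nearI AE (nearI nbF nmu).
apply: filterS => z [[bz zE] [bF mE]].
by rewrite (jv z (conj bz zE)) mE [in RHS]zE gmul_jet.
Qed.

Lemma jproj_plot_preserving k l X : (k <= l)%N -> plot_preserving l k (jproj k) X.
Proof.
move=> kl p A z0 AX pA; have [c [Psi [fam AE]]] := jplot_family (findim_mx _ _) pA.
apply: jplot_ext (plot_jet (findim_mx _ _) (jplot_src pA) fam k).
by apply: filterS AE => z [bz zE]; rewrite [in RHS]zE jproj_jet.
Qed.

Lemma unit_plot k x E (g : E -> I) z0 : findim E -> plot g z0 -> g z0 = x ->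
  jplot (G := G) k (fun z => jet k (g z) (@unit_ R G)) z0.
Proof.
move=> fE pg gx; have [c ac cx] := atlas_cover x.
apply: (@plot_jet _ _ _ fE c z0 (fun _ => @unit_ R G)) => //; rewrite gx.
by apply: family_const => //; exact: bis_unit.
Qed.

End JetSpace.

(** * Tangent vectors of the jet groupoid along the identities *)

Section Tau.
Context {R : realType} (G : lie_groupoid R).
Local Notation I := (base G).
Local Notation n := (mdim I).
Local Notation m := (mdim (arrows G)).
Local Notation bis := (bisection_at (Gam := gpd_of G)).
Local Notation e := (fun i : 'I_n => delta_mx ord0 i : 'rV[R]_n).
Local Notation one := (@unit_ R G).
Implicit Types (k l : nat) (F H : I -> arrows G) (x y z : I) (E : normedModType R)
  (c : chart R I n) (d : chart R (arrows G) m).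

Definition kap_one k c d z : jcoord G k := kap k c d z one.

(** A single [A] serves all identities near a point, as the smoothness of [tau] in [z] requires. *)
Definition jchart_at k c d (A : jcoord G k -> jets G) z : Prop :=
  [/\ cdom c z, cdom d (one z), jplot k A (kap_one k c d z) &
   \forall p \near kap_one k c d z, forall X, is_jet k X -> cdom c X.1 -> cdom d (jval X) ->
     kapX k c d X = p -> X = A p].

Lemma sm_uhat c d z : atlas c -> atlas d -> cdom c z -> cdom d (one z) ->
  sm (hat c d one) (cmap c z) /\ \forall w \near cmap c z, cdom d (one (cinv c w)).
Proof. by move=> ac ad cz dz; exact: (sm_map (@unit_smooth _ G z) ac ad cz dz). Qed.

Definition unit_coord k c d (w : 'rV[R]_n) : jcoord G k := (w, coefs k (jetc (hat c d one) w)).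

Lemma sm_unit_coord k c d z : atlas c -> atlas d -> cdom c z -> cdom d (one z) -> sm (unit_coord k c d) (cmap c z).
Proof.
move=> ac ad cz dz; have [su _] := sm_uhat ac ad cz dz.
apply: sm_pair; first exact: sm_id.
by apply: sm_coefs => J sJ; exact: sm_iter.
Qed.

Lemma jchart_at_ex k c d x : atlas c -> atlas d -> cdom c x -> cdom d (one x) ->
  exists A, \forall z \near x, jchart_at (k := k) c d A z.
Proof.
move=> ac ad cx dx; have [A [pA AX]] := jchart k ac ad cx dx (bis_unit x).
exists A; have [_ nd] := sm_uhat ac ad cx dx.
have sk := sm_unit_coord k ac ad cx dx.
have N1 := near_comp (sm_cont sk) pA.
have N2 := near_comp (sm_cont sk) (near_near AX).
have := nearI (near_cdom cx) (near_comp (cmap_cont cx) (nearI nd (nearI N1 N2))).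
by apply: filterS => z [cz [dz [n1 n2]]]; split=> //; rewrite cmapK // in dz.
Qed.

Section Fixed.
Variables (k : nat) (c : chart R I n) (d : chart R (arrows G) m) (A : jcoord G k -> jets G).
Hypotheses (ac : atlas c) (ad : atlas d).

(* The jet coordinates of G_k form a submanifold of [jcoord], given by the symmetry of the
   partial derivatives, onto which [A] retracts; [q] need not be tangent to it. *)
Definition tau z (q : jcoord G k) : (jets G -> R) -> R :=
  fun h => if `[< dfun (d := jspace G k) h (jet k z one) >] then 'D_q (h \o A) (kap_one k c d z) else 0.

Lemma jchart_at_one z : jchart_at c d A z -> A (kap_one k c d z) = jet k z one.
Proof.
move=> [cz dz pA AX]; apply/esym; apply: (nbhs_singleton AX) => //.
- exact: is_jet_jet (bis_unit z).
- by rewrite jval_jet //; exact: bis_unit.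
- by apply: kapX_jet => //; exact: bis_unit.
Qed.

Lemma jchart_at_sm z h : jchart_at c d A z -> dfun (d := jspace G k) h (jet k z one) ->
  sm (h \o A) (kap_one k c d z).
Proof.
move=> gz dh; have [cz dz pA AX] := gz.
by apply: (@dfun_plot _ _ _ k) => //; rewrite jchart_at_one.
Qed.

Lemma tauD z a q q' : jchart_at c d A z -> tau z (a *: q + q') = a *: tau z q + tau z q'.
Proof.
move=> gz; apply/funext => h; rewrite /tau !fctE /=; case: asboolP => [dh|_]; last by rewrite scaler0 addr0.
have sh := sm_diff (jchart_at_sm gz dh).
by rewrite deriveDv // deriveZv.
Qed.

Lemma tau0 z : tau z 0 = 0.
Proof. by apply/funext => h; rewrite /tau; case: asboolP => // _; rewrite derive0. Qed.

Lemma tau_sum z T (r : seq T) (a : T -> R) (q : T -> jcoord G k) : jchart_at c d A z ->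
  tau z (\sum_(t <- r) a t *: q t) = \sum_(t <- r) a t *: tau z (q t).
Proof.
move=> gz; elim: r => [|t r IH]; first by rewrite !big_nil tau0.
by rewrite !big_cons tauD // IH.
Qed.

Lemma tauB z q q' : jchart_at c d A z -> tau z (q - q') = tau z q - tau z q'.
Proof. by move=> gz; rewrite -scaleN1r addrC tauD // scaleN1r addrC. Qed.

(** Near 0 the curve is [A] of its own coordinates, so the chain rule applies to [h \o A]. *)
Lemma tau_velocity z (g : R -> jets G) : jchart_at c d A z -> jplot k g 0 -> g 0 = jet k z one ->
  velocity (S := jspace G k) g = tau z ('D_1 (fun t => kapX k c d (g t)) 0).
Proof.
move=> gz pg g0; have [cz dz pA AX] := gz.
have bz := bis_unit z.
have cg : cdom c (g 0).1 by rewrite g0.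
have dg : cdom d (jval (g 0)) by rewrite g0 jval_jet.
have sk := sm_kapX ac ad cg dg pg.
have k0 : kapX k c d (g 0) = kap_one k c d z by rewrite g0 kapX_jet.
have [nj /(_ c d ac ad cg dg) [nc _ _]] := pg.
have gE : \forall t \near (0 : R), A (kapX k c d (g t)) = g t.
  have n1 := near_comp (sm_cont sk) (P := fun p => forall X, is_jet k X -> cdom c X.1 -> cdom d (jval X) ->
     kapX k c d X = p -> X = A p).
  rewrite k0 in n1; have := nearI nj (nearI nc (n1 AX)).
  by apply: filterS => t [jt [[ct dt] Ht]]; rewrite -(Ht (g t)).
apply/funext => h; rewrite /velocity /push /tau g0; case: asboolP => // dh.
have sh := jchart_at_sm gz dh.
rewrite derive1E -k0 -(@derive_comp _ _ _ _ (fun t => kapX k c d (g t)) (h \o A)); last 2 first.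
- exact: sm_diff.
- by rewrite k0; exact: sm_diff.
by apply: near_eq_derive; apply: filterS gE => t /= ->.
Qed.

Lemma tau_smooth x (q : I -> jcoord G k) h : (\forall z \near x, jchart_at c d A z) ->
  sm (q \o cinv c) (cmap c x) -> dfun (d := jspace G k) h (jet k x one) ->
  smooth_fun (fun z => tau z (q z) h) x.
Proof.
move=> ng sq dh; have gx := nbhs_singleton ng; have [cx dx _ _] := gx.
apply: (fun_chart ac cx).
have sk := sm_unit_coord k ac ad cx dx.
have N := near_comp (sm_cont sk) (dfun_near ac ad cx dx (bis_unit x) dh).
apply: (@sm_near_ext _ _ _ (fun w => 'D_((q \o cinv c) w) (h \o A) (unit_coord k c d w))).
  have := nearI (near_cimg cx) (nearI N (near_chart cx ng)).
  apply: filterS => w [/cinvK [cw we] [Hw gw]]; have [_ dw _ _] := gw.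
  have kE : kap_one k c d (cinv c w) = unit_coord k c d w by rewrite /kap_one /kap we.
  rewrite /= /tau asboolT ?kE //; apply: Hw => //.
  - exact: is_jet_jet (bis_unit _).
  - by rewrite jval_jet //; exact: bis_unit.
  - by rewrite -kE; apply: kapX_jet => //; exact: bis_unit.
apply: sm_D => //; exact: jchart_at_sm gx dh.
Qed.

End Fixed.

Lemma derive_coefs E k (C : E -> seq 'I_n -> 'rV[R]_m) p v :
  (forall J, (size J <= k)%N -> sm (fun p => C p J) p) ->
  'D_v (fun p => coefs k (C p)) p = coefs k (fun J => 'D_v (fun p => C p J) p).
Proof.
move=> sC; apply/matrixP => i j.
have cm a b (f : E -> 'M[R]_(a, b)) i' j' : differentiable f p ->
    ('D_v f p) i' j' = 'D_v (fun p => f p i' j') p.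
  by move=> df; rewrite (derive_lcomp _ (@mxcoord_continuous _ _ _ i' j')).
rewrite cm; last by apply: sm_diff; exact: sm_coefs.
rewrite mxE cm; last by apply: sm_diff; apply: sC; exact: size_ldec.
by congr ('D_v _ p); apply/funext => p'; rewrite mxE.
Qed.

(** The coordinates are derivatives in w of one function of (t, w), taken along a curve with
    velocity (1, v) at t = 0. *)
Lemma derive_kapX k c d (yz : R -> I) (Psi : R -> I -> arrows G) : atlas c -> atlas d ->
  cdom c (yz 0) -> cdom d (Psi 0 (yz 0)) -> plot yz 0 -> pfamily c 0 (yz 0) Psi ->
  (\forall t \near (0 : R), bis (yz t) (Psi t)) ->
  let v := 'D_1 (cmap c \o yz) 0 in
  'D_1 (fun t => kapX k c d (jet k (yz t) (Psi t))) 0 =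
  (v, coefs k (fun J => 'D_(1, v) (iter_deriv (map (pair (0 : R)) (map e J))
         (fun p : R * 'rV[R]_n => hat c d (Psi p.1) p.2)) (0, cmap c (yz 0)))).
Proof.
move=> ac ad cy dP py pf nb v.
have [nc sy] := plotE py ac cy; have [sh nd] := family_hat pf ad dP.
set f := (fun p : R * 'rV[R]_n => hat c d (Psi p.1) p.2) in sh *.
pose B (t : R) := (t, (cmap c \o yz) t).
have sB : sm B 0 by apply: sm_pair => //; exact: sm_id.
have DB : 'D_1 B 0 = (1, v).
  by rewrite derive_pair ?derive_id //; exact: sm_diff.
pose C (t : R) J := iter_deriv (map (pair (0 : R)) (map e J)) f (B t).
have sC J : sm (fun t => C t J) 0.
  by apply: (@sm_comp _ _ _ _ (iter_deriv (map (pair (0 : R)) (map e J)) f) B) => //; exact: sm_iter.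
have dP' : \forall t \near (0 : R), cdom d (Psi t (yz t)).
  have := nearI nc (near_comp (sm_cont sB) nd).
  by apply: filterS => t [ct] /=; rewrite cmapK.
transitivity ('D_1 (fun t => ((cmap c \o yz) t, coefs k (C t))) 0).
  apply: near_eq_derive; have := nearI nb (nearI nc dP').
  apply: filterS => t [bt [ct dt]]; rewrite kapX_jet //; congr (_, coefs k _).
  by apply/funext => J; rewrite /C /jetc (iter_partial f).
rewrite derive_pair; [|exact: sm_diff|by apply: sm_diff; exact: sm_coefs].
have DC : (fun J => 'D_1 (fun t => C t J) 0) = (fun J => 'D_(1, v) (iter_deriv (map (pair (0 : R)) (map e J)) f) (B 0)).
  apply/funext => J; rewrite -DB -(@derive_comp _ _ _ _ B) //; first exact: sm_diff.
  by apply: sm_diff; exact: sm_iter.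
have := @derive_coefs R k C 0 1 (fun J _ => sC J); rewrite DC => DC'.
by rewrite -DC'.
Qed.

End Tau.

(** * Sections of the algebroid *)

Section Sections.
Context {R : realType} (G : lie_groupoid R).
Local Notation I := (base G).
Local Notation n := (mdim I).
Local Notation m := (mdim (arrows G)).
Local Notation e := (fun i : 'I_n => delta_mx ord0 i : 'rV[R]_n).
Local Notation one := (@unit_ R G).
Implicit Types (k l : nat) (F H : I -> arrows G) (x y z : I) (E : normedModType R)
  (c : chart R I n) (d : chart R (arrows G) m).

Definition shat c d : 'rV[R]_m -> 'rV[R]_n := cmap c \o (@src R G \o cinv d).

(* [th] is, in the chart [d], a section of ker s_* along the identities *)
Definition vert c d (th : 'rV[R]_n -> 'rV[R]_m) z : Prop :=
  sm th (cmap c z) /\ \forall w \near cmap c z, 'D_(th w) (shat c d) (hat c d one w) = 0.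

Definition sect c d (th : 'rV[R]_n -> 'rV[R]_m) : I -> (arrows G -> R) -> R :=
  fun y => tanv d (one y) (th (cmap c y)).

Lemma sm_shat c d X : atlas c -> atlas d -> cdom d X -> cdom c (src X) ->
  sm (shat c d) (cmap d X) /\ \forall q \near cmap d X, cdom c (src (cinv d q)).
Proof.
move=> ac ad dX cX; have pS : plot (@src R G \o cinv d) (cmap d X) by exact: (@mmap_src _ _ X _ ad dX).
by have [|nS sS] := plotE pS ac; first by rewrite /= cmapK.
Qed.

Lemma uhatE c d z : cdom c z -> hat c d one (cmap c z) = cmap d (one z).
Proof. by move=> cz; rewrite /hat /= cmapK. Qed.

Lemma sm_shat_one c d z : atlas c -> atlas d -> cdom c z -> cdom d (one z) ->
  sm (shat c d) (hat c d one (cmap c z)).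
Proof. by move=> ac ad cz dz; rewrite uhatE //; have [|] := sm_shat ac ad dz; first by rewrite src_unit. Qed.

Lemma shat_uhat c d z : atlas c -> atlas d -> cdom c z -> cdom d (one z) ->
  \forall w \near cmap c z, shat c d (hat c d one w) = w.
Proof.
move=> ac ad cz dz; have [_ nd] := sm_uhat ac ad cz dz.
have := nearI (near_cimg cz) nd; apply: filterS => w [/cinvK [cw we] dw].
by rewrite /shat /hat /= cmapK // src_unit we.
Qed.

Lemma vert_near c d th z : cdom c z -> vert c d th z -> \forall y \near z, vert c d th y.
Proof.
move=> cz [st vt].
exact: (near_comp (cmap_cont cz) (P := fun w => sm th w /\ _) (nearI (sm_near st) (near_near vt))).
Qed.

(** The identities are moved by t th, then brought back into the source fibres by [rho]; as [th] is
    tangent to these fibres, this does not change the derivative at t = 0. *)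
Lemma gen_ex c d th z : atlas c -> atlas d -> cdom c z -> cdom d (one z) -> vert c d th z ->
  exists F : R -> I -> arrows G, generates z (sect c d th) F.
Proof.
move=> ac ad cz dz [st vt].
have [rho [srho rho0 srcrho rhoK]] := retraction ac ad cz dz (bis_unit z).
have [su nu] := sm_uhat ac ad cz dz; set u := hat c d one in su vt *.
have uz : u (cmap c z) = cmap d (one z) by exact: uhatE.
pose Q (p : R * 'rV[R]_n) := u p.2 + p.1 *: th p.2.
pose r (p : R * 'rV[R]_n) := rho (p.2, Q p).
have sQ p : sm u p.2 -> sm th p.2 -> sm Q p.
  move=> h1 h2; apply: smD; first by apply: (@sm_comp _ _ _ _ u snd) => //; exact: sm_snd.
  apply: sm_scale; first exact: sm_fst.
  by apply: (@sm_comp _ _ _ _ th snd) => //; exact: sm_snd.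
have Q0 w : Q (0, w) = u w by rewrite /Q /= scale0r addr0.
have sB : sm (fun p : R * 'rV[R]_n => (p.2, Q p)) (0, cmap c z).
  by apply: sm_pair; [exact: sm_snd|exact: sQ].
have sr : sm r (0, cmap c z) by apply: sm_comp => //; rewrite /= Q0 uz.
have r0 : r (0, cmap c z) = cmap d (one z) by rewrite /r /= Q0 uz rho0.
pose F (t : R) y := cinv d (r (t, cmap c y)).
have nimg : \forall p \near ((0 : R), cmap c z), (cmap c @` cdom c) p.2 := near_snd _ (near_cimg cz).
have pr : plot (fun p => cinv d (r p)) (0, cmap c z).
  by apply: (@plot_comp _ _ _ _ (cinv d) r) => //; rewrite r0; exact: plot_chart.
have pF : plot (fun p : R * 'rV[R]_n => F p.1 (cinv c p.2)) (0, cmap c z).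
  apply: plot_ext pr; by apply: filterS nimg => -[t w] /cinvK [_ /= we]; rewrite /F we.
(* Differentiate rho (S q, q) = q, where S is the source map in charts, along [th w], which the
   differential of S kills. *)
have rK : \forall w \near cmap c z, rho (w, u w) = u w /\ 'D_(0, th w) rho (w, u w) = th w.
  have n1 := near_comp (sm_cont su) (P := fun q => nbhs q (fun q => cdom c (src (cinv d q)) /\ rho (cmap c (src (cinv d q)), q) = q)).
  rewrite uz in n1; have {}n1 := n1 (near_near rhoK).
  have sBw : sm (fun w => (w, u w)) (cmap c z) by apply: sm_pair => //; exact: sm_id.
  have n2 := near_comp (sm_cont sBw) (P := fun p => sm rho p).
  rewrite uz in n2; have {}n2 := n2 (sm_near srho).
  have n3 := near_comp (sm_cont su) (P := fun q => sm (shat c d) q) (sm_near (sm_shat_one ac ad cz dz)).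
  have := nearI n1 (nearI n2 (nearI n3 (nearI vt (shat_uhat ac ad cz dz)))).
  apply: filterS => w [m1 [m2 [m3 [m4 m5]]]].
  have Sw : shat c d (u w) = w by exact: m5.
  have [_ e1] := nbhs_singleton m1.
  have e1' : rho (w, u w) = u w by rewrite -{1}Sw.
  split=> //.
  have ds : differentiable (fun q => (shat c d q, q)) (u w).
    by apply: differentiable_pair => //; exact: sm_diff.
  have Dp : 'D_(th w) (fun q => (shat c d q, q)) (u w) = (0, th w).
    rewrite derive_pair //; last exact: sm_diff.
    by rewrite (m4 : 'D_(th w) (shat c d) (u w) = 0) derive_id.
  have := @derive_comp _ _ _ _ (fun q => (shat c d q, q)) rho (u w) (th w) ds.
  rewrite Dp Sw => <-; last exact: sm_diff.
  have nE : \forall q \near u w, (rho \o (fun q => (shat c d q, q))) q = id q by apply: filterS m1 => q [].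
  by rewrite (near_eq_derive _ nE) derive_id.
have F0 : \forall y \near z, F 0 y = one y.
  apply: (chart_near cz); have := nearI (near_cimg cz) (nearI rK nu).
  apply: filterS => w [/cinvK [cw we] [[e1 _] dw]].
  by rewrite /F /r we /= Q0 e1 /u /hat /= cmapK.
have fam : family c (0 : R) z F.
  split=> //; last by apply: (bis_ext _ (bis_unit z)); apply: filterS F0 => y ->.
  have n1 := near_comp (sm_cont sB) (P := fun p => src (cinv d (rho p)) = cinv c p.1).
  rewrite /= Q0 uz in n1; have := nearI nimg (n1 srcrho).
  by apply: filterS => -[t w] /= [/cinvK [_ we]]; rewrite /F we.
exists F; split=> //.
- move=> c1 ac1 c1z; have [_ pF1 _ _] := family_chart findim_real ac1 c1z fam; exact: pF1.
- have [c' ac' cy] := atlas_cover (tgt (F 0 z)).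
  have := near_slicel (family_bis findim_real fam ac' cy).
  by apply: filterS => t /=; rewrite cmapK.
- apply: (chart_near cz).
  have := nearI (near_slice (plot_near pr)) (nearI (near_cimg cz) (nearI rK (nearI nu (near_slice (sm_near sr))))).
  apply: filterS => w [pw [/cinvK [cw we] [[e1 e2] [dw srw]]]].
  pose g (t : R) := F t (cinv c w).
  have gE t : g t = cinv d (r (t, w)) by rewrite /g /F we.
  have g0 : g 0 = one (cinv c w) by rewrite gE /r /= Q0 e1 /u /hat /= cmapK.
  have pg : plot g 0.
    apply: (@plot_ext _ _ _ (fun t => cinv d (r (t, w)))); first by near=> t; rewrite gE.
    apply: (@plot_comp _ _ _ _ (fun p => cinv d (r p)) (fun t : R => (t, w))) => //.
    exact: sm_pairl.
  have dg : cdom d (g 0) by rewrite g0.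
  have := velocity_tanv ad dg pg; rewrite g0 => ->.
  rewrite /sect we; congr (tanv d _ _).
  have rw0 : r (0, w) = u w by rewrite /r /= Q0.
  have nimd : \forall t \near (0 : R), (cmap d @` cdom d) (r (t, w)).
    have sl : sm (fun t : R => r (t, w)) 0.
      by apply: (@sm_comp _ _ _ _ r (fun t : R => (t, w))) => //; exact: sm_pairl.
    apply: (near_comp (P := fun q => (cmap d @` cdom d) q) (sm_cont sl)).
    by rewrite rw0 /u /hat /=; exact: near_cimg.
  transitivity ('D_1 (fun t : R => rho (w, u w + t *: th w)) 0); last first.
    apply: near_eq_derive; apply: filterS nimd => t /cinvK [_ re].
    by rewrite /= gE re.
  rewrite (@derive_affine _ _ _ _ (fun t : R => (w, u w + t *: th w)) rho 0 1 (0, th w)).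
    by rewrite scale0r addr0 e2.
  move=> h; rewrite -[RHS]/(h *: (0 : 'rV[R]_n) + w, h *: th w + (u w + 0 *: th w)).
  by rewrite scaler0 add0r scale0r addr0 addr0 -[h *: 1]/(h * 1) mulr1 addrC.
Unshelve. all: by end_near. Qed.

Lemma generates_ext z th th' (F : R -> I -> arrows G) : (\forall y \near z, th y = th' y) -> generates z th F -> generates z th' F.
Proof.
move=> tt [g1 g2 g3 g4]; split=> //.
by have := nearI tt g4; apply: filterS => y [<-].
Qed.

(** The derivative in t commutes with those that define the jet coordinates. *)
Lemma gen_kapX k c d th z s (F : R -> I -> arrows G) : atlas c -> atlas d ->
  cdom c z -> cdom d (one z) -> (\forall y \near z, s y = sect c d th y) -> generates z s F ->
  [/\ jplot k (fun t => jet k z (F t)) 0, jet k z (F 0) = jet k z one &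
    'D_1 (fun t => kapX k c d (jet k z (F t))) 0 = (0, coefs k (jetc th (cmap c z)))].
Proof.
move=> ac ad cz dz sE [g1 g2 g3 g4].
have F0z : F 0 z = one z := nbhs_singleton g2.
have pf : pfamily c 0 z F by split=> //; exact: g1.
split.
- apply: (@plot_jet_gen _ _ _ c 0 F (fun _ => z) k findim_real _ pf g3); exact: plot_cst.
- exact: jet_near.
have dF : cdom d (F 0 z) by rewrite F0z.
have [sf nf] := family_hat pf ad dF.
set f := (fun p : R * 'rV[R]_n => hat c d (F p.1) p.2) in sf *.
rewrite (@derive_kapX _ _ k c d (fun _ => z) F) //; last exact: plot_cst.
have -> : 'D_1 (cmap c \o (fun _ : R => z)) 0 = 0 by exact: derive_cst.
congr (_, coefs k _); apply/funext => J; rewrite -/f.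
rewrite derive_iterC // -(iter_partial ('D_(1, 0) f)) /jetc.
suff key : \forall w \near cmap c z, 'D_(1, 0) f (0, w) = th w.
  exact: (nbhs_singleton (near_iter_deriv_eq (map e J) key)).
have := nearI (near_cimg cz) (nearI (near_chart cz g4) (nearI (near_chart cz sE)
  (nearI (near_chart cz g2) (nearI (near_slice nf) (near_slice (plot_near (g1 c ac cz))))))).
apply: filterS => w [/cinvK [cw we] [e4 [es [e2 [dw pw]]]]].
have pg : plot (fun t : R => F t (cinv c w)) 0.
  apply: (@plot_comp _ _ _ _ (fun p : R * 'rV[R]_n => F p.1 (cinv c p.2)) (fun t : R => (t, w))) => //.
  exact: sm_pairl.
rewrite es /sect we (velocity_tanv ad) // e2 in e4.
rewrite /= e2 in dw.
rewrite (tanv_inj ad dw e4); apply/esym.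
apply: (@derive_affine _ _ _ _ (fun t : R => (t, w)) f 0 1 (1, 0)) => h.
by rewrite -[RHS]/(h *: 1 + 0, h *: (0 : 'rV[R]_n) + w) scaler0 add0r.
Qed.

(** The right-hand side does not mention [F]: the choice made in [jprol] is immaterial. *)
Lemma gen_velocity k c d A th z s (F : R -> I -> arrows G) : atlas c -> atlas d ->
  jchart_at (k := k) c d A z -> (\forall y \near z, s y = sect c d th y) -> generates z s F ->
  velocity (S := jspace G k) (fun t => jet k z (F t)) = tau c d A z (0, coefs k (jetc th (cmap c z))).
Proof.
move=> ac ad gz sE gF; have [cz dz _ _] := gz.
have [pj g0 Dg] := gen_kapX k ac ad cz dz sE gF.
by rewrite (tau_velocity ac ad gz pj g0) Dg.
Qed.

(** [tau] need not be injective, but the jet of a vertical section is the derivative of the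
    coordinates of a curve of jets. Each coordinate is a smooth function on G_k, on which the vector
    can be evaluated. *)
Lemma tau_vert_inj k c d A th z : atlas c -> atlas d -> jchart_at (k := k) c d A z -> vert c d th z ->
  tau c d A z (0, coefs k (jetc th (cmap c z))) = 0 ->
  forall J, (size J <= k)%N -> jetc th (cmap c z) J = 0.
Proof.
move=> ac ad gz vz t0 J sJ; have [cz dz _ _] := gz.
have [F gF] := gen_ex ac ad cz dz vz.
have sE : \forall y \near z, sect c d th y = sect c d th y by near=> y.
have [pj g0 Dg] := gen_kapX k ac ad cz dz sE gF.
have vel := gen_velocity ac ad gz sE gF; rewrite t0 in vel.
suff C0 : coefs k (jetc th (cmap c z)) = 0.
  have C0' : coefs k (fun _ => 0 : 'rV[R]_m) = coefs k (jetc th (cmap c z)).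
    by rewrite C0; apply/matrixP => i j; rewrite !mxE.
  by rewrite -(coefK (jetc th (cmap c z)) sJ) -C0' coefK.
have cj : cdom c (jet k z (F 0)).1 by [].
have dj : cdom d (jval (jet k z (F 0))) by rewrite g0 jval_jet //; exact: bis_unit.
have sk := sm_kapX ac ad cj dj pj.
apply/matrixP => i j; rewrite mxE.
pose h (X : jets G) : R := (kapX k c d X).2 i j.
pose L (p : jcoord G k) : R := p.2 i j.
have sL p : sm L p by apply: sm_entry; exact: sm_snd.
have dh : dfun (d := jspace G k) h (jet k z (F 0)).
  move=> p B y By pB; rewrite -By in cj dj.
  have sB := sm_kapX ac ad cj dj pB.
  have e0 : h \o B = (fun w => L (kapX k c d (B w))) by [].
  rewrite e0. by apply: (@sm_comp _ _ _ _ L (fun w => kapX k c d (B w))).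
have := congr1 (fun v => v h) vel; rewrite /velocity /push asboolT // derive1E.
rewrite -[h \o _]/(L \o (fun t => kapX k c d (jet k z (F t)))) derive_comp; [|exact: sm_diff|exact: sm_diff].
rewrite Dg /L (@derive_affine _ _ _ _ snd (fun P : 'M[R]_(_, m) => P i j) _ _ (coefs k (jetc th (cmap c z)))) //.
by rewrite derive_coord mxE => ->; rewrite mxE.
Unshelve. all: by end_near. Qed.

Lemma jprol_gen k c d th z s : atlas c -> atlas d -> cdom c z -> cdom d (one z) -> vert c d th z ->
  (\forall y \near z, s y = sect c d th y) ->
  exists2 F : R -> I -> arrows G, generates z s F &
    jprol k s z = velocity (S := jspace G k) (fun t => jet k z (F t)).
Proof.
move=> ac ad cz dz vz sE.
pose S := [set xi : (jets G -> R) -> R | exists2 F, generates z s F &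
                     xi = velocity (S := jspace G k) (fun t => jet k z (F t))].
suff : S (jprol k s z) by [].
apply: (@xgetPex ((jets G -> R) -> R)%type 0 S).
have [F gF] := gen_ex ac ad cz dz vz.
exists (velocity (S := jspace G k) (fun t => jet k z (F t))); exists F => //.
by apply: generates_ext gF; apply: filterS sE => y ->.
Qed.

Lemma jprol_tau k c d A th z s : atlas c -> atlas d -> jchart_at (k := k) c d A z -> vert c d th z ->
  (\forall y \near z, s y = sect c d th y) ->
  jprol k s z = tau c d A z (0, coefs k (jetc th (cmap c z))).
Proof.
move=> ac ad gz vz sE; have [cz dz _ _] := gz.
have [F gF ->] := jprol_gen k ac ad cz dz vz sE; exact: gen_velocity gF.
Qed.

Lemma gsec_sect c d th x : atlas c -> atlas d -> cdom c x -> cdom d (one x) -> vert c d th x ->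
  algd_sec (Gam := gpd_of G) x (sect c d th).
Proof.
move=> ac ad cx dx vx; have [st vt] := vx; have [su nu] := sm_uhat ac ad cx dx.
have nd : \forall y \near x, cdom d (one y).
  by apply: (chart_near cx); exact: nu.
split.
- have := nearI (near_cdom cx) (nearI nd (vert_near cx vx)).
  apply: filterS => y [cy [dy [sy vy]]]; split; first exact: tangent_tanv.
  apply/funext => h; rewrite /push /=; case: asboolP => // sh.
  rewrite src_unit in sh.
  have sh1 : smooth_fun (h \o @src R G) (one y).
    by apply: fun_comp; [exact: mmap_src|rewrite src_unit].
  rewrite /sect /tanv asboolT //.
  have [|sS nS] := sm_shat (c := c) ac ad dy; first by rewrite src_unit.
  have Sy : shat c d (cmap d (one y)) = cmap c y by rewrite /shat /= cmapK // src_unit.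
  transitivity ('D_(th (cmap c y)) ((h \o cinv c) \o shat c d) (cmap d (one y))).
    by apply: near_eq_derive; apply: filterS nS => q cq; rewrite /shat /= cmapK.
  rewrite derive_comp; [|exact: sm_diff|by rewrite Sy; exact: sm_diff (sh c ac cy)].
  have := nbhs_singleton vy; rewrite uhatE // => ->.
  by rewrite derive0.
- move=> h sh; apply: (fun_chart ac cx).
  have n1 : \forall y \near x, smooth_fun h (one y).
    by apply: (near_comp (map_cont (@unit_smooth _ G x))); exact: fun_near.
  apply: (@sm_near_ext _ _ _ (fun w => 'D_(th w) (h \o cinv d) (hat c d one w))).
    have := nearI (near_cimg cx) (near_chart cx n1).
    apply: filterS => w [/cinvK [cw we] sw].
  have he : hat c d one w = cmap d (one (cinv c w)) by [].
  by rewrite he [RHS]/= /sect /tanv (asboolT sw) we.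
  by apply: sm_D => //; rewrite uhatE //; exact: sh.
Qed.

End Sections.

(** * The bracket in coordinates *)

Lemma agreeB (R : realType) k (E W : normedModType R) (f f' g g' : E -> W) x :
  sm f x -> sm f' x -> sm g x -> sm g' x -> agree k f f' x -> agree k g g' x ->
  agree k (fun y => f y - g y) (fun y => f' y - g' y) x.
Proof.
move=> sf sf' sg sg' ff gg vs s.
rewrite (iter_derivD vs sf (smN sg)) (iter_derivD vs sf' (smN sg')) ff //.
have L (h : E -> W) : sm h x -> iter_deriv vs (fun y => - h y) x = - iter_deriv vs h x.
  move=> sh; rewrite -scaleN1r -iter_derivZ //; congr (iter_deriv vs _ x).
  by apply/funext => y; rewrite scaleN1r.
by rewrite !L // gg.
Qed.

Lemma derive_bracket_lin (R : realType) (E : normedModType R) (f g h b : E -> E) (q : E) (a : R) :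
  differentiable f q -> differentiable g q -> differentiable h q ->
  (\forall r \near q, b r = a *: f r + g r) ->
  'D_(b q) h q - 'D_(h q) b q =
  a *: ('D_(f q) h q - 'D_(h q) f q) + ('D_(g q) h q - 'D_(h q) g q).
Proof.
move=> df dg dh nb.
have e1 : 'D_(b q) h q = a *: 'D_(f q) h q + 'D_(g q) h q.
  rewrite (nbhs_singleton nb).
  exact: (etrans (deriveDv _ _ dh) (congr1 (+%R^~ _) (deriveZv _ _ dh))).
have daf : differentiable (fun r => a *: f r) q by exact: differentiableZ.
have e2 : 'D_(h q) b q = a *: 'D_(h q) f q + 'D_(h q) g q.
  apply: (etrans (near_eq_derive _ nb)).
  exact: (etrans (deriveDf _ daf dg) (congr1 (+%R^~ _) (deriveZf _ _ df))).
by rewrite e1 e2 scalerBr opprD addrACA.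
Qed.

Section Bracket.
Context {R : realType} (G : lie_groupoid R).
Local Notation I := (base G).
Local Notation n := (mdim I).
Local Notation m := (mdim (arrows G)).
Local Notation one := (@unit_ R G).

Implicit Types (th mu : 'rV[R]_n -> 'rV[R]_m).

Section Local.
Variables (c : chart R I n) (d : chart R (arrows G) m) (x : I)
  (mt : 'rV[R]_m * 'rV[R]_m -> 'rV[R]_m).
Hypotheses (ac : atlas c) (ad : atlas d) (cx : cdom c x) (dx : cdom d (one x)).

Let T := cmap c \o (@tgt R G \o cinv d).
Let S := shat c d.
Let u := hat c d one.
Let r0 := cmap d (one x).

Definition mul_at (p : 'rV[R]_m * 'rV[R]_m) : Prop :=
  src (cinv d p.1) = tgt (cinv d p.2) ->
      cdom d (mul (cinv d p.1) (cinv d p.2)) /\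
      mt p = cmap d (mul (cinv d p.1) (cinv d p.2)).

Definition mul_coord : Prop := sm mt (r0, r0) /\ \forall p \near (r0, r0), mul_at p.

Hypothesis hm : mul_coord.

(* the right invariant vector field extending [th]: see [rinv_bar] *)
Definition bar (th : 'rV[R]_n -> 'rV[R]_m) (r : 'rV[R]_m) : 'rV[R]_m :=
  'D_(th (T r), 0) mt (u (T r), r).

(* the bracket of the algebroid: see [abracket_sect] *)
Definition brk (th mu : 'rV[R]_n -> 'rV[R]_m) (w : 'rV[R]_n) : 'rV[R]_m :=
  'D_(bar th (u w)) (bar mu) (u w) - 'D_(bar mu (u w)) (bar th) (u w).

Lemma sm_that : sm T r0 /\ \forall r \near r0, cdom c (tgt (cinv d r)).
Proof.
have pT : plot (@tgt R G \o cinv d) r0 by exact: (@mmap_tgt _ _ (one x) _ ad dx).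
by have [|nT sT] := plotE pT ac; first by rewrite /= cmapK // tgt_unit.
Qed.

Lemma that_one : T r0 = cmap c x. Proof. by rewrite /T /r0 /= cmapK // tgt_unit. Qed.
Lemma uhat_one : u (cmap c x) = r0. Proof. exact: uhatE. Qed.

Lemma sm_u : sm u (cmap c x). Proof. by have [] := sm_uhat ac ad cx dx. Qed.

Lemma near_u (P : 'rV[R]_m -> Prop) : (\forall r \near r0, P r) -> \forall w \near cmap c x, P (u w).
Proof. by move=> Pr; apply: (near_comp (sm_cont sm_u)); rewrite uhat_one. Qed.

Lemma sm_uT : sm (fun r => (u (T r), r)) r0.
Proof.
apply: sm_pair; last exact: sm_id.
have [sT _] := sm_that.
by apply: (@sm_comp _ _ _ _ u T) => //; rewrite that_one; exact: sm_u.
Qed.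

Lemma uT_one : (u (T r0), r0) = (r0, r0). Proof. by rewrite that_one uhat_one. Qed.

Lemma sm_thT th : sm th (cmap c x) -> sm (fun r => (th (T r), 0 : 'rV[R]_m)) r0.
Proof.
move=> sth; apply: sm_pair; last exact: sm_cst.
have [sT _] := sm_that.
by apply: (@sm_comp _ _ _ _ th T) => //; rewrite that_one.
Qed.

Lemma sm_bar th : sm th (cmap c x) -> sm (bar th) r0.
Proof.
move=> sth; apply: (@sm_D _ _ _ _ mt (fun r => (u (T r), r)) (fun r => (th (T r), 0))) => //.
- by rewrite uT_one; exact: hm.1.
- exact: sm_uT.
- exact: sm_thT.
Qed.

(** Shows that the velocity of e |-> g e X depends on [g] only through its velocity. *)
Lemma bar_curve (X : arrows G) (g : R -> arrows G) q : cdom d X -> cdom d (one (tgt X)) ->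
  sm mt (cmap d (one (tgt X)), cmap d X) ->
  (\forall p \near (cmap d (one (tgt X)), cmap d X), mul_at p) ->
  g 0 = one (tgt X) -> plot g 0 -> (\forall e \near (0 : R), src (g e) = tgt X) ->
  tanv d (one (tgt X)) q = velocity (S := mspace (arrows G)) g ->
  [/\ plot (fun e => mul (g e) X) 0,
      \forall e \near (0 : R), cdom d (mul (g e) X) &
      'D_1 (fun e => cmap d (mul (g e) X)) 0 = 'D_(q, 0) mt (cmap d (one (tgt X)), cmap d X)].
Proof.
move=> dX dt smt mtE g0 pg sg qg.
have p0 : plot (fun e => mul (g e) X) 0.
  by apply: plot_mul => //; exact: plot_cst.
have dg0 : cdom d (g 0) by rewrite g0.
have [ng sgh] := plotE pg ad dg0.
have dm0 : cdom d (mul (g 0) X) by rewrite g0 mul_unitl.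
have [nm _] := plotE p0 ad dm0.
split; [exact: p0|exact: nm|].
rewrite (velocity_tanv ad dg0 pg) g0 in qg; have -> := tanv_inj ad dt qg.
have sp : sm (fun e : R => ((cmap d \o g) e, cmap d X)) 0 by apply: sm_pair sgh (sm_cst _ _).
have gX0 : (cmap d (g 0), cmap d X) = (cmap d (one (tgt X)), cmap d X) by rewrite g0.
transitivity ('D_1 (mt \o (fun e : R => ((cmap d \o g) e, cmap d X))) 0); last first.
  rewrite (derive_comp _ (sm_diff sp)) /=; last by rewrite gX0; exact: sm_diff smt.
  by rewrite gX0 (derive_pair _ (sm_diff sgh) (sm_diff (sm_cst _ _))) derive_cst.
apply: near_eq_derive.
have := near_comp (sm_cont sp) (P := mul_at).
rewrite /= g0 => /(_ mtE) n1; have := nearI n1 (nearI ng sg).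
by apply: filterS => e [H [dge sge]]; move: H; rewrite /mul_at /= !cmapK // => /(_ sge) [_ ->].
Qed.

Lemma near_bar_curve : \forall X \near one x,
  [/\ cdom d X, cdom d (one (tgt X)), cdom c (tgt X),
  sm mt (cmap d (one (tgt X)), cmap d X) &
  \forall p \near (cmap d (one (tgt X)), cmap d X), mul_at p].
Proof.
have [smt mtE] := hm.
have ct : {for one x, continuous (fun X => tgt X)} by apply: map_cont; exact: mmap_tgt.
have [_ nd] := sm_uhat ac ad cx dx; have {}nd : \forall y \near x, cdom d (one y) by exact: (chart_near cx nd).
have N1 := near_comp ct (P := fun y => cdom c y /\ cdom d (one y)).
rewrite tgt_unit in N1; have {}N1 := N1 (nearI (near_cdom cx) nd).
have sB := sm_uT; have N2 := near_comp (sm_cont sB) (P := fun p => sm mt p /\ nbhs p mul_at).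
rewrite uT_one in N2; have {}N2 := N2 (nearI (sm_near smt) (near_near mtE)).
have := nearI (near_cdom dx) (nearI N1 (near_comp (cmap_cont dx) N2)).
apply: filterS => X [dX [[cX dt]]] /=.
have -> : T (cmap d X) = cmap c (tgt X) by rewrite /T /= cmapK.
by rewrite /u uhatE // => -[sX nX]; split.
Qed.

Lemma bar_one (X : arrows G) th : cdom d X -> cdom c (tgt X) ->
  bar th (cmap d X) = 'D_(th (cmap c (tgt X)), 0) mt (cmap d (one (tgt X)), cmap d X).
Proof.
move=> dX cX; have TX : T (cmap d X) = cmap c (tgt X) by rewrite /T /= cmapK.
by rewrite /bar TX /u (uhatE d cX).
Qed.

Lemma rinv_bar th : vert c d th x -> \forall X \near one x,
  rinv_field (sect c d th) X = tanv d X (bar th (cmap d X)) /\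
  'D_(bar th (cmap d X)) S (cmap d X) = 0.
Proof.
move=> vth.
have ct : {for one x, continuous (fun X => tgt X)} by apply: map_cont; exact: mmap_tgt.
have cs : {for one x, continuous (fun X => src X)} by apply: map_cont; exact: mmap_src.
have N1 := near_comp ct (P := fun y => vert c d th y).
rewrite tgt_unit in N1; have {}N1 := N1 (vert_near cx vth).
have N2 := near_comp cs (P := fun y => cdom c y).
rewrite src_unit in N2; have {}N2 := N2 (near_cdom cx).
have := nearI near_bar_curve (nearI N1 N2).
apply: filterS => X [[dX dt cX smt mtE] [vX csX]].
have key (g : R -> arrows G) : g 0 = one (tgt X) -> plot g 0 ->
    (\forall e \near (0 : R), src (g e) = tgt X) ->
    sect c d th (tgt X) = velocity (S := mspace (arrows G)) g ->
    velocity (S := mspace (arrows G)) (fun e => mul (g e) X) = tanv d X (bar th (cmap d X)) /\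
    'D_(bar th (cmap d X)) S (cmap d X) = 0.
  move=> g0 pg sg gE; have [pm nm Dm] := bar_curve dX dt smt mtE g0 pg sg gE.
  have m0 : mul (g 0) X = X by rewrite g0 mul_unitl.
  have dm0 : cdom d (mul (g 0) X) by rewrite m0.
  rewrite (bar_one th dX cX) -Dm; split.
    have := velocity_tanv ad dm0 pm; rewrite m0 => ->; congr (tanv d X _).
  have [_ sm0] := plotE pm ad dm0.
  have dS : differentiable S (cmap d (mul (g 0) X)).
    by rewrite m0; have [sS _] := sm_shat ac ad dX csX; exact: sm_diff sS.
  have := @derive_comp _ _ _ _ (cmap d \o (fun e : R => mul (g e) X)) S 0 1 (sm_diff sm0) dS; rewrite /= m0 => <-.
  rewrite -[RHS](derive_cst (cmap c (src X)) (0 : R) 1).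
  apply: near_eq_derive; have := nearI nm sg; apply: filterS => e [dme sge] /=.
  by rewrite /S /shat /= cmapK // src_mul.
have [F [g1 g2 g3 g4]] := gen_ex ac ad cX dt vX.
have F0 : F 0 (tgt X) = one (tgt X) := nbhs_singleton g2.
have pF : plot (fun e : R => F e (tgt X)) 0.
  have p1 := g1 c ac cX.
  apply: (@plot_ext _ _ _ (fun e : R => F e (cinv c (cmap c (tgt X))))).
    by near=> e; rewrite cmapK.
  apply: (@plot_comp _ _ _ _ (fun p : R * 'rV[R]_n => F p.1 (cinv c p.2)) (fun e : R => (e, cmap c (tgt X)))) => //.
  exact: sm_pairl.
have sF : \forall e \near (0 : R), src (F e (tgt X)) = tgt X by apply: filterS g3 => e /bis_src.
have vF := nbhs_singleton g4.
have [_ DS] := key (fun e => F e (tgt X)) F0 pF sF vF; split=> //.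
pose Sx := [set w | exists b : R -> arrows G,
    [/\ b 0 = one (tgt X),
        dplot (d := mspace (arrows G)) b (0 : R),
        \forall e \near (0 : R), src (b e) = tgt X,
        sect c d th (tgt X) = velocity (S := mspace (arrows G)) b &
        w = velocity (S := mspace (arrows G)) (fun e => mul (b e) X)]].
have : Sx (rinv_field (sect c d th) X).
  apply: (@xgetPex ((arrows G -> R) -> R)%type 0 Sx).
  by exists (velocity (S := mspace (arrows G)) (fun e => mul (F e (tgt X)) X)), (fun e => F e (tgt X)).
by case=> g [h1 h2 h3 h4 ->]; have [] := key g h1 h2 h3 h4.
Unshelve. all: by end_near. Qed.

Lemma bar_tangent th : vert c d th x -> \forall r \near r0, 'D_(bar th r) S r = 0.
Proof.
move=> /rinv_bar H; have := nearI (near_cimg dx) (near_chart dx H).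
by apply: filterS => r [/cinvK [_ re] [_]]; rewrite re.
Qed.

Lemma abracket_sect th mu : vert c d th x -> vert c d mu x ->
  \forall y \near x, abracket (sect c d th) (sect c d mu) y = sect c d (brk th mu) y.
Proof.
move=> vt vm; have [st _] := vt; have [sm' _] := vm.
have c1 : {for x, continuous one} by apply: map_cont; exact: unit_smooth.
have N1 := near_comp c1 (near_near (nearI (rinv_bar vt) (rinv_bar vm))).
have N2 := near_comp c1 (near_comp (cmap_cont dx) (nearI (sm_near (sm_bar st)) (sm_near (sm_bar sm')))).
have := nearI (near_comp c1 (near_cdom dx)) (nearI (near_cdom cx) (nearI N1 N2)).
apply: filterS => y [dy [cy [H [s1 s2]]]].
rewrite /abracket (@vbracket_tanv _ _ d (one y) _ _ (bar th) (bar mu) ad dy s1 s2).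
- by rewrite /sect /brk /u (uhatE d cy).
- by apply: filterS H => X [[]].
- by apply: filterS H => X [_ []].
Qed.

Lemma sm_brk th mu : sm th (cmap c x) -> sm mu (cmap c x) -> sm (brk th mu) (cmap c x).
Proof.
have su := sm_u; move=> /sm_bar st /sm_bar sm'; rewrite -uhat_one in st sm'.
apply: smB.
  apply: (@sm_D _ _ _ _ (bar mu) u (fun w => bar th (u w))) => //.
  exact: (@sm_comp _ _ _ _ (bar th) u).
apply: (@sm_D _ _ _ _ (bar th) u (fun w => bar mu (u w))) => //.
exact: (@sm_comp _ _ _ _ (bar mu) u).
Qed.

(** Fields tangent to the source fibres are closed under bracket: differentiate D_b S = 0 along a,
    exchange the roles, and use the symmetry of the second derivatives of S. *)
Lemma vert_brk th mu : vert c d th x -> vert c d mu x -> vert c d (brk th mu) x.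
Proof.
move=> vt vm; have [st _] := vt; have [sm' _] := vm; split; first exact: sm_brk.
have [|sS _] := sm_shat ac ad dx (c := c); first by rewrite src_unit.
have := nearI (near_u (sm_near sS)) (nearI (nearI (near_u (sm_near (sm_bar st))) (near_u (sm_near (sm_bar sm'))))
  (nearI (near_u (near_near (bar_tangent vt))) (near_u (near_near (bar_tangent vm))))).
apply: filterS => w [s1 [[s2 s3] [h1 h2]]].
have L (a b : 'rV[R]_m -> 'rV[R]_m) : sm a (u w) -> sm b (u w) -> nbhs (u w) (fun r => 'D_(b r) S r = 0) ->
    'D_('D_(a (u w)) b (u w)) S (u w) = - 'D_(a (u w)) ('D_(b (u w)) S) (u w).
  move=> sa sb hb; apply/eqP; rewrite -addr_eq0; apply/eqP.
  have := @derive_D _ _ _ _ S id b (u w) (a (u w)) (findim_mx _ _) s1 (@sm_id _ _ _) sb.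
  rewrite derive_id => <-.
  rewrite -[RHS](derive_cst (0 : 'rV[R]_n) (u w) (a (u w))).
  exact: near_eq_derive.
rewrite /brk deriveBv; last exact: sm_diff.
have e3 := @schwarz _ _ _ S (u w) (bar th (u w)) (bar mu (u w)) (findim_mx _ _) s1.
apply/eqP; rewrite subr_eq0; apply/eqP.
exact: (etrans (L _ _ s2 s3 h2) (etrans (congr1 -%R (esym e3)) (esym (L _ _ s3 s2 h1)))).
Qed.

Lemma agree_bar k th th' : sm th (cmap c x) -> sm th' (cmap c x) -> agree k th th' (cmap c x) ->
  agree k (bar th) (bar th') r0.
Proof.
move=> st st' tt; have [sT _] := sm_that.
apply: (@agree_D _ k _ _ _ mt mt (fun r => (u (T r), r)) (fun r => (u (T r), r))
  (fun r => (th (T r), 0)) (fun r => (th' (T r), 0))) => //.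
- by rewrite uT_one; exact: hm.1.
- by rewrite uT_one; exact: hm.1.
- exact: sm_thT.
- exact: sm_thT.
- exact: sm_uT.
- exact: sm_uT.
- apply: agree_pair => //; rewrite -?that_one.
  + by apply: (@sm_comp _ _ _ _ th T) => //; rewrite that_one.
  + by apply: (@sm_comp _ _ _ _ th' T) => //; rewrite that_one.
  + exact: sm_cst.
  + exact: sm_cst.
  + by apply: (@agree_comp _ k _ _ _ T T th th') => //; rewrite that_one.
Qed.

(** The bracket differentiates its arguments once, whence the loss of one order; this is why the
    first bracket takes values in J^(k-1) g. *)
Lemma agree_brk k th th' mu mu' : sm th (cmap c x) -> sm th' (cmap c x) ->
  sm mu (cmap c x) -> sm mu' (cmap c x) ->
  agree k.+1 th th' (cmap c x) -> agree k.+1 mu mu' (cmap c x) ->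
  agree k (brk th mu) (brk th' mu') (cmap c x).
Proof.
move=> st st' sm1 sm2 tt mm; have su := sm_u.
have at' := agree_bar st st' tt; have am := agree_bar sm1 sm2 mm.
have [bt bt' bm bm'] : [/\ sm (bar th) r0, sm (bar th') r0, sm (bar mu) r0 & sm (bar mu') r0].
  by split; exact: sm_bar.
rewrite -uhat_one in at' am bt bt' bm bm'.
have L (a a' b b' : 'rV[R]_m -> 'rV[R]_m) : sm a (u (cmap c x)) -> sm a' (u (cmap c x)) ->
    sm b (u (cmap c x)) -> sm b' (u (cmap c x)) -> agree k.+1 a a' (u (cmap c x)) ->
    agree k.+1 b b' (u (cmap c x)) ->
    sm (fun w => 'D_(a (u w)) b (u w)) (cmap c x) /\
    agree k (fun w => 'D_(a (u w)) b (u w)) (fun w => 'D_(a' (u w)) b' (u w)) (cmap c x).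
  move=> sa sa' sb sb' aa bb.
  have sau : sm (fun w => a (u w)) (cmap c x) by exact: (@sm_comp _ _ _ _ a u).
  have sau' : sm (fun w => a' (u w)) (cmap c x) by exact: (@sm_comp _ _ _ _ a' u).
  split; first exact: (@sm_D _ _ _ _ b u (fun w => a (u w))).
  apply: (@agree_D _ k _ _ _ b b' u u (fun w => a (u w)) (fun w => a' (u w))) => //.
  by apply: (@agree_comp _ k _ _ _ u u a a') => //; exact: agreeW aa.
have [s1 a1] := L _ _ _ _ bt bt' bm bm' at' am.
have [s2 a2] := L _ _ _ _ bm bm' bt bt' am at'.
have [s3 _] := L _ _ _ _ bt' bt bm' bm (agree_sym at') (agree_sym am).
have [s4 _] := L _ _ _ _ bm' bm bt' bt (agree_sym am) (agree_sym at').
apply: (@agreeB _ k) => //.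
Qed.

Lemma brkC th mu w : brk mu th w = - brk th mu w.
Proof. by rewrite /brk opprB. Qed.

Lemma brk_linl a th th' mu : sm th (cmap c x) -> sm th' (cmap c x) -> sm mu (cmap c x) ->
  \forall w \near cmap c x, brk (fun w => a *: th w + th' w) mu w = a *: brk th mu w + brk th' mu w.
Proof.
move=> st st' smu.
have nm : \forall r \near r0, sm mt (u (T r), r).
  by have := near_comp (sm_cont sm_uT) (P := fun p => sm mt p); rewrite uT_one; apply; exact: sm_near hm.1.
have nb : \forall r \near r0, bar (fun w => a *: th w + th' w) r = a *: bar th r + bar th' r.
  apply: filterS nm => r /sm_diff dmt.
  rewrite /bar -[(a *: th (T r) + th' (T r), 0)]/((a *: th (T r) + th' (T r), 0) : 'rV[R]_m * 'rV[R]_m).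
  have -> : ((a *: th (T r) + th' (T r), 0) : 'rV[R]_m * 'rV[R]_m) =
      a *: ((th (T r), 0) : 'rV[R]_m * 'rV[R]_m) + (th' (T r), 0).
    by rewrite -[RHS]/(a *: th (T r) + th' (T r), a *: (0 : 'rV[R]_m) + 0) scaler0 addr0.
  exact: (etrans (deriveDv _ _ dmt) (congr1 (+%R^~ _) (deriveZv _ _ dmt))).
have := nearI (near_u (near_near nb)) (nearI (near_u (sm_near (sm_bar st)))
  (nearI (near_u (sm_near (sm_bar st'))) (near_u (sm_near (sm_bar smu))))).
apply: filterS => w [nbw [s1 [s2 s3]]].
exact: (derive_bracket_lin (sm_diff s1) (sm_diff s2) (sm_diff s3) nbw).
Qed.

Lemma brk_suml (A : Type) (s : seq A) (a : A -> R) (th : A -> 'rV[R]_n -> 'rV[R]_m) mu :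
  (forall t, sm (th t) (cmap c x)) -> sm mu (cmap c x) ->
  \forall w \near cmap c x, brk (fun w => \sum_(t <- s) a t *: th t w) mu w =
    \sum_(t <- s) a t *: brk (th t) mu w.
Proof.
move=> st smu; elim: s => [|t s IH].
  (* Writing 0 as -1 *: 0 + 0 shows that the bracket of 0 with [mu] is the sum of itself and its
     opposite. *)
  have := brk_linl (-1) (@sm_cst _ _ _ 0 _) (@sm_cst _ _ _ 0 _) smu.
  apply: filterS => w; rewrite big_nil.
  rewrite (_ : (fun w : 'rV[R]_n => \sum_(t <- [::]) a t *: th t w) = fun=> 0); last first.
    by apply/funext => w'; rewrite big_nil.
  rewrite (_ : (fun _ : 'rV[R]_n => -1 *: (0 : 'rV[R]_m) + 0) = fun=> 0); last first.
    by apply/funext => w'; rewrite scaler0 addr0.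
  by rewrite scaleN1r addNr.
have ss : sm (fun w => \sum_(t <- s) a t *: th t w) (cmap c x).
  by apply: sm_sum => i _; exact: (sm_scale (sm_cst _ _) (st i)).
have := nearI IH (brk_linl (a t) (st t) ss smu); apply: filterS => w [h1].
rewrite h1 big_cons => <-; congr (brk _ mu w).
by apply/funext => w'; rewrite big_cons.
Qed.

(** Constant coefficients suffice: those of D sigma are frozen at the point where the jet is
    taken. *)
Lemma brk_sum (A : Type) (s : seq A) (a b : A -> R) (th : A -> 'rV[R]_n -> 'rV[R]_m) :
  (forall t, sm (th t) (cmap c x)) ->
  \forall w \near cmap c x,
    brk (fun w => \sum_(t <- s) a t *: th t w) (fun w => \sum_(t <- s) b t *: th t w) w =
    \sum_(t <- s) \sum_(t' <- s) (a t * b t') *: brk (th t) (th t') w.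
Proof.
move=> st.
have ss : sm (fun w => \sum_(t <- s) b t *: th t w) (cmap c x).
  by apply: sm_sum => i _; exact: (sm_scale (sm_cst _ _) (st i)).
have H (l : seq A) : \forall w \near cmap c x, \sum_(t <- l) a t *: brk (th t) (fun w => \sum_(t <- s) b t *: th t w) w =
    \sum_(t <- l) \sum_(t' <- s) (a t * b t') *: brk (th t) (th t') w.
  elim: l => [|t l IH]; first by near=> w; rewrite !big_nil.
  have := nearI IH (brk_suml s b st (st t)); apply: filterS => w [h1 h2].
  rewrite !big_cons h1 brkC h2 -sumrN scaler_sumr; congr (_ + _); apply: eq_bigr => t' _.
  by rewrite (brkC (th t)) !scalerN opprK scalerA.
have := nearI (brk_suml s a st ss) (H s); apply: filterS => w [h1 h2]; exact: etrans h1 h2.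
Unshelve. all: by end_near. Qed.

End Local.
End Bracket.

(** * The non-linear Spencer operator in coordinates *)

Section NonLinear.
Context {R : realType} (G : lie_groupoid R).
Local Notation I := (base G).
Local Notation n := (mdim I).
Local Notation m := (mdim (arrows G)).
Local Notation bis := (bisection_at (Gam := gpd_of G)).
Local Notation bmulG := (bmul (Gam := gpd_of G)).
Local Notation binvG := (binv (Gam := gpd_of G)).
Local Notation one := (@unit_ R G).
Local Notation e := (fun i : 'I_n => delta_mx ord0 i : 'rV[R]_n).
Implicit Types (k l : nat) (F H : I -> arrows G) (x y z : I) (E : normedModType R)
  (c : chart R I n) (d : chart R (arrows G) m).

Lemma local_inv_ext x (f f' : I -> I) : (\forall y \near x, f y = f' y) ->
  local_inv x f = local_inv x f'.
Proof.
move=> ff; rewrite /local_inv; congr (xget _ _); apply/seteqP; split=> g /= gf.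
  by have := nearI ff gf; apply: filterS => y [<-].
by have := nearI ff gf; apply: filterS => y [->].
Qed.

(** [binv] depends on a base point through [local_inv]. To invert y |-> j^k_y phi, jets of inverses
    at varying base points have to come from one bisection. *)
Lemma binv_near x F : bis x F ->
  \forall y \near x, \forall y1 \near tgt (F y), binvG y F y1 = binvG x F y1.
Proof.
move=> bF; have [_ gf _ _] := local_invP bF.
have := nearI (bis_near bF) (near_near gf); apply: filterS => y [bFy ngf].
have [mgy _ fgy gyy] := local_invP bFy.
have cg := map_cont mgy.
have n1 := near_comp cg (P := fun y' => local_inv x (fun y => tgt (F y)) (tgt (F y')) = y').
rewrite gyy in n1; have := nearI fgy (n1 ngf).
by apply: filterS => y1 [e1 e2]; rewrite /binv /=; rewrite e1 in e2; rewrite e2.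
Qed.

Lemma bmul_binvl x F : bis x F -> \forall y \near x, bmulG (binvG x F) F y = one y.
Proof.
move=> bF; have [_ gf _ _] := local_invP bF.
have := nearI gf (bis_srcs bF); apply: filterS => y [e1 e2].
by rewrite /bmul /binv /= e1 mul_invl e2.
Qed.

Lemma tunit_velocity k (g : R -> I) z : g 0 = z -> plot g 0 ->
  tunit (Gam := jgpd G k) z (velocity (S := mspace I) g) =
  velocity (S := jspace G k) (fun t => jet k (g t) one).
Proof.
move=> g0 pg; apply/funext => h; rewrite /tunit /velocity /push /= g0.
case: asboolP => // dh; rewrite asboolT // => c ac cz.
apply: (@dfun_plot _ _ _ k h (fun w => jet k (cinv c w) one)); rewrite ?cmapK //.
by apply: (@unit_plot _ _ k z) => //; [exact: plot_chart|rewrite cmapK].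
Qed.

(** The same [mt] serves all H' with the value of [H] at the point, so products with different left
    factors can be compared. *)
Lemma mul_hat E c c' d1 d2 d (z0 : E) x Psi H : findim E -> family c z0 x Psi ->
  bis (tgt (Psi z0 x)) H -> atlas c' -> atlas d1 -> atlas d2 -> atlas d ->
  cdom c' (tgt (Psi z0 x)) -> cdom d1 (H (tgt (Psi z0 x))) -> cdom d2 (Psi z0 x) ->
  cdom d (bmulG H (Psi z0) x) ->
  exists mt : 'rV[R]_m * 'rV[R]_m -> 'rV[R]_m,
    sm mt (cmap d1 (H (tgt (Psi z0 x))), cmap d2 (Psi z0 x)) /\
    forall H', bis (tgt (Psi z0 x)) H' -> H' (tgt (Psi z0 x)) = H (tgt (Psi z0 x)) ->
      \forall p \near (z0, cmap c x), hat c d (bmulG H' (Psi p.1)) p.2 =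
        mt (hat c' d1 H' (cmap c' (tgt (Psi p.1 (cinv c p.2)))), hat c d2 (Psi p.1) p.2).
Proof.
move=> fE fam bH ac' ad1 ad2 ad cy d1H d2X d3.
have [mt [smt mtE]] := mul_extension bH erefl ad1 ad2 ad d1H d2X d3.
exists mt; split=> // H' bH' HH.
have [sP nP] := family_hat (family_pfamily fam) ad2 d2X.
have [[ac cx] _ _ _] := fam.
have [|nT sT] := plotE (plot_family_tgt fam) ac'; first by rewrite /= cmapK.
have [sH nH] := sm_map (bis_map bH') ac' ad1 cy (eq_ind_r (cdom d1) d1H HH).
pose t (p : E * 'rV[R]_n) := cmap c' (tgt (Psi p.1 (cinv c p.2))).
have t0 : t (z0, cmap c x) = cmap c' (tgt (Psi z0 x)) by rewrite /t /= cmapK.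
have ct : {for (z0, cmap c x), continuous t} by exact: sm_cont sT.
have N1 := near_comp ct (P := fun w => cdom d1 (H' (cinv c' w)) /\ src (H' (cinv c' w)) = cinv c' w).
rewrite t0 in N1; have {}N1 := N1 (nearI nH (near_chart cy (bis_srcs bH'))).
pose B (p : E * 'rV[R]_n) := (hat c' d1 H' (t p), hat c d2 (Psi p.1) p.2).
have sB : sm B (z0, cmap c x).
  by apply: sm_pair => //; apply: (@sm_comp _ _ _ _ (hat c' d1 H') t) => //; rewrite t0.
have B0 : B (z0, cmap c x) = (cmap d1 (H (tgt (Psi z0 x))), cmap d2 (Psi z0 x)).
  by rewrite /B t0 /hat /= !cmapK // HH.
have N2 := near_comp (sm_cont sB) (P := fun p => src (cinv d1 p.1) = tgt (cinv d2 p.2) ->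
      cdom d (mul (cinv d1 p.1) (cinv d2 p.2)) /\
      mt p = cmap d (mul (cinv d1 p.1) (cinv d2 p.2))).
rewrite B0 in N2; have := nearI (N2 mtE) (nearI nT (nearI N1 nP)).
apply: filterS => p [Hm [ctp [[d1p sp] d2p]]].
have ti : cinv c' (t p) = tgt (Psi p.1 (cinv c p.2)) by exact: cmapK.
rewrite ti in d1p sp; move: Hm; rewrite /B /hat /= ti (cmapK d1p) (cmapK d2p).
by move=> /(_ sp) [_ <-].
Qed.

(** The left factor sees (z, w) only through the target of [Psi z] at w, so agreement of [H] and
    [H'] at one point gives agreement in both variables together. *)
Lemma agree_left E k c d (z0 : E) x Psi H H' : findim E -> family c z0 x Psi -> atlas d ->
  bis (tgt (Psi z0 x)) H -> bis (tgt (Psi z0 x)) H' -> cdom d (bmulG H (Psi z0) x) ->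
  meq k (tgt (Psi z0 x)) H H' ->
  agree k (fun p : E * 'rV[R]_n => hat c d (bmulG H (Psi p.1)) p.2)
          (fun p : E * 'rV[R]_n => hat c d (bmulG H' (Psi p.1)) p.2) (z0, cmap c x).
Proof.
move=> fE fam ad bH bH' dHP HH; have [[ac cx] _ _ _] := fam.
have [c' ac' cy] := atlas_cover (tgt (Psi z0 x)).
have [d1 ad1 d1H] := atlas_cover (H (tgt (Psi z0 x))).
have [d2 ad2 d2X] := atlas_cover (Psi z0 x).
have [mt [smt mtE]] := mul_hat fE fam bH ac' ad1 ad2 ad cy d1H d2X dHP.
have E1 := mtE H bH erefl; have E2 := mtE H' bH' (esym HH.1).
apply: (agree_near_ext (f := fun p : E * 'rV[R]_n => mt (hat c' d1 H (cmap c' (tgt (Psi p.1 (cinv c p.2)))), hat c d2 (Psi p.1) p.2))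
  (g := fun p : E * 'rV[R]_n => mt (hat c' d1 H' (cmap c' (tgt (Psi p.1 (cinv c p.2)))), hat c d2 (Psi p.1) p.2))).
- by apply: filterS E1 => p ->.
- by apply: filterS E2 => p ->.
have [sP nP] := family_hat (family_pfamily fam) ad2 d2X.
have [|nT sT] := plotE (plot_family_tgt fam) ac'; first by rewrite /= cmapK.
pose t (p : E * 'rV[R]_n) := cmap c' (tgt (Psi p.1 (cinv c p.2))).
have t0 : t (z0, cmap c x) = cmap c' (tgt (Psi z0 x)) by rewrite /t /= cmapK.
have st : sm t (z0, cmap c x) by [].
have [sH _] := sm_map (bis_map bH) ac' ad1 cy d1H.
have [|sH' _] := sm_map (bis_map bH') ac' ad1 cy; first by rewrite -HH.1.
have s1 : sm (fun p => hat c' d1 H (t p)) (z0, cmap c x).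
  by apply: (@sm_comp _ _ _ _ (hat c' d1 H) t) => //; rewrite t0.
have s2 : sm (fun p => hat c' d1 H' (t p)) (z0, cmap c x).
  by apply: (@sm_comp _ _ _ _ (hat c' d1 H') t) => //; rewrite t0.
pose B H0 (p : E * 'rV[R]_n) := (hat c' d1 H0 (t p), hat c d2 (Psi p.1) p.2).
have B0 : B H (z0, cmap c x) = (cmap d1 (H (tgt (Psi z0 x))), cmap d2 (Psi z0 x)).
  by rewrite /B t0 /hat /= !cmapK.
apply: (@agree_comp _ k _ _ _ (B H) (B H') mt mt) => //; try exact: sm_pair; rewrite ?B0 //.
apply: agree_pair => //.
apply: (@agree_comp _ k _ _ _ t t (hat c' d1 H) (hat c' d1 H')) => //; rewrite t0 //.
exact: (HH.2 c' d1 ac' ad1 cy d1H).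
Qed.

(** Lift the plot w |-> sigma (cinv c w) by [jplot_family]: the parameter of the family is the
    coordinate of the source. *)
Lemma sigma_rep k x (sigma : I -> jets G) c : bisection_at (Gam := jgpd G k) x sigma ->
  atlas c -> cdom c x ->
  exists2 Psi, family c (cmap c x) x Psi &
    \forall y \near x, bis y (Psi (cmap c y)) /\ sigma y = jet k y (Psi (cmap c y)).
Proof.
move=> [U Ux [oU sU mU _]] ac cx.
have pA : jplot k (fun w => sigma (cinv c w)) (cmap c x) by exact: (mU x Ux c ac cx).
have [c0 [Psi [fam PE]]] := jplot_family (findim_mx _ _) pA.
have s0 : (sigma x).1 = x := sU x Ux.
rewrite cmapK // s0 in fam.
exists Psi; first exact: (family_chart (findim_mx _ _) ac cx fam).
have nU : \forall y \near x, U y by exact: open_nbhs_nbhs.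
have := nearI nU (nearI (near_cdom cx) (near_comp (cmap_cont cx) PE)).
apply: filterS => y [Uy [cy]]; rewrite cmapK //.
by rewrite [(sigma y).1](sU y Uy).
Qed.

Lemma near_param z (g : R -> I) (P : I -> Prop) : plot g 0 -> g 0 = z ->
  (\forall y \near z, P y) -> \forall t \near (0 : R), P (g t).
Proof. by move=> pg g0 Pz; apply: (near_comp (plot_cont pg)); rewrite g0. Qed.

(** The two actions in i(v) D sigma are products in G_k, hence act on curves of jets, where they
    become jets of products of bisections of G. *)
Lemma nl_velocity k z (sigma : I -> jets G) c Psi (g : R -> I) : family c (cmap c z) z Psi ->
  (\forall y \near z, bis y (Psi (cmap c y)) /\ sigma y = jet k.+1 y (Psi (cmap c y))) ->
  plot g 0 -> g 0 = z ->
  nl_spencer k sigma z (velocity (S := mspace I) g) =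
  velocity (S := jspace G k)
    (fun t => jet k (g t) (bmulG (binvG z (jrep (sigma z))) (Psi (cmap c (g t))))) -
  velocity (S := jspace G k) (fun t => jet k (g t) one).
Proof.
move=> fam sE pg g0; rewrite /nl_spencer (tunit_velocity k g0 pg).
set phi := jrep (sigma z); set lam : I -> jgpd G k := fun y => jet k y phi.
set sigk : I -> jgpd G k := fun y => jproj k (sigma y).
congr (_ - _).
have [bz sz] := nbhs_singleton sE; have [[ac cz] _ _ _] := fam.
have bphi : bis z phi by rewrite /phi sz; exact: jrep_bis.
have phiE : meq k.+1 z (Psi (cmap c z)) phi by rewrite /phi sz; exact: jrep_meq.
have pu : jplot k (fun t => jet k (g t) one) 0 by exact: (@unit_plot _ _ k z).
have skE : \forall y \near z, sigk y = jet k y (Psi (cmap c y)).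
  by apply: filterS sE => y [by_ sy]; rewrite /sigk sy jproj_jet.
have gun : gunit (jgpd G k) z = jet k (g 0) one by rewrite g0.
have pp1 : plot_preserving k k (fun Y => gmul (g := jgpd G k) (sigk (tgt (jval Y))) Y) (jet k (g 0) one).
  apply: (mul_plot_preserving fam skE).
  by rewrite jval_jet ?tgt_unit //; exact: bis_unit.
(* Multiplying the curve of identities over [g] by sigma_k gives the curve of sigma_k over [g]. *)
have e1 : j1act sigk (gunit (jgpd G k) z) (velocity (S := jspace G k) (fun t => jet k (g t) one)) =
    velocity (S := jspace G k) (fun t => jet k (g t) (Psi (cmap c (g t)))).
  rewrite gun; apply: etrans (push_velocity pp1) _; apply: velocity_ext.
  have := near_param pg g0 (nearI sE skE); apply: filterS => t [[bt st] kt].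
  have tu : tgt (one (g t)) = g t by rewrite tgt_unit.
  have b1 : bis (g t) one by exact: bis_unit.
  rewrite jval_jet // tgt_unit kt -{1}tu gmul_jet ?tu //; apply: jet_near.
  apply: filterS (bis_srcs bt) => y sy; rewrite /bmul /= tgt_unit.
  by rewrite -{2}sy mul_unitr.
rewrite e1.
have ty : tgt (Psi (cmap c z) z) = tgt (phi z) by rewrite phiE.1.
(* The inverse of y |-> j^k_y phi in G_k consists of the jets of the inverse of phi. *)
have binvE : \forall y1 \near tgt (phi z), (binv (Gam := jgpd G k) z lam) y1 = jet k y1 (binvG z phi).
  have lE : local_inv z (fun y => gtgt (lam y)) = local_inv z (fun y => tgt (phi y)).
    apply: local_inv_ext; apply: filterS (bis_near bphi) => y by_.
    by rewrite /lam /= jval_jet.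
  have [mg gf fg gz] := local_invP bphi; rewrite /binv lE.
  set gi := local_inv _ _ in mg gf fg gz *.
  have cg := map_cont mg.
  have n1 := near_comp cg (P := fun y => bis y phi /\ nbhs (tgt (phi y)) (fun y1 => binvG y phi y1 = binvG z phi y1)).
  rewrite gz in n1; have := nearI fg (n1 (nearI (bis_near bphi) (binv_near bphi))).
  apply: filterS => y1 [ty1 [b1 nb1]].
  apply: etrans (ginv_jet k b1 : ginv (lam (gi y1)) = _) _; rewrite ty1 in nb1 *.
  exact: jet_near.
have binvz : bis (tgt (phi z)) (binvG z phi) by exact: bis_inv.
have [c' ac' cy] := atlas_cover (tgt (phi z)).
have famB : family c' (cmap c' (tgt (phi z))) (tgt (phi z)) (fun _ : 'rV[R]_n => binvG z phi).
  exact: family_const.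
have sg0 : sigk z = jet k (g 0) (Psi (cmap c (g 0))) by rewrite (nbhs_singleton skE) g0.
have pp2 : plot_preserving k k (fun Y => gmul (g := jgpd G k) ((binv (Gam := jgpd G k) z lam) (tgt (jval Y))) Y)
    (jet k (g 0) (Psi (cmap c (g 0)))).
  by apply: (mul_plot_preserving famB binvE); rewrite g0 jval_jet.
rewrite -[jproj k (sigma z)]/(sigk z) sg0; apply: etrans (push_velocity pp2) _; apply: velocity_ext.
have nT (P : I -> Prop) : (\forall y \near tgt (phi z), P y) -> \forall y \near z, P (tgt (Psi (cmap c y) y)).
  move=> nP; have pT := plot_family_tgt fam.
  have sB : sm (fun w : 'rV[R]_n => (w, w)) (cmap c z) by apply: sm_pair; exact: sm_id.
  have p1 : plot (fun w : 'rV[R]_n => tgt (Psi w (cinv c w))) (cmap c z).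
    exact: (@plot_comp _ _ _ _ (fun p : 'rV[R]_n * 'rV[R]_n => tgt (Psi p.1 (cinv c p.2))) (fun w => (w, w))).
  have h2 := near_comp (plot_cont p1) (P := P); rewrite cmapK // ty in h2.
  have := nearI (near_cdom cz) (near_comp (cmap_cont cz) (h2 nP)).
  by apply: filterS => y [cy']; rewrite cmapK.
have := near_param pg g0 (nearI sE (nT _ (nearI (bis_near binvz) binvE))).
apply: filterS => t [[bt st] [b1 b2]].
by rewrite jval_jet // b2 gmul_jet.
Qed.

Lemma coefsB k (C C' : seq 'I_n -> 'rV[R]_m) : coefs k C - coefs k C' = coefs k (fun J => C J - C' J).
Proof. by apply/matrixP => i j; rewrite !mxE. Qed.

Lemma coefs_ext k (C C' : seq 'I_n -> 'rV[R]_m) : (forall J, (size J <= k)%N -> C J = C' J) ->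
  coefs k C = coefs k C'.
Proof. by move=> CC; apply/matrixP => i j; rewrite !mxE CC // size_ldec. Qed.

(** [H] replaces the inverse of the representative chosen by [jrep]. It must agree with it to order
    k + 1, because k-jets are differentiated once along the curve. *)
Lemma nl_tau k c d A z (sigma : I -> jets G) Psi H v : atlas d -> jchart_at (k := k) c d A z ->
  family c (cmap c z) z Psi ->
  (\forall y \near z, bis y (Psi (cmap c y)) /\ sigma y = jet k.+1 y (Psi (cmap c y))) ->
  bis (tgt (Psi (cmap c z) z)) H ->
  meq k.+1 (tgt (Psi (cmap c z) z)) (binvG z (Psi (cmap c z))) H ->
  nl_spencer k sigma z (tanv c z v) =
  tau c d A z (0, coefs k (jetc (fun w =>
    'D_(v, 0) (fun p : 'rV[R]_n * 'rV[R]_n => hat c d (bmulG H (Psi p.1)) p.2) (cmap c z, w)) (cmap c z))).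
Proof.
move=> ad gz fam sE bH mH; have [[ac cz] _ _ _] := fam; have [_ dz _ _] := gz.
have [bz sz] := nbhs_singleton sE.
pose ln (t : R) : 'rV[R]_n := t *: v + cmap c z; pose g t := cinv c (ln t).
have l0 : ln 0 = cmap c z by rewrite /ln scale0r add0r.
have g0 : g 0 = z by rewrite /g l0 cmapK.
have sln : sm ln 0 by exact: sm_line.
have pg : plot g 0 by exact: plot_line.
have cg : \forall t \near (0 : R), cmap c (g t) = ln t.
  have : \forall t \near (0 : R), (cmap c @` cdom c) (ln t).
    by apply: (near_comp (sm_cont sln)); rewrite l0; exact: near_cimg.
  by apply: filterS => t /cinvK [].
have Dg : 'D_1 (cmap c \o g) 0 = v.
  by rewrite (near_eq_derive _ cg) [LHS](derive_line id v (cmap c z) 0) derive_id.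
have -> : tanv c z v = velocity (S := mspace I) g.
  have cg0 : cdom c (g 0) by rewrite g0.
  by have := velocity_tanv ac cg0 pg; rewrite Dg g0.
rewrite (nl_velocity fam sE pg g0).
set phi := jrep (sigma z); set K := binvG z phi.
have bphi : bis z phi by rewrite /phi sz; exact: jrep_bis.
have phiE : meq k.+1 z (Psi (cmap c z)) phi by rewrite /phi sz; exact: jrep_meq.
have bK : bis (tgt (Psi (cmap c z) z)) K by rewrite phiE.1; exact: bis_inv.
have mK : meq k.+1 (tgt (Psi (cmap c z) z)) K H.
  by apply: meq_trans (meq_sym (meq_binv bz bphi phiE)) mH.
have fln : family c 0 z (fun t => Psi (ln t)).
  by apply: (@family_param _ _ _ _ ln) => //; rewrite l0.
have K1 : meq k.+1 z (bmulG K (Psi (cmap c z))) one.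
  apply: meq_trans (meq_near _ (bmul_binvl bphi)).
  by apply: meq_bmul => //; exact: meq_refl.
pose PK (t : R) := bmulG K (Psi (ln t)).
have [c' ac' cy] := atlas_cover (tgt (Psi (cmap c z) z)).
have famM : family c 0 z PK.
  apply: (family_mul (c' := c') findim_real fln); rewrite /= l0.
  exact: family_const.
have PK0 : PK 0 z = one z by rewrite /PK l0 K1.1.
have PKg : PK 0 (g 0) = one z by rewrite g0.
have famMg : family c 0 (g 0) PK by rewrite g0.
have nbM : \forall t \near (0 : R), bis (g t) (PK t) by exact: (near_bis_diag findim_real pg famMg).
rewrite (@velocity_ext _ _ k _ (fun t => jet k (g t) (PK t))); last first.
  by apply: filterS cg => t ct; rewrite ct.
have pj1 : jplot k (fun t => jet k (g t) (PK t)) 0.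
  exact: (plot_jet_gen k findim_real pg (family_pfamily famMg) nbM).
have pj2 : jplot k (fun t => jet k (g t) one) 0 by exact: (@unit_plot _ _ k z).
have z1 : jet k (g 0) (PK 0) = jet k z one.
  by rewrite g0; apply: jet_meq; rewrite /PK l0; apply: meqW K1.
rewrite (tau_velocity ac ad gz pj1 z1) (tau_velocity ac ad gz pj2); last by rewrite g0.
rewrite -(tauB ac ad _ _ gz); congr (tau _ _ _ _ _).
have famU : family c 0 (g 0) (fun _ : R => one) by rewrite g0; apply: family_const => //; exact: bis_unit.
have cg0 : cdom c (g 0) by rewrite g0.
rewrite (derive_kapX k ac ad cg0 _ pg (family_pfamily famMg) nbM); last by rewrite PKg.
rewrite (derive_kapX k ac ad cg0 _ pg (family_pfamily famU)); last 2 first.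
- by rewrite g0.
- by near=> t; exact: bis_unit.
rewrite Dg {}g0 in PKg famMg nbM pg pj1 pj2 z1 famU cg0 *.
set f := (fun p : R * 'rV[R]_n => hat c d (PK p.1) p.2).
pose f' (p : R * 'rV[R]_n) := hat c d (bmulG H (Psi (ln p.1))) p.2.
set u := hat c d one.
rewrite -[LHS]/(v - v, coefs k _ - coefs k _) subrr coefsB; congr (_, _).
apply: coefs_ext => J sJ.
set DJ := map (pair (0 : R)) _.
have aH : agree k.+1 f f' (0, cmap c z).
  have := @agree_left R k.+1 c d 0 z (fun t => Psi (ln t)) K H findim_real fln ad.
  by rewrite [ln 0]l0; apply => //; rewrite K1.1.
have sff : sm f (0, cmap c z).
  by have [|] := family_hat (family_pfamily famM) ad; first by rewrite PK0.
have famH : family c 0 z (fun t => bmulG H (Psi (ln t))).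
  apply: (family_mul (c' := c') findim_real fln); rewrite /= l0.
  exact: family_const.
have H0 : bmulG H (Psi (ln 0)) z = one z.
  by rewrite -K1.1 /bmul /= l0 -mK.1.
have sff' : sm f' (0, cmap c z).
  by have [|] := family_hat (family_pfamily famH) ad; first by rewrite H0.
(* The direction (1, v) splits. The part (0, v) moves the base point and sees only the identities,
   so it cancels against the velocity of the curve of identities. *)
have e1 : 'D_(1, v) (iter_deriv DJ f) (0, cmap c z) =
    'D_(1, 0) (iter_deriv DJ f') (0, cmap c z) + 'D_v (jetc u ^~ J) (cmap c z).
  have -> : ((1, v) : R * 'rV[R]_n) = (1, 0) + (0, v).
    by rewrite -[RHS]/(1 + 0, 0 + v) addr0 add0r.
  rewrite deriveDv; last by apply: sm_diff; exact: sm_iter.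
  pose e0 : R * 'rV[R]_n := (1, 0).
  have sD : (size (e0 :: DJ) <= k.+1)%N by rewrite /= !size_map.
  have e3 : 'D_(0, v) (iter_deriv DJ f) (0, cmap c z) = 'D_v (jetc u ^~ J) (cmap c z).
    have := iter_partial f 0 (cmap c z) (v :: map e J); rewrite /= -/DJ => <-.
    have := K1.2 c d ac ad cz; rewrite K1.1 => /(_ dz (v :: map e J)).
    rewrite /= size_map => /(_ sJ).
    by rewrite /f /PK /= l0.
  exact: (f_equal2 +%R (aH (e0 :: DJ) sD) e3).
have e2 : 'D_(1, v) (iter_deriv DJ (fun p : R * 'rV[R]_n => u p.2)) (0, cmap c z) =
    'D_v (jetc u ^~ J) (cmap c z).
  have -> : iter_deriv DJ (fun p : R * 'rV[R]_n => u p.2) = fun p => jetc u p.2 J.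
    by apply/funext => -[t w]; rewrite /DJ -iter_partial.
  exact: (@derive_affine _ _ _ _ snd (jetc u ^~ J)).
rewrite e1 e2 addrK derive_iterC // /DJ -iter_partial /jetc; congr (iter_deriv _ _ _).
apply/funext => w; rewrite -l0.
apply: (@derive_affine _ _ _ _ (fun p : R * 'rV[R]_n => (ln p.1, p.2)) (fun p => hat c d (bmulG H (Psi p.1)) p.2) (0, w)) => h.
rewrite -[RHS]/(h *: v + ln 0, h *: (0 : 'rV[R]_n) + w) /= l0.
by rewrite /ln -[h *: 1]/(h * 1) mulr1 addr0.
Unshelve. all: by end_near. Qed.

End NonLinear.

(** * Exactness *)

Section Exactness.
Context {R : realType} (G : lie_groupoid R).
Local Notation I := (base G).
Local Notation n := (mdim I).
Local Notation m := (mdim (arrows G)).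
Local Notation bis := (bisection_at (Gam := gpd_of G)).
Local Notation bmulG := (bmul (Gam := gpd_of G)).
Local Notation binvG := (binv (Gam := gpd_of G)).
Local Notation one := (@unit_ R G).
Local Notation e := (fun i : 'I_n => delta_mx ord0 i : 'rV[R]_n).
Implicit Types (k l : nat) (F H : I -> arrows G) (x y z : I) (E : normedModType R)
  (c : chart R I n) (d : chart R (arrows G) m).

(** The source of [Th z] at w is w for all z; differentiate this in z. *)
Lemma vert_family E c d (z0 : E) x (Th : E -> I -> arrows G) v : findim E -> family c z0 x Th -> atlas d ->
  (\forall y \near x, Th z0 y = one y) -> cdom d (one x) ->
  vert c d (fun w => 'D_(v, 0) (fun p : E * 'rV[R]_n => hat c d (Th p.1) p.2) (z0, w)) x.
Proof.
move=> fE fam ad Th0 dx; have [[ac cx] _ sT _] := fam.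
have dT : cdom d (Th z0 x) by rewrite (nbhs_singleton Th0).
have [sf nf] := family_hat (family_pfamily fam) ad dT.
set f := (fun p : E * 'rV[R]_n => hat c d (Th p.1) p.2) in sf *.
split.
  apply: (@sm_comp _ _ _ _ ('D_(v, 0) f) (fun w => (z0, w))) => //; first exact: sm_pairr.
  exact: sm_derive.
have nS : \forall p \near (z0, cmap c x), shat c d (f p) = p.2.
  have := nearI (near_snd z0 (near_cimg cx)) (nearI sT nf).
  by apply: filterS => -[z w] /= [/cinvK [_ we] [sw dw]]; rewrite /shat /f /hat /= cmapK // sw we.
have fu : \forall w \near cmap c x, f (z0, w) = hat c d one w.
  by apply: filterS (near_chart cx Th0) => w e0; rewrite /f /hat /= e0.
have [su nu] := sm_uhat ac ad cx dx.
have nSu := near_comp (sm_cont su) (P := fun q => sm (shat c d) q) (sm_near (sm_shat_one ac ad cx dx)).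
have := nearI (near_slice (sm_near sf)) (nearI (near_slice (near_near nS)) (nearI fu nSu)).
apply: filterS => w [sfw [nSw [fw sSw]]]; rewrite -fw.
have dS : differentiable (shat c d) (f (z0, w)) by rewrite fw; exact: sm_diff.
rewrite -(derive_comp _ (sm_diff sfw) dS).
have -> : 'D_(v, 0) (shat c d \o f) (z0, w) = 'D_(v, 0) (fun p : E * 'rV[R]_n => id p.2) (z0, w).
  exact: near_eq_derive.
by rewrite (@derive_affine _ _ _ _ snd (id : 'rV[R]_n -> 'rV[R]_n) _ _ 0) // derive0.
Qed.

(** Here sigma is represented by a constant family, whose derivative in the parameter is 0. *)
Lemma nl_spencer_jet k x F (sigma : I -> jets G) : bis x F ->
  (\forall y \near x, sigma y = jet k.+1 y F) ->
  forall v, mtangent x v -> nl_spencer k sigma x v = 0.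
Proof.
move=> bF sE v; have [c ac cx] := atlas_cover x; have [d ad dx] := atlas_cover (one x).
move=> /(tangent_ex ac cx) [q ->].
have [A /nbhs_singleton gx] := jchart_at_ex k ac ad cx dx.
have fam : family c (cmap c x) x (fun _ : 'rV[R]_n => F) by exact: family_const.
have sE' : \forall y \near x, bis y F /\ sigma y = jet k.+1 y F by exact: filterS (nearI (bis_near bF) sE).
rewrite (@nl_tau _ _ k c d A x sigma (fun _ => F) (binvG x F) q ad gx fam sE' (bis_inv bF) (meq_refl _ _ _)).
suff -> : (0, coefs k (jetc (fun w => 'D_(q, 0) (fun p : 'rV[R]_n * 'rV[R]_n =>
    hat c d (bmulG (binvG x F) F) p.2) (cmap c x, w)) (cmap c x))) = 0 :> jcoord G k by exact: tau0.
have -> : (fun w => 'D_(q, 0) (fun p : 'rV[R]_n * 'rV[R]_n =>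
    hat c d (bmulG (binvG x F) F) p.2) (cmap c x, w)) = fun=> 0.
  apply/funext => w.
  by rewrite (@derive_affine _ _ _ _ snd (hat c d (bmulG (binvG x F) F)) _ _ 0) // derive0.
congr (_, _); apply/matrixP => i j; rewrite !mxE /jetc iter_deriv_cst0 mxE //.
Qed.

Lemma mul_binv_cancel x F : bis x F -> \forall t \near tgt (F x), forall X : arrows G, tgt X = t ->
  mul (F (tgt (mul (binvG x F t) X))) (mul (binvG x F t) X) = X.
Proof.
move=> bF; have [mg gf fg gx] := local_invP bF.
rewrite /binv /=; set g := local_inv _ _ in mg gf fg gx *.
have n1 := near_comp (map_cont mg) (P := fun y => src (F y) = y); rewrite gx in n1.
have := nearI fg (n1 (bis_srcs bF)); apply: filterS => t [e1 e2] X tX.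
have sX : src (inv (F (g t))) = tgt X by rewrite src_inv e1.
rewrite tgt_mul // tgt_inv e2 mulA ?tgt_inv //.
by rewrite mul_invr e1 -tX mul_unitl.
Qed.

(** [Psi z] is the product of [Psi (cmap c x)] and [La z], that is, f = M o la in charts with [M]
    independent of z. The z-derivative of [la] has zero k-jet, and applying the differential of [M]
    keeps it so. *)
Lemma nl_spencer_eq0 k c d x (sigma : I -> jets G) Psi v : atlas d ->
  family c (cmap c x) x Psi ->
  (\forall y \near x, bis y (Psi (cmap c y)) /\ sigma y = jet k.+1 y (Psi (cmap c y))) ->
  cdom d (Psi (cmap c x) x) ->
  nl_spencer k sigma x (tanv c x v) = 0 ->
  forall J, (size J <= k)%N ->
    'D_(v, 0) (iter_deriv (map (pair (0 : 'rV[R]_n)) (map e J))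
      (fun p : 'rV[R]_n * 'rV[R]_n => hat c d (Psi p.1) p.2)) (cmap c x, cmap c x) = 0.
Proof.
move=> ad fam sE dP nl0 J sJ; have [[ac cx] _ _ _] := fam.
have [d1 ad1 dx] := atlas_cover (one x).
have [A /nbhs_singleton gx] := jchart_at_ex k ac ad1 cx dx.
have [bP _] := nbhs_singleton sE.
pose H := binvG x (Psi (cmap c x)).
have bH : bis (tgt (Psi (cmap c x) x)) H by exact: bis_inv.
pose La (z : 'rV[R]_n) := bmulG H (Psi z).
have [c' ac' cy] := atlas_cover (tgt (Psi (cmap c x) x)).
have famL : family c (cmap c x) x La.
  by apply: (family_mul (c' := c') (findim_mx _ _) fam); exact: family_const.
have La0 : \forall y \near x, La (cmap c x) y = one y by exact: bmul_binvl.
have Lax : La (cmap c x) x = one x := nbhs_singleton La0.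
rewrite (nl_tau v ad1 gx fam sE bH (meq_refl _ _ _)) in nl0.
pose la (p : 'rV[R]_n * 'rV[R]_n) := hat c d1 (La p.1) p.2.
pose ze w := 'D_(v, 0) la (cmap c x, w).
have vz : vert c d1 ze x by exact: vert_family.
have jz := tau_vert_inj ac ad1 gx vz nl0.
set f := (fun p : 'rV[R]_n * 'rV[R]_n => hat c d (Psi p.1) p.2).
have [sf _] := family_hat (family_pfamily fam) ad dP.
have [|sla nla] := family_hat (family_pfamily famL) ad1; first by rewrite Lax.
have tL : tgt (La (cmap c x) x) = x by rewrite Lax tgt_unit.
have bP' : bis (tgt (La (cmap c x) x)) (Psi (cmap c x)) by rewrite tL.
have PL : bmulG (Psi (cmap c x)) (La (cmap c x)) x = Psi (cmap c x) x.
  by have := mul_unitr (Psi (cmap c x) x); rewrite (bis_src bP) /bmul /= tL Lax.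
have := @mul_hat _ _ _ c c d d1 d (cmap c x) x La (Psi (cmap c x)) (findim_mx _ _) famL bP' ac ad ad1 ad.
rewrite PL Lax tgt_unit => /(_ cx dP dx dP) [mt [smt /(_ _ bP erefl) mtE]].
have [sT _] := sm_that ac ad1 cx dx.
pose T := cmap c \o (@tgt R G \o cinv d1).
have Tx : T (cmap d1 (one x)) = cmap c x by rewrite /T /= cmapK // tgt_unit.
have [sP _] := sm_map (bis_map bP) ac ad cx dP.
pose B q := (hat c d (Psi (cmap c x)) (T q), q).
have sB : sm B (cmap d1 (one x)).
  apply: sm_pair; last exact: sm_id.
  by apply: (@sm_comp _ _ _ _ (hat c d (Psi (cmap c x))) T) => //; rewrite Tx.
have B0 : B (cmap d1 (one x)) = (cmap d (Psi (cmap c x) x), cmap d1 (one x)).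
  by rewrite /B Tx /hat /= cmapK.
pose M q := mt (B q).
have sM : sm M (cmap d1 (one x)) by apply: (@sm_comp _ _ _ _ mt B) => //; rewrite B0.
have la0 : la (cmap c x, cmap c x) = cmap d1 (one x) by rewrite /la /hat /= cmapK // Lax.
have fM : \forall p \near (cmap c x, cmap c x), f p = M (la p).
  have N1 := near_comp (plot_cont (plot_family_tgt fam)) (P := fun t => forall X : arrows G, tgt X = t ->
    mul (Psi (cmap c x) (tgt (mul (H t) X))) (mul (H t) X) = X).
  rewrite /= cmapK // in N1; have {}N1 := N1 (mul_binv_cancel bP).
  have := nearI mtE (nearI N1 nla); apply: filterS => p [mp [cp dp]].
  rewrite /M /B /T /= {2}/la {2}/hat /= cmapK // -mp /f /hat /=.
  by rewrite -[in LHS](cp (Psi p.1 (cinv c p.2)) erefl).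
rewrite derive_iterC // -iter_partial.
have Z : agree k (fun w => 'D_(v, 0) f (cmap c x, w)) (fun _ => 0) (cmap c x).
  have sla1 : sm (fun w => la (cmap c x, w)) (cmap c x).
    by apply: (@sm_comp _ _ _ _ la (fun w => (cmap c x, w))) => //; exact: sm_pairr.
  have sM1 : sm M (la (cmap c x, cmap c x)) by rewrite la0.
  apply: (@agree_near_ext _ k _ _ (fun w => 'D_(ze w) M (la (cmap c x, w))) _ (fun w => 'D_0 M (la (cmap c x, w)))).
  - have := nearI (near_slice (near_near fM)) (nearI (near_slice (sm_near sla)) (near_comp (sm_cont sla1) (sm_near sM1))).
    apply: filterS => w [n1 [s1 s2]].
    by rewrite /ze -(derive_comp _ (sm_diff s1) (sm_diff s2)); apply/esym; exact: near_eq_derive.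
  - by near=> w; rewrite derive0.
  apply: (@agree_D _ k _ _ _ M M (fun w => la (cmap c x, w)) (fun w => la (cmap c x, w)) ze (fun _ => 0)) => //.
  - by case: vz.
  - exact: sm_cst.
  - apply: agree_basis; [by case: vz|exact: sm_cst|] => J' sJ'.
    by rewrite jz // /jetc iter_deriv_cst0.
have := Z (map e J); rewrite size_map => /(_ sJ) ->; exact: iter_deriv_cst0.
Unshelve. all: by end_near. Qed.

Lemma plot_diag c z (Psi : 'rV[R]_n -> I -> arrows G) : family c (cmap c z) z Psi ->
  plot (fun w => Psi w (cinv c w)) (cmap c z).
Proof.
move=> [_ pP _ _].
have sB : sm (fun w : 'rV[R]_n => (w, w)) (cmap c z) by apply: sm_pair; exact: sm_id.
exact: (@plot_comp _ _ _ _ (fun p : 'rV[R]_n * 'rV[R]_n => Psi p.1 (cinv c p.2)) (fun w => (w, w))).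
Qed.

(** The target of a jet is that of its value, so sigma and the map underlying it induce the same
    diffeomorphism of the base. *)
Lemma bisection_jval k x (sigma : I -> jets G) : bisection_at (Gam := jgpd G k) x sigma ->
  bis x (fun y => jval (sigma y)).
Proof.
move=> [U Ux bU]; exists U => //; have [oU sU mU dU] := bU; split=> //.
  move=> y Uy; have by_ : bisection_at (Gam := jgpd G k) y sigma by exists U.
  have [c ac cy] := atlas_cover y; have [Psi _ PE] := sigma_rep by_ ac cy.
  have [b0 s0] := nbhs_singleton PE.
  by rewrite /= s0 jval_jet //; exact: bis_src.
move=> y Uy c ac cy; have by_ : bisection_at (Gam := jgpd G k) y sigma by exists U.
have [Psi fam PE] := sigma_rep by_ ac cy.
apply: (@plot_ext _ _ _ (fun w => Psi w (cinv c w))); last exact: plot_diag.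
have := nearI (near_cimg cy) (near_chart cy PE).
by apply: filterS => w [/cinvK [_ we] []]; rewrite we => b1 s1; rewrite /= s1 jval_jet.
Qed.

Lemma family_at c x (Psi : 'rV[R]_n -> I -> arrows G) : family c (cmap c x) x Psi ->
  \forall y \near x, family c (cmap c y) y Psi.
Proof.
move=> fam; have [[ac cx] _ _ _] := fam.
have N := family_near (findim_mx _ _) fam.
have sB : sm (fun w : 'rV[R]_n => (w, w)) (cmap c x) by apply: sm_pair; exact: sm_id.
have := nearI (near_cdom cx) (near_comp (cmap_cont cx) (near_comp (sm_cont sB) (P := fun q => family c q.1 (cinv c q.2) Psi) N)).
by apply: filterS => y [cy]; rewrite /= cmapK.
Qed.

Lemma nl_spencer_exact k x (sigma : I -> jets G) : bisection_at (Gam := jgpd G k.+1) x sigma ->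
  (\forall y \near x, forall v, mtangent y v -> nl_spencer k sigma y v = 0) ->
  \forall y \near x, sigma y = jet k.+1 y (fun y => jval (sigma y)).
Proof.
move=> bs nl0; have [c ac cx] := atlas_cover x.
have [Psi fam PE] := sigma_rep bs ac cx.
have bF := bisection_jval bs; set F := (fun y => jval (sigma y)) in bF *.
have [b0 s0] := nbhs_singleton PE.
have Fx : F x = Psi (cmap c x) x by rewrite /F s0 jval_jet.
have [d ad dF] := atlas_cover (F x).
have dP : cdom d (Psi (cmap c x) x) by rewrite -Fx.
have [sf nf] := family_hat (family_pfamily fam) ad dP.
set f := (fun p : 'rV[R]_n * 'rV[R]_n => hat c d (Psi p.1) p.2) in sf *.
have [sF nF] := sm_map (bis_map bF) ac ad cx dF.
have sB w : sm (fun w : 'rV[R]_n => (w, w)) w by apply: sm_pair; exact: sm_id.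
have nPE := near_near PE.
have FE : \forall w \near cmap c x, hat c d F w = f (w, w).
  have := nearI (near_cimg cx) (near_chart cx PE); apply: filterS => w [/cinvK [_ we] [b1 s1]].
  by rewrite we in b1 s1; rewrite /f /hat /F /= s1 jval_jet.
have H0 : \forall w \near cmap c x, forall v J, (size J <= k)%N ->
    'D_(v, 0) (iter_deriv (map (pair (0 : 'rV[R]_n)) (map e J)) f) (w, w) = 0.
  have Nd := near_comp (sm_cont (sB (cmap c x))) (P := fun p : 'rV[R]_n * 'rV[R]_n => cdom d (Psi p.1 (cinv c p.2))) nf.
  have := nearI (near_cimg cx) (nearI (near_chart cx (family_at fam)) (nearI (near_chart cx nPE) (nearI Nd (near_chart cx nl0)))).
  apply: filterS => w [/cinvK [cw we] [fw [Pw [dw nw]]]] v J sJ.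
  have dw' : cdom d (Psi (cmap c (cinv c w)) (cinv c w)) by rewrite we.
  have := nl_spencer_eq0 (v := v) ad fw Pw dw' (nw _ (tangent_tanv v ac cw)) sJ.
  by rewrite we.
(* Differentiating along the diagonal gives the direction (e i, e i) = (e i, 0) + (0, e i). The
   first part vanishes by [H0], which reaches order k, hence one more order is gained. *)
have key J : (size J <= k.+1)%N -> \forall w \near cmap c x,
    jetc (hat c d F) w J = iter_deriv (map (pair (0 : 'rV[R]_n)) (map e J)) f (w, w).
  elim: J => [_|i J IH sJ]; first exact: FE.
  have {}IH := near_near (IH (ltnW sJ)).
  have Nf := near_comp (sm_cont (sB (cmap c x))) (sm_near sf).
  have := nearI IH (nearI H0 Nf); apply: filterS => w [n1 [h0 sw]].
  rewrite /jetc /= (near_eq_derive _ n1).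
  have sit : sm (iter_deriv (map (pair (0 : 'rV[R]_n)) (map e J)) f) (w, w) by exact: sm_iter.
  have := @derive_comp _ _ _ _ (fun w : 'rV[R]_n => (w, w)) (iter_deriv (map (pair (0 : 'rV[R]_n)) (map e J)) f) w (e i) (sm_diff (sB w)) (sm_diff sit).
  rewrite (derive_pair _ (sm_diff (@sm_id _ _ _)) (sm_diff (@sm_id _ _ _))) derive_id /= => ->.
  have -> : ((e i, e i) : 'rV[R]_n * 'rV[R]_n) = (e i, 0) + (0, e i).
    by rewrite -[RHS]/(e i + 0, 0 + e i) addr0 add0r.
  by rewrite (deriveDv _ _ (sm_diff sit)) h0 // add0r.
(* There are finitely many lists of bounded length, so one neighbourhood serves them all. *)
have {}key : \forall w \near cmap c x, forall J, (size J <= k.+1)%N ->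
    jetc (hat c d F) w J = iter_deriv (map (pair (0 : 'rV[R]_n)) (map e J)) f (w, w).
  have N : \forall w \near cmap c x, forall l : lidx G k.+1, jetc (hat c d F) w (ldec l) =
      iter_deriv (map (pair (0 : 'rV[R]_n)) (map e (ldec l))) f (w, w).
    by apply: near_forall => l; apply: key; exact: size_ldec.
  by apply: filterS N => w H J /ldec_ex [l <-].
apply: (chart_near cx).
have Nf := near_comp (sm_cont (sB (cmap c x))) (sm_near sf).
have := nearI (near_cimg cx) (nearI key (nearI (near_chart cx PE) (nearI (sm_near sF) (nearI Nf (nearI nF (near_chart cx (bis_near bF))))))).
apply: filterS => w [/cinvK [cw we] [kw [[Pw sw] [sFw [sfw [dw bw]]]]]].
rewrite we in Pw sw.
rewrite sw; apply/esym/jet_meq.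
have Fw : F (cinv c w) = Psi w (cinv c w) by rewrite /F sw jval_jet.
apply: (meqI (bis_map bw) (bis_map Pw) ac ad cw dw Fw).
rewrite we; apply: agree_basis => //.
  by apply: (@sm_comp _ _ _ _ f (fun w' => (w, w'))) => //; exact: sm_pairr.
by move=> J sJ; rewrite kw // -iter_partial.
Qed.

End Exactness.

(** * Separation of variables *)

Section Separation.
Context {R : realType} (n m : nat).
Implicit Types (x z w : 'rV[R]_n).

(** The factors [p] are shared by all indices: [J] will be the set of coordinate directions, and one
    family theta_t has to serve for all of them. *)
Definition separable (J : finType) x (f : J -> 'rV[R]_n -> 'rV[R]_n -> 'rV[R]_m) : Prop :=
  exists (T : finType) (b : J -> T -> 'rV[R]_n -> R) (p : T -> 'rV[R]_n -> 'rV[R]_m),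
  [/\ forall i t, sm (b i t) x, forall t w, sm (p t) w &
      forall i z w, f i z w = \sum_t b i t z *: p t w].

Lemma separableD (J : finType) x (f g : J -> 'rV[R]_n -> 'rV[R]_n -> 'rV[R]_m) :
  separable x f -> separable x g -> separable x (fun i z w => f i z w + g i z w).
Proof.
move=> [T [b [p [sb sp E]]]] [T' [b' [p' [sb' sp' E']]]].
exists (T + T')%type, (fun i t => match t with inl t => b i t | inr t => b' i t end),
  (fun t => match t with inl t => p t | inr t => p' t end); split.
- by move=> i [] t.
- by move=> [] t.
- by move=> i z w; rewrite big_sumType /= E E'.
Qed.

Lemma separable_tq (J : finType) x j (C : J -> 'rV[R]_n -> seq 'I_n -> 'rV[R]_m) :
  (forall i s, (size s <= j)%N -> sm (fun z => C i z s) x) ->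
  separable x (fun i z w => tq j (C i z) (w - z)).
Proof.
elim: j J C => [|j IH] J C sC.
  exists 'I_m, (fun i a z => C i z [::] ord0 a), (fun a _ => delta_mx ord0 a); split.
  - by move=> i a; apply: sm_entry; exact: sC.
  - by move=> a w; exact: sm_cst.
  - by move=> i z w; exact: row_sum_delta.
have [|T [b [p [sb sp E]]]] := IH (J * 'I_n)%type (fun q z => shiftC (C q.1 z) q.2).
  by move=> q s sj; apply: sC; rewrite size_rcons.
pose r : R := (j.+1%:R)^-1.
(* Each coordinate w_l - z_l is split: z_l joins the coefficients, w_l the functions [p]. *)
exists (T + 'I_n * T)%type,
  (fun i t => match t with inl t => fun z => - r * \sum_l z ord0 l * b (i, l) t z
   | inr q => fun z => r * b (i, q.1) q.2 z end),
  (fun t => match t with inl t => p t | inr q => fun w => w ord0 q.1 *: p q.2 w end); split.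
- move=> i [t|[l t]].
    apply: smM; first exact: sm_cst.
    by apply: sm_sum => l _; apply: smM => //; exact: sm_coord.
  by apply: smM => //; exact: sm_cst.
- move=> [t|[l t]] w //; apply: sm_scale => //; exact: sm_coord.
- move=> i z w; rewrite tqS big_sumType /=.
  transitivity (r *: \sum_l (w - z) ord0 l *: \sum_t b (i, l) t z *: p t w).
    by congr (_ *: _); apply: eq_bigr => l _; rewrite -(E (i, l)).
  have -> : \sum_t (- r * \sum_l z ord0 l * b (i, l) t z) *: p t w =
      - (r *: \sum_l z ord0 l *: \sum_t b (i, l) t z *: p t w).
    rewrite -scaleNr scaler_sumr.
    under [RHS]eq_bigr do rewrite scaler_sumr scaler_sumr.
    rewrite exchange_big /=; apply: eq_bigr => t _.
    rewrite mulr_sumr scaler_suml; apply: eq_bigr => l _.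
    by rewrite !scalerA mulrA.
  have -> : \sum_(q : 'I_n * T) (r * b (i, q.1) q.2 z) *: (w ord0 q.1 *: p q.2 w) =
      r *: \sum_l w ord0 l *: \sum_t b (i, l) t z *: p t w.
    rewrite -(pair_bigA _ (fun l t => (r * b (i, l) t z) *: (w ord0 l *: p t w))) /= scaler_sumr.
    apply: eq_bigr => l _; rewrite !scaler_sumr; apply: eq_bigr => t _.
    by rewrite !scalerA; congr (_ *: _); rewrite -!mulrA; congr (_ * _); rewrite mulrC.
  rewrite addrC -scalerBr; congr (_ *: _); rewrite -sumrB; apply: eq_bigr => l _.
  by rewrite !mxE scalerBl.
Qed.

Lemma separable_taylor (J : finType) x k (C : J -> 'rV[R]_n -> seq 'I_n -> 'rV[R]_m) :
  (forall i s, (size s <= k)%N -> sm (fun z => C i z s) x) ->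
  separable x (fun i z w => taylor k (C i z) (w - z)).
Proof.
elim: k => [|k IH] sC.
  have [T [b [p [sb sp E]]]] := separable_tq sC.
  by exists T, b, p; split=> // i z w; rewrite -E /taylor big_ord_recl big_ord0 addr0.
have s1 : forall i s, (size s <= k)%N -> sm (fun z => C i z s) x.
  by move=> i s sk; apply: sC; exact: leqW.
have [T [b [p [sb sp E]]]] := separableD (IH s1) (separable_tq sC).
by exists T, b, p; split=> // i z w; rewrite -E /taylor big_ord_recr.
Qed.

(** The Taylor polynomial of [f i (z, .)] at w = z has coefficients that are smooth in z. *)
Lemma taylor_separation (J : finType) x k (f : J -> 'rV[R]_n * 'rV[R]_n -> 'rV[R]_m) :
  (forall i, sm (f i) (x, x)) ->
  exists (T : finType) (b : J -> T -> 'rV[R]_n -> R) (p : T -> 'rV[R]_n -> 'rV[R]_m),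
  [/\ forall i t, sm (b i t) x, forall t w, sm (p t) w &
    \forall z \near x, forall i, agree k (fun w => f i (z, w)) (fun w => \sum_t b i t z *: p t w) z].
Proof.
move=> sf.
have sB z : sm (fun w : 'rV[R]_n => (w, w)) z by apply: sm_pair; exact: sm_id.
pose C i z s := jetc (fun w => f i (z, w)) z s.
have [|T [b [p [sb sp E]]]] := @separable_taylor J x k C.
  move=> i s _; rewrite /C /jetc; under eq_fun do rewrite iter_partial.
  by apply: (@sm_comp _ _ _ _ (iter_deriv _ (f i)) (fun w : 'rV[R]_n => (w, w))) => //; exact: sm_iter.
exists T, b, p; split=> //.
apply: near_forall => i.
have := near_comp (sm_cont (sB x)) (P := fun q => sm (f i) q) (sm_near (sf i)).
apply: filterS => z sz.
have sfz : sm (fun w => f i (z, w)) z.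
  by apply: (@sm_comp _ _ _ _ (f i) (fun w => (z, w))) => //; exact: sm_pairr.
have := @taylor_agree _ _ _ (findim_mx _ _) k (fun w => f i (z, w)) z sfz.
move/agree_sym; rewrite (_ : (fun y => taylor k (jetc (fun w => f i (z, w)) z) (y - z)) = (fun w => \sum_t b i t z *: p t w)) //.
by apply/funext => w; rewrite -E.
Qed.

End Separation.

(** * Decomposition of families of vertical sections *)

Section Decomposition.
Context {R : realType} (G : lie_groupoid R).
Local Notation I := (base G).
Local Notation n := (mdim I).
Local Notation m := (mdim (arrows G)).
Local Notation one := (@unit_ R G).
Variables (c : chart R I n) (d : chart R (arrows G) m) (x : I).
Hypotheses (ac : atlas c) (ad : atlas d) (cx : cdom c x) (dx : cdom d (one x)).
Let S := shat c d.
Let u := hat c d one.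

(* The projection of R^m onto the kernel of D S at [u w], along the image of D u. *)
Definition vproj (q : 'rV[R]_n -> 'rV[R]_m) (w : 'rV[R]_n) : 'rV[R]_m :=
  q w - 'D_('D_(q w) S (u w)) u w.

Lemma sm_vproj q : sm q (cmap c x) ->
  sm (fun w => 'D_(q w) S (u w)) (cmap c x) /\ sm (vproj q) (cmap c x).
Proof.
move=> sq; have su := sm_u ac ad cx dx.
have s1 : sm (fun w => 'D_(q w) S (u w)) (cmap c x).
  by apply: (@sm_D _ _ _ _ S u q) => //; exact: sm_shat_one.
split=> //; apply: smB => //.
by apply: (@sm_D _ _ _ _ u id (fun w => 'D_(q w) S (u w))) => //; exact: sm_id.
Qed.

(** S o u is the identity, so D S (D u a) = a; take a = D S q. *)
Lemma vert_vproj q : sm q (cmap c x) -> vert c d (vproj q) x.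
Proof.
move=> sq; split; first by have [] := sm_vproj sq.
have su := sm_u ac ad cx dx.
have nS := near_comp (sm_cont su) (P := fun q => sm S q) (sm_near (sm_shat_one ac ad cx dx)).
have := nearI nS (nearI (sm_near su) (near_near (shat_uhat ac ad cx dx))).
apply: filterS => w [sS [suw nid]]; rewrite -/S -/u /vproj.
have dS := sm_diff sS.
apply: (etrans (deriveBv _ _ dS)); apply/eqP; rewrite subr_eq0; apply/eqP.
have := derive_comp ('D_(q w) S (u w)) (sm_diff suw) dS; rewrite (near_eq_derive _ nid) => <-.
by rewrite derive_id.
Qed.

Lemma agree_vproj k q q' z : cdom c z -> cdom d (one z) -> sm q (cmap c z) -> sm q' (cmap c z) ->
  agree k q q' (cmap c z) -> agree k (vproj q) (vproj q') (cmap c z).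
Proof.
move=> cz dz sq sq' qq; have su := sm_u ac ad cz dz; have sS := sm_shat_one ac ad cz dz.
have s1 p : sm p (cmap c z) -> sm (fun w => 'D_(p w) S (u w)) (cmap c z).
  by move=> sp; apply: (@sm_D _ _ _ _ S u p).
have s2 p : sm p (cmap c z) -> sm (fun w => 'D_('D_(p w) S (u w)) u w) (cmap c z).
  move=> /s1 sp; apply: (@sm_D _ _ _ _ u id (fun w => 'D_(p w) S (u w))) => //; exact: sm_id.
apply: (agreeB sq sq' (s2 q sq) (s2 q' sq') qq).
have aS : agree k (fun w => 'D_(q w) S (u w)) (fun w => 'D_(q' w) S (u w)) (cmap c z).
  by apply: (@agree_D _ k _ _ _ S S u u q q'); [exact: findim_mx|exact: sS|exact: sS|exact: sq|exact: sq'|exact: su|exact: su| |exact: qq|].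
have si : sm (fun w : 'rV[R]_n => w) (cmap c z) by exact: sm_id.
by apply: (@agree_D _ k _ _ _ u u (fun w => w) (fun w => w)); [exact: findim_mx|exact: su|exact: su|exact: (s1 q sq)|exact: (s1 q' sq')|exact: si|exact: si| |exact: aS|].
Qed.

Lemma vproj_sum (T : finType) (a : T -> R) (p : T -> 'rV[R]_n -> 'rV[R]_m) w :
  sm S (u w) -> sm u w -> vproj (fun w => \sum_t a t *: p t w) w = \sum_t a t *: vproj (p t) w.
Proof.
move=> /sm_diff dS /sm_diff du; rewrite /vproj.
have -> : 'D_(\sum_t a t *: p t w) S (u w) = \sum_t a t *: 'D_(p t w) S (u w).
  by rewrite (derive_sumv _ _ dS); apply: eq_bigr => t _; exact: deriveZv.
have -> : 'D_(\sum_t a t *: 'D_(p t w) S (u w)) u w = \sum_t a t *: 'D_('D_(p t w) S (u w)) u w.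
  by rewrite (derive_sumv _ _ du); apply: eq_bigr => t _; exact: deriveZv.
by rewrite -sumrB; apply: eq_bigr => t _; rewrite scalerBr.
Qed.

(** The sections found by [taylor_separation] need not be vertical. They may be projected, since
    [vproj] is linear, preserves agreement to order [k] and fixes the vertical [f i (z, .)]. *)
Lemma vert_decomposition (J : finType) k (f : J -> 'rV[R]_n * 'rV[R]_n -> 'rV[R]_m) :
  (forall i, sm (f i) (cmap c x, cmap c x)) ->
  (forall i, \forall p \near (cmap c x, cmap c x), 'D_(f i p) S (u p.2) = 0) ->
  exists (T : finType) (b : J -> T -> 'rV[R]_n -> R) (th : T -> 'rV[R]_n -> 'rV[R]_m),
  [/\ forall i t, sm (b i t) (cmap c x), forall t, vert c d (th t) x &
    \forall z \near cmap c x, forall i,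
      agree k (fun w => f i (z, w)) (fun w => \sum_t b i t z *: th t w) z].
Proof.
move=> sf vf; have [T [b [p [sb sp E]]]] := taylor_separation k sf.
exists T, b, (fun t => vproj (p t)); split=> //.
  by move=> t; apply: vert_vproj; exact: sp.
have sB z : sm (fun w : 'rV[R]_n => (w, w)) z by apply: sm_pair; exact: sm_id.
have [su nd] := sm_uhat ac ad cx dx.
have nS := near_comp (sm_cont su) (P := fun q => sm S q) (sm_near (sm_shat_one ac ad cx dx)).
have ndx : \forall y \near x, cdom d (one y) by exact: (chart_near cx nd).
apply: near_forall => i.
have N1 := near_comp (sm_cont (sB (cmap c x))) (P := fun q => sm (f i) q) (sm_near (sf i)).
have N2 := near_comp (sm_cont (sB (cmap c x))) (P := fun q => nbhs q (fun p => 'D_(f i p) S (u p.2) = 0)) (near_near (vf i)).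
have := nearI (near_cimg cx) (nearI E (nearI N1 (nearI N2 (nearI (near_near (nearI nS (sm_near su))) (near_chart cx ndx))))).
apply: filterS => z [/cinvK [cz ze] [Ez [s1 [n2 [n3 dz]]]]].
have sfz : sm (fun w => f i (z, w)) z.
  by apply: (@sm_comp _ _ _ _ (f i) (fun w => (z, w))) => //; exact: sm_pairr.
have ssum : sm (fun w => \sum_t b i t z *: p t w) z.
  by apply: sm_sum => t _; exact: (sm_scale (sm_cst _ _) (sp t z)).
have := @agree_vproj k (fun w => f i (z, w)) (fun w => \sum_t b i t z *: p t w) (cinv c z) cz dz.
rewrite ze => /(_ sfz ssum (Ez i)).
apply: agree_near_ext.
  apply: filterS (near_slice n2) => w vw; rewrite /vproj.
  by rewrite (vw : 'D_(f i (z, w)) S (u w) = 0) derive0 subr0.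
by apply: filterS n3 => w [sS suw]; exact: vproj_sum.
Qed.

End Decomposition.

(** * Algebroid-valued forms *)

Section CoordinateFields.
Context {R : realType} (I : manifold R).
Local Notation n := (mdim I).
Variables (c : chart R I n) (x : I).
Hypotheses (ac : atlas c) (cx : cdom c x).

(** The 1-form with components [b i] in the chart: [v (ccoord c i)] is the i-th coordinate of
    [v]. *)
Definition coord_form (b : 'I_n -> 'rV[R]_n -> R) : I -> ((I -> R) -> R) -> R :=
  fun z v => \sum_i b i (cmap c z) * v (ccoord c i).

(** Constant in the chart, so brackets of such fields vanish and d om only involves derivatives of
    the components. *)
Definition cfield (v : 'rV[R]_n) : I -> (I -> R) -> R := fun y => tanv c y v.

Lemma vfield_cfield v : vfield_near x (cfield v).
Proof.
split; first by apply: filterS (near_cdom cx) => y cy; exact: tangent_tanv.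
move=> h sh; apply: (fun_chart ac cx).
apply: (@sm_near_ext _ _ _ ('D_v (h \o cinv c))); last by apply: sm_derive; exact: sh.
have := nearI (near_cimg cx) (near_chart cx (fun_near sh)).
by apply: filterS => w [/cinvK [cw we] sw]; rewrite /cfield /tanv /= asboolT // we.
Qed.

Lemma vbracket_cfield v w : vbracket (cfield v) (cfield w) x = 0.
Proof.
rewrite (@vbracket_tanv _ _ c x _ _ (fun _ => v) (fun _ => w) ac cx (@sm_cst _ _ _ _ _) (@sm_cst _ _ _ _ _)).
- by rewrite !derive_cst subrr tanv0.
- by near=> q.
- by near=> q.
Unshelve. all: by end_near. Qed.

Lemma dform_coord (b : 'I_n -> 'rV[R]_n -> R) v w : (forall i, sm (b i) (cmap c x)) ->
  dform (coord_form b) (cfield v) (cfield w) x =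
  \sum_i (w ord0 i * 'D_v (b i) (cmap c x) - v ord0 i * 'D_w (b i) (cmap c x)).
Proof.
move=> sb; rewrite /dform vbracket_cfield.
have -> : coord_form b x 0 = 0 by rewrite /coord_form big1 // => i _; rewrite mulr0.
have H v' w' : cfield v' x (fun y => coord_form b y (cfield w' y)) = \sum_i w' ord0 i * 'D_v' (b i) (cmap c x).
  have N : \forall z \near cmap c x, ((fun y => coord_form b y (cfield w' y)) \o cinv c) z = \sum_i w' ord0 i *: b i z.
    apply: filterS (near_cimg cx) => z /cinvK [cz ze]; rewrite /coord_form /= ze; apply: eq_bigr => i _.
    by rewrite /cfield tanv_coord // mulrC.
  have ss : sm (fun z => \sum_i w' ord0 i *: b i z) (cmap c x).
    by apply: sm_sum => i _; exact: (sm_scale (sm_cst _ _) (sb i)).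
  rewrite /cfield /tanv asboolT; last first.
    apply: (fun_chart ac cx); apply: sm_near_ext ss.
    by apply: filterS N => z /= ->.
  rewrite (near_eq_derive _ N) derive_sumf; last first.
    by move=> i; apply: sm_diff; exact: (sm_scale (sm_cst _ _) (sb i)).
  by apply: eq_bigr => i _; rewrite deriveZf //; exact: sm_diff.
by rewrite !H subr0 sumrB.
Unshelve. all: by end_near. Qed.

End CoordinateFields.

(** * Finite sums of tensors om_t (x) j^k theta_t *)

Section Forms.
Context {R : realType} (G : lie_groupoid R).
Local Notation I := (base G).
Local Notation n := (mdim I).
Local Notation m := (mdim (arrows G)).
Local Notation one := (@unit_ R G).
Variables (k : nat) (c : chart R I n) (d : chart R (arrows G) m) (x : I) (A : jcoord G k -> jets G).
Hypotheses (ac : atlas c) (ad : atlas d) (ngA : \forall z \near x, jchart_at c d A z).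
Implicit Types (th : 'rV[R]_n -> 'rV[R]_m) (h : I -> R).

Lemma jchart_at_cx : cdom c x. Proof. by have [] := nbhs_singleton ngA. Qed.
Lemma coord_form_smooth (b : 'I_n -> 'rV[R]_n -> R) V : (forall i, sm (b i) (cmap c x)) -> vfield_near x V ->
  sm ((fun y => coord_form c b y (V y)) \o cinv c) (cmap c x).
Proof.
move=> sb [_ sV].
have sVi i : sm ((fun y => V y (ccoord c i)) \o cinv c) (cmap c x).
  by apply: sV => //; [apply: fun_coord => //|]; exact: jchart_at_cx.
apply: (@sm_near_ext _ _ _ (fun w => \sum_i b i w * ((fun y => V y (ccoord c i)) \o cinv c) w)).
  by apply: filterS (near_cimg jchart_at_cx) => w /cinvK [_ we]; rewrite /coord_form /= we.
by apply: sm_sum => i _; exact: smM.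
Qed.

Lemma coord_form_sform (b : 'I_n -> 'rV[R]_n -> R) : (forall i, sm (b i) (cmap c x)) ->
  sform_at x (coord_form c b).
Proof.
move=> sb; split.
  near=> y => a v w _ _; rewrite /coord_form mulr_sumr -big_split /=; apply: eq_bigr => i _.
  by rewrite [X in _ * X]/= mulrDr; congr (_ + _); rewrite mulrCA.
move=> V nV; apply: (fun_chart ac jchart_at_cx); exact: coord_form_smooth.
Unshelve. all: by end_near. Qed.

Lemma jprol_algd z th : jchart_at c d A z -> vert c d th z ->
  algd (Gam := jgpd G k) z (tau c d A z (0, coefs k (jetc th (cmap c z)))).
Proof.
move=> gz vz; have [cz dz _ _] := gz.
have [F gF] := gen_ex ac ad cz dz vz.
have sE : \forall y \near z, sect c d th y = sect c d th y by near=> y.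
have [pj g0 Dg] := gen_kapX k ac ad cz dz sE gF.
rewrite -(gen_velocity ac ad gz sE gF); split.
  by exists (fun t => jet k z (F t)).
apply/funext => h; rewrite /push; case: asboolP => // _.
rewrite /velocity /push g0; case: asboolP => // _.
by rewrite derive1E; exact: (derive_cst (h z)).
Unshelve. all: by end_near. Qed.

Variables (T : finType) (th : T -> 'rV[R]_n -> 'rV[R]_m).
Hypothesis vth : forall t, vert c d (th t) x.

Lemma near_vth : \forall z \near x, forall t, vert c d (th t) z.
Proof. by apply: near_forall => t; apply: vert_near (vth t); exact: jchart_at_cx. Qed.

Lemma jetc_sum (s : seq T) (a : T -> R) w J : (forall t, sm (th t) w) ->
  jetc (fun w => \sum_(t <- s) a t *: th t w) w J = \sum_(t <- s) a t *: jetc (th t) w J.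
Proof.
move=> st; rewrite /jetc iter_deriv_sum; last by move=> t; exact: (sm_scale (sm_cst _ _) (st t)).
by apply: eq_bigr => t _; rewrite iter_derivZ.
Qed.

Lemma vert_sum (s : seq T) (a : T -> R) z : jchart_at c d A z -> (forall t, vert c d (th t) z) ->
  vert c d (fun w => \sum_(t <- s) a t *: th t w) z.
Proof.
move=> [cz dz _ _] vz; split.
  by apply: sm_sum => t _; exact: (sm_scale (sm_cst _ _) (vz t).1).
have [su _] := sm_uhat ac ad cz dz.
have nS := near_comp (sm_cont su) (P := fun q => sm (shat c d) q) (sm_near (sm_shat_one ac ad cz dz)).
have nv : \forall w \near cmap c z, forall t, 'D_(th t w) (shat c d) (hat c d one w) = 0.
  by apply: near_forall => t; exact: (vz t).2.
have := nearI nS nv; apply: filterS => w [/sm_diff dS vw].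
rewrite (derive_sumv _ _ dS) big1 // => t _.
by rewrite (deriveZv _ _ dS) vw scaler0.
Qed.

Lemma coefs_sum (s : seq T) (a : T -> R) (C : T -> seq 'I_n -> 'rV[R]_m) :
  coefs k (fun J => \sum_(t <- s) a t *: C t J) = \sum_(t <- s) a t *: coefs k (C t).
Proof.
apply/matrixP => i j; rewrite mxE !summxE; apply: eq_bigr => t _; by rewrite !mxE.
Qed.

(** At a fixed [z] the coefficients are numbers, so the sum is the prolongation at [z] of one
    vertical section. *)
Lemma jprol_sum (s : seq T) (a : T -> R) z : jchart_at c d A z -> (forall t, vert c d (th t) z) ->
  \sum_(t <- s) a t *: jprol k (sect c d (th t)) z =
  tau c d A z (0, coefs k (jetc (fun w => \sum_(t <- s) a t *: th t w) (cmap c z))).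
Proof.
move=> gz vz.
have -> : ((0, coefs k (jetc (fun w => \sum_(t <- s) a t *: th t w) (cmap c z))) : jcoord G k) =
    \sum_(t <- s) a t *: (0, coefs k (jetc (th t) (cmap c z))).
  transitivity ((0, \sum_(t <- s) a t *: coefs k (jetc (th t) (cmap c z))) : jcoord G k).
    congr (_, _); rewrite -coefs_sum; apply: coefs_ext => J _; apply: jetc_sum => t; exact: (vz t).1.
  elim: s => [|t s IH]; first by rewrite !big_nil.
  by rewrite !big_cons -IH -[RHS]/(a t *: 0 + 0, _ + _) scaler0 addr0.
rewrite (tau_sum _ _ _ _ _ gz) //; apply: eq_bigr => t _; congr (_ *: _).
by apply: jprol_tau => //; near=> y.
Unshelve. all: by end_near. Qed.

Lemma near_algd_sum : \forall y \near x, forall (s : seq T) (a : T -> R),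
  algd (Gam := jgpd G k) y (\sum_(t <- s) a t *: jprol k (sect c d (th t)) y).
Proof.
have := nearI ngA near_vth; apply: filterS => y [gy vy] s a.
by rewrite jprol_sum //; apply: jprol_algd => //; exact: vert_sum.
Qed.

Lemma jprol_sec (s : seq T) (a : T -> I -> R) : (forall t, sm (a t \o cinv c) (cmap c x)) ->
  algd_sec (Gam := jgpd G k) x (fun y => \sum_(t <- s) a t y *: jprol k (sect c d (th t)) y).
Proof.
move=> sa; split; first by apply: filterS near_algd_sum => y H; exact: H.
move=> h dh; have sth t : sm (th t) (cmap c x) by exact: (vth t).1.
pose q (y : I) : jcoord G k := (0, \sum_(t <- s) a t y *: coefs k (jetc (th t) (cmap c y))).
apply: (@fun_ext _ _ (fun y => tau c d A y (q y) h)).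
  have := nearI ngA near_vth; apply: filterS => y [gy vy].
  have qE : q y = (0, coefs k (jetc (fun w => \sum_(t <- s) a t y *: th t w) (cmap c y))).
    congr (_, _); rewrite -coefs_sum; apply: coefs_ext => J _.
    by apply/esym/jetc_sum => t; exact: (vy t).1.
  by rewrite qE -jprol_sum.
apply: tau_smooth => //.
apply: sm_pair; first exact: sm_cst.
apply: sm_sum => t _; apply: (@sm_scale _ _ _ (a t \o cinv c)) => //.
apply: (@sm_near_ext _ _ _ (fun w => coefs k (jetc (th t) w))).
  by apply: filterS (near_cimg jchart_at_cx) => w /cinvK [_ we]; rewrite /= we.
by apply: sm_coefs => J _; exact: sm_iter.
Qed.

Variable b : 'I_n -> T -> 'rV[R]_n -> R.
Hypothesis sb : forall i t, sm (b i t) (cmap c x).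
Let om t := coord_form c (fun i => b i t).

Lemma sum_form (s : seq T) : aform_at (Gam := jgpd G k) x
  (\sum_(t <- s) tens (Gam := jgpd G k) (om t) (jprol k (sect c d (th t)))).
Proof.
have uE y v : (\sum_(t <- s) tens (Gam := jgpd G k) (om t) (jprol k (sect c d (th t)))) y v =
    \sum_(t <- s) om t y v *: jprol k (sect c d (th t)) y.
  by elim: s => [|t r IH]; rewrite ?big_nil // !big_cons -IH.
split.
- by apply: filterS near_algd_sum => y H v _; rewrite uE.
- have N : \forall y \near x, forall t, forall (a : R) v w, mtangent y v -> mtangent y w ->
      om t y (a *: v + w) = a * om t y v + om t y w.
    by apply: near_forall => t; have [] := coord_form_sform (fun i => sb i t).
  apply: filterS N => y H a v w tv tw; rewrite !uE scaler_sumr -big_split /=.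
  by apply: eq_bigr => t _; rewrite H // scalerDl scalerA.
- move=> V nV; under eq_fun do rewrite uE.
  by apply: jprol_sec => t; apply: coord_form_smooth => // i.
Qed.

End Forms.

(** * The Maurer-Cartan equation *)

Lemma addr_transpose (U : zmodType) (a b a' b' : U) : a + b = a' + b' -> a - a' = b' - b.
Proof. by move=> E; apply/eqP; rewrite subr_eq addrAC [b' + a']addrC -E addrK. Qed.

Section Cocycle.
Context {R : realType} (V W : normedModType R).
Hypotheses (fV : findim V) (fW : findim W).
Variables (P : (V * V) * W -> W) (z0 : V) (r0 : W).
Hypothesis sP : sm P ((z0, z0), r0).
Hypothesis P1 : \forall q \near (z0, r0), P ((q.1, q.1), q.2) = q.2.
Hypothesis P2 : \forall q \near ((z0, z0), r0),
  P ((z0, q.1.2), q.2) = P ((z0, q.1.1), P ((q.1.1, q.1.2), q.2)).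

(** When P ((z, z'), .) is left multiplication by Psi_z^-1 Psi_z', this is the Maurer-Cartan form of
    Psi, as a vector field in r. *)
Definition mc_form (v : V) (z : V) (r : W) : W := 'D_((0, v), 0) P ((z, z), r).

Let fVVW : findim ((V * V) * W)%type.
Proof. by []. Qed.

Let D (v : V) := ((0, v), 0) : (V * V) * W.
Let Dr (s : W) := ((0, 0), s) : (V * V) * W.

Lemma sm_mc_form v : sm (fun q : V * W => mc_form v q.1 q.2) (z0, r0).
Proof.
apply: (@sm_comp _ _ _ _ ('D_(D v) P) (fun q : V * W => ((q.1, q.1), q.2))) => //; last exact: sm_derive.
apply: sm_pair; last exact: sm_snd.
by apply: sm_pair; exact: sm_fst.
Qed.

Lemma derive_right v p : 'D_v (fun z' => P ((p.1.1, z'), p.2)) p.1.2 = 'D_(D v) P p.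
Proof.
case: p => [[z z'] r] /=; apply: (@derive_affine _ _ _ _ (fun z' => ((z, z'), r)) P z' v (D v)) => h.
rewrite -[RHS]/((h *: (0 : V) + z, h *: v + z'), h *: (0 : W) + r).
by rewrite !scaler0 !add0r.
Qed.

Lemma derive_last s p : 'D_s (fun r => P (p.1, r)) p.2 = 'D_(Dr s) P p.
Proof.
case: p => [[z z'] r] /=; apply: (@derive_affine _ _ _ _ (fun r => ((z, z'), r)) P r s (Dr s)) => h.
rewrite -[RHS]/((h *: (0 : V) + z, h *: (0 : V) + z'), h *: s + r).
by rewrite !scaler0 !add0r.
Qed.

(* the derivative of [P2] in [z''] at [z'' = z'] *)
Lemma cocycle_derive w : \forall z \near z0,
  'D_(D w) P ((z0, z), r0) = 'D_(Dr (mc_form w z r0)) P ((z0, z), r0).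
Proof.
have sc : sm (fun z : V => ((z, z), r0)) z0.
  by apply: sm_pair; [apply: sm_pair; exact: sm_id|exact: sm_cst].
have sc0 : sm (fun z : V => ((z0, z), r0)) z0.
  by apply: sm_pair; [exact: sm_pairr|exact: sm_cst].
have n1 := near_comp (sm_cont sc) (P := fun q => nbhs q (fun q => P ((z0, q.1.2), q.2) = P ((z0, q.1.1), P ((q.1.1, q.1.2), q.2)))) (near_near P2).
have n2 := near_comp (sm_cont sc) (P := fun q => sm P q) (sm_near sP).
have n3 := near_comp (sm_cont sc0) (P := fun q => sm P q) (sm_near sP).
have := nearI n1 (nearI n2 (nearI n3 (near_slicel P1))).
apply: filterS => z [h1 [s1 [s2 h4]]].
rewrite /= in h4.
rewrite -(derive_right w ((z0, z), r0)) /=.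
have sz : sm (fun z' : V => ((z, z'), r0)) z.
  by apply: sm_pair; [exact: sm_pairr|exact: sm_cst].
transitivity ('D_w ((fun r => P ((z0, z), r)) \o (fun z' => P ((z, z'), r0))) z).
  apply: near_eq_derive.
  exact: (near_comp (sm_cont sz) (P := fun q => P ((z0, q.1.2), q.2) = P ((z0, q.1.1), P ((q.1.1, q.1.2), q.2))) h1).
have sw : sm (fun z' => P ((z, z'), r0)) z by apply: (@sm_comp _ _ _ _ P (fun z' => ((z, z'), r0))).
have sr : sm (fun r => P ((z0, z), r)) (P ((z, z), r0)).
  by rewrite h4; apply: (@sm_comp _ _ _ _ P (fun r => ((z0, z), r))) => //; exact: sm_pairr.
apply: etrans (derive_comp w (sm_diff sw) (sm_diff sr)) _; rewrite h4.
have e1 : 'D_w (fun z' => P ((z, z'), r0)) z = mc_form w z r0 := derive_right w ((z, z), r0).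
by rewrite e1; exact: (derive_last (mc_form w z r0) ((z0, z), r0)).
Qed.

(** [cocycle_derive] is differentiated once more, in z at z0. What matters is that the right-hand
    side is symmetric in [v] and [w]. *)
Lemma cocycle_derive2 v w :
  'D_v (fun z => mc_form w z r0) z0 + 'D_(mc_form w z0 r0) (mc_form v z0) r0 =
  'D_(D v) ('D_(D w) P) ((z0, z0), r0).
Proof.
have sc0 : sm (fun z : V => ((z0, z), r0)) z0.
  by apply: sm_pair; [exact: sm_pairr|exact: sm_cst].
have Dc0 : 'D_v (fun z : V => ((z0, z), r0)) z0 = D v.
  rewrite derive_pair; [|by apply: sm_diff; exact: sm_pairr|exact: sm_diff (sm_cst _ _)].
  rewrite derive_pair; [|exact: sm_diff (sm_cst _ _)|exact: sm_diff (sm_id _)].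
  by rewrite !derive_cst derive_id.
have smz : sm (fun z => mc_form w z r0) z0.
  by apply: (@sm_comp _ _ _ _ (fun q : V * W => mc_form w q.1 q.2) (fun z => (z, r0))) => //; [exact: sm_pairl|exact: sm_mc_form].
have smr : sm (mc_form v z0) r0.
  by apply: (@sm_comp _ _ _ _ (fun q : V * W => mc_form v q.1 q.2) (fun r => (z0, r))) => //; [exact: sm_pairr|exact: sm_mc_form].
pose u (z : V) := Dr (mc_form w z r0).
have su : sm u z0 by apply: sm_pair => //; exact: sm_cst.
have Du : 'D_v u z0 = Dr ('D_v (fun z => mc_form w z r0) z0).
  rewrite derive_pair; [|exact: sm_diff (sm_cst _ _)|exact: sm_diff smz].
  by rewrite derive_cst.
have sDw : sm ('D_(D w) P) ((z0, z0), r0) by exact: sm_derive.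
have e1 : 'D_(D v) ('D_(D w) P) ((z0, z0), r0) = 'D_v (fun z => 'D_(D w) P ((z0, z), r0)) z0.
  by rewrite -Dc0; exact: (esym (derive_comp v (sm_diff sc0) (sm_diff sDw))).
rewrite e1 (near_eq_derive _ (cocycle_derive w)).
have De q : 'D_(Dr q) P ((z0, z0), r0) = q.
  have nP : \forall r \near r0, P ((z0, z0), r) = id r by exact: near_slice P1.
  have := derive_last q ((z0, z0), r0); rewrite /= => <-.
  by apply: (etrans (near_eq_derive _ nP)); exact: derive_id.
have Ds : 'D_(D v) ('D_(u z0) P) ((z0, z0), r0) = 'D_(mc_form w z0 r0) (mc_form v z0) r0.
  apply: (etrans (@schwarz _ _ _ P ((z0, z0), r0) (u z0) (D v) fW sP)); apply/esym.
  apply: (@derive_affine _ _ _ _ (fun r => ((z0, z0), r)) ('D_(D v) P) r0 _ (u z0)) => h.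
  rewrite -[RHS]/((h *: (0 : V) + z0, h *: (0 : V) + z0), h *: mc_form w z0 r0 + r0).
  by rewrite !scaler0 !add0r.
have E := @derive_D _ _ _ _ P (fun z : V => ((z0, z), r0)) u z0 v fVVW sP sc0 su.
rewrite Dc0 Du in E.
exact: (esym (etrans E (f_equal2 +%R (De _) Ds))).
Qed.

Lemma maurer_cartan v w :
  'D_v (fun z => mc_form w z r0) z0 - 'D_w (fun z => mc_form v z r0) z0 =
  'D_(mc_form v z0 r0) (mc_form w z0) r0 - 'D_(mc_form w z0 r0) (mc_form v z0) r0.
Proof.
have e3 := @schwarz _ _ _ P ((z0, z0), r0) (D w) (D v) fW sP.
exact: (addr_transpose (etrans (cocycle_derive2 v w) (etrans e3 (esym (cocycle_derive2 w v))))).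
Qed.

End Cocycle.

Lemma derive_mid (R : realType) (V W U : normedModType R) (F : (V * V) * W -> U) v z z' r :
  'D_v (fun z' => F ((z, z'), r)) z' = 'D_((0, v), 0) F ((z, z'), r).
Proof.
apply: (@derive_affine _ _ _ _ (fun z' => ((z, z'), r)) F z' v ((0, v), 0)) => h.
rewrite -[RHS]/((h *: (0 : V) + z, h *: v + z'), h *: (0 : W) + r).
by rewrite !scaler0 !add0r.
Qed.

(** * The cocycle of quotients of a family of bisections *)

Section MaurerCartan.
Context {R : realType} (G : lie_groupoid R).
Local Notation I := (base G).
Local Notation n := (mdim I).
Local Notation m := (mdim (arrows G)).
Local Notation bmulG := (bmul (Gam := gpd_of G)).
Local Notation one := (@unit_ R G).
Local Notation V := 'rV[R]_n.

(** With Q and P the values of Psi_z and of its inverse, this is Theta_(w0,z) Theta_(z,z') =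
    Theta_(w0,z') applied to an arrow X. *)
Lemma mul_cancel_mid (B Q P A X : arrows G) t : src B = t -> src Q = tgt P -> src P = t ->
  tgt A = t -> src A = tgt X -> mul Q P = one t ->
  mul (mul B Q) (mul (mul P A) X) = mul (mul B A) X.
Proof.
move=> sB sQ sP tA sA QP.
have tQ : tgt Q = t by rewrite -(tgt_mul sQ) QP tgt_unit.
have sPA : src P = tgt A by rewrite sP tA.
have sBQ : src B = tgt Q by rewrite sB tQ.
rewrite mulA; [|by rewrite src_mul // tgt_mul|by rewrite src_mul].
congr (mul _ X); rewrite -mulA //; last by rewrite tgt_mul.
by rewrite [mul Q _]mulA // QP -tA mul_unitl.
Qed.

(** [quo_act_comp] cancels Psi_z against its inverse in this order too, at the pairs that
    [mul_cancel_mid] requires to be composable. *)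
Lemma family_inverse_sided (E : normedModType R) c c' (z0 : E) x (Psi : E -> I -> arrows G) : findim E ->
  family c z0 x Psi -> atlas c' -> cdom c' (tgt (Psi z0 x)) ->
  exists Phi : E -> I -> arrows G,
  [/\ family c' z0 (tgt (Psi z0 x)) Phi,
      \forall p \near (z0, cmap c x), Phi p.1 (tgt (Psi p.1 (cinv c p.2))) = inv (Psi p.1 (cinv c p.2)) &
      \forall p \near (z0, cmap c' (tgt (Psi z0 x))),
        [/\ src (Phi p.1 (cinv c' p.2)) = cinv c' p.2,
            src (Psi p.1 (tgt (Phi p.1 (cinv c' p.2)))) = tgt (Phi p.1 (cinv c' p.2)) &
            mul (Psi p.1 (tgt (Phi p.1 (cinv c' p.2)))) (Phi p.1 (cinv c' p.2)) = one (cinv c' p.2)]].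
Proof.
move=> fE fam ac' cy.
have [Phi [[g [sg gx fg gf nc'] PhiE] [fPhi PhiL]]] := family_inverse fE fam ac' cy.
exists Phi; split=> //.
have [_ _ sP _] := fam.
have sG : sm (fun p : E * V => (p.1, g p)) (z0, cmap c' (tgt (Psi z0 x))).
  by apply: sm_pair => //; exact: sm_fst.
have nG (P : E * V -> Prop) : (\forall p \near (z0, cmap c x), P p) ->
    \forall p \near (z0, cmap c' (tgt (Psi z0 x))), P (p.1, g p).
  by move=> nP; apply: (near_comp (sm_cont sG)); rewrite /= gx.
have := nearI (near_snd z0 (near_cimg cy)) (nearI fg (nG _ (nearI nc' sP))).
apply: filterS => -[z w] /= [/cinvK [_ we] [e1 [e2 e3]]].
have tE : tgt (Psi z (cinv c (g (z, w)))) = cinv c' w by rewrite -(cmapK e2) e1.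
have PE : Phi z (cinv c' w) = inv (Psi z (cinv c (g (z, w)))) by rewrite PhiE we.
by rewrite PE src_inv tgt_inv e3 mul_invr tE.
Qed.

Section Local.
Variables (c c' : chart R I n) (d : chart R (arrows G) m) (x : I)
  (mt : 'rV[R]_m * 'rV[R]_m -> 'rV[R]_m) (Psi Phi : V -> I -> arrows G).
Hypotheses (ad : atlas d) (dx : cdom d (one x)) (hm : mul_coord d x mt).
Hypotheses (fam : family c (cmap c x) x Psi) (ac' : atlas c') (cy : cdom c' (tgt (Psi (cmap c x) x)))
  (fPhi : family c' (cmap c x) (tgt (Psi (cmap c x) x)) Phi)
  (PhiL : \forall p \near (cmap c x, cmap c x), Phi p.1 (tgt (Psi p.1 (cinv c p.2))) = inv (Psi p.1 (cinv c p.2)))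
  (PhiR : \forall p \near (cmap c x, cmap c' (tgt (Psi (cmap c x) x))),
        [/\ src (Phi p.1 (cinv c' p.2)) = cinv c' p.2,
            src (Psi p.1 (tgt (Phi p.1 (cinv c' p.2)))) = tgt (Phi p.1 (cinv c' p.2)) &
            mul (Psi p.1 (tgt (Phi p.1 (cinv c' p.2)))) (Phi p.1 (cinv c' p.2)) = one (cinv c' p.2)]).

Let w0 := cmap c x.
Let r0 := cmap d (one x).
Let u := hat c d one.
Let T := cmap c \o (@tgt R G \o cinv d).

(* [Psi_z^-1 Psi_z'] for [q = (z, z')] *)
Definition quo (q : V * V) : I -> arrows G := bmulG (Phi q.1) (Psi q.2).
Definition quo_hat (p : (V * V) * V) : 'rV[R]_m := hat c d (quo p.1) p.2.
(* left multiplication by [quo p.1] *)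
Definition quo_act (p : (V * V) * 'rV[R]_m) : 'rV[R]_m := mt (quo_hat (p.1, T p.2), p.2).

Let ac : atlas c. Proof. by have [[]] := fam. Qed.
Let cx : cdom c x. Proof. by have [[]] := fam. Qed.
Let fVV : findim (V * V)%type. Proof. by []. Qed.
Let fV : findim V. Proof. by []. Qed.

Lemma family_quo : family c (w0, w0) x quo.
Proof.
apply: (@family_mul _ _ _ c c' (w0, w0) x (fun q => Psi q.2) (fun q => Phi q.1)) => //.
- by apply: (@family_param _ _ _ _ snd) => //; exact: sm_snd.
- by apply: (@family_param _ _ _ _ fst) => //; exact: sm_fst.
Qed.

Lemma quo_diag : \forall p \near (w0, w0), quo (p.1, p.1) (cinv c p.2) = one (cinv c p.2).
Proof.
have [_ _ sP _] := fam; have := nearI PhiL sP; apply: filterS => p [e1 e2].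
by rewrite /quo /bmul /= e1 mul_invl e2.
Qed.

Lemma quo_x : quo (w0, w0) x = one x.
Proof. by have := nbhs_singleton quo_diag; rewrite /= /w0 cmapK. Qed.

Lemma sm_quo_hat : sm quo_hat ((w0, w0), w0) /\
  \forall p \near ((w0, w0), w0), cdom d (quo p.1 (cinv c p.2)).
Proof. by apply: (family_hat (family_pfamily family_quo)) => //; rewrite quo_x. Qed.

Lemma quo_hat_diag : \forall p \near (w0, w0), quo_hat ((p.1, p.1), p.2) = u p.2.
Proof. by apply: filterS quo_diag => p e; rewrite /quo_hat /hat /= e. Qed.

Lemma T_r0 : T r0 = w0. Proof. by rewrite /T /r0 /= cmapK // tgt_unit. Qed.

Lemma sm_qT : sm (fun p : (V * V) * 'rV[R]_m => (p.1, T p.2)) ((w0, w0), r0).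
Proof.
have [sT _] := sm_that ac ad cx dx.
by apply: sm_pair; [exact: sm_fst|apply: (@sm_comp _ _ _ _ T snd) => //; exact: sm_snd].
Qed.

Lemma near_qT (P : (V * V) * V -> Prop) : (\forall p \near ((w0, w0), w0), P p) ->
  \forall p \near ((w0, w0), r0), P (p.1, T p.2).
Proof. by move=> nP; apply: (near_comp (sm_cont sm_qT)); rewrite /= T_r0. Qed.

Lemma sm_qB : sm (fun p : (V * V) * 'rV[R]_m => (quo_hat (p.1, T p.2), p.2)) ((w0, w0), r0).
Proof.
apply: sm_pair; last exact: sm_snd.
apply: (@sm_comp _ _ _ _ quo_hat (fun p : (V * V) * 'rV[R]_m => (p.1, T p.2))) => //; first exact: sm_qT.
by rewrite /= T_r0; have [] := sm_quo_hat.
Qed.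

Lemma quo_hat0 : quo_hat ((w0, w0), w0) = r0.
Proof. by rewrite /quo_hat /hat /= /w0 cmapK // quo_x. Qed.

Lemma sm_quo_act : sm quo_act ((w0, w0), r0).
Proof.
apply: (@sm_comp _ _ _ _ mt (fun p : (V * V) * 'rV[R]_m => (quo_hat (p.1, T p.2), p.2))) => //; first exact: sm_qB.
by rewrite /= T_r0 quo_hat0; exact: hm.1.
Qed.

Lemma quo_actE : \forall p \near ((w0, w0), r0), let X := cinv d p.2 in
  [/\ cmap d X = p.2, cdom c (tgt X), cdom d (mul (quo p.1 (tgt X)) X) &
      quo_act p = cmap d (mul (quo p.1 (tgt X)) X)].
Proof.
have [_ ndq] := sm_quo_hat; have [_ _ sq _] := family_quo; have [_ nT] := sm_that ac ad cx dx.
have N := near_comp (sm_cont sm_qB) (P := mul_at d mt).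
rewrite /= T_r0 quo_hat0 in N; have {}N := N hm.2.
have := nearI (near_snd (w0, w0) (near_cimg dx)) (nearI (near_snd (w0, w0) nT) (nearI N (nearI (near_qT ndq) (near_qT sq)))).
apply: filterS => -[q r] /= [/cinvK [dX re] [cX [Hm [dq sqq]]]].
have TX : cinv c (T r) = tgt (cinv d r) by rewrite /T /= cmapK.
rewrite TX in dq sqq.
move: Hm; rewrite /mul_at /quo_act /quo_hat /hat /= -/(T r) TX cmapK // => /(_ sqq) [h1 h2].
by split.
Qed.

Lemma quo_act_diag : \forall q \near (w0, r0), quo_act ((q.1, q.1), q.2) = q.2.
Proof.
have sB : sm (fun q : V * 'rV[R]_m => ((q.1, q.1), q.2)) (w0, r0).
  by apply: sm_pair; [apply: sm_pair; exact: sm_fst|exact: sm_snd].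
have N1 := near_comp (sm_cont sB) (P := fun p => let X := cinv d p.2 in
  [/\ cmap d X = p.2, cdom c (tgt X), cdom d (mul (quo p.1 (tgt X)) X) &
      quo_act p = cmap d (mul (quo p.1 (tgt X)) X)]) quo_actE.
have [sT _] := sm_that ac ad cx dx.
have sB2 : sm (fun q : V * 'rV[R]_m => (q.1, T q.2)) (w0, r0).
  by apply: sm_pair; [exact: sm_fst|apply: (@sm_comp _ _ _ _ T snd) => //; exact: sm_snd].
have N2 := near_comp (sm_cont sB2) (P := fun p => quo (p.1, p.1) (cinv c p.2) = one (cinv c p.2)).
rewrite /= T_r0 in N2; have := nearI N1 (N2 quo_diag).
apply: filterS => -[z r] /= [[re cX _ ->]].
by rewrite /T /= cmapK // => ->; rewrite mul_unitl.
Qed.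

(** Acting on arrows turns products of bisections into composites of maps of one chart, which is the
    form of the cocycle relation that [maurer_cartan] takes. *)
Lemma quo_act_comp : \forall q \near ((w0, w0), r0),
  quo_act ((w0, q.1.2), q.2) = quo_act ((w0, q.1.1), quo_act ((q.1.1, q.1.2), q.2)).
Proof.
pose Q := fun p : (V * V) * 'rV[R]_m => let X := cinv d p.2 in
  [/\ cmap d X = p.2, cdom c (tgt X), cdom d (mul (quo p.1 (tgt X)) X) &
      quo_act p = cmap d (mul (quo p.1 (tgt X)) X)].
have a0 : quo_act ((w0, w0), r0) = r0 by have := nbhs_singleton quo_act_diag.
have s11 : sm (fun q : (V * V) * 'rV[R]_m => q.1.1) ((w0, w0), r0).
  by apply: (@sm_comp _ _ _ _ fst fst) => //; exact: sm_fst.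
have s12 : sm (fun q : (V * V) * 'rV[R]_m => q.1.2) ((w0, w0), r0).
  by apply: (@sm_comp _ _ _ _ snd fst) => //; [exact: sm_fst|exact: sm_snd].
have s2 : sm (fun q : (V * V) * 'rV[R]_m => q.2) ((w0, w0), r0) by exact: sm_snd.
have sB1 : sm (fun q : (V * V) * 'rV[R]_m => ((w0, q.1.2), q.2)) ((w0, w0), r0).
  by apply: sm_pair => //; apply: sm_pair => //; exact: sm_cst.
have sB2 : sm (fun q : (V * V) * 'rV[R]_m => ((w0, q.1.1), quo_act q)) ((w0, w0), r0).
  by apply: sm_pair; [apply: sm_pair => //; exact: sm_cst|exact: sm_quo_act].
have N1 := near_comp (sm_cont sB1) (P := Q) quo_actE.
have N2 := near_comp (sm_cont sB2) (P := Q); rewrite /= a0 in N2; have {}N2 := N2 quo_actE.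
have [sT _] := sm_that ac ad cx dx.
have [[_ _] pP sP bP] := fam.
have [|nT sTP] := plotE (plot_family_tgt fam) ac'; first by rewrite /= cmapK.
have sB3 : sm (fun q : (V * V) * 'rV[R]_m => (q.1.2, T q.2)) ((w0, w0), r0).
  by apply: sm_pair => //; apply: (@sm_comp _ _ _ _ T snd) => //; exact: sm_snd.
pose t (p : V * V) := cmap c' (tgt (Psi p.1 (cinv c p.2))).
have st : sm t (w0, w0) by exact: sTP.
have t0 : t (w0, w0) = cmap c' (tgt (Psi (cmap c x) x)) by rewrite /t /= /w0 cmapK.
have N3 := near_comp (sm_cont sB3) (P := fun p => src (Psi p.1 (cinv c p.2)) = cinv c p.2 /\ cdom c' (tgt (Psi p.1 (cinv c p.2)))).
rewrite /= T_r0 in N3; have {}N3 := N3 (nearI sP nT).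
have st3 : sm (fun q : (V * V) * 'rV[R]_m => t (q.1.2, T q.2)) ((w0, w0), r0).
  by apply: (@sm_comp _ _ _ _ t (fun q : (V * V) * 'rV[R]_m => (q.1.2, T q.2))) => //; rewrite /= T_r0.
have sB4 : sm (fun q : (V * V) * 'rV[R]_m => (q.1.1, t (q.1.2, T q.2))) ((w0, w0), r0) by exact: sm_pair.
have sB5 : sm (fun q : (V * V) * 'rV[R]_m => (w0, t (q.1.2, T q.2))) ((w0, w0), r0).
  by apply: sm_pair => //; exact: sm_cst.
pose L (p : V * V) := [/\ src (Phi p.1 (cinv c' p.2)) = cinv c' p.2,
            src (Psi p.1 (tgt (Phi p.1 (cinv c' p.2)))) = tgt (Phi p.1 (cinv c' p.2)) &
            mul (Psi p.1 (tgt (Phi p.1 (cinv c' p.2)))) (Phi p.1 (cinv c' p.2)) = one (cinv c' p.2)].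
have N4 := near_comp (sm_cont sB4) (P := L); rewrite /= T_r0 t0 in N4.
have N5 := near_comp (sm_cont sB5) (P := L); rewrite /= T_r0 t0 in N5.
have := nearI quo_actE (nearI N1 (nearI N2 (nearI N3 (nearI (N4 PhiR) (N5 PhiR))))).
apply: filterS => -[[z z'] r] /= [[re cX d1 e1] [[_ _ _ ->] [[_ _ _ ->] [[sA cA] [[l1 l2 l3] [l4 _ _]]]]]].
have TX : cinv c (T r) = tgt (cinv d r) by rewrite /T /= cmapK.
rewrite TX in sA cA; rewrite /t /= TX cmapK // in l1 l2 l3 l4.
congr (cmap d _); rewrite e1 cmapK //.
set X := cinv d r in sA cA l1 l2 l3 l4 *; set A := Psi z' (tgt X) in sA cA l1 l2 l3 l4 *.
have qE : quo (z, z') (tgt X) = mul (Phi z (tgt A)) A by [].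
have tY : tgt (mul (quo (z, z') (tgt X)) X) = tgt (Phi z (tgt A)).
  by rewrite qE tgt_mul ?tgt_mul // src_mul.
have tPsi : tgt (Psi z (tgt (Phi z (tgt A)))) = tgt A by rewrite -(tgt_mul l2) l3 tgt_unit.
rewrite tY /quo /bmul /= tPsi.
by rewrite (@mul_cancel_mid (Phi w0 (tgt A)) (Psi z (tgt (Phi z (tgt A)))) (Phi z (tgt A)) A X (tgt A)).
Qed.

Definition zeta (v z w : V) : 'rV[R]_m := 'D_((0, v), 0) quo_hat ((z, z), w).

Let dg (p : V * V) : (V * V) * V := ((p.1, p.1), p.2).

Lemma sm_dg p : sm dg p.
Proof. by apply: sm_pair; [apply: sm_pair; exact: sm_fst|exact: sm_snd]. Qed.

Lemma sm_zeta v : sm (fun p : V * V => zeta v p.1 p.2) (w0, w0).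
Proof.
apply: (@sm_comp _ _ _ _ ('D_((0, v), 0) quo_hat) dg) => //; first exact: sm_dg.
by apply: sm_derive; have [] := sm_quo_hat.
Qed.

Lemma zeta_vert v : \forall p \near (w0, w0), 'D_(zeta v p.1 p.2) (shat c d) (u p.2) = 0.
Proof.
have [sq nq] := sm_quo_hat; have [_ _ sT _] := family_quo.
have nS : \forall p \near ((w0, w0), w0), shat c d (quo_hat p) = p.2.
  have := nearI (near_snd (w0, w0) (near_cimg cx)) (nearI sT nq).
  by apply: filterS => -[q w] /= [/cinvK [_ we] [sw dw]]; rewrite /shat /quo_hat /hat /= cmapK // sw we.
have [su _] := sm_uhat ac ad cx dx.
have nSu := near_comp (sm_cont su) (P := fun q => sm (shat c d) q) (sm_near (sm_shat_one ac ad cx dx)).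
have N1 := near_comp (sm_cont (sm_dg (w0, w0))) (P := fun p => sm quo_hat p) (sm_near sq).
have N2 := near_comp (sm_cont (sm_dg (w0, w0))) (P := fun p => nbhs p (fun p => shat c d (quo_hat p) = p.2)) (near_near nS).
have := nearI N1 (nearI N2 (nearI quo_hat_diag (near_snd w0 nSu))).
apply: filterS => -[z w] /= [sqw [nSw [uw sS]]].
have sS' : sm (shat c d) (quo_hat ((z, z), w)) by rewrite uw.
rewrite -uw; apply: etrans (esym (derive_comp ((0, v), 0) (sm_diff sqw) (sm_diff sS'))) _.
apply: etrans (near_eq_derive _ nSw) _.
apply: etrans (@derive_affine _ _ _ _ snd (id : V -> V) ((z, z), w) ((0, v), 0) 0 _) _ => //.
exact: derive0.
Qed.

(** Left multiplications commute with right translations, so the derivative of Theta_(z,z') in z' is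
    right invariant, extending [zeta]. *)
Lemma mc_form_bar v : \forall p \near (w0, r0), mc_form quo_act v p.1 p.2 = bar c d mt (zeta v p.1) p.2.
Proof.
have [sq _] := sm_quo_hat.
have sB : sm (fun q : V * 'rV[R]_m => ((q.1, q.1), q.2)) (w0, r0).
  by apply: sm_pair; [apply: sm_pair; exact: sm_fst|exact: sm_snd].
have sB2 : sm (fun q : V * 'rV[R]_m => (q.1, T q.2)) (w0, r0).
  have [sT _] := sm_that ac ad cx dx.
  by apply: sm_pair; [exact: sm_fst|apply: (@sm_comp _ _ _ _ T snd) => //; exact: sm_snd].
have N1 := near_comp (sm_cont sB) (P := fun p => sm quo_hat (p.1, T p.2)) (near_qT (sm_near sq)).
have N2 := near_comp (sm_cont sB2) (P := fun p => quo_hat ((p.1, p.1), p.2) = u p.2).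
rewrite /= T_r0 in N2.
have N3 := near_comp (sm_cont sm_qB) (P := fun p => sm mt p).
rewrite /= T_r0 quo_hat0 in N3.
have N4 := near_comp (sm_cont sB) (P := fun p => sm mt (quo_hat (p.1, T p.2), p.2)) (N3 (sm_near hm.1)).
have := nearI N1 (nearI (N2 quo_hat_diag) N4).
apply: filterS => -[z r] /= [s1 [h2 s3]].
rewrite /mc_form /bar -/T -/(u (T r)) -h2.
have sz : sm (fun z' : V => ((z, z'), T r)) z.
  by apply: sm_pair; [exact: sm_pairr|exact: sm_cst].
have sqz : sm (fun z' : V => quo_hat ((z, z'), T r)) z.
  by apply: (@sm_comp _ _ _ _ quo_hat (fun z' : V => ((z, z'), T r))).
have sp : sm (fun z' : V => (quo_hat ((z, z'), T r), r)) z by apply: sm_pair => //; exact: sm_cst.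
rewrite -(derive_mid quo_act v z z r).
apply: (etrans (derive_comp v (sm_diff sp) (sm_diff s3))).
by rewrite (derive_pair _ (sm_diff sqz) (sm_diff (sm_cst _ _))) derive_cst derive_mid.
Qed.

Lemma quo_act_one : \forall p \near ((w0, w0), w0), quo_act (p.1, u p.2) = quo_hat p.
Proof.
have [su nd] := sm_uhat ac ad cx dx; have [_ _ sq _] := family_quo.
have sB : sm (fun p : (V * V) * V => (p.1, u p.2)) ((w0, w0), w0).
  by apply: sm_pair; [exact: sm_fst|apply: (@sm_comp _ _ _ _ u snd) => //; exact: sm_snd].
have u0 : u w0 = r0 by exact: uhatE.
have N := near_comp (sm_cont sB) (P := fun p => let X := cinv d p.2 in
  [/\ cmap d X = p.2, cdom c (tgt X), cdom d (mul (quo p.1 (tgt X)) X) &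
      quo_act p = cmap d (mul (quo p.1 (tgt X)) X)]).
rewrite /= u0 in N.
have := nearI (N quo_actE) (nearI (near_snd (w0, w0) nd) sq).
apply: filterS => -[q w] /= [[_ _ _ ->] [dw sw]].
rewrite /u {1 2}/hat /= cmapK // tgt_unit.
by rewrite /quo_hat /hat /=; congr (cmap d _); rewrite -{2}sw mul_unitr.
Qed.

(** The Maurer-Cartan equation of [quo_act], read at the identities. *)
Lemma brk_zeta v1 v2 : \forall w \near w0,
  'D_v1 (fun z => zeta v2 z w) w0 - 'D_v2 (fun z => zeta v1 z w) w0 =
  brk c d mt (zeta v1 w0) (zeta v2 w0) w.
Proof.
have [su _] := sm_uhat ac ad cx dx; have u0 : u w0 = r0 by exact: uhatE.
have sBw : sm (fun w : V => ((w0, w0), u w)) w0 by apply: sm_pair => //; exact: sm_cst.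
have sBw1 : sm (fun w : V => (w0, u w)) w0 by apply: sm_pair => //; exact: sm_cst.
have N1 := near_comp (sm_cont sBw) (P := fun p => sm quo_act p); rewrite u0 in N1.
have N2 := near_comp (sm_cont sBw1) (P := fun p => nbhs p (fun q => quo_act ((q.1, q.1), q.2) = q.2)).
have N3 := near_comp (sm_cont sBw) (P := fun p => nbhs p (fun q =>
  quo_act ((w0, q.1.2), q.2) = quo_act ((w0, q.1.1), quo_act ((q.1.1, q.1.2), q.2)))).
have N4 v := near_comp (sm_cont sBw1) (P := fun p => nbhs p (fun p => mc_form quo_act v p.1 p.2 = bar c d mt (zeta v p.1) p.2)).
rewrite u0 in N2 N3.
have {}N4 v : \forall w \near w0, nbhs (w0, u w) (fun p => mc_form quo_act v p.1 p.2 = bar c d mt (zeta v p.1) p.2).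
  by apply: N4; rewrite u0; exact: near_near (mc_form_bar v).
have N5 := near_comp (sm_cont (sm_dg (w0, w0))) (P := fun p => nbhs p (fun p => quo_act (p.1, u p.2) = quo_hat p)) (near_near quo_act_one).
have {}N5 := near_slice (near_near N5).
have := nearI (N1 (sm_near sm_quo_act)) (nearI (N2 (near_near quo_act_diag)) (nearI (N3 (near_near quo_act_comp)) (nearI (nearI (N4 v1) (N4 v2)) N5))).
apply: filterS => w [sP [P1 [P2 [[b1 b2] n5]]]].
have MC := maurer_cartan (findim_mx _ _) (findim_mx _ _) sP P1 P2 v1 v2.
have zE v : \forall z \near w0, mc_form quo_act v z (u w) = zeta v z w.
  apply: filterS (near_slicel n5) => z nz.
  rewrite /mc_form /zeta -!(derive_mid _ v z z).
  apply: near_eq_derive.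
  have sz : sm (fun z' : V => ((z, z'), w)) z.
    by apply: sm_pair; [exact: sm_pairr|exact: sm_cst].
  exact: (near_comp (sm_cont sz) (P := fun p => quo_act (p.1, u p.2) = quo_hat p) nz).
have e1 := near_slice b1; have e2 := near_slice b2; rewrite /= in e1 e2.
have e1' := nbhs_singleton e1; have e2' := nbhs_singleton e2.
have F1 := etrans (near_eq_derive (mc_form quo_act v1 w0 (u w)) e2)
  (congr1 (fun q => 'D_q (bar c d mt (zeta v2 w0)) (u w)) e1').
have F2 := etrans (near_eq_derive (mc_form quo_act v2 w0 (u w)) e1)
  (congr1 (fun q => 'D_q (bar c d mt (zeta v1 w0)) (u w)) e2').
exact: (etrans (f_equal2 (fun a b => a - b) (esym (near_eq_derive v1 (zE v2))) (esym (near_eq_derive v2 (zE v1))))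
  (etrans MC (f_equal2 (fun a b => a - b) F1 F2))).
Qed.

End Local.
End MaurerCartan.

(** * The integrability condition *)

(** Agreement is known along the diagonal, which can be differentiated in the direction (v, v). As
    (v, 0) = (v, v) - (0, v), it remains to subtract a derivative in w, which costs one order. *)
Lemma agree_diag (R : realType) k (V W : normedModType R) (g h : V * V -> W) x v :
  findim W -> sm g (x, x) -> sm h (x, x) ->
  (\forall z \near x, agree k.+1 (fun w => g (z, w)) (fun w => h (z, w)) z) ->
  agree k (fun w => 'D_(v, 0) g (x, w)) (fun w => 'D_(v, 0) h (x, w)) x.
Proof.
move=> fW sg sh gh vs svs.
set DV := map (pair (0 : V)) vs.
rewrite (iter_partial ('D_(v, 0) g)) (iter_partial ('D_(v, 0) h)) -/DV -(derive_iterC _ _ fW sg) -(derive_iterC _ _ fW sh).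
have sB : sm (fun w : V => (w, w)) x by apply: sm_pair; exact: sm_id.
have DB : 'D_v (fun w : V => (w, w)) x = (v, v).
  by rewrite (derive_pair _ (sm_diff (@sm_id _ _ _)) (sm_diff (@sm_id _ _ _))) derive_id.
have H (f : V * V -> W) : sm f (x, x) -> 'D_(v, 0) (iter_deriv DV f) (x, x) =
    'D_v (fun z => iter_deriv vs (fun w => f (z, w)) z) x - iter_deriv (v :: vs) (fun w => f (x, w)) x.
  move=> sf; have sI : sm (iter_deriv DV f) (x, x) by exact: sm_iter.
  have e1 : 'D_v (fun z => iter_deriv vs (fun w => f (z, w)) z) x = 'D_(v, v) (iter_deriv DV f) (x, x).
    rewrite -DB; apply: etrans (derive_comp v (sm_diff sB) (sm_diff sI)).
    by congr ('D_v _ x); apply/funext => z; rewrite (iter_partial f).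
  have e2 : iter_deriv (v :: vs) (fun w => f (x, w)) x = 'D_(0, v) (iter_deriv DV f) (x, x).
    exact: (iter_partial f x x (v :: vs)).
  have -> : ((v, 0) : V * V) = (v, v) - (0, v) by rewrite -[RHS]/(v - 0, v - v) subr0 subrr.
  by rewrite e1 e2; exact: deriveBv (sm_diff sI).
rewrite (H g sg) (H h sh); congr (_ - _).
  by apply: near_eq_derive; apply: filterS gh => z; apply; exact: leqW.
exact: (nbhs_singleton gh (v :: vs)).
Qed.

(** * The non-linear Spencer form near a point *)

Section NlLocal.
Context {R : realType} (G : lie_groupoid R).
Local Notation I := (base G).
Local Notation n := (mdim I).
Local Notation m := (mdim (arrows G)).
Local Notation bis := (bisection_at (Gam := gpd_of G)).
Local Notation bmulG := (bmul (Gam := gpd_of G)).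
Local Notation binvG := (binv (Gam := gpd_of G)).
Local Notation one := (@unit_ R G).
Local Notation V := 'rV[R]_n.
Local Notation e := (fun i : 'I_n => delta_mx ord0 i : 'rV[R]_n).

Lemma mul_coord_ex d x : atlas d -> cdom d (one x) -> exists mt, mul_coord d x mt.
Proof.
move=> ad dx; have m1 : mul (one x) (one x) = one x by have := mul_unitl (one x); rewrite tgt_unit.
have dm : cdom d (mul (one x) (one x)) by rewrite m1.
by have [mt H] := mul_extension (bis_unit x) (tgt_unit x) ad ad ad dx dx dm; exists mt.
Qed.

(** Identifies the smooth family of inverses with the germwise [binv] that occurs in [nl_tau]. *)
Lemma family_inverse_binv c c' x (Psi Phi : V -> I -> arrows G) :
  family c (cmap c x) x Psi ->
  (\forall p \near (cmap c x, cmap c x), Phi p.1 (tgt (Psi p.1 (cinv c p.2))) = inv (Psi p.1 (cinv c p.2))) ->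
  family c' (cmap c x) (tgt (Psi (cmap c x) x)) Phi ->
  \forall y \near x, bis (tgt (Psi (cmap c y) y)) (Phi (cmap c y)) /\
    \forall t \near tgt (Psi (cmap c y) y), binvG y (Psi (cmap c y)) t = Phi (cmap c y) t.
Proof.
move=> fam PhiL fPhi; have [[ac cx] _ _ _] := fam.
have [c1 ac1 cy] := atlas_cover (tgt (Psi (cmap c x) x)).
have N1 := family_bis (findim_mx _ _) fam ac1 cy.
have sB : sm (fun w : V => (w, w)) (cmap c x) by apply: sm_pair; exact: sm_id.
have M1 := near_comp (sm_cont sB) (P := fun p => bis (cinv c p.2) (Psi p.1)) N1.
have M2 := near_comp (sm_cont sB) (P := fun p => nbhs p (fun p =>
  Phi p.1 (tgt (Psi p.1 (cinv c p.2))) = inv (Psi p.1 (cinv c p.2)))) (near_near PhiL).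
have := nearI (near_cdom cx) (near_comp (cmap_cont cx) (nearI M1 M2)).
apply: filterS => y [cy'] /=; rewrite cmapK // => -[bP nP].
have E : \forall y' \near y, Phi (cmap c y) (tgt (Psi (cmap c y) y')) = inv (Psi (cmap c y) y').
  by apply: (chart_near cy'); exact: near_slice nP.
have [mg gf fg gy] := local_invP bP.
have n1 := near_comp (map_cont mg) (P := fun y' => Phi (cmap c y) (tgt (Psi (cmap c y) y')) = inv (Psi (cmap c y) y')).
rewrite gy in n1.
have H : \forall t \near tgt (Psi (cmap c y) y), binvG y (Psi (cmap c y)) t = Phi (cmap c y) t.
  have := nearI fg (n1 E); apply: filterS => t [e1 e2].
  by rewrite e1 in e2; rewrite e2.
split=> //; exact: bis_ext H (bis_inv bP).
Qed.

(** The interface between the geometry of sigma and the computation of D_1: from here on only these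
    properties of [ze] are used. *)
Lemma nl_spencer_local k (x : I) (sigma : I -> jets G) (c : chart R I n) (d : chart R (arrows G) m) mt A :
  bisection_at (Gam := jgpd G k.+1) x sigma -> atlas c -> atlas d -> cdom c x -> cdom d (one x) ->
  mul_coord d x mt -> (\forall z \near x, jchart_at (k := k) c d A z) ->
  exists ze : V -> V * V -> 'rV[R]_m,
  [/\ forall v, sm (ze v) (cmap c x, cmap c x),
      forall v, \forall p \near (cmap c x, cmap c x), 'D_(ze v p) (shat c d) (hat c d one p.2) = 0,
      \forall p \near (cmap c x, cmap c x), forall v, ze v p = \sum_i v ord0 i *: ze (e i) p,
      forall v1 v2, \forall w \near cmap c x,
        'D_(v1, 0) (ze v2) (cmap c x, w) - 'D_(v2, 0) (ze v1) (cmap c x, w) =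
        brk c d mt (fun w => ze v1 (cmap c x, w)) (fun w => ze v2 (cmap c x, w)) w &
      \forall y \near x, forall v, nl_spencer k sigma y (tanv c y v) =
        tau c d A y (0, coefs k (jetc (fun w => ze v (cmap c y, w)) (cmap c y)))].
Proof.
move=> bs ac ad cx dx hm ngA.
have [Psi fam PE] := sigma_rep bs ac cx.
have [c' ac' cy] := atlas_cover (tgt (Psi (cmap c x) x)).
have [Phi [fPhi PhiL PhiR]] := family_inverse_sided (findim_mx _ _) fam ac' cy.
have sz := sm_zeta ad dx fam fPhi PhiL.
exists (fun v p => zeta c d Psi Phi v p.1 p.2); split=> //.
- move=> v; exact: zeta_vert ad dx fam fPhi PhiL v.
- have [sq _] := sm_quo_hat ad dx fam fPhi PhiL.
  have sB : sm (fun p : V * V => ((p.1, p.1), p.2)) (cmap c x, cmap c x) by exact: sm_dg.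
  have := near_comp (sm_cont sB) (P := fun p => sm (quo_hat c d Psi Phi) p) (sm_near sq).
  apply: filterS => -[z w] /= /sm_diff dq v.
  rewrite /zeta.
  have -> : (((0, v), 0) : (V * V) * V) = \sum_i v ord0 i *: ((0, e i), 0).
    rewrite {1}(row_sum_delta v).
    elim/big_rec2: _ => [//|i s1 s2 _ <-].
    by rewrite -[RHS]/((v ord0 i *: 0 + 0, v ord0 i *: e i + s2), v ord0 i *: 0 + 0) !scaler0 !addr0.
  by rewrite (derive_sumv _ _ dq); apply: eq_bigr => i _; exact: deriveZv.
- move=> v1 v2; have H := brk_zeta ad dx hm fam ac' cy fPhi PhiL PhiR v1 v2.
  have E v (f : V * V -> 'rV[R]_m) w : 'D_v (fun z => f (z, w)) (cmap c x) = 'D_(v, 0) f (cmap c x, w).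
    apply: (@derive_affine _ _ _ _ (fun z : V => (z, w)) f) => h.
    by rewrite -[RHS]/(h *: v + cmap c x, h *: (0 : V) + w) !scaler0 !add0r.
  apply: filterS H => w; apply: etrans.
  exact: (f_equal2 (fun a b => a - b) (esym (E v1 (fun p => zeta c d Psi Phi v2 p.1 p.2) w))
    (esym (E v2 (fun p => zeta c d Psi Phi v1 p.1 p.2) w))).
have := nearI ngA (nearI (family_at fam) (nearI (near_near PE) (family_inverse_binv fam PhiL fPhi))).
apply: filterS => y [gy [fy [Py [bH mH]]]] v.
have zE : (fun w => 'D_(v, 0) (fun p : V * V => hat c d (bmulG (Phi (cmap c y)) (Psi p.1)) p.2) (cmap c y, w)) =
    (fun w => zeta c d Psi Phi v (cmap c y) w).
  apply/funext => w.
  apply: (@derive_affine _ _ _ _ (fun p : V * V => ((cmap c y, p.1), p.2)) (quo_hat c d Psi Phi)) => h.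
  rewrite -[LHS]/((cmap c y, h *: v + cmap c y), h *: (0 : V) + w).
  by rewrite -[RHS]/((h *: (0 : V) + cmap c y, h *: v + cmap c y), h *: (0 : V) + w) !scaler0 !add0r.
by apply: etrans (nl_tau v ad gy fy Py bH (meq_near _ mH)) _; rewrite zE.
Qed.

End NlLocal.

(** * The identity D (D sigma) = [D sigma, D sigma] / 2 *)

Section Compatibility.
Context {R : realType} (G : lie_groupoid R).
Local Notation I := (base G).
Local Notation n := (mdim I).
Local Notation m := (mdim (arrows G)).
Local Notation one := (@unit_ R G).
Local Notation V := 'rV[R]_n.
Local Notation e := (fun i : 'I_n => delta_mx ord0 i : 'rV[R]_n).
Implicit Types (k l : nat) (x y z : I) (c : chart R I n) (d : chart R (arrows G) m).

Lemma jpr_jprol k l c d x th : (l <= k)%N -> atlas c -> atlas d -> cdom c x -> cdom d (one x) ->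
  vert c d th x -> jpr k l x (jprol k (sect c d th) x) = jprol l (sect c d th) x.
Proof.
move=> lk ac ad cx dx vx.
have sE : \forall y \near x, sect c d th y = sect c d th y by near=> y.
have [F gF ->] := jprol_gen k ac ad cx dx vx sE.
have [A /nbhs_singleton gx] := jchart_at_ex l ac ad cx dx.
rewrite (jprol_tau ac ad gx vx sE) -(gen_velocity ac ad gx sE gF).
have [_ g0 _] := gen_kapX k ac ad cx dx sE gF.
rewrite /jpr -g0 push_velocity; last exact: jproj_plot_preserving.
apply: velocity_ext; have [_ _ g3 _] := gF.
by apply: filterS g3 => t bt; rewrite jproj_jet.
Unshelve. all: by end_near. Qed.

(** The operators are characterised on smooth forms only; D sigma is one because near [x] it equals
    a sum of tensors. *)
Lemma aform_ext (Gam : gpd_data I) x u u' : aform_eq (Gam := Gam) x u u' ->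
  aform_at (Gam := Gam) x u' -> aform_at (Gam := Gam) x u.
Proof.
move=> uu [f1 f2 f3]; split.
- by have := nearI uu f1; apply: filterS => y [e1 h1] v tv; rewrite e1 //; exact: h1.
- have := nearI uu f2; apply: filterS => y [e1 h1] a v w tv tw.
  by rewrite !e1 ?h1 //; exact: tangent_lin.
- move=> W nW; have [s1 s2] := f3 W nW; have [tW _] := nW.
  have E : \forall y \near x, u' y (W y) = u y (W y).
    by have := nearI uu tW; apply: filterS => y [e1 t1]; rewrite e1.
  split; first by have := nearI E s1; apply: filterS => y [<-].
  move=> h dh; apply: fun_ext (s2 h dh).
  by apply: filterS E => y ->.
Qed.

Section Point.
Variables (k : nat) (c : chart R I n) (d : chart R (arrows G) m) (x : I).
Hypotheses (ac : atlas c) (ad : atlas d) (cx : cdom c x) (dx : cdom d (one x)).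
Variables (T : finType) (th : T -> V -> 'rV[R]_m) (b : 'I_n -> T -> V -> R).
Hypotheses (vth : forall t, vert c d (th t) x) (sb : forall i t, sm (b i t) (cmap c x)).
Let om t := coord_form c (fun i => b i t).
Let xi t := jprol k (sect c d (th t)).
Let U (s : seq T) := \sum_(t <- s) tens (Gam := jgpd G k) (om t) (xi t).

Lemma jprol_sec1 t : algd_sec (Gam := jgpd G k) x (xi t).
Proof.
have [A ngA] := jchart_at_ex k ac ad cx dx.
have := @jprol_sec _ _ k c d x A ac ad ngA T th vth [:: t] (fun _ _ => 1) (fun _ => @sm_cst _ _ _ _ _).
rewrite (_ : (fun y => _) = xi t) //.
by apply/funext => y; rewrite big_seq1 scale1r.
Qed.

Lemma U_form s : aform_at (Gam := jgpd G k) x (U s).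
Proof. by have [A ngA] := jchart_at_ex k ac ad cx dx; exact: (sum_form ac ad ngA vth sb). Qed.

Lemma om_sform t : sform_at x (om t).
Proof.
have [A ngA] := jchart_at_ex k ac ad cx dx.
by apply: (coord_form_sform ac ngA).
Qed.

Lemma U_cons t s : U (t :: s) = 1 *: tens (Gam := jgpd G k) (om t) (xi t) + U s.
Proof. by rewrite /U big_cons scale1r. Qed.

Lemma tens_form t : aform_at (Gam := jgpd G k) x (tens (Gam := jgpd G k) (om t) (xi t)).
Proof. by have := U_form [:: t]; rewrite /U big_seq1. Qed.

(** D kills prolongations, so only the terms with d om_t survive. *)
Lemma spencer_sum D D1 p q s : is_spencer k D -> is_spencer_ext k D D1 ->
  D1 (U s) x (tanv c x p) (tanv c x q) =
  \sum_(t <- s) dform (om t) (cfield c p) (cfield c q) x *: jprol k.-1 (sect c d (th t)) x.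
Proof.
move=> [_ _ _ D0 _] [_ D1lin D1t].
have tp : mtangent x (tanv c x p) by exact: tangent_tanv.
have tq : mtangent x (tanv c x q) by exact: tangent_tanv.
elim: s => [|t s IH].
  (* Linearity is given on combinations a *: u + u'; the value at 0 is forced to be 0 by 0 = 1 *: 0
     + 0. *)
  have U0 : 1 *: U [::] + U [::] = U [::] by rewrite /U big_nil scaler0 addr0.
  have := D1lin x 1 (U [::]) (U [::]) _ _ (U_form [::]) (U_form [::]) tp tq.
  rewrite U0 scale1r big_nil => E.
  by apply: (@addrI _ (D1 (U [::]) x (tanv c x p) (tanv c x q))); rewrite addr0 -E.
rewrite U_cons (D1lin x 1 _ _ _ _ (tens_form t) (U_form s) tp tq) scale1r big_cons IH; congr (_ + _).
have := D1t x (om t) (xi t) (cfield c p) (cfield c q) (om_sform t) (jprol_sec1 t)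
  (vfield_cfield ac cx p) (vfield_cfield ac cx q).
rewrite -[cfield c p x]/(tanv c x p) -[cfield c q x]/(tanv c x q) => ->.
rewrite !D0 //; [|exact: gsec_sect|exact: gsec_sect].
by rewrite !scaler0 !subr0 /xi (jpr_jprol (leq_pred k) ac ad cx dx (vth t)).
Qed.

Lemma bracket_sum B Bk mt v w s s' : is_bracket1 k B -> is_bracket k B Bk -> mul_coord d x mt ->
  mtangent x v -> mtangent x w ->
  Bk (U s) (U s') x v w =
  \sum_(t <- s) \sum_(t' <- s') wedge (om t) (om t') x v w *: jprol k.-1 (sect c d (brk c d mt (th t) (th t'))) x.
Proof.
move=> [_ _ _ _ Bj] [_ Bl Br Bt] hm tv tw.
have Bkt t t' : Bk (tens (Gam := jgpd G k) (om t) (xi t)) (tens (Gam := jgpd G k) (om t') (xi t')) x v w =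
    wedge (om t) (om t') x v w *: jprol k.-1 (sect c d (brk c d mt (th t) (th t'))) x.
  rewrite Bt //; try exact: om_sform; try exact: jprol_sec1.
  rewrite /xi Bj; [|exact: gsec_sect|exact: gsec_sect].
  have vb := vert_brk ac ad cx dx hm (vth t) (vth t').
  have [A' /nbhs_singleton gx'] := jchart_at_ex k.-1 ac ad cx dx.
  rewrite (jprol_tau ac ad gx' vb (abracket_sect ac ad cx dx hm (vth t) (vth t'))).
  by rewrite (@jprol_tau _ _ _ c d A' _ x (sect c d (brk c d mt (th t) (th t'))) ac ad gx' vb) //; near=> y.
have H1 t : Bk (tens (Gam := jgpd G k) (om t) (xi t)) (U s') x v w =
    \sum_(t' <- s') wedge (om t) (om t') x v w *: jprol k.-1 (sect c d (brk c d mt (th t) (th t'))) x.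
  have ft := tens_form t; elim: s' => [|t' r IH].
    have U0 : 1 *: U [::] + U [::] = U [::] by rewrite /U big_nil scaler0 addr0.
    have := Br x 1 _ (U [::]) (U [::]) _ _ ft (U_form [::]) (U_form [::]) tv tw.
    rewrite U0 scale1r big_nil => E.
    by apply: (@addrI _ (Bk (tens (Gam := jgpd G k) (om t) (xi t)) (U [::]) x v w)); rewrite addr0 -E.
  rewrite U_cons (Br x 1 _ _ _ _ _ ft (tens_form t') (U_form r) tv tw) scale1r big_cons.
  by rewrite IH (Bkt t t').
elim: s => [|t r IH].
  have U0 : 1 *: U [::] + U [::] = U [::] by rewrite /U big_nil scaler0 addr0.
  have := Bl x 1 (U [::]) (U [::]) (U s') _ _ (U_form [::]) (U_form [::]) (U_form s') tv tw.
  rewrite U0 scale1r big_nil => E.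
  by apply: (@addrI _ (Bk (U [::]) (U s') x v w)); rewrite addr0 -E.
rewrite U_cons (Bl x 1 _ _ _ _ _ (tens_form t) (U_form r) (U_form s') tv tw) scale1r big_cons.
by rewrite IH (H1 t).
Unshelve. all: by end_near. Qed.

End Point.
(** Exchanging t and t' changes the sign of the sum, so it equals half its difference with the
    exchanged sum: this is where the factor 1/2 of D_1 is used. *)
Lemma half_wedge_sum (T : finType) (W : lmodType R) (a a' : T -> R) (X : T -> T -> W) :
  (forall t t', X t' t = - X t t') ->
  \sum_t \sum_t' (a t * a' t') *: X t t' =
  \sum_t \sum_t' (2^-1 * (a t * a' t' - a' t * a t')) *: X t t'.
Proof.
move=> XC; set s := LHS.
have E : \sum_t \sum_t' (a' t * a t') *: X t t' = - s.
  rewrite exchange_big /= -sumrN; apply: eq_bigr => t _; rewrite -sumrN; apply: eq_bigr => t' _.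
  by rewrite XC scalerN mulrC.
transitivity (2^-1 *: (s - (- s))).
  have -> : s - - s = 2 *: s by rewrite opprK scaler_nat mulr2n.
  by rewrite scalerA mulVf ?scale1r // pnatr_eq0.
rewrite -E /s -sumrB scaler_sumr; apply: eq_bigr => t _.
rewrite -sumrB scaler_sumr; apply: eq_bigr => t' _.
by rewrite -scalerBl scalerA.
Qed.

(** The Maurer-Cartan equation for the decomposition of zeta: d om_t on the left, half of the
    bracket on the right. Both [agree_diag] and [agree_brk] cost one order, whence k + 1 in the
    hypotheses. *)
Lemma mc_agree k c d x mt (T : finType) (b : 'I_n -> T -> V -> R) (th : T -> V -> 'rV[R]_m)
    (ze : V -> V * V -> 'rV[R]_m) (p q : V) : let w0 := cmap c x in
  atlas c -> atlas d -> cdom c x -> cdom d (one x) -> mul_coord d x mt ->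
  (forall v, sm (ze v) (w0, w0)) ->
  (\forall p \near (w0, w0), forall v, ze v p = \sum_i v ord0 i *: ze (e i) p) ->
  (\forall w \near w0, 'D_(p, 0) (ze q) (w0, w) - 'D_(q, 0) (ze p) (w0, w) =
      brk c d mt (fun w => ze p (w0, w)) (fun w => ze q (w0, w)) w) ->
  (\forall z \near w0, forall i, agree k.+1 (fun w => ze (e i) (z, w)) (fun w => \sum_t b i t z *: th t w) z) ->
  (forall i t, sm (b i t) w0) -> (forall t, sm (th t) w0) ->
  let al r t := \sum_i b i t w0 * r ord0 i in
  (forall r, agree k.+1 (fun w => ze r (w0, w)) (fun w => \sum_t al r t *: th t w) w0) ->
  agree k (fun w => \sum_t (\sum_i (q ord0 i * 'D_p (b i t) w0 - p ord0 i * 'D_q (b i t) w0)) *: th t w)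
    (fun w => \sum_t \sum_t' (2^-1 * (al p t * al q t' - al q t * al p t')) *: brk c d mt (th t) (th t') w) w0.
Proof.
move=> w0 ac ad cx dx hm sze lze MC agr sb sth al Ag.
have sr r : sm (fun w => ze r (w0, w)) w0.
  by apply: (@sm_comp _ _ _ _ (ze r) (fun w => (w0, w))) => //; exact: sm_pairr.
have sa r : sm (fun w => \sum_t al r t *: th t w) w0.
  by apply: sm_sum => t _; exact: (sm_scale (sm_cst _ _) (sth t)).
have sDz v r : sm (fun w => 'D_(v, 0) (ze r) (w0, w)) w0.
  apply: (@sm_comp _ _ _ _ ('D_(v, 0) (ze r)) (fun w => (w0, w))) => //; first exact: sm_pairr.
  exact: sm_derive.
pose gi (v : V) i w := \sum_t 'D_v (b i t) w0 *: th t w.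
have sgi v i : sm (gi v i) w0.
  by apply: sm_sum => t _; exact: (sm_scale (sm_cst _ _) (sth t)).
(* In the decomposition the derivative in z falls on the coefficients [b] alone. *)
have step1 v i : agree k (fun w => 'D_(v, 0) (ze (e i)) (w0, w)) (gi v i) w0.
  pose h (p : V * V) := \sum_t b i t p.1 *: th t p.2.
  have sh : sm h (w0, w0).
    apply: sm_sum => t _; apply: sm_scale.
      by apply: (@sm_comp _ _ _ _ (b i t) fst) => //; exact: sm_fst.
    by apply: (@sm_comp _ _ _ _ (th t) snd) => //; exact: sm_snd.
  have Dh w : 'D_(v, 0) h (w0, w) = gi v i w.
    transitivity ('D_v (fun z : V => \sum_t b i t z *: th t w) w0).
      apply/esym/(@derive_affine _ _ _ _ (fun z : V => (z, w)) h) => l.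
      by rewrite -[RHS]/(l *: v + w0, l *: (0 : V) + w) scaler0 add0r.
    rewrite derive_sumf; last first.
      by move=> t; apply: sm_diff; exact: (sm_scale (sb i t) (sm_cst _ _)).
    apply: eq_bigr => t _; rewrite derive_scale; [|exact: sm_diff (sb i t)|exact: sm_diff (sm_cst _ _)].
    by rewrite derive_cst scaler0 addr0.
  have -> : gi v i = (fun w => 'D_(v, 0) h (w0, w)) by apply/funext => w; rewrite Dh.
  apply: agree_diag => //.
  by apply: filterS agr => z az; exact: az.
pose g v (r : V) w := \sum_i r ord0 i *: gi v i w.
have sg v r : sm (g v r) w0 by apply: sm_sum => i _; exact: (sm_scale (sm_cst _ _) (sgi v i)).
have step2 v r : agree k (g v r) (fun w => 'D_(v, 0) (ze r) (w0, w)) w0.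
  have E : \forall w \near w0, \sum_i r ord0 i *: 'D_(v, 0) (ze (e i)) (w0, w) = 'D_(v, 0) (ze r) (w0, w).
    have N : \forall w \near w0, forall i, sm (ze (e i)) (w0, w).
      by apply: near_forall => i; exact: (near_slice (sm_near (sze (e i)))).
    have := nearI N (near_slice (near_near lze)); apply: filterS => w [sw lw].
    have nE : \forall p \near (w0, w), ze r p = \sum_i r ord0 i *: ze (e i) p by apply: filterS lw.
    rewrite (near_eq_derive _ nE) derive_sumf; last first.
      by move=> i; apply: sm_diff; exact: (sm_scale (sm_cst _ _) (sw i)).
    by apply: eq_bigr => i _; rewrite deriveZf //; exact: sm_diff (sw i).
  apply: (@agree_near_ext _ k _ _ (g v r) _ (fun w => \sum_i r ord0 i *: 'D_(v, 0) (ze (e i)) (w0, w)) _ _ _ E).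
    by near=> w.
  apply: agree_sum => i.
  - exact: (sm_scale (sm_cst _ _) (sgi v i)).
  - exact: (sm_scale (sm_cst _ _) (sDz v (e i))).
  - exact: (agree_scale (sm_cst _ _) (sm_cst _ _) (sgi v i) (sDz v (e i)) (@agree_refl _ _ _ _ _ _) (agree_sym (step1 v i))).
have step3 : (fun w => \sum_t (\sum_i (q ord0 i * 'D_p (b i t) w0 - p ord0 i * 'D_q (b i t) w0)) *: th t w) =
    (fun w => g p q w - g q p w).
  apply/funext => w; rewrite /g -sumrB.
  under [RHS]eq_bigr do rewrite /gi !scaler_sumr -sumrB.
  rewrite exchange_big /=; apply: eq_bigr => t _; rewrite scaler_suml; apply: eq_bigr => i _.
  by rewrite scalerBl !scalerA.
rewrite step3.
apply: agree_trans (agreeB (sg p q) (sDz p q) (sg q p) (sDz q p) (step2 p q) (step2 q p)) _.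
have aMC : agree k (fun w => 'D_(p, 0) (ze q) (w0, w) - 'D_(q, 0) (ze p) (w0, w))
    (brk c d mt (fun w => ze p (w0, w)) (fun w => ze q (w0, w))) w0 by apply: agree_near; exact: MC.
apply: agree_trans aMC _.
apply: agree_trans (agree_brk ac ad cx dx hm (sr p) (sa p) (sr q) (sa q) (Ag p) (Ag q)) _.
apply: agree_near.
have := brk_sum ac ad cx dx hm (index_enum T) (al p) (al q) sth.
apply: filterS => w E; apply: etrans E _.
by apply: half_wedge_sum => t t'; exact: brkC.
Unshelve. all: by end_near. Qed.

(** D sigma and the sum of tensors [U] have the same germ, on which the operators depend. Both terms
    then become prolongations at [x] of vertical sections, whose k-jets [mc_agree] compares. *)
Lemma spencer_compat k D D1 B Bk x (sigma : I -> jets G) : is_spencer k.+1 D ->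
  is_spencer_ext k.+1 D D1 -> is_bracket1 k.+1 B -> is_bracket k.+1 B Bk ->
  bisection_at (Gam := jgpd G k.+2) x sigma ->
  forall v w, mtangent x v -> mtangent x w -> nl_spencer1 D1 Bk (nl_spencer k.+1 sigma) x v w = 0.
Proof.
move=> hD hD1 hB hBk bs v w tv tw.
have [c ac cx] := atlas_cover x; have [d ad dx] := atlas_cover (one x).
have [mt hm] := mul_coord_ex ad dx.
have [A ngA] := jchart_at_ex k.+1 ac ad cx dx.
have [A' /nbhs_singleton gx'] := jchart_at_ex k ac ad cx dx.
have [ze [sze vze lze MC nlE]] := nl_spencer_local bs ac ad cx dx hm ngA.
have [T [b [th [sb vth agr]]]] := vert_decomposition ac ad cx dx k.+1 (fun i => sze (e i)) (fun i => vze (e i)).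
have sth t : sm (th t) (cmap c x) by exact: (vth t).1.
set w0 := cmap c x in sze vze lze MC agr sb sth *.
have sB (z : V) : sm (fun w : V => (w, w)) z by apply: sm_pair; exact: sm_id.
pose al (z r : V) t := \sum_i b i t z * r ord0 i.
have Ag : \forall z \near w0, forall r : V,
    agree k.+1 (fun w => ze r (z, w)) (fun w => \sum_t al z r t *: th t w) z.
  have N1 : \forall z \near w0, forall i, sm (ze (e i)) (z, z).
    by apply: near_forall => i; apply: (near_comp (sm_cont (sB w0)) (P := fun p => sm (ze (e i)) p)); exact: sm_near.
  have N2 : \forall z \near w0, forall t, sm (th t) z by apply: near_forall => t; exact: sm_near.
  have N3 := near_comp (sm_cont (sB w0)) (P := fun p => nbhs p (fun p => forall v, ze v p = \sum_i v ord0 i *: ze (e i) p)) (near_near lze).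
  have := nearI agr (nearI N1 (nearI N2 N3)); apply: filterS => z [az [sz [tz lz]]] r.
  apply: (@agree_near_ext _ k.+1 _ _ (fun w => \sum_i r ord0 i *: ze (e i) (z, w)) _
    (fun w => \sum_i r ord0 i *: \sum_t b i t z *: th t w)).
  - by apply: filterS (near_slice lz) => w' ->.
  - near=> w'; under eq_bigr do rewrite scaler_sumr.
    rewrite exchange_big /=; apply: eq_bigr => t _; rewrite /al scaler_suml; apply: eq_bigr => i _.
    by rewrite scalerA mulrC.
  have s1 i : sm (fun w => ze (e i) (z, w)) z.
    by apply: (@sm_comp _ _ _ _ (ze (e i)) (fun w => (z, w))) => //; exact: sm_pairr.
  have s2 i : sm (fun w => \sum_t b i t z *: th t w) z.
    by apply: sm_sum => t _; exact: (sm_scale (sm_cst _ _) (tz t)).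
  apply: agree_sum => i.
  - exact: (sm_scale (sm_cst _ _) (s1 i)).
  - exact: (sm_scale (sm_cst _ _) (s2 i)).
  - exact: (agree_scale (sm_cst _ _) (sm_cst _ _) (s1 i) (s2 i) (@agree_refl _ _ _ _ _ _) (az i)).
set om := fun t => coord_form c (fun i => b i t).
have omE t y r : cdom c y -> om t y (tanv c y r) = al (cmap c y) r t.
  by move=> cy; rewrite /om /coord_form /al; apply: eq_bigr => i _; rewrite tanv_coord.
set U := \sum_(t <- index_enum T) tens (Gam := jgpd G k.+1) (om t) (jprol k.+1 (sect c d (th t))).
have UE y u : U y u = \sum_(t <- index_enum T) om t y u *: jprol k.+1 (sect c d (th t)) y.
  by rewrite /U; elim: (index_enum T) => [|t r IH]; rewrite ?big_nil // !big_cons -IH.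
have uU : aform_eq (Gam := jgpd G k.+1) x (nl_spencer k.+1 sigma) U.
  have := nearI (near_cdom cx) (nearI ngA (nearI nlE (nearI (near_vth ngA vth) (near_comp (cmap_cont cx) Ag)))).
  apply: filterS => y [cy [gy [nly [vy Agy]]]] u /(tangent_ex ac cy) [r ->].
  rewrite nly UE (jprol_sum ac ad _ _ gy vy).
  suff E : coefs k.+1 (jetc (fun w => ze r (cmap c y, w)) (cmap c y)) =
    coefs k.+1 (jetc (fun w => \sum_(t <- index_enum T) om t y (tanv c y r) *: th t w) (cmap c y)) by rewrite E.
  apply: coefs_ext => J sJ.
  have -> : (fun w => \sum_(t <- index_enum T) om t y (tanv c y r) *: th t w) = (fun w => \sum_t al (cmap c y) r t *: th t w).
    by apply/funext => w'; apply: eq_bigr => t _; rewrite omE.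
  by apply: (Agy r); rewrite size_map.
have fU : aform_at (Gam := jgpd G k.+1) x U by exact: (U_form k.+1 ac ad cx dx vth sb).
have fnl := aform_ext uU fU.
rewrite -[LHS]/(D1 (nl_spencer k.+1 sigma) x v w - 2^-1 *: Bk (nl_spencer k.+1 sigma) (nl_spencer k.+1 sigma) x v w).
have -> : D1 (nl_spencer k.+1 sigma) x v w = D1 U x v w by have [h _ _] := hD1; exact: h.
have -> : Bk (nl_spencer k.+1 sigma) (nl_spencer k.+1 sigma) x v w = Bk U U x v w by have [h _ _ _] := hBk; exact: h.
rewrite (bracket_sum ac ad cx dx vth sb _ _ hB hBk hm tv tw).
have [p vE] := tangent_ex ac cx tv; have [q wE] := tangent_ex ac cx tw.
rewrite {1}vE {1}wE (spencer_sum ac ad cx dx vth sb p q _ hD hD1).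
rewrite -[k.+1.-1]/k.
have E1 := jprol_sum ac ad (index_enum T) (fun t => dform (om t) (cfield c p) (cfield c q) x) gx' vth.
apply: etrans (f_equal2 (fun a b => a - b) E1 erefl) _.
have vbk (s : T * T) : vert c d (brk c d mt (th s.1) (th s.2)) x by exact: vert_brk.
have -> : 2^-1 *: \sum_t \sum_t' wedge (om t) (om t') x v w *: jprol k (sect c d (brk c d mt (th t) (th t'))) x =
    \sum_(s <- index_enum (T * T)%type) (2^-1 * wedge (om s.1) (om s.2) x v w) *: jprol k (sect c d (brk c d mt (th s.1) (th s.2))) x.
  rewrite -(pair_bigA _ (fun t t' => (2^-1 * wedge (om t) (om t') x v w) *: jprol k (sect c d (brk c d mt (th t) (th t'))) x)) /= scaler_sumr.
  by apply: eq_bigr => t _; rewrite scaler_sumr; apply: eq_bigr => t' _; rewrite scalerA.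
rewrite (@jprol_sum _ _ k c d A' ac ad _ (fun s : T * T => brk c d mt (th s.1) (th s.2)) _ _ x gx' vbk).
have M := mc_agree ac ad cx dx hm sze lze (MC p q) agr sb sth (nbhs_singleton Ag).
suff -> : coefs k (jetc (fun w => \sum_t dform (om t) (cfield c p) (cfield c q) x *: th t w) (cmap c x)) =
  coefs k (jetc (fun w' => \sum_(s <- index_enum (T * T)%type) (2^-1 * wedge (om s.1) (om s.2) x v w) *: brk c d mt (th s.1) (th s.2) w') (cmap c x)).
  by rewrite subrr.
apply: coefs_ext => J sJ.
have -> : (fun w => \sum_t dform (om t) (cfield c p) (cfield c q) x *: th t w) =
    (fun w => \sum_t (\sum_i (q ord0 i * 'D_p (b i t) w0 - p ord0 i * 'D_q (b i t) w0)) *: th t w).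
  by apply/funext => w'; apply: eq_bigr => t _; rewrite /om dform_coord.
have -> : (fun w' => \sum_(s <- index_enum (T * T)%type) (2^-1 * wedge (om s.1) (om s.2) x v w) *: brk c d mt (th s.1) (th s.2) w') =
    (fun w' => \sum_t \sum_t' (2^-1 * (al w0 p t * al w0 q t' - al w0 q t * al w0 p t')) *: brk c d mt (th t) (th t') w').
  apply/funext => w'.
  rewrite -(pair_bigA _ (fun t t' => (2^-1 * wedge (om t) (om t') x v w) *: brk c d mt (th t) (th t') w')) /=.
  by apply: eq_bigr => t _; apply: eq_bigr => t' _; rewrite /wedge vE wE !omE.
by apply: M; rewrite size_map.
Unshelve. all: by end_near. Qed.

End Compatibility.

Theorem mainTheorem2 (R : realType) (G : lie_groupoid R) (k : nat) (hk : (1 <= k)%N)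
    (D : (base G -> (jets G -> R) -> R) ->
         base G -> ((base G -> R) -> R) -> (jets G -> R) -> R)
    (hD : is_spencer k D)
    (D1 : (base G -> ((base G -> R) -> R) -> (jets G -> R) -> R) ->
          base G -> ((base G -> R) -> R) -> ((base G -> R) -> R) -> (jets G -> R) -> R)
    (hD1 : is_spencer_ext k D D1)
    (B : (base G -> (jets G -> R) -> R) -> (base G -> (jets G -> R) -> R) ->
         base G -> (jets G -> R) -> R)
    (hB : is_bracket1 k B)
    (Bk : (base G -> ((base G -> R) -> R) -> (jets G -> R) -> R) ->
          (base G -> ((base G -> R) -> R) -> (jets G -> R) -> R) ->
          base G -> ((base G -> R) -> R) -> ((base G -> R) -> R) -> (jets G -> R) -> R)
    (hBk : is_bracket k B Bk)
    (x0 : base G) (sigma : base G -> jets G)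
    (hsigma : bisection_at (Gam := jgpd G k.+1) x0 sigma) :
  (\forall x \near x0, forall v w,
     mtangent x v -> mtangent x w ->
     nl_spencer1 D1 Bk (nl_spencer k sigma) x v w = 0) /\
  ((\forall x \near x0, forall v,
      mtangent x v -> nl_spencer k sigma x v = 0) <->
   (exists2 F : base G -> arrows G,
      bisection_at (Gam := gpd_of G) x0 F &
      \forall x \near x0, sigma x = jet k.+1 x F)).
Proof.
case: k hk hD hD1 hB hBk hsigma => [//|l] _ hD hD1 hB hBk hsigma; split.
  (* The bisection is one at every point of its domain, so [spencer_compat] applies at all points
     near [x0]. *)
  have [U Ux bU] := hsigma; have [oU _ _ _] := bU.
  have : \forall y \near x0, U y by exact: open_nbhs_nbhs.
  apply: filterS => y Uy v w tv tw.
  by apply: (spencer_compat hD hD1 hB hBk) => //; exists U.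
split=> [nl0|[F bF sE]].
  exists (fun y => jval (sigma y)); first exact: bisection_jval hsigma.
  exact: nl_spencer_exact hsigma nl0.
have := nearI (bis_near bF) (near_near sE); apply: filterS => y [bFy sEy] v tv.
exact: nl_spencer_jet bFy sEy v tv.
Qed.
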